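(* Let $X$ be the variance gamma LSBM, i.e. $T$ is the gamma subordinator with zero drift and Lévy density $\mu(z)=(\nu z)^{-1}e^{-z/\nu}$ on $(0,\infty)$, $\nu>0$, so $\psi(u)=\frac1\nu\log(1+\nu u)$, and let $\tilde W$ have drift $\beta$ and initial value $x_0>0$. Set $\alpha=\sqrt{2/\nu+\beta^2}$. Then for $s>0$ and $x_1\neq0$, \[ p_1^*(x_0;s,x_1)=\frac{e^{\beta(x_1-x_0)}}{2\pi\nu}\int_{\mathbb{R}}\frac{(1+i\nu z)^{-s/\nu}}{\sqrt{\beta^2-2iz}}\,e^{-x_0\sqrt{\beta^2-2iz}}\Big[e^{|x_1|\sqrt{\beta^2-2iz}}\,\mathrm{Ei}\big(-|x_1|(\alpha+\sqrt{\beta^2-2iz})\big)-e^{-|x_1|\sqrt{\beta^2-2iz}}\,\mathrm{Ei}\big(-|x_1|(\alpha-\sqrt{\beta^2-2iz})\big)\Big]dz, \] where $\mathrm{Ei}$ is the exponential integral function and $\sqrt{\cdot}$ is the principal branch.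
   Context: Setup (LSBM): $W$ standard Brownian motion, $\tilde W_S=x_0+W_S+\beta S$, $T$ a subordinator independent of $W$, $X_t=\tilde W_{T_t}$. $T^*(x_0)=\inf\{S\ge0:\tilde W_S\le0\}$; first passage time of the second kind $t_1^*=\inf\{t\ge0:T_t\ge T^*(x_0)\}$. $p_1^*(x_0;s,x_1)=E_{x_0}[\delta(t_1^*-s)\delta(X_{t_1^*}-x_1)]$ is the joint density of $(t_1^*,X_{t_1^*})$ at $(s,x_1)$. $\mathrm{Ei}(x)=-\int_{-x}^\infty e^{-t}t^{-1}dt$ (principal value / analytic continuation for complex arguments). $(1+i\nu z)^{-s/\nu}$ uses the principal branch. *)

(* Defs.v *)
From HB Require Import structures.
From mathcomp Require Import all_boot all_order all_algebra.
From mathcomp Require Import all_classical all_reals all_analysis.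
From mathcomp Require Import complex.
Set Implicit Arguments. Unset Strict Implicit. Unset Printing Implicit Defensive.
Import Order.TTheory GRing.Theory Num.Theory.
Import numFieldNormedType.Exports.
Local Open Scope classical_set_scope.
Local Open Scope ring_scope.

Section Defs.
Variable R : realType.

Definition toC (x : R) : R[i] := (x%:C)%C.
Definition cI : R[i] := 'i%C.

Definition cRe (w : R[i]) : R := complex.Re w.
Definition cIm (w : R[i]) : R := complex.Im w.

Definition cexp (w : R[i]) : R[i] :=
  ((expR (cRe w) * cos (cIm w)) +i* (expR (cRe w) * sin (cIm w)))%C.

Definition carg (w : R[i]) : R :=
  let a := cRe w in let b := cIm w in
  if 0 < a then atan (b / a)
  else if a < 0 then (if 0 <= b then atan (b / a) + pi else atan (b / a) - pi)
  else if 0 < b then pi / 2 else if b < 0 then - (pi / 2) else 0.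

Definition clog (w : R[i]) : R[i] :=
  ((ln (Num.sqrt (cRe w ^+ 2 + cIm w ^+ 2))) +i* (carg w))%C.

Definition cpow (w a : R[i]) : R[i] := cexp (a * clog w).

Definition cintegral (D : set R) (f : R -> R[i]) : R[i] :=
  ((\int[lebesgue_measure]_(x in D) cRe (f x)) +i*
   (\int[lebesgue_measure]_(x in D) cIm (f x)))%C.

Definition cintegrable (D : set R) (f : R -> R[i]) : Prop :=
  (lebesgue_measure).-integrable D (fun x => (cRe (f x))%:E) /\
  (lebesgue_measure).-integrable D (fun x => (cIm (f x))%:E).

(* Exponential integral Ei, analytically continued to C \ [0, +oo)
   (principal branch): Ei(w) = - E1(-w), with
   E1(z) = e^{-z} \int_0^oo e^{-t}/(t+z) dt  for |arg z| < pi.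
   For real w = -x < 0 this is Ei(-x) = - \int_x^oo e^{-t}/t dt. *)
Definition Ei (w : R[i]) : R[i] :=
  - (cexp w * cintegral `[0, +oo[
        (fun t => toC (expR (- t)) / (toC t - w))).

Local Open Scope ereal_scope.

Context d (Omega : measurableType d) (P : probability Omega R).

Definition finite_inter (n : nat) (E : nat -> set Omega) : set Omega :=
  \big[setI/setT]_(i < n) E i.

Definition indep_increments (X : R -> Omega -> R) : Prop :=
  forall (n : nat) (t : nat -> R) (A : nat -> set R),
    (0 <= t 0)%R -> (forall i, (t i < t i.+1)%R) ->
    (forall i, measurable (A i)) ->
    P (finite_inter n (fun i => [set w | X (t i.+1) w - X (t i) w \in A i]%R))
    = \prod_(i < n) P [set w | (X (t i.+1) w - X (t i) w)%R \in A i].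

Definition standard_BM (W : R -> Omega -> R) : Prop :=
  [/\ (forall t, measurable_fun setT (W t)),
      (forall w, W 0%R w = 0%R),
      (forall w, {within `[0%R, +oo[, continuous (fun S => W S w)}),
      indep_increments W &
      (forall s t (A : set R), (0 <= s)%R -> (s < t)%R -> measurable A ->
         P [set w | (W t w - W s w)%R \in A] =
         \int[lebesgue_measure]_(x in A)
            ((Num.sqrt (2 * pi * (t - s)))^-1 *
             expR (- (x ^+ 2) / (2 * (t - s))))%:E)].

(* gamma subordinator: zero drift, Levy density (nu z)^{-1} e^{-z/nu},
   i.e. Laplace exponent psi(u) = (1/nu) log(1 + nu u):
   E[exp(-u (T_{t+h} - T_t))] = exp(-h psi(u)) = (1 + nu u)^(-h/nu). *)
Definition gamma_subordinator (nu : R) (T : R -> Omega -> R) : Prop :=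
  (forall t, measurable_fun setT (T t)) /\
  [/\ (forall w, T 0%R w = 0%R),
      (forall w s t, (0 <= s)%R -> (s <= t)%R -> (T s w <= T t w)%R),
      (forall w t, (0 <= t)%R -> cvg_to ((fun r => T r w) @ at_right t) (nbhs (T t w))),
      indep_increments T &
      (forall u t h, (0 <= u)%R -> (0 <= t)%R -> (0 <= h)%R ->
         \int[P]_w (expR (- u * (T (t + h) w - T t w)))%:E =
         ((1 + nu * u) `^ (- (h / nu)))%:E)].

Definition indep_processes (W T : R -> Omega -> R) : Prop :=
  forall (n m : nat) (s t : nat -> R) (A B : nat -> set R),
    (forall i, 0 <= s i)%R -> (forall j, 0 <= t j)%R ->
    (forall i, measurable (A i)) -> (forall j, measurable (B j)) ->
    P (finite_inter n (fun i => [set w | W (s i) w \in A i]) `&`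
       finite_inter m (fun j => [set w | T (t j) w \in B j]))
    = P (finite_inter n (fun i => [set w | W (s i) w \in A i])) *
      P (finite_inter m (fun j => [set w | T (t j) w \in B j])).

Definition Wtilde (x0 beta : R) (W : R -> Omega -> R) (S : R) (w : Omega) : R :=
  (x0 + W S w + beta * S)%R.

Definition Tstar (x0 beta : R) (W : R -> Omega -> R) (w : Omega) : \bar R :=
  ereal_inf [set S%:E | S in [set S : R | (0 <= S)%R /\ (Wtilde x0 beta W S w <= 0)%R]].

Definition t1star (x0 beta : R) (W T : R -> Omega -> R) (w : Omega) : \bar R :=
  ereal_inf [set t%:E | t in [set t : R | (0 <= t)%R /\
                                    Tstar x0 beta W w <= (T t w)%:E]].

Definition LSBM (x0 beta : R) (W T : R -> Omega -> R) (t : R) (w : Omega) : R :=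
  Wtilde x0 beta W (T t w) w.

Definition first_passage_event (x0 beta : R) (W T : R -> Omega -> R)
    (A : set (R * R)) : set Omega :=
  [set w | exists s : R, t1star x0 beta W T w = s%:E /\
                         A (s, LSBM x0 beta W T s w)].

End Defs.
Arguments cI {R}.

Local Open Scope ring_scope.

Definition vg_integrand {R : realType} (nu beta x0 s x1 : R) (z : R) : R[i] :=
  let alpha := Num.sqrt (2 / nu + beta ^+ 2) in
  let q := sqrtc (toC (beta ^+ 2) - toC 2 * cI * toC z) in
  let a := toC `|x1| in
  cpow (1 + cI * toC nu * toC z) (toC (- (s / nu))) / q * cexp (- (toC x0 * q)) *
  (cexp (a * q) * Ei (- (a * (toC alpha + q)))
   - cexp (- (a * q)) * Ei (- (a * (toC alpha - q)))).

Definition vg_density_formula {R : realType} (nu beta x0 s x1 : R) : R[i] :=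
  toC (expR (beta * (x1 - x0)) / (2 * pi * nu)) *
  cintegral setT (vg_integrand nu beta x0 s x1).

(* Main.v *)
Require Import Defs.
From HB Require Import structures.
From mathcomp Require Import all_boot all_order all_algebra.
From mathcomp Require Import all_classical all_reals all_analysis.
From mathcomp Require Import complex measurable_realfun ring lra.
Set Implicit Arguments. Unset Strict Implicit. Unset Printing Implicit Defensive.
Import Order.TTheory GRing.Theory Num.Theory.
Import numFieldNormedType.Exports HBNNSimple.
Local Open Scope classical_set_scope.
Local Open Scope ring_scope.

(** Let [tau] be the first time the Brownian path with drift reaches [0]; then
    [t1*] is the first time at which the subordinator [T] exceeds [tau]. The
    strong Markov property and the exponential martingale give the Fourier
    transform of [tau], [expR (- x0 * (beta + q z))] with
    [q z = sqrt (beta ^+ 2 - 2 * 'i * z)]; it is integrable, so [tau] has a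
    density [p] on the event that it is finite.

    The gamma Levy density is a mixture of exponentials,
      [expR (- u / nu) / (nu * u) =
         \int_(r > 0) (alpha + r) / nu * expR (- rate r * u)]
    with [rate r = ((alpha + r) ^+ 2 - beta ^+ 2) / 2]. A level is therefore
    crossed by a jump from [v] below it to [h] above it, at time [s] and for
    the parameter [r], with weight [(alpha + r) / nu * expR (- rate r * (v + h))].
    Given the overshoot [h], the position [X] at time [t1*] is that of a
    Brownian motion with drift started at [0] and run for the time [h];
    integrating over [h] produces the resolvent kernel
    [expR (beta * y) * expR (- `|y| * (alpha + r)) / (alpha + r)]. So the
    density of [(t1*, X)] at [(s, y)] is the integral over [r > 0] of
    [expR (beta * y) / nu * expR (- `|y| * (alpha + r))] times the Laplace
    transform at [rate r] of [v |-> E (p (T s + v))]. Inserting the Fourier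
    integral of [p] leaves the integral over [r] of
    [expR (- `|y| * (alpha + r)) / (rate r + 'i * z)], and the partial fractions
    [1 / (rate r + 'i * z) = (1 / (alpha + r - q z) - 1 / (alpha + r + q z)) / q z]
    turn it into the two exponential integrals.

    Laws are identified through their Laplace transforms throughout. *)

(** * Integration and uniqueness of Laplace transforms *)

(** The hypotheses describe the processes by increments, independence and path regularity; they give
    no jump measure of [T] and no filtration. A crossing is therefore not decomposed along the jumps
    of a path. Levels are spread by Lebesgue measure, the joint Laplace transform of level, crossing
    time and value after the jump is computed from the exponent of [T] alone, and it is compared
    with that of the explicit weight. Such an identity can only be tested at a random level with a
    density; this is why [tau] must have one. Random times are reached through deterministic grids.
    A sum over the cells of differences of indicators selects the first grid time after the passage,
    each term involves fixed times only, and dominated convergence removes the mesh. The strong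
    Markov property, the joint measurability of Brownian paths and the crossing identities all come
    from this device. Analytic continuation is avoided: real and imaginary parts are carried
    separately, and characteristic functions come from real differential equations or Gaussian
    integrals. *)

Lemma mfun_ex d d' (T : measurableType d) (T' : measurableType d') (f : T -> T') :
  measurable_fun setT f -> exists g : {mfun T >-> T'}, g = f :> (T -> T').
Proof.
move=> mf; pose m' := isMeasurableFun.Build _ _ _ _ f mf.
pose g : {mfun T >-> T'} := HB.pack f m'.
by exists g.
Qed.

Lemma ge0_integral_density d (T : measurableType d) (R : realType)
  (mu m : {measure set T -> \bar R}) (g : T -> R) (f : T -> \bar R) :
  measurable_fun setT g -> (forall x, 0 <= g x) ->
  (forall A, measurable A -> m A = (\int[mu]_(x in A) (g x)%:E)%E) ->
  measurable_fun setT f -> (forall x, (0 <= f x)%E) ->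
  (\int[m]_x f x = \int[mu]_x (f x * (g x)%:E))%E.
Proof.
move=> mg g0 mE mf f0.
have mEg : measurable_fun setT (EFin \o g) by exact/measurable_EFinP.
pose h := nnsfun_approx measurableT mf.
have hf (x : T) : (h n x)%:E @[n --> \oo] --> f x by apply: cvg_nnsfun_approx => //= *; exact: f0.
have nh (x : T) a b : (a <= b)%N -> h a x <= h b x.
  by move=> ab; exact/lefP/(nd_nnsfun_approx measurableT mf).
have -> : (\int[m]_x f x = limn (fun n => \int[m]_x (h n x)%:E))%E.
  rewrite -monotone_convergence//=.
  - by apply: eq_integral => x _; apply/esym/cvg_lim => //; exact: hf.
  - by move=> n; exact/measurable_EFinP.
  - by move=> n x _; rewrite lee_fin.
  - by move=> x _ a b ab; rewrite lee_fin nh.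
have -> : (\int[mu]_x (f x * (g x)%:E) = limn (fun n => \int[mu]_x ((h n x)%:E * (g x)%:E)))%E.
  rewrite -monotone_convergence//=.
  - apply: eq_integral => x _; apply/esym/cvg_lim => //.
    exact: cvgeZr (hf x).
  - by move=> n; apply: emeasurable_funM => //; exact/measurable_EFinP.
  - by move=> n x _; rewrite -EFinM lee_fin mulr_ge0.
  - by move=> x _ a b ab; rewrite -!EFinM lee_fin ler_wpM2r// nh.
congr (limn _); apply/funext => n.
under eq_integral do rewrite fimfunE -fsumEFin//.
under [RHS]eq_integral.
  move=> x _; rewrite fimfunE -fsumEFin// ge0_mule_fsuml; last first.
    by move=> r; rewrite EFinM nnfun_muleindic_ge0.
  over.
rewrite ge0_integral_fsum//=; last 2 first.
  - move=> r; apply/measurable_EFinP; exact: measurable_funM.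
  - by move=> r x _; rewrite EFinM nnfun_muleindic_ge0.
rewrite ge0_integral_fsum//=; last 2 first.
  - move=> r; apply: emeasurable_funM => //; apply/measurable_EFinP; exact: measurable_funM.
  - by move=> r x _; rewrite mule_ge0 ?lee_fin// -lee_fin EFinM nnfun_muleindic_ge0.
apply: eq_fsbigr => r _.
rewrite integralZl_indic_nnsfun// integral_indic// setIT mE//.
under [RHS]eq_integral do rewrite EFinM -muleA.
have [r0|r0] := leP 0 r.
  rewrite [RHS]ge0_integralZl//; last 2 first.
  - by apply: emeasurable_funM => //; apply/measurable_EFinP.
  - by move=> x _; rewrite -EFinM lee_fin mulr_ge0.
  - congr (_ * _)%E; rewrite [LHS]integral_mkcond; apply: eq_integral => x _.
    by rewrite patchE indicE; case: (_ \in _); rewrite ?mul1e ?mul0e.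
(* A negative [r] is not a value of the approximating function: its fibre is empty and both sides
   vanish. *)
rewrite preimage_nnfun0// integral_set0 mule0 integral0_eq// => x _.
by rewrite indicE in_set0 mul0e mule0.
Qed.

Section density.
Context d (T : measurableType d) (R : realType) (mu : {measure set T -> \bar R})
  (f : T -> \bar R).
Hypotheses (mf : measurable_fun setT f) (f0 : forall x, (0 <= f x)%E).

(** The two proofs are arguments that the value ignores; carrying them in the term lets the measure
    structure be attached to it canonically. *)
Definition density_measure of measurable_fun setT f & (forall x, (0 <= f x)%E) :=
  fun A => (\int[mu]_(x in A) f x)%E.

Local Notation dm := (density_measure mf f0).

Let dm0 : dm set0 = 0%E. Proof. by rewrite /density_measure integral_set0. Qed.

Let dm_ge0 A : (0 <= dm A)%E. Proof. exact: integral_ge0. Qed.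

Let dm_sigma : semi_sigma_additive dm.
Proof. exact: semi_sigma_additive_nng_induced. Qed.

HB.instance Definition _ := isMeasure.Build _ _ _ dm dm0 dm_ge0 dm_sigma.

End density.

(** Agreement on rectangles forces the law of [(U, V)] to be the product of the two laws; Tonelli
    does the rest. The target spaces are arbitrary, so that whole paths can be taken for [U] and
    [V]. *)
Lemma indep_fubini d1 d2 d3 (T : measurableType d1) (X : measurableType d2)
  (Y : measurableType d3) (R : realType) (P : probability T R) (U : T -> X) (V : T -> Y)
  (F : X * Y -> \bar R) :
  measurable_fun setT U -> measurable_fun setT V ->
  (forall A B, measurable A -> measurable B ->
     P (U @^-1` A `&` V @^-1` B) = (P (U @^-1` A) * P (V @^-1` B))%E) ->
  measurable_fun setT F -> (forall z, (0 <= F z)%E) ->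
  (\int[P]_w F (U w, V w) = \int[P]_w1 \int[P]_w2 F (U w1, V w2))%E.
Proof.
move=> /mfun_ex[u <-] /mfun_ex[v <-] ind mF F0.
have muv : measurable_fun setT (fun w => (u w, v w)) by exact/measurable_fun_pair.
have [uv uvE] := mfun_ex muv.
transitivity (\int[distribution P uv]_z F z)%E.
  rewrite ge0_integral_distribution//.
  by apply: eq_integral => w _ /=; rewrite uvE.
transitivity (\int[(distribution P u \x distribution P v)%E]_z F z)%E.
  apply: eq_measure_integral => A mA _; apply/esym.
  apply: (@product_measure_unique _ _ _ _ _ _ _ (distribution P uv)) => // B C mB mC.
  by rewrite /= /distribution /pushforward uvE; exact: ind.
rewrite fubini_tonelli1//= ge0_integral_distribution//=.
- apply: eq_integral => w _; rewrite /fubini_F ge0_integral_distribution//.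
  exact: measurableT_comp.
- exact: measurable_fun_fubini_tonelli_F.
- by move=> x; exact: integral_ge0.
Qed.

Section real_dct.
Context d (T : measurableType d) (R : realType) (mu : {measure set T -> \bar R}).

Lemma dct_EFin (D : set T) (f_ : nat -> T -> R) (f g : T -> R) : measurable D ->
  (forall n, measurable_fun D (f_ n)) ->
  (forall x, D x -> f_ n x @[n --> \oo] --> f x) ->
  mu.-integrable D (EFin \o g) ->
  (forall n x, D x -> `|f_ n x| <= g x) ->
  mu.-integrable D (EFin \o f) /\
  ((\int[mu]_(x in D) (f_ n x)%:E)%E @[n --> \oo] --> (\int[mu]_(x in D) (f x)%:E)%E).
Proof.
move=> mD mf_ cf ig fg.
have mf : measurable_fun D f by apply: (measurable_fun_cvg mf_).
have [] := @dominated_convergence _ _ _ mu D mD (fun n => EFin \o f_ n) (EFin \o f)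
  (EFin \o g).
- by move=> n; apply/measurable_EFinP.
- exact/measurable_EFinP.
- by apply: aeW => x Dx; apply: cvg_EFin; [exact: nearW|exact: cf].
- exact: ig.
- by apply: aeW => x n Dx /=; rewrite lee_fin fg.
by move=> ? _ ?; split.
Qed.

Lemma dct_Rint (D : set T) (f_ : nat -> T -> R) (f g : T -> R) : measurable D ->
  (forall n, measurable_fun D (f_ n)) ->
  (forall x, D x -> f_ n x @[n --> \oo] --> f x) ->
  mu.-integrable D (EFin \o g) ->
  (forall n x, D x -> `|f_ n x| <= g x) ->
  (\int[mu]_(x in D) f_ n x) @[n --> \oo] --> (\int[mu]_(x in D) f x).
Proof.
move=> mD mf_ cf ig fg; have [intf] := dct_EFin mD mf_ cf ig fg.
by move=> h; apply: fine_cvg; rewrite fineK//; exact: integrable_fin_num.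
Qed.

Lemma integrable_dom (D : set T) (f g : T -> R) : measurable D ->
  measurable_fun D f -> mu.-integrable D (EFin \o g) ->
  (forall x, D x -> `|f x| <= g x) -> mu.-integrable D (EFin \o f).
Proof.
move=> mD mf ig fg; apply: le_integrable ig => //; first exact/measurable_EFinP.
by move=> x Dx /=; rewrite lee_fin (le_trans (fg _ Dx))// ler_norm.
Qed.

End real_dct.

Section laplace_uniqueness.
Context (R : realType).

Lemma cvg_nat_expRN (c : R) : 0 < c -> n%:R * expR (- (c * n%:R)) @[n --> \oo] --> (0:R).
Proof.
move=> c0.
apply: (@squeeze_cvgr _ _ _ _ (fun=> 0) (fun n => (2 / c ^+ 2) * n.+1%:R^-1 * 2)).
- apply: nearW => n; rewrite mulr_ge0 ?expR_ge0//=.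
  case: n => [|n].
    by rewrite mul0r invr1 mulr1; apply: mulr_ge0 => //; apply: divr_ge0 => //; exact: sqr_ge0.
  rewrite expRN ler_pdivrMr ?expR_gt0//.
  have cn : 0 <= c * n.+1%:R by rewrite mulr_ge0// ltW.
  have h : (c * n.+1%:R) ^+ 2 / 2 <= expR (c * n.+1%:R).
    by apply: le_trans (expR_ge1Dxn 1 cn); rewrite -[leLHS]add0r lerD// -[2]/(2`!%:R).
  apply: le_trans (ler_wpM2l _ h); last by apply: mulr_ge0 => //; rewrite divr_ge0// divr_ge0// sqr_ge0.
  have E (u v : R) : v != 0 -> 2 / c ^+ 2 / v * 2 * ((c * u) ^+ 2 / 2) = 2 * u ^+ 2 / v.
    by move=> v0; field; rewrite v0 gt_eqF.
  rewrite E; last by rewrite pnatr_eq0.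
  rewrite ler_pdivlMr ?ltr0n// -(@natr1 _ n.+1) expr2 mulrA mulrC ler_pM2r//.
  have n1 : 1 <= n.+1%:R :> R by rewrite ler1n.
  by lra.
- exact: cvg_cst.
- rewrite [X in _ --> X](_ : 0 = 2 / c ^+ 2 * 0 * 2); last by rewrite mulr0 mul0r.
  apply: cvgM; last exact: cvg_cst.
  by apply: cvgM; [exact: cvg_cst|exact: cvg_harmonic].
Qed.

Lemma expRN_le1 (x : R) : 0 <= x -> expR (- x) <= 1.
Proof. by move=> x0; rewrite -[leRHS]expR0 ler_expR oppr_le0. Qed.

Lemma bernoulli_ineq (x : R) n : 0 <= x <= 1 -> 1 - n%:R * x <= (1 - x) ^+ n.
Proof.
move=> /andP[x0 x1]; elim: n => [|n ih]; first by rewrite mul0r subr0 expr0.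
rewrite exprS; apply: le_trans (ler_wpM2l _ ih); last by rewrite subr_ge0.
have h : 0 <= n%:R * (x * x) by rewrite !mulr_ge0.
by rewrite -natr1; nra.
Qed.

Let ln2V_ge0 (b : R) : 0 < b -> 0 <= ln 2 / b.
Proof. by move=> b0; apply: divr_ge0; apply: ltW => //; rewrite ln_gt0// ltr1n. Qed.

(** A polynomial in the Laplace kernel [x = expR (- (ln 2 / b * y))], of the kind used in proofs of
    the Stone-Weierstrass theorem. The rate is chosen so that [x < 1 / 2] exactly when [y > b]; then
    [n * (2 * x) ^+ n] tends to 0 for [y > b] and is at least [n] for [y <= b], which decides the
    limit of [(1 - x ^+ n) ^+ (n * 2 ^ n)]. *)
Let ray_approx (b : R) (n : nat) (y : R) : R :=
  (1 - expR (- (ln 2 / b * y)) ^+ n) ^+ (n * 2 ^ n).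

Let ln2_gt0 : 0 < ln 2 :> R. Proof. by rewrite ln_gt0// ltr1n. Qed.

Let ray_approx_bound (b : R) n (y : R) : 0 < b -> 0 <= y -> 0 <= ray_approx b n y <= 1.
Proof.
move=> b0 y0; rewrite /ray_approx.
have e1 : expR (- (ln 2 / b * y)) <= 1.
  by apply: expRN_le1; apply: mulr_ge0 => //; exact: ln2V_ge0.
have e0 : 0 <= expR (- (ln 2 / b * y)) by rewrite expR_ge0.
have := @exprn_ile1 _ n _ e0 e1; have := exprn_ge0 n e0.
move=> h0 h1; rewrite exprn_ge0 ?subr_ge0//= exprn_ile1 ?subr_ge0// lerBlDr lerDl.
Qed.

Let ray_approx_cvg (b y : R) : 0 < b -> 0 <= y ->
  ray_approx b n y @[n --> \oo] --> (\1_(`]b, +oo[) y : R).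
Proof.
move=> b0 y0.

set c := ln 2 / b * (y - b).
have key n : (n * 2 ^ n)%:R * expR (- (ln 2 / b * y)) ^+ n = n%:R * expR (- (c * n%:R)) :> R.
  rewrite natrM -mulrA; congr (_ * _).
  rewrite natrX -{1}(@lnK _ (2:R)) ?posrE//.
  rewrite -exprMn -expRD -expRM_natr; congr expR.
  by rewrite /c; field; rewrite gt_eqF.
have x01 n : (0 <= expR (- (ln 2 / b * y)) ^+ n <= 1).
  rewrite exprn_ge0 ?expR_ge0//= exprn_ile1// ?expR_ge0//.
  by apply: expRN_le1; apply: mulr_ge0 => //; exact: ln2V_ge0.
rewrite indicE mem_setE in_itv/= andbT.
have [by_|yb] := ltP b y.
- apply: (@squeeze_cvgr _ _ _ _ (fun n => 1 - n%:R * expR (- (c * n%:R))) (fun=> 1)).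
  + apply: nearW => n; have /andP[_ ->] := ray_approx_bound n b0 y0; rewrite andbT.
    by rewrite -key; exact: bernoulli_ineq.
  + rewrite -[X in _ --> X](subr0 1); apply: cvgB; first exact: cvg_cst.
    by apply: cvg_nat_expRN; rewrite /c mulr_gt0 ?divr_gt0 ?subr_gt0.
  + exact: cvg_cst.
(* Here [c <= 0], so [n * expR (- (c * n)) >= n]. The factor [n] in the exponent of [ray_approx] is
   what still gives the limit 0 at [y = b], where [2 ^ n] alone would not. *)
- apply: (@squeeze_cvgr _ _ _ _ (fun=> 0) (fun n => (n.+1%:R)^-1)).
  + apply: nearW => n; have /andP[-> _] /= := ray_approx_bound n b0 y0.
    rewrite /ray_approx.
    apply: (@le_trans _ _ (expR (- expR (- (ln 2 / b * y)) ^+ n) ^+ (n * 2 ^ n))).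
      apply: lerXn2r; rewrite ?nnegrE ?expR_ge0// ?subr_ge0; first by case/andP: (x01 n).
      exact: expR_ge1Dx.
    rewrite -[leLHS]expRM_natl mulrN key [leLHS]expRN lef_pV2 ?posrE ?expR_gt0//.
    apply: le_trans (expR_ge1Dx _).
    rewrite -natr1 addrC lerD2l ler_peMr// -expR0 ler_expR oppr_ge0 /c.
    by rewrite mulr_le0_ge0// mulr_ge0_le0 ?subr_le0// divr_ge0// ltW.
  + exact: cvg_cst.
  + exact: cvg_harmonic.
Qed.

(** Powers of a Laplace kernel are again Laplace kernels, at the points [i * th]; equality of
    transforms thus extends to all polynomials in the kernel. *)
Lemma integral_poly_expR d (T : measurableType d) (mu : {measure set T -> \bar R})
    (r g : T -> R) (th : R) (p : {poly R}) :
  0 <= th -> measurable_fun setT r -> (forall x, 0 <= r x) ->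
  mu.-integrable setT (EFin \o g) ->
  (\int[mu]_x (p.[expR (- (th * r x))] * g x)%:E =
   \sum_(i < size p) (p`_i)%:E * \int[mu]_x (expR (- (i%:R * th * r x)) * g x)%:E)%E.
Proof.
move=> th0 mr r0 ig.
have mg : measurable_fun setT g by apply/measurable_EFinP; exact: measurable_int ig.
have me i : mu.-integrable setT (EFin \o (fun x => expR (- (i%:R * th * r x)) * g x)).
  apply: (@integrable_dom _ _ _ _ _ _ (fun x => `|g x|)) => //.
  - apply: measurable_funM => //; apply: measurableT_comp => //.
    by apply: measurableT_comp => //; exact: measurable_funM.
  - exact: integrable_norm.
  - move=> x _; rewrite normrM ler_piMl// ger0_norm ?expR_ge0//.
    by apply: expRN_le1; rewrite !mulr_ge0.
rewrite (eq_integral (fun x => \sum_(i < size p) (p`_i)%:E * (expR (- (i%:R * th * r x)) * g x)%:E)%E).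
  rewrite integral_sum//=.
    by apply: eq_bigr => i _; rewrite integralZl//; exact: me.
  by move=> i; apply: integrableZl => //; exact: me.
move=> x _; rewrite horner_coef mulr_suml -sumEFin; apply: eq_bigr => i _.
by rewrite -EFinM -mulrA -expRM_natl mulrN !mulrA.
Qed.

Context d1 d2 (T1 : measurableType d1) (T2 : measurableType d2)
  (m1 : {measure set T1 -> \bar R}) (m2 : {measure set T2 -> \bar R}).

(** Ray indicators are bounded pointwise limits of polynomials in a Laplace kernel. The weights [g1]
    and [g2] are arbitrary integrable functions, so that several variables can be treated one after
    the other, the remaining kernels being absorbed in the weight. *)
Lemma laplace_rays (r1 g1 : T1 -> R) (r2 g2 : T2 -> R) :
  measurable_fun setT r1 -> measurable_fun setT r2 ->
  (forall x, 0 <= r1 x) -> (forall x, 0 <= r2 x) ->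
  m1.-integrable setT (EFin \o g1) -> m2.-integrable setT (EFin \o g2) ->
  (forall u : R, 0 <= u -> (\int[m1]_x (expR (- (u * r1 x)) * g1 x)%:E =
     \int[m2]_x (expR (- (u * r2 x)) * g2 x)%:E)%E) ->
  forall b : R, (\int[m1]_x (\1_(`]b, +oo[) (r1 x) * g1 x)%:E =
     \int[m2]_x (\1_(`]b, +oo[) (r2 x) * g2 x)%:E)%E.
Proof.
move=> mr1 mr2 r10 r20 ig1 ig2 H.
have pos (b : R) : 0 < b -> (\int[m1]_x (\1_(`]b, +oo[) (r1 x) * g1 x)%:E =
     \int[m2]_x (\1_(`]b, +oo[) (r2 x) * g2 x)%:E)%E.
  move=> b0.
  pose q n (y : R) := (1 - expR (- (ln 2 / b * y)) ^+ n) ^+ (n * 2 ^ n).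
  have aux d (T : measurableType d) (mu : {measure set T -> \bar R}) (r g : T -> R) :
      measurable_fun setT r -> (forall x, 0 <= r x) -> mu.-integrable setT (EFin \o g) ->
      (\int[mu]_x (q n (r x) * g x)%:E @[n --> \oo] -->
       \int[mu]_x (\1_(`]b, +oo[) (r x) * g x)%:E)%E.
    move=> mr r0 ig.
    have mg : measurable_fun setT g by apply/measurable_EFinP; exact: measurable_int ig.
    apply: (proj2 (@dct_EFin _ _ _ mu setT (fun n x => q n (r x) * g x)
      (fun x => \1_(`]b, +oo[) (r x) * g x) (fun x => `|g x|) _ _ _ _ _)) => //.
    - move=> n; apply: measurable_funM => //; apply: measurable_funX.
      apply: measurable_funB => //; apply: measurable_funX.
      apply: measurableT_comp => //; apply: measurableT_comp => //.
      exact: measurable_funM.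
    - by move=> x _; apply: cvgM; [exact: ray_approx_cvg|exact: cvg_cst].
    - exact: integrable_norm.
    - move=> n x _; rewrite normrM ler_piMl//.
      have /andP[h0 h1] := ray_approx_bound n b0 (r0 x).
      by rewrite ger0_norm.
  have c1 := aux _ _ _ _ _ mr1 r10 ig1.
  have c2 := aux _ _ _ _ _ mr2 r20 ig2.
  rewrite -(cvg_lim _ c1)// -(cvg_lim _ c2)//; congr (limn _); apply/funext => n.
  pose p : {poly R} := (1 - 'X^n) ^+ (n * 2 ^ n).
  have qp y : q n y = p.[expR (- (ln 2 / b * y))].
    by rewrite /p horner_exp !hornerE.
  under eq_integral do rewrite qp.
  under [RHS]eq_integral do rewrite qp.
  have th0 : 0 <= ln 2 / b by rewrite divr_ge0 ?ltW.
  rewrite !integral_poly_expR//; apply: eq_bigr => i _; congr (_ * _)%E.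
  by apply: H; rewrite mulr_ge0.
(* For [b < 0] the indicator is the kernel at [u = 0], since the variables are nonnegative; [b = 0]
   is the limit of the levels [1 / n.+1]. *)
move=> b; have [b0|b0|->] := ltgtP b 0; [|exact: pos|].
- have E (y : R) : 0 <= y -> \1_(`]b, +oo[) y = expR (- (0 * y)).
    move=> y0; rewrite mul0r oppr0 expR0 indicE mem_setE in_itv/= andbT.
    by rewrite (lt_le_trans b0).
  under eq_integral do rewrite E//.
  under [RHS]eq_integral do rewrite E//.
  exact: H.
- have aux d (T : measurableType d) (mu : {measure set T -> \bar R}) (r g : T -> R) :
      measurable_fun setT r -> (forall x, 0 <= r x) -> mu.-integrable setT (EFin \o g) ->
      (\int[mu]_x (\1_(`]n.+1%:R^-1, +oo[) (r x) * g x)%:E @[n --> \oo] -->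
       \int[mu]_x (\1_(`]0%R, +oo[) (r x) * g x)%:E)%E.
    move=> mr r0 ig.
    have mg : measurable_fun setT g by apply/measurable_EFinP; exact: measurable_int ig.
    apply: (proj2 (@dct_EFin _ _ _ mu setT (fun n x => \1_(`]n.+1%:R^-1, +oo[) (r x) * g x)
      (fun x => \1_(`]0%R, +oo[) (r x) * g x) (fun x => `|g x|) _ _ _ _ _)) => //.
    - by move=> n; apply: measurable_funM => //; apply: measurableT_comp.
    - move=> x _; apply: cvgM; last exact: cvg_cst.
      have [rx|rx] := ltP 0 (r x).
      + apply: cvg_near_cst; have /cvgrPdist_lt/(_ _ rx) := @cvg_harmonic R.
        apply: filterS => n /=; rewrite sub0r normrN ger0_norm ?invr_ge0// => h.
        by rewrite !indicE !mem_setE !in_itv/= !andbT h rx.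
      + apply: cvg_near_cst; apply: nearW => n; rewrite !indicE !mem_setE !in_itv/= !andbT.
        rewrite !ltNge (le_trans rx) ?invr_ge0// rx//.
    - exact: integrable_norm.
    - move=> n x _; rewrite normrM ler_piMl// indicE.
      by case: (_ \in _); rewrite ?normr1 ?normr0.
  have c1 := aux _ _ _ _ _ mr1 r10 ig1.
  have c2 := aux _ _ _ _ _ mr2 r20 ig2.
  rewrite -(cvg_lim _ c1)// -(cvg_lim _ c2)//; congr (limn _); apply/funext => n.
  exact: pos.
Qed.

End laplace_uniqueness.

(** * Generating pi-systems and uniqueness of finite measures *)

Definition pi_gen d (T : measurableType d) (G : set (set T)) :=
  [/\ d.-measurable = <<s G >>, setI_closed G &
    exists g : nat -> set T, (forall i, G (g i)) /\ \bigcup_k g k = setT].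

Lemma pi_gen_measurable d (T : measurableType d) : pi_gen (@measurable d T).
Proof.
split.
- by apply/esym/sigma_algebra_id; exact: sigma_algebra_measurable.
- by move=> A B; exact: measurableI.
- by exists (fun=> setT); split => //; rewrite bigcup_const.
Qed.

Lemma pi_gen_rays (R : realType) : pi_gen (@RGenOInfty.G R).
Proof.
split; first exact: RGenOInfty.measurableE.
- move=> _ _ [x ->] [y ->]; exists (Num.max x y); apply/seteqP; split => z /=.
    by rewrite !in_itv/= !andbT gt_max => -[-> ->].
  by rewrite !in_itv/= !andbT gt_max => /andP.
- exists (fun n => `]-n%:R, +oo[%classic); split; first by move=> i; exists (- i%:R).
  apply/seteqP; split => // x _; exists (Num.truncn `|x|).+1 => //=.
  rewrite in_itv/= andbT ltrNl (le_lt_trans (ler_norm _))// normrN.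
  by rewrite truncnS_gt.
Qed.

Section pi_gen_unique.
Context (R : realType).
Local Open Scope ereal_scope.

Lemma pi_gen_unique d (T : measurableType d) (G : set (set T))
  (m1 m2 : {measure set T -> \bar R}) : pi_gen G -> m1 setT < +oo ->
  (forall A, G A -> m1 A = m2 A) -> forall A, measurable A -> m1 A = m2 A.
Proof.
move=> [mG IG [g [gG gT]]] fin H; apply: (@measure_unique _ _ _ G g) => // k.
apply: le_lt_trans fin; apply: le_measure; rewrite ?inE// mG.
exact: sub_sigma_algebra.
Qed.

Lemma pi_gen_prod d1 d2 (X : measurableType d1) (Y : measurableType d2) GX GY
  (m1 m2 : {measure set (X * Y) -> \bar R}) : pi_gen GX -> pi_gen GY -> m1 setT < +oo ->
  (forall A B, GX A -> GY B -> m1 (A `*` B) = m2 (A `*` B)) ->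
  forall C, measurable C -> m1 C = m2 C.
Proof.
move=> piX piY fin H.
have finC C : measurable C -> m1 C < +oo.
  by move=> mC; apply: le_lt_trans fin; apply: le_measure; rewrite ?inE.
have mGY A : GY A -> measurable A by case: piY => -> _ _; exact: sub_sigma_algebra.
have H1 A B : measurable A -> GY B -> m1 (A `*` B) = m2 (A `*` B).
  move=> mA GB; have mB : measurable ([set: X] `*` B) by apply: measurableX => //; exact: mGY.
  pose n1 := @measure_function_pushforward__canonical__measure_function_Measure
    _ _ _ _ _ (mrestr m1 mB) fst measurable_fst.
  pose n2 := @measure_function_pushforward__canonical__measure_function_Measure
    _ _ _ _ _ (mrestr m2 mB) fst measurable_fst.
  have E C : (fst @^-1` C) `&` ([set: X] `*` B) = C `*` B.
    by apply/seteqP; split => -[x y] /=; [move=> [? []]|move=> []].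
  have : n1 A = n2 A.
    apply: (pi_gen_unique piX) => //.
    - by rewrite /n1 /= /pushforward /mrestr E; apply: finC.
    - by move=> C GC; rewrite /n1 /n2 /= /pushforward /mrestr !E H.
  by rewrite /n1 /n2 /= /pushforward /mrestr !E.
have H2 A B : measurable A -> measurable B -> m1 (A `*` B) = m2 (A `*` B).
  move=> mA mB; have mA' : measurable (A `*` [set: Y]) by apply: measurableX.
  pose n1 := @measure_function_pushforward__canonical__measure_function_Measure
    _ _ _ _ _ (mrestr m1 mA') snd measurable_snd.
  pose n2 := @measure_function_pushforward__canonical__measure_function_Measure
    _ _ _ _ _ (mrestr m2 mA') snd measurable_snd.
  have E C : (snd @^-1` C) `&` (A `*` [set: Y]) = A `*` C.
    by apply/seteqP; split => -[x y] /=; [move=> [? []]|move=> []].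
  have : n1 B = n2 B.
    apply: (pi_gen_unique piY) => //.
    - by rewrite /n1 /= /pushforward /mrestr E; apply: finC; exact: measurableX.
    - by move=> C GC; rewrite /n1 /n2 /= /pushforward /mrestr !E H1.
  by rewrite /n1 /n2 /= /pushforward /mrestr !E.
apply: (@pi_gen_unique _ _ [set A `*` B | A in measurable & B in measurable]) => //.
  split.
  - exact: measurable_prod_measurableType.
  - move=> _ _ [A mA [B mB <-]] [A' mA' [B' mB' <-]].
    exists (A `&` A'); first exact: measurableI.
    by exists (B `&` B'); [exact: measurableI|rewrite setXI].
  - exists (fun=> setT); split; last by rewrite bigcup_const.
    by move=> _; exists setT => //; exists setT => //; rewrite setXTT.
by move=> _ [A mA [B mB <-]]; exact: H2.
Qed.

Lemma rays3_unique (m1 m2 : {measure set (R * (R * R)) -> \bar R}) : m1 setT < +oo ->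
  (forall a b c : R, m1 (`]a, +oo[ `*` (`]b, +oo[ `*` `]c, +oo[)) =
                 m2 (`]a, +oo[ `*` (`]b, +oo[ `*` `]c, +oo[))) ->
  forall C, measurable C -> m1 C = m2 C.
Proof.
move=> fin H.
have H1 A : RGenOInfty.G A -> forall C : set (R * R), measurable C ->
    m1 (A `*` C) = m2 (A `*` C).
  move=> [a ->] C mC.
  have mA' : measurable (`]a, +oo[ `*` [set: R * R]) by apply: measurableX.
  pose n1 := @measure_function_pushforward__canonical__measure_function_Measure
    _ _ _ _ _ (mrestr m1 mA') snd measurable_snd.
  pose n2 := @measure_function_pushforward__canonical__measure_function_Measure
    _ _ _ _ _ (mrestr m2 mA') snd measurable_snd.
  have E D : (snd @^-1` D) `&` (`]a, +oo[ `*` [set: R * R]) = `]a, +oo[ `*` D.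
    by apply/seteqP; split => -[x y] /=; [move=> [? []]|move=> []].
  have : n1 C = n2 C.
    apply: (pi_gen_prod (@pi_gen_rays R) (@pi_gen_rays R)) => //.
    - rewrite /n1 /= /pushforward /mrestr E; apply: le_lt_trans fin.
      by apply: le_measure; rewrite ?inE//; exact: measurableX.
    - by move=> _ _ [b ->] [c ->]; rewrite /n1 /n2 /= /pushforward /mrestr !E H.
  by rewrite /n1 /n2 /= /pushforward /mrestr !E.
apply: (pi_gen_prod (@pi_gen_rays R) (@pi_gen_measurable _ (R * R)%type)) => //.
by move=> A B GA mB; exact: H1.
Qed.

End pi_gen_unique.

Section laplace3.
Context (R : realType) d1 d2 (T1 : measurableType d1) (T2 : measurableType d2)
  (m1 : {measure set T1 -> \bar R}) (m2 : {measure set T2 -> \bar R}).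

Lemma measurable_fun_expRN_indic d (T : measurableType d) (r : T -> R) (u b : R) :
  measurable_fun setT r ->
  measurable_fun setT (fun x => expR (- (u * r x))) /\
  measurable_fun setT (fun x => \1_(`]b, +oo[) (r x) : R).
Proof.
move=> mr; split; last exact: measurableT_comp.
by apply: measurableT_comp => //; apply: measurableT_comp => //; exact: measurable_funM.
Qed.

Lemma integrable_expRN_indic d (T : measurableType d) (mu : {measure set T -> \bar R})
    (f g : T -> R) :
  measurable_fun setT f -> (forall x, 0 <= f x <= 1) ->
  mu.-integrable setT (EFin \o g) -> mu.-integrable setT (EFin \o (fun x => f x * g x)).
Proof.
move=> mf f01 ig.
have mg : measurable_fun setT g by apply/measurable_EFinP; exact: measurable_int ig.
apply: (@integrable_dom _ _ _ _ _ _ (fun x => `|g x|)) => //.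
- exact: measurable_funM.
- exact: integrable_norm.
- by move=> x _; have /andP[f0 f1] := f01 x; rewrite normrM ler_piMl// ger0_norm.
Qed.

(* Laplace kernels only separate nonnegative values: a signed variable enters
   through its positive and negative parts [s1] and [y1]. *)
Lemma laplace3_unique (r1 s1 y1 g1 : T1 -> R) (r2 s2 y2 g2 : T2 -> R) (F : R * (R * R) -> \bar R) :
  measurable_fun setT r1 -> measurable_fun setT s1 -> measurable_fun setT y1 ->
  measurable_fun setT r2 -> measurable_fun setT s2 -> measurable_fun setT y2 ->
  (forall x, [/\ 0 <= r1 x, 0 <= s1 x, 0 <= y1 x & 0 <= g1 x]) ->
  (forall x, [/\ 0 <= r2 x, 0 <= s2 x, 0 <= y2 x & 0 <= g2 x]) ->
  m1.-integrable setT (EFin \o g1) -> m2.-integrable setT (EFin \o g2) ->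
  (forall u v w : R, 0 <= u -> 0 <= v -> 0 <= w ->
    (\int[m1]_x (expR (- (u * r1 x)) * (expR (- (v * s1 x)) * (expR (- (w * y1 x)) * g1 x)))%:E =
     \int[m2]_x (expR (- (u * r2 x)) * (expR (- (v * s2 x)) * (expR (- (w * y2 x)) * g2 x)))%:E)%E) ->
  measurable_fun setT F -> (forall z, (0 <= F z)%E) ->
  (\int[m1]_x (F (r1 x, (s1 x, y1 x)) * (g1 x)%:E) =
   \int[m2]_x (F (r2 x, (s2 x, y2 x)) * (g2 x)%:E))%E.
Proof.
move=> mr1 ms1 my1 mr2 ms2 my2 pos1 pos2 ig1 ig2 H mF F0.
have mg1 : measurable_fun setT g1 by apply/measurable_EFinP; exact: measurable_int ig1.
have mg2 : measurable_fun setT g2 by apply/measurable_EFinP; exact: measurable_int ig2.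
have e01 (u x : R) : 0 <= u -> 0 <= x -> 0 <= expR (- (u * x)) <= 1.
  by move=> u0 x0; rewrite expR_ge0 expRN_le1// mulr_ge0.
have i01 (b x : R) : (0 <= (\1_(`]b, +oo[) x : R) <= 1) by rewrite indicE; case: (_ \in _); rewrite ?lexx ?ler01.
have r10 x : 0 <= r1 x by case: (pos1 x). have s10 x : 0 <= s1 x by case: (pos1 x).
have y10 x : 0 <= y1 x by case: (pos1 x). have g10 x : 0 <= g1 x by case: (pos1 x).
have r20 x : 0 <= r2 x by case: (pos2 x). have s20 x : 0 <= s2 x by case: (pos2 x).
have y20 x : 0 <= y2 x by case: (pos2 x). have g20 x : 0 <= g2 x by case: (pos2 x).
have me d (T : measurableType d) (r : T -> R) (u : R) : measurable_fun setT r ->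
    measurable_fun setT (fun x => expR (- (u * r x))).
  by move=> mr; case: (measurable_fun_expRN_indic u 0 mr).
have mi d (T : measurableType d) (r : T -> R) (b : R) : measurable_fun setT r ->
    measurable_fun setT (fun x => \1_(`]b, +oo[) (r x) : R).
  by move=> mr; case: (measurable_fun_expRN_indic 0 b mr).
(* The three kernels are exchanged for ray indicators one variable at a time; the factors not yet,
   or already, exchanged are part of the weight. *)
have H1 a (v w : R) : 0 <= v -> 0 <= w ->
    (\int[m1]_x (\1_(`]a, +oo[) (r1 x) * (expR (- (v * s1 x)) * (expR (- (w * y1 x)) * g1 x)))%:E =
     \int[m2]_x (\1_(`]a, +oo[) (r2 x) * (expR (- (v * s2 x)) * (expR (- (w * y2 x)) * g2 x)))%:E)%E.
  move=> v0 w0; apply: laplace_rays => //.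
  - by do 2 (apply: integrable_expRN_indic; [exact: me|by move=> x; exact: e01|]).
  - by do 2 (apply: integrable_expRN_indic; [exact: me|by move=> x; exact: e01|]).
  - by move=> u u0; exact: H.
have H2 a b (w : R) : 0 <= w ->
    (\int[m1]_x (\1_(`]b, +oo[) (s1 x) * (\1_(`]a, +oo[) (r1 x) * (expR (- (w * y1 x)) * g1 x)))%:E =
     \int[m2]_x (\1_(`]b, +oo[) (s2 x) * (\1_(`]a, +oo[) (r2 x) * (expR (- (w * y2 x)) * g2 x)))%:E)%E.
  move=> w0; apply: laplace_rays => //.
  - apply: integrable_expRN_indic; [exact: mi|by move=> x; exact: i01|].
    by apply: integrable_expRN_indic; [exact: me|by move=> x; exact: e01|].
  - apply: integrable_expRN_indic; [exact: mi|by move=> x; exact: i01|].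
    by apply: integrable_expRN_indic; [exact: me|by move=> x; exact: e01|].
  - move=> v v0; under eq_integral do rewrite mulrCA.
    by under [RHS]eq_integral do rewrite mulrCA; exact: H1.
have H3 a b c :
    (\int[m1]_x (\1_(`]c, +oo[) (y1 x) * (\1_(`]b, +oo[) (s1 x) * (\1_(`]a, +oo[) (r1 x) * g1 x)))%:E =
     \int[m2]_x (\1_(`]c, +oo[) (y2 x) * (\1_(`]b, +oo[) (s2 x) * (\1_(`]a, +oo[) (r2 x) * g2 x)))%:E)%E.
  apply: laplace_rays => //.
  - by do 2 (apply: integrable_expRN_indic; [exact: mi|by move=> x; exact: i01|]).
  - by do 2 (apply: integrable_expRN_indic; [exact: mi|by move=> x; exact: i01|]).
  - move=> w w0; under eq_integral do rewrite mulrCA (mulrCA (expR _)).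
    by under [RHS]eq_integral do rewrite mulrCA (mulrCA (expR _)); exact: H2.
have mEg1 : measurable_fun setT (EFin \o g1) by exact/measurable_EFinP.
have mEg2 : measurable_fun setT (EFin \o g2) by exact/measurable_EFinP.
have Eg10 x : (0 <= (EFin \o g1) x)%E by rewrite /= lee_fin.
have Eg20 x : (0 <= (EFin \o g2) x)%E by rewrite /= lee_fin.
pose D1 := density_measure m1 mEg1 Eg10; pose D2 := density_measure m2 mEg2 Eg20.
have mZ1 : measurable_fun setT (fun x => (r1 x, (s1 x, y1 x))).
  by apply/measurable_fun_pair => //; exact/measurable_fun_pair.
have mZ2 : measurable_fun setT (fun x => (r2 x, (s2 x, y2 x))).
  by apply/measurable_fun_pair => //; exact/measurable_fun_pair.
pose n1 := @measure_function_pushforward__canonical__measure_function_Measure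
    _ _ _ _ _ D1 _ mZ1.
pose n2 := @measure_function_pushforward__canonical__measure_function_Measure
    _ _ _ _ _ D2 _ mZ2.
have nE a b c d (T : measurableType d) (mu : {measure set T -> \bar R}) (r s y g : T -> R) :
   (\int[mu]_(x in (fun x => (r x, (s x, y x))) @^-1` (`]a, +oo[ `*` (`]b, +oo[ `*` `]c, +oo[))) (g x)%:E =
   \int[mu]_x (\1_(`]c, +oo[) (y x) * (\1_(`]b, +oo[) (s x) * (\1_(`]a, +oo[) (r x) * g x)))%:E)%E.
  rewrite integral_mkcond; apply: eq_integral => x _; rewrite patchE !indicE !mulrA -!natrM !mulnb.
  case: ifPn => [/set_mem[/= h1 [h2 h3]]|/negP h].
    by rewrite !mem_setE h1 h2 h3 mul1r.
  rewrite (_ : _ && _ = false) ?mul0r//.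
  apply/negP => /andP[/andP[]]; rewrite !mem_setE => h3 h2 h1.
  by apply: h; apply/mem_set.
have n1n2 C : measurable C -> n1 C = n2 C.
  apply: rays3_unique.
  - rewrite /n1 /= /pushforward /D1/= /density_measure preimage_setT.
    have /integrableP[_] := ig1; apply: le_lt_trans.
    rewrite le_eqVlt; apply/orP; left; apply/eqP.
    by apply: eq_integral => x _ /=; rewrite ger0_norm.
  - by move=> a b c; rewrite /n1 /n2/= /pushforward /D1 /D2/= /density_measure !nE.
transitivity (\int[n1]_z F z)%E.
  apply/esym; transitivity (\int[D1]_x F (r1 x, (s1 x, y1 x)))%E.
    exact: (ge0_integral_pushforward mZ1 D1 measurableT mF (fun z _ => F0 z)).
  by apply: (@ge0_integral_density _ _ _ m1 D1 g1) => //; exact: measurableT_comp.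
transitivity (\int[n2]_z F z)%E.
  by apply: eq_measure_integral => C mC _; exact: n1n2.
transitivity (\int[D2]_x F (r2 x, (s2 x, y2 x)))%E.
  exact: (ge0_integral_pushforward mZ2 D2 measurableT mF (fun z _ => F0 z)).
by apply: (@ge0_integral_density _ _ _ m2 D2 g2) => //; exact: measurableT_comp.
Qed.

End laplace3.

(** * Calculus on the line *)

Section derive_toolkit.
Context (R : realType).
Implicit Types (f g : R -> R) (x a b c : R).

Lemma dcst c x : is_derive x 1 (fun=> c : R) 0.
Proof. exact: is_derive_cst. Qed.

Lemma did x : is_derive x 1 (fun t : R => t) 1.
Proof. exact: is_derive_id. Qed.

Lemma dD f g x a b : is_derive x 1 f a -> is_derive x 1 g b ->
  is_derive x 1 (fun t => f t + g t) (a + b).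
Proof. by move=> ? ?; exact: is_deriveD. Qed.

Lemma dN f x a : is_derive x 1 f a -> is_derive x 1 (fun t => - f t) (- a).
Proof. by move=> ?; exact: is_deriveN. Qed.

Lemma dM f g x a b : is_derive x 1 f a -> is_derive x 1 g b ->
  is_derive x 1 (fun t => f t * g t) (f x * b + g x * a).
Proof. by move=> ? ?; exact: is_deriveM. Qed.

Lemma dZ c f x a : is_derive x 1 f a -> is_derive x 1 (fun t => c * f t) (c * a).
Proof.
move=> h; apply: is_derive_eq (dM (dcst c x) h) _.
by rewrite mulr0 addr0.
Qed.

Lemma dcomp f g x a b : is_derive (g x) 1 f a -> is_derive x 1 g b ->
  is_derive x 1 (fun t => f (g t)) (a * b).
Proof. by move=> ? ?; exact: is_derive1_comp. Qed.

Lemma dexpR g x b : is_derive x 1 g b -> is_derive x 1 (fun t => expR (g t)) (expR (g x) * b).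
Proof. by move=> h; apply: dcomp. Qed.

Lemma dcos g x b : is_derive x 1 g b -> is_derive x 1 (fun t => cos (g t)) (- sin (g x) * b).
Proof. by move=> h; apply: dcomp. Qed.

Lemma dsin g x b : is_derive x 1 g b -> is_derive x 1 (fun t => sin (g t)) (cos (g x) * b).
Proof. by move=> h; apply: dcomp. Qed.

Lemma dX n g x b : is_derive x 1 g b ->
  is_derive x 1 (fun t => g t ^+ n) (n%:R * g x ^+ n.-1 * b).
Proof.
move=> h; elim: n => [|n ih].
  by under eq_fun do rewrite expr0; apply: is_derive_eq (dcst 1 x) _; rewrite !mul0r.
under eq_fun do rewrite exprS; apply: is_derive_eq (dM h ih) _.
case: n {ih} => [|n]; first by rewrite !mul0r expr0; ring.
by rewrite /= -(natr1 n.+1) exprS; ring.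
Qed.

End derive_toolkit.

Section signed_FTC.
Context (R : realType).
Notation mu := (@lebesgue_measure R).

Lemma is_derive_continuous (F f : R -> R) : (forall x : R, is_derive x 1 F (f x)) -> continuous F.
Proof.
move=> dF x; apply: differentiable_continuous; apply/derivable1_diffP.
by case: (dF x).
Qed.

Lemma FTC_segment (F f : R -> R) a b : a < b -> (forall x : R, is_derive x 1 F (f x)) ->
  continuous f -> (\int[mu]_(x in `[a, b]) (f x)%:E = (F b - F a)%:E)%E.
Proof.
move=> ab dF cf; rewrite (@continuous_FTC2 _ f F)//.
- by apply: continuous_subspaceT.
- split.
  + by move=> x _; case: (dF x).
  + by apply: cvg_at_right_filter; exact: (is_derive_continuous dF).
  + by apply: cvg_at_left_filter; exact: (is_derive_continuous dF).
- by move=> x _; rewrite derive1E; case: (dF x).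
Qed.

(** The integrand may change sign, so integrability is assumed and the half-line is exhausted by the
    segments from 0 to [n.+1] under dominated convergence. *)
Lemma FTC_halfline (F f : R -> R) (l : R) : (forall x : R, is_derive x 1 F (f x)) ->
  continuous f -> mu.-integrable `[0, +oo[ (EFin \o f) ->
  F n%:R @[n --> \oo] --> l ->
  \int[mu]_(x in `[0, +oo[) f x = l - F 0.
Proof.
move=> dF cf intf Fl.
have mf : measurable_fun setT f by exact: continuous_measurable_fun.
have mI : measurable (`[0, +oo[ : set R) by [].
have := @dct_Rint _ _ _ mu `[0, +oo[ (fun n x => f x * \1_(`[0%R, n.+1%:R]) x) f (fun x => `|f x|) mI.
move=> /(_ _ _ _ _)/cvg_lim => <-//; last first.
- by move=> n x _; rewrite normrM ler_piMr// indicE; case: (_ \in _); rewrite ?normr1 ?normr0.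
- exact: (integrable_norm intf).
- move=> x; rewrite /= in_itv/= andbT => x0.
  apply: cvg_near_cst; near=> n.
  rewrite indicE mem_setE in_itv/= x0/= ltW ?mulr1//.
  near: n; exists (Num.truncn `|x|) => // n /= hn.
  rewrite (le_lt_trans (ler_norm _))// (lt_le_trans (truncnS_gt _))//.
  by rewrite ler_nat ltnS.
- move=> n; apply: measurable_funM; first exact: measurable_funTS.
  by apply: measurable_funTS; exact: measurable_indic.
apply/cvg_lim => //.
rewrite (_ : (fun n => _) = (fun n => F n.+1%:R - F 0)).
  apply: cvgB; last exact: cvg_cst.
  by rewrite -(cvg_shiftS (fun n => F n%:R)) in Fl.
apply/funext => n; rewrite /Rintegral.
rewrite (_ : (\int[mu]_(x in _) _)%E = (F n.+1%:R - F 0)%:E)//.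
rewrite -(@FTC_segment _ f)//.
rewrite integral_mkcond [RHS]integral_mkcond; apply: eq_integral => x _.
rewrite !patchE !indicE !mem_setE !in_itv/= andbT.
by case: (0 <= x) => //=; case: (_ <= _); rewrite ?mulr1 ?mulr0.
Unshelve. all: by end_near. Qed.

Lemma FTC_line (F f : R -> R) (l l' : R) : (forall x : R, is_derive x 1 F (f x)) ->
  continuous f -> mu.-integrable setT (EFin \o f) ->
  F n%:R @[n --> \oo] --> l -> F (- n%:R) @[n --> \oo] --> l' ->
  \int[mu]_x f x = l - l'.
Proof.
move=> dF cf intf Fl Fl'.
have mf : measurable_fun setT f by exact: continuous_measurable_fun.
have := @dct_Rint _ _ _ mu setT (fun n x => f x * \1_(`[- n.+1%:R, n.+1%:R]) x) f (fun x => `|f x|) measurableT.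
move=> /(_ _ _ _ _)/cvg_lim => <-//; last first.
- by move=> n x _; rewrite normrM ler_piMr// indicE; case: (_ \in _); rewrite ?normr1 ?normr0.
- exact: (integrable_norm intf).
- move=> x _.
  apply: cvg_near_cst; near=> n.
  rewrite indicE mem_setE in_itv/= -ler_norml ltW ?mulr1//.
  near: n; exists (Num.truncn `|x|) => // n /= hn.
  by rewrite (lt_le_trans (truncnS_gt _))// ler_nat ltnS.
- by move=> n; apply: measurable_funM => //; exact: measurable_indic.
apply/cvg_lim => //.
rewrite (_ : (fun n => _) = (fun n => F n.+1%:R - F (- n.+1%:R))).
  by apply: cvgB; [rewrite -(cvg_shiftS (fun n => F n%:R)) in Fl|
    rewrite -(cvg_shiftS (fun n => F (- n%:R))) in Fl'].
apply/funext => n; rewrite /Rintegral.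
rewrite (_ : (\int[mu]_(x in _) _)%E = (F n.+1%:R - F (- n.+1%:R))%:E)//.
rewrite -(@FTC_segment _ f)//; last by rewrite gtrN.
rewrite [RHS]integral_mkcond; apply: eq_integral => x _.
rewrite !patchE !indicE !mem_setE !in_itv/=.
by case: (_ && _); rewrite ?mulr1 ?mulr0.
Unshelve. all: by end_near. Qed.

End signed_FTC.

Section expcos.
Context (R : realType).
Notation mu := (@lebesgue_measure R).

Lemma cvg_expRN_pinfty (c : R) : 0 < c -> expR (- (c * v)) @[v --> +oo] --> 0.
Proof.
move=> c0; apply: (@cvg_comp _ _ _ (fun v => c * v) (fun v => expR (- v)) _ +oo); last exact: cvgr_expR.
by apply: gt0_cvgMry => //; exact: cvg_id.
Qed.

Lemma integrable_expRN_halfline (c : R) : 0 < c ->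
  mu.-integrable `[0, +oo[ (EFin \o (fun v => expR (- (c * v)))) /\
  (\int[mu]_(v in `[0%R, +oo[) (expR (- (c * v)))%:E = (c^-1)%:E)%E.
Proof.
move=> c0.
have d (x : R) : is_derive x 1 (fun v => - (c^-1 * expR (- (c * v)))) (expR (- (c * x))).
  apply: (is_derive_eq (dN (dZ c^-1 (dexpR (dN (dZ c (did x))))))).
  by rewrite mulr1 mulrN mulrN opprK mulrCA mulVf ?mulr1// gt_eqF.
have cf : continuous (fun v : R => expR (- (c * v))).
  exact: (@is_derive_continuous _ _ _ (fun x => dexpR (dN (dZ c (did x))))).
have int : (\int[mu]_(v in `[0%R, +oo[) (expR (- (c * v)))%:E = (c^-1)%:E)%E.
  rewrite (@ge0_continuous_FTC2y _ _ (fun v => - (c^-1 * expR (- (c * v)))) 0 0)//.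
  - by rewrite mulr0 oppr0 expR0 mulr1 -EFinB sub0r opprK.
  - by apply: continuous_subspaceT.
  - rewrite -oppr0 -(mulr0 c^-1); apply: cvgN; apply: cvgM; first exact: cvg_cst.
    exact: cvg_expRN_pinfty.
  - by apply: cvg_at_right_filter; exact: (is_derive_continuous d).
  - by move=> x _; rewrite derive1E; case: (d x).
split => //; apply/integrableP; split.
  by apply/measurable_EFinP; apply: measurable_funTS; exact: continuous_measurable_fun.
under eq_integral do rewrite /= ger0_norm ?expR_ge0//.
by rewrite int ltry.
Qed.

(** The phase lets one primitive serve both trigonometric integrals: [k = 0] gives the cosine and
    [k = - (pi / 2)] the sine. *)
Let expcos_phase (c z k : R) : 0 < c ->
  \int[mu]_(v in `[0, +oo[) (expR (- (c * v)) * cos (z * v + k)) = (c * cos k - z * sin k) / (c ^+ 2 + z ^+ 2).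
Proof.
move=> c0; have [ie _] := integrable_expRN_halfline c0.
have cz0 : c ^+ 2 + z ^+ 2 != 0 by rewrite gt_eqF// ltr_wpDr ?sqr_ge0// exprn_gt0.
have cos1 (x : R) : `|cos x| <= 1 by rewrite ler_norml cos_geN1 cos_le1.
have sin1 (x : R) : `|sin x| <= 1 by rewrite ler_norml sin_geN1 sin_le1.
have de (x : R) : is_derive x 1 (fun v => expR (- (c * v))) (- c * expR (- (c * x))).
  by apply: (is_derive_eq (dexpR (dN (dZ c (did x))))); rewrite mulr1 mulrC.
have dl (x : R) : is_derive x 1 (fun v => z * v + k) z.
  by apply: (is_derive_eq (dD (dZ z (did x)) (dcst k x))); ring.
have dc x := dcos (dl x); have ds x := dsin (dl x).
have cf : continuous (fun v => expR (- (c * v)) * cos (z * v + k)).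
  by move=> x; apply: cvgM; [exact: (is_derive_continuous de)|exact: (is_derive_continuous dc)].
have dF (x : R) : is_derive x 1 (fun v => (c ^+ 2 + z ^+ 2)^-1 *
    (expR (- (c * v)) * (z * sin (z * v + k) - c * cos (z * v + k)))) (expR (- (c * x)) * cos (z * x + k)).
  apply: (is_derive_eq (dZ (c ^+ 2 + z ^+ 2)^-1 (dM (de x) (dD (dZ z (ds x)) (dN (dZ c (dc x))))))).
  by field.
rewrite (FTC_halfline dF (l := 0))//; first by rewrite !mulr0 oppr0 expR0 !add0r; field.
- apply: (integrable_dom _ _ ie) => //; first by apply: measurable_funTS; exact: continuous_measurable_fun.
  by move=> x _; rewrite normrM ger0_norm ?expR_ge0// ler_piMr ?expR_ge0.
rewrite -(mulr0 (c ^+ 2 + z ^+ 2)^-1); apply: cvgM; first exact: cvg_cst.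
have e0 : expR (- (c * n%:R)) * (`|z| + `|c|) @[n --> \oo] --> 0.
  rewrite -(mul0r (`|z| + `|c|)); apply: cvgM; last exact: cvg_cst.
  exact: cvg_comp (@cvgr_idn R) (cvg_expRN_pinfty c0).
apply: (@squeeze_cvgr _ _ _ _ (fun n => - (expR (- (c * n%:R)) * (`|z| + `|c|))) _ _ _ _ _ e0); last first.
  by rewrite -oppr0; exact: cvgN.
apply: nearW => n; rewrite -ler_norml normrM ger0_norm ?expR_ge0// ler_wpM2l ?expR_ge0//.
by rewrite (le_trans (ler_normB _ _))// !normrM lerD// ler_piMr.
Qed.

Lemma expcos_halfline (c z : R) : 0 < c ->
  \int[mu]_(v in `[0, +oo[) (expR (- (c * v)) * cos (z * v)) = c / (c ^+ 2 + z ^+ 2) /\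
  \int[mu]_(v in `[0, +oo[) (expR (- (c * v)) * sin (z * v)) = z / (c ^+ 2 + z ^+ 2).
Proof.
move=> c0; split.
  have := expcos_phase z 0 c0; rewrite cos0 sin0 mulr1 mulr0 subr0.
  by under eq_Rintegral do rewrite addr0.
have := expcos_phase z (- (pi / 2)) c0; rewrite cosN sinN cos_pihalf sin_pihalf mulr0 sub0r mulrN mulr1 opprK.
by under eq_Rintegral do rewrite cosBpihalf.
Qed.

End expcos.

(** * Gaussian densities against exponential weights *)

Section gaussian.
Context (R : realType).
Notation mu := (@lebesgue_measure R).

Definition gaussd (S y : R) : R :=
  (Num.sqrt (2 * pi * S))^-1 * expR (- (y ^+ 2) / (2 * S)).

Lemma gaussd_normal S : 0 < S -> gaussd S = normal_pdf 0 (Num.sqrt S).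
Proof.
move=> S0; apply/funext => y.
have s0 : Num.sqrt S != 0 by rewrite gt_eqF// sqrtr_gt0.
rewrite /gaussd /normal_pdf (negbTE s0) /normal_peak /normal_fun subr0.
rewrite sqr_sqrtr ?ltW// -[S *+ 2]mulr_natl -[_ *+ 2]mulr_natl.
by congr (_ ^-1 * _); congr (Num.sqrt _); ring.
Qed.

Lemma gaussd_ge0 S y : 0 <= gaussd S y.
Proof. by rewrite mulr_ge0 ?invr_ge0 ?sqrtr_ge0// expR_ge0. Qed.

Lemma is_derive_gaussd S (y : R) : 0 < S ->
  is_derive y 1 (gaussd S) (- (y / S) * gaussd S y).
Proof.
move=> S0.
have E : gaussd S = fun y => (Num.sqrt (2 * pi * S))^-1 * expR (- (2 * S)^-1 * y ^+ 2).
  by apply/funext => x; rewrite /gaussd; congr (_ * expR _); ring.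
rewrite {1}E.
apply: (is_derive_eq (dZ _ (dexpR (dZ _ (dX 2 (did y)))))).
rewrite E /=; move: (Num.sqrt _)^-1 (expR _) => a b.
by field; rewrite gt_eqF.
Qed.

Lemma continuous_gaussd S : 0 < S -> continuous (gaussd S).
Proof. by move=> S0; apply: is_derive_continuous => x; exact: is_derive_gaussd. Qed.

Lemma measurable_gaussd S : measurable_fun setT (gaussd S).
Proof.
apply: measurable_funM => //; apply: measurableT_comp => //.
by apply: measurable_funM => //; apply: measurableT_comp => //; exact: measurable_funX.
Qed.

Lemma integrable_gaussd S : 0 < S -> mu.-integrable setT (EFin \o gaussd S).
Proof. by move=> S0; rewrite gaussd_normal//; exact: integrable_normal_pdf. Qed.

Lemma integral_gaussd S : 0 < S -> (\int[mu]_y (gaussd S y)%:E = 1)%E.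
Proof. by move=> S0; rewrite gaussd_normal//; exact: integral_normal_pdf. Qed.

(** Half of the Gaussian exponent absorbs the exponential: the difference of the two exponents is
    the square of [a * S - |y| / 2] divided by [S]. The price is the doubled variance. *)
Lemma gaussd_exp_bound (S a y : R) : 0 < S ->
  expR (a * `|y|) * gaussd S y <= Num.sqrt 2 * expR (a ^+ 2 * S) * gaussd (2 * S) y.
Proof.
move=> S0; rewrite /gaussd.
have -> : (Num.sqrt (2 * pi * (2 * S)))^-1 = (Num.sqrt 2)^-1 * (Num.sqrt (2 * pi * S))^-1.
  by rewrite -invfM -sqrtrM//; congr (Num.sqrt _)^-1; ring.
set s := (Num.sqrt (2 * pi * S))^-1.
have -> : Num.sqrt 2 * expR (a ^+ 2 * S) * ((Num.sqrt 2)^-1 * s * expR (- y ^+ 2 / (2 * (2 * S)))) =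
    s * expR (a ^+ 2 * S + - y ^+ 2 / (2 * (2 * S))).
  by rewrite expRD; field; rewrite gt_eqF// sqrtr_gt0.
rewrite mulrCA ler_wpM2l ?invr_ge0 ?sqrtr_ge0// -expRD ler_expR.
rewrite -subr_ge0.
have -> : a ^+ 2 * S + - y ^+ 2 / (2 * (2 * S)) - (a * `|y| + - y ^+ 2 / (2 * S)) =
   (a * S - `|y| / 2) ^+ 2 / S.
  by rewrite -(real_normK (num_real y)); field; rewrite gt_eqF.
by rewrite divr_ge0 ?sqr_ge0// ltW.
Qed.

Lemma integrable_gauss_dom S (a K : R) (f : R -> R) : 0 < S -> measurable_fun setT f ->
  (forall y, `|f y| <= K * expR (a * `|y|)) ->
  mu.-integrable setT (EFin \o (fun y => f y * gaussd S y)).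
Proof.
move=> S0 mf fK.
have K0 : 0 <= K.
  have := fK 0; rewrite normr0 mulr0 expR0 mulr1; exact: le_trans.
have ig : mu.-integrable setT (EFin \o (fun y => (K * (Num.sqrt 2 * expR (a ^+ 2 * S))) * gaussd (2 * S) y)).
  rewrite (_ : EFin \o _ = (fun y => (K * (Num.sqrt 2 * expR (a ^+ 2 * S)))%:E * (EFin \o gaussd (2 * S)) y)%E)//.
  by apply: integrableZl => //; apply: integrable_gaussd; rewrite mulr_gt0.
apply: (integrable_dom _ _ ig) => //.
  by apply: measurable_funM => //; exact: measurable_gaussd.
move=> y _; rewrite normrM (ger0_norm (gaussd_ge0 _ _)) -mulrA.
apply: (@le_trans _ _ (K * expR (a * `|y|) * gaussd S y)).
  by rewrite ler_wpM2r// gaussd_ge0.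
by rewrite -mulrA ler_wpM2l// gaussd_exp_bound.
Qed.

Lemma gaussd_cvg0 S (a K : R) (f : R -> R) : 0 < S ->
  (forall y, `|f y| <= K * expR (a * `|y|)) ->
  f n%:R * gaussd S n%:R @[n --> \oo] --> 0 /\
  f (- n%:R) * gaussd S (- n%:R) @[n --> \oo] --> 0.
Proof.
move=> S0 fK.
have K0 : 0 <= K.
  by have := fK 0; rewrite normr0 mulr0 expR0 mulr1; exact: le_trans.
(* [(a + 1) ^+ 2 * S / 2] is the maximum over [t] of [(a + 1) * t - t ^+ 2 / (2 * S)]; the extra 1
   leaves the decay [expR (- |y|)]. *)
pose C := K * (Num.sqrt (2 * pi * S))^-1 * expR ((a + 1) ^+ 2 * S / 2).
have bnd (y : R) : `|f y * gaussd S y| <= C * expR (- (1 * `|y|)).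
  rewrite normrM (ger0_norm (gaussd_ge0 _ _)).
  apply: (le_trans (ler_wpM2r (gaussd_ge0 _ _) (fK y))).
  rewrite /gaussd /C -!mulrA ler_wpM2l// mulrCA ler_wpM2l ?invr_ge0 ?sqrtr_ge0//.
  rewrite -!expRD ler_expR -subr_ge0.
  have -> : (a + 1) * ((a + 1) * (S / 2)) - 1 * `|y| - (a * `|y| + - y ^+ 2 / (2 * S)) =
      ((a + 1) * S - `|y|) ^+ 2 / (2 * S).
    by rewrite -(real_normK (num_real y)); field; rewrite gt_eqF.
  by rewrite divr_ge0 ?sqr_ge0// mulr_ge0// ltW.
have c0 : C * expR (- (1 * n%:R)) @[n --> \oo] --> 0.
  rewrite -(mulr0 C); apply: cvgM; first exact: cvg_cst.
  exact: cvg_comp (@cvgr_idn R) (cvg_expRN_pinfty (@ltr01 R)).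
have sq (g : nat -> R) : (forall n, `|g n| <= C * expR (- (1 * n%:R))) -> g n @[n --> \oo] --> 0.
  move=> gC; apply: norm_cvg0; apply: (@squeeze_cvgr _ _ _ _ (fun=> 0) _ _ _ _ _ c0).
    by apply: nearW => n; rewrite normr_ge0 gC.
  exact: cvg_cst.
split; apply: sq => n; apply: (le_trans (bnd _)).
  by rewrite ger0_norm.
by rewrite normrN ger0_norm.
Qed.

End gaussian.

(** * Fourier inversion *)

Section real_fubini.
Context d1 d2 (T1 : measurableType d1) (T2 : measurableType d2) (R : realType).
Context (m1 : {sigma_finite_measure set T1 -> \bar R}) (m2 : {sigma_finite_measure set T2 -> \bar R}).

(** A bound by a product gives integrability on the product space and also along every section, so
    the exchange holds for real integrals without any almost-everywhere clause. *)
Lemma fubini_Rint (f : T1 * T2 -> R) (k1 : T1 -> R) (k2 : T2 -> R) :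
  measurable_fun setT f ->
  m1.-integrable setT (EFin \o k1) -> m2.-integrable setT (EFin \o k2) ->
  (forall x, 0 <= k1 x) -> (forall y, 0 <= k2 y) ->
  (forall x y, `|f (x, y)| <= k1 x * k2 y) ->
  m1.-integrable setT (EFin \o (fun x => \int[m2]_y f (x, y))) /\
  \int[m1]_x \int[m2]_y f (x, y) = \int[m2]_y \int[m1]_x f (x, y).
Proof.
move=> mf i1 i2 k10 k20 fk.
have mk1 : measurable_fun setT k1 by apply/measurable_EFinP; exact: measurable_int i1.
have mk2 : measurable_fun setT k2 by apply/measurable_EFinP; exact: measurable_int i2.
have mEf : measurable_fun setT (EFin \o f) by exact/measurable_EFinP.
have fin1 : (\int[m1]_x (k1 x)%:E < +oo)%E.
  have /integrableP[_] := i1; rewrite (eq_integral (fun x => (k1 x)%:E))// => x _ /=.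
  by rewrite ger0_norm.
have fin2 : (\int[m2]_x (k2 x)%:E)%E \is a fin_num by exact: integrable_fin_num i2.
have intf : (m1 \x m2)%E.-integrable setT (EFin \o f).
  apply/integrable12ltyP => //.
  apply: (@le_lt_trans _ _ (\int[m1]_x ((k1 x)%:E * \int[m2]_y (k2 y)%:E))%E).
    apply: ge0_le_integral => //.
    - by move=> x _; exact: integral_ge0.
    - apply: (@measurable_fun_fubini_tonelli_F _ _ _ _ _ m2 (fun z => `|(EFin \o f) z|)%E) => //.
      exact: measurableT_comp.
    - by apply: emeasurable_funM => //; exact/measurable_EFinP.
    - move=> x _; rewrite -ge0_integralZl//; last 3 first.
      + exact/measurable_EFinP.
      + by move=> y _; rewrite lee_fin.
      + by rewrite lee_fin.
      apply: ge0_le_integral => //.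
      + by apply: measurableT_comp => //; apply: measurableT_comp => //; exact: measurable_pair1.
      + by apply: emeasurable_funM => //; exact/measurable_EFinP.
      + by move=> y _ /=; rewrite lee_fin fk.
  rewrite ge0_integralZr//; last 3 first.
  - exact/measurable_EFinP.
  - by move=> x _; rewrite lee_fin.
  - by apply: integral_ge0 => y _; rewrite lee_fin.
  have fin1' : (\int[m1]_x (k1 x)%:E)%E \is a fin_num by exact: integrable_fin_num i1.
  by rewrite -(fineK fin2) -(fineK fin1') -EFinM ltry.
have fx x : (\int[m2]_y (f (x, y))%:E)%E \is a fin_num.
  apply: integrable_fin_num => //.
  apply: (@integrable_dom _ _ _ _ _ _ (fun y => k1 x * k2 y)) => //.
  - exact: measurableT_comp.
  - have := integrableZl measurableT (k1 x) i2; exact.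
have fy y : (\int[m1]_x (f (x, y))%:E)%E \is a fin_num.
  apply: integrable_fin_num => //.
  apply: (@integrable_dom _ _ _ _ _ _ (fun x => k2 y * k1 x)) => //.
  - exact: measurableT_comp.
  - have := integrableZl measurableT (k2 y) i1; exact.
  - by move=> x _; rewrite mulrC.
split.
- have := integrable_fubini_F intf; apply: eq_integrable => // x _.
  by rewrite /fubini_F /= /Rintegral fineK.

- rewrite /Rintegral; congr fine.
  under eq_integral do rewrite fineK//.
  under [RHS]eq_integral do rewrite fineK//.
  exact: (Fubini intf).
Qed.

Lemma tonelli_swap (f : T1 * T2 -> \bar R) : measurable_fun setT f ->
  (forall z, (0 <= f z)%E) ->
  (\int[m1]_x \int[m2]_y f (x, y) = \int[m2]_y \int[m1]_x f (x, y))%E.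
Proof. by move=> mf f0; exact: (fubini_tonelli f). Qed.

End real_fubini.

(** [measurableTypeR R] is the copy of [R] that carries Lebesgue measure; this states measurability
    of the projection as a map from that copy into [R]. *)
Lemma measurable_fst_R (R : realType) d (T : measurableType d) :
  measurable_fun [set: measurableTypeR R * T] (fun z => z.1 : R).
Proof. exact: (@measurable_fst _ _ (measurableTypeR R) T). Qed.

Lemma measurable_snd_R (R : realType) d (T : measurableType d) :
  measurable_fun [set: T * measurableTypeR R] (fun z => z.2 : R).
Proof. exact: (@measurable_snd _ _ T (measurableTypeR R)). Qed.

Section fourier_density.
Context (R : realType).
Notation mu := (@lebesgue_measure R).

Lemma integrable_expRN_abs (e : R) : 0 < e ->
  mu.-integrable setT (EFin \o (fun z => expR (- (e * `|z|)))) /\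
  \int[mu]_z expR (- (e * `|z|)) = 2 / e.
Proof.
move=> e0.
have cf : continuous (fun z : R => expR (- (e * `|z|))).
  move=> z; apply: continuous_comp; last exact: continuous_expR.
  by apply: cvgN; apply: cvgM; [exact: cvg_cst|exact: norm_continuous].
have E : (\int[mu]_z (expR (- (e * `|z|)))%:E = (2 / e)%:E)%E.
  rewrite ge0_symfun_integralT//; last by move=> z /=; rewrite normrN.
  rewrite (_ : [set x | 0 <= x] = `[0, +oo[%classic); last first.
    by apply/seteqP; split => x /=; rewrite in_itv/= andbT.
  under eq_integral.
    move=> z; rewrite inE/= in_itv/= andbT => z0; rewrite ger0_norm//.
    over.
  by have [_ ->] := integrable_expRN_halfline e0; rewrite -EFinM.
split; last by rewrite /Rintegral E.
apply/integrableP; split; first by apply/measurable_EFinP; exact: continuous_measurable_fun.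
by under eq_integral do rewrite /= ger0_norm ?expR_ge0//; rewrite E ltry.
Qed.

Lemma cauchy_kernel (e x : R) : 0 < e ->
  \int[mu]_z (expR (- (e * `|z|)) * cos (z * x)) = 2 * e / (e ^+ 2 + x ^+ 2).
Proof.
move=> e0; have [ie iE] := integrable_expRN_abs e0.
have [ih ihE] := integrable_expRN_halfline e0.
have [hc _] := expcos_halfline x e0.
have ccos : continuous (fun z : R => cos (z * x)).
  move=> z; apply: continuous_comp; last exact: continuous_cos.
  by apply: cvgM; [exact: cvg_id|exact: cvg_cst].
have mcos : measurable_fun setT (fun z : R => cos (z * x)) by exact: continuous_measurable_fun.
have cexp : continuous (fun z : R => expR (- (e * `|z|))).
  move=> z; apply: continuous_comp; last exact: continuous_expR.
  by apply: cvgN; apply: cvgM; [exact: cvg_cst|exact: norm_continuous].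
have mexp : measurable_fun setT (fun z : R => expR (- (e * `|z|))) by exact: continuous_measurable_fun.
have icos : mu.-integrable setT (EFin \o (fun z => expR (- (e * `|z|)) * cos (z * x))).
  apply: (integrable_dom _ _ ie) => //; first exact: measurable_funM.
  by move=> z _; rewrite normrM ger0_norm ?expR_ge0// ler_piMr ?expR_ge0// ler_norml cos_geN1 cos_le1.
have icosh : mu.-integrable `[0, +oo[ (EFin \o (fun z => expR (- (e * z)) * cos (x * z))).
  apply: (integrable_dom _ _ ih) => //.
    apply: measurable_funTS; apply: measurable_funM.
      by apply: measurableT_comp => //; apply: measurableT_comp => //; exact: measurable_funM.
    by under eq_fun do rewrite mulrC.
  by move=> z _; rewrite normrM ger0_norm ?expR_ge0// ler_piMr ?expR_ge0// ler_norml cos_geN1 cos_le1.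
(* Folding an even integrand onto the half-line is done for nonnegative functions, hence the shift
   [1 + cos]. *)
have S : \int[mu]_z (expR (- (e * `|z|)) * (1 + cos (z * x))) = 2 * (e^-1 + e / (e ^+ 2 + x ^+ 2)).
  rewrite /Rintegral ge0_symfun_integralT; last 3 first.
  - by move=> z; rewrite mulr_ge0 ?expR_ge0// -lerBlDl sub0r cos_geN1.
  - by move=> z; apply: cvgM; [exact: cexp|apply: cvgD; [exact: cvg_cst|exact: ccos]].
  - by move=> z /=; rewrite normrN mulNr cosN.
  rewrite (_ : [set x | 0 <= x] = `[0, +oo[%classic); last first.
    by apply/seteqP; split => z /=; rewrite in_itv/= andbT.
  under eq_integral.
    move=> z; rewrite inE/= in_itv/= andbT => z0.
    rewrite ger0_norm// mulrDr mulr1 EFinD (mulrC z).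
    over.
  rewrite (integralD _ ih icosh)//.
  rewrite ihE -[X in (_ + X)%E]fineK; last exact: integrable_fin_num icosh.
  by rewrite -/(Rintegral _ _ _) hc -EFinD -EFinM.
have -> : \int[mu]_z (expR (- (e * `|z|)) * cos (z * x)) =
    \int[mu]_z (expR (- (e * `|z|)) * (1 + cos (z * x)) - expR (- (e * `|z|))).
  by apply: eq_Rintegral => z _; rewrite mulrDr mulr1 addrAC subrr add0r.
rewrite (RintegralB measurableT _ ie).
  by rewrite S iE mulrDr addrAC subrr add0r mulrA.
have ie2 : mu.-integrable setT (EFin \o (fun z => expR (- (e * `|z|)) * 2)).
  by have := integrableZr measurableT 2 ie.
apply: (integrable_dom _ _ ie2) => //.
- by apply: measurable_funM => //; exact: measurable_funD.
- move=> z _; rewrite normrM ger0_norm ?expR_ge0// ler_wpM2l ?expR_ge0//.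
  by rewrite ler_norml; have := cos_geN1 (z * x); have := cos_le1 (z * x); lra.
Qed.

Context d (T : measurableType d) (P : probability T R) (Y g : T -> R).
Hypotheses (mY : measurable_fun setT Y) (mg : measurable_fun setT g)
  (g01 : forall w, 0 <= g w <= 1).
Let C z := \int[P]_w (g w * cos (z * Y w)).
Let S z := \int[P]_w (g w * sin (z * Y w)).
Variable k : R -> R.
Hypotheses (ik : mu.-integrable setT (EFin \o k)).
Hypotheses (Ck : forall z, `|C z| <= k z) (Sk : forall z, `|S z| <= k z).

(** The integrand is the real part of the Fourier transform times [expR (- 'i * z * r)]; the
    imaginary part is odd in [z] and contributes nothing. *)
Definition fourier_inv (r : R) := (2 * pi)^-1 * \int[mu]_z (C z * cos (z * r) + S z * sin (z * r)).

Let g0 w : 0 <= g w. Proof. by case/andP: (g01 w). Qed.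
Let g1 w : g w <= 1. Proof. by case/andP: (g01 w). Qed.

Let ig (f : T -> R) : measurable_fun setT f -> (forall w, `|f w| <= 1) ->
  P.-integrable setT (EFin \o (fun w => g w * f w)).
Proof.
move=> mf f1; apply: (@integrable_dom _ _ _ _ _ _ (fun=> 1)) => //.
- exact: measurable_funM.
- exact: finite_measure_integrable_cst.
- by move=> w _; rewrite normrM (ger0_norm (g0 w)) mulr_ile1.
Qed.

Let cos1 (x : R) : `|cos x| <= 1. Proof. by rewrite ler_norml cos_geN1 cos_le1. Qed.
Let sin1 (x : R) : `|sin x| <= 1. Proof. by rewrite ler_norml sin_geN1 sin_le1. Qed.

Let mcosE d' (T' : measurableType d') (f : T' -> R) : measurable_fun setT f ->
  measurable_fun setT (fun x => cos (f x)).
Proof. exact: (measurableT_comp (continuous_measurable_fun (@continuous_cos R))). Qed.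

Let msinE d' (T' : measurableType d') (f : T' -> R) : measurable_fun setT f ->
  measurable_fun setT (fun x => sin (f x)).
Proof. exact: (measurableT_comp (continuous_measurable_fun (@continuous_sin R))). Qed.

(** Inversion integral with Abel damping. By [fepsE] it is the law of [Y], weighted by [g], smoothed
    by the Cauchy kernel [ke e]. This gives nonnegativity at once, and its limit as [e] tends to 0
    can be taken in two ways: pointwise in [r], and after integration over an interval. *)
Let feps (e r : R) := (2 * pi)^-1 * \int[mu]_z (expR (- (e * `|z|)) * (C z * cos (z * r) + S z * sin (z * r))).
Let ke (e x : R) := pi^-1 * (e / (e ^+ 2 + x ^+ 2)).

Let mexp (e : R) : measurable_fun setT (fun z : R => expR (- (e * `|z|))).
Proof.
apply: continuous_measurable_fun => z; apply: continuous_comp; last exact: continuous_expR.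
by apply: cvgN; apply: cvgM; [exact: cvg_cst|exact: norm_continuous].
Qed.

Let CSE z r : C z * cos (z * r) + S z * sin (z * r) = \int[P]_w (g w * cos (z * (r - Y w))).
Proof.
have mzY : measurable_fun setT (fun w => z * Y w) by exact: measurable_funM.
have i1 := ig (mcosE mzY) (fun w => cos1 _).
have i2 := ig (msinE mzY) (fun w => sin1 _).
have sc (f : T -> R) (c : R) : P.-integrable setT (EFin \o f) -> P.-integrable setT (EFin \o (fun y => c * f y)).
  by move=> h; have := integrableZl measurableT c h.
transitivity (\int[P]_w (cos (z * r) * (g w * cos (z * Y w)) + sin (z * r) * (g w * sin (z * Y w)))).
  rewrite (RintegralD measurableT (sc _ (cos (z * r)) i1) (sc _ (sin (z * r)) i2)).
  rewrite (@RintegralZl _ _ _ P setT _ (cos (z * r)) measurableT i1).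
  by rewrite (@RintegralZl _ _ _ P setT _ (sin (z * r)) measurableT i2) mulrC (mulrC (S z)).
by apply: eq_Rintegral => w _; rewrite mulrBr cosB; ring.
Qed.

Let ke_ge0 e x : 0 < e -> 0 <= ke e x.
Proof. by move=> e0; rewrite mulr_ge0 ?invr_ge0 ?pi_ge0// divr_ge0 ?ltW// ltr_wpDr ?sqr_ge0// exprn_gt0. Qed.

Let ke_le e x : 0 < e -> ke e x <= (pi * e)^-1.
Proof.
move=> e0; rewrite /ke invfM ler_wpM2l ?invr_ge0 ?pi_ge0//.
rewrite ler_pdivrMr; last by rewrite ltr_wpDr ?sqr_ge0// exprn_gt0.
rewrite mulrDr expr2 mulrA mulVf ?gt_eqF// mul1r lerDl mulr_ge0 ?sqr_ge0//.
by rewrite invr_ge0 ltW.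
Qed.

Let mke e : 0 < e -> measurable_fun setT (ke e).
Proof.
move=> e0; apply: continuous_measurable_fun => x; apply: cvgM; first exact: cvg_cst.
apply: cvgM; first exact: cvg_cst.
apply: cvgV; first by rewrite gt_eqF// ltr_wpDr ?sqr_ge0// exprn_gt0.
by apply: cvgD; [exact: cvg_cst|exact: exprn_continuous].
Qed.

Let ike e r : 0 < e -> P.-integrable setT (EFin \o (fun w => g w * ke e (r - Y w))).
Proof.
move=> e0; apply: (@integrable_dom _ _ _ _ _ _ (fun=> (pi * e)^-1)) => //.
- apply: measurable_funM => //; apply: (measurableT_comp (mke e0)).
  exact: measurable_funB.
- exact: finite_measure_integrable_cst.
- move=> w _; rewrite normrM (ger0_norm (g0 w)) (ger0_norm (ke_ge0 _ e0)).
  by rewrite -[leRHS]mul1r ler_pM// ?ke_le// ke_ge0.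
Qed.

Let fepsE e r : 0 < e -> feps e r = \int[P]_w (g w * ke e (r - Y w)).
Proof.
move=> e0; have [ie _] := integrable_expRN_abs e0.
have mf : measurable_fun [set: measurableTypeR R * T] (fun zw : measurableTypeR R * T => expR (- (e * `|zw.1|)) * (g zw.2 * cos (zw.1 * (r - Y zw.2)))).
  have m1 := @measurable_fst_R R _ T.
  apply: measurable_funM; first exact: (measurableT_comp (mexp e) m1).
  apply: measurable_funM; first exact: (measurableT_comp mg measurable_snd).
  apply: mcosE; apply: measurable_funM => //.
  by apply: measurable_funB => //; exact: (measurableT_comp mY measurable_snd).
have i1 : P.-integrable setT (EFin \o (fun=> 1 : R)) by exact: finite_measure_integrable_cst.
have b (z : R) (w : T) : `|expR (- (e * `|z|)) * (g w * cos (z * (r - Y w)))| <= expR (- (e * `|z|)) * 1.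
  rewrite normrM ger0_norm ?expR_ge0// ler_wpM2l ?expR_ge0// normrM (ger0_norm (g0 w)).
  by rewrite mulr_ile1.
have [_ /= E] := fubini_Rint mf ie i1 (fun z => expR_ge0 _) (fun=> ler01) b.
rewrite /feps; transitivity ((2 * pi)^-1 *
    \int[mu]_z \int[P]_w (expR (- (e * `|z|)) * (g w * cos (z * (r - Y w))))).
  congr (_ * _); apply: eq_Rintegral => z _; rewrite CSE.
  rewrite (@RintegralZl _ _ _ P setT _ (expR (- (e * `|z|))) measurableT)//.
  by apply: ig => //; apply: mcosE; apply: measurable_funM => //; exact: measurable_funB.
rewrite E.
have mexpcos (x : R) : measurable_fun setT (fun z : R => expR (- (e * `|z|)) * cos (z * x)).
  by apply: (measurable_funM (mexp e)); apply: mcosE; exact: measurable_funM.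
have Ew w : \int[mu]_x (expR (- (e * `|x|)) * (g w * cos (x * (r - Y w)))) = g w * (2 * e / (e ^+ 2 + (r - Y w) ^+ 2)).
  rewrite -(cauchy_kernel _ e0) -RintegralZl//; first by apply: eq_Rintegral => z _; rewrite mulrCA.
  apply: (integrable_dom _ _ ie) => //.
    exact: mexpcos.
  by move=> z _; rewrite normrM ger0_norm ?expR_ge0// ler_piMr ?expR_ge0.
under eq_Rintegral do rewrite Ew.
have ikk : P.-integrable setT (EFin \o (fun w => g w * (2 * e / (e ^+ 2 + (r - Y w) ^+ 2)))).
  have -> : (fun w => g w * (2 * e / (e ^+ 2 + (r - Y w) ^+ 2))) = (fun w => 2 * (pi * (g w * ke e (r - Y w)))).
    apply/funext => w; rewrite /ke.
    have D0 : e ^+ 2 + (r - Y w) ^+ 2 != 0 by rewrite gt_eqF// ltr_wpDr ?sqr_ge0// exprn_gt0.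
    have p0 : pi != 0 :> R by rewrite gt_eqF// pi_gt0.
    by move: (pi : R) (_ + _) p0 D0 => p D p0 D0; field; rewrite ?p0 ?D0.
  have h := integrableZl measurableT pi (ike r e0).
  by have := integrableZl measurableT 2 h.
rewrite -(@RintegralZl _ _ _ P setT _ (2 * pi)^-1 measurableT ikk).
apply: eq_Rintegral => w _; rewrite /ke.
have D0 : e ^+ 2 + (r - Y w) ^+ 2 != 0 by rewrite gt_eqF// ltr_wpDr ?sqr_ge0// exprn_gt0.
have p0 : pi != 0 :> R by rewrite gt_eqF// pi_gt0.
by move: (pi : R) (_ + _) p0 D0 => p D p0 D0; field; rewrite ?p0 ?D0.
Qed.

Let measurable_transform (f : R -> R) : continuous f -> (forall x, `|f x| <= 1) ->
  measurable_fun setT (fun z : R => \int[P]_w (g w * f (z * Y w))).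
Proof.
move=> cf f1; have fE := measurableT_comp (continuous_measurable_fun cf).
(* Measurability of a parametric integral comes from Tonelli, for nonnegative integrands; the
   constant 1 is added here and its integral subtracted at the end. *)
have mf : measurable_fun [set: measurableTypeR R * T]
    (fun zw : measurableTypeR R * T => (g zw.2 * (1 + f (zw.1 * Y zw.2)))%:E).
  apply/measurable_EFinP; apply: measurable_funM; first exact: (measurableT_comp mg measurable_snd).
  apply: measurable_funD => //; apply: fE; apply: measurable_funM; first exact: measurable_fst_R.
  exact: (measurableT_comp mY measurable_snd).
have m := measurable_fun_fubini_tonelli_F (m2 := P) _ mf.
have {}m : measurable_fun setT (fun z : R => fine (\int[P]_w (g w * (1 + f (z * Y w)))%:E)).
  apply: measurableT_comp => //; apply: m => -[z w]; rewrite lee_fin mulr_ge0//.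
  by have := f1 (z * Y w); rewrite ler_norml; lra.
rewrite (_ : (fun z => _) = fun z : R => fine (\int[P]_w (g w * (1 + f (z * Y w)))%:E) - \int[P]_w (g w * 1)).
  exact: measurable_funB.
apply/funext => z; rewrite -/(Rintegral _ _ _) -RintegralB//; last 2 first.
- apply: (@integrable_dom _ _ _ _ _ _ (fun=> 2)) => //.
  + by apply: measurable_funM => //; apply: measurable_funD => //; apply: fE; exact: measurable_funM.
  + exact: finite_measure_integrable_cst.
  + move=> w _; rewrite normrM (ger0_norm (g0 w)) -[leRHS]mul1r ler_pM//.
    by have := f1 (z * Y w); rewrite !ler_norml; lra.
- by apply: ig => // w; rewrite normr1.
by apply: eq_Rintegral => w _; ring.
Qed.

Lemma measurable_cos_transform : measurable_fun setT (fun z : R => \int[P]_w (g w * cos (z * Y w))).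
Proof. by apply: measurable_transform => //; exact: continuous_cos. Qed.

Let mC : measurable_fun setT C := measurable_cos_transform.

Lemma measurable_sin_transform : measurable_fun setT (fun z : R => \int[P]_w (g w * sin (z * Y w))).
Proof. by apply: measurable_transform => //; exact: continuous_sin. Qed.

Let mS : measurable_fun setT S := measurable_sin_transform.

Let en n : R := n.+1%:R^-1.
Let en0 n : 0 < en n. Proof. by rewrite invr_gt0. Qed.

Let mCS r : measurable_fun setT (fun z => C z * cos (z * r) + S z * sin (z * r)).
Proof.
have mzr : measurable_fun setT (fun z : R => z * r) by exact: measurable_funM.
exact: (measurable_funD (measurable_funM mC (mcosE mzr)) (measurable_funM mS (msinE mzr))).
Qed.

Let bCS z r : `|C z * cos (z * r) + S z * sin (z * r)| <= 2 * k z.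
Proof.
rewrite (le_trans (ler_normD _ _))// !normrM (_ : 2 * k z = k z * 1 + k z * 1); last ring.
by rewrite lerD// ler_pM.
Qed.

Let i2k : mu.-integrable setT (EFin \o (fun z => 2 * k z)).
Proof. by have := integrableZl measurableT 2 ik. Qed.

Let feps_cvg r : feps (en n) r @[n --> \oo] --> fourier_inv r.
Proof.
rewrite /feps /fourier_inv; apply: cvgM; first exact: cvg_cst.
apply: (@dct_Rint _ _ _ mu setT _ _ (fun z => 2 * k z)) => //.
- by move=> n; exact: (measurable_funM (mexp (en n)) (mCS r)).
- move=> z _; rewrite -[X in _ --> X]mul1r; apply: cvgM; last exact: cvg_cst.
  rewrite -expR0 -oppr0 -(mul0r `|z|).
  apply: continuous_cvg; first exact: continuous_expR.
  by apply: cvgN; apply: cvgM; [exact: cvg_harmonic|exact: cvg_cst].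
- move=> n z _; rewrite normrM (le_trans _ (bCS z r))// ler_piMl//.
  by rewrite ger0_norm ?expR_ge0// expRN_le1// mulr_ge0// ltW.
Qed.

Lemma fourier_inv_ge0 r : 0 <= fourier_inv r.
Proof.
have h : feps (en n) r @[n --> \oo] --> fourier_inv r by exact: feps_cvg.
 rewrite -(cvg_lim _ h)//; apply: limr_ge.
  by apply/cvg_ex; exists (fourier_inv r).
apply: nearW => n; rewrite fepsE//; apply: Rintegral_ge0 => w _.
by rewrite mulr_ge0// ke_ge0.
Qed.

Lemma measurable_fourier_inv : measurable_fun setT fourier_inv.
Proof.
apply: (@measurable_fun_cvg _ _ _ _ (fun n r => feps (en n) r)) => [n|r _]; last exact: feps_cvg.
have -> : feps (en n) = fun r => fine (\int[P]_w (g w * ke (en n) (r - Y w))%:E).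
  by apply/funext => r; rewrite fepsE.
apply: measurableT_comp => //.
apply: (measurable_fun_fubini_tonelli_F (m2 := P) (fun rw : measurableTypeR R * T => (g rw.2 * ke (en n) (rw.1 - Y rw.2))%:E)).
  apply/measurable_EFinP; apply: measurable_funM; first exact: (measurableT_comp mg measurable_snd).
  apply: (measurableT_comp (mke (en0 n))); apply: measurable_funB; first exact: measurable_fst_R.
  exact: (measurableT_comp mY measurable_snd).
by move=> -[r w]; rewrite lee_fin mulr_ge0// ke_ge0.
Qed.

(** Limit of the mass that a Cauchy law centred at [y] gives to the segment from [a] to [b]: 1
    inside, 0 outside, and 1/2 at each end point. *)
Let h_ (a b y : R) := 2^-1 * (Num.sg (b - y) - Num.sg (a - y)).

Let atan_cvg (x : R) : pi^-1 * atan (x / en n) @[n --> \oo] --> 2^-1 * Num.sg x.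
Proof.
have p0 : pi != 0 :> R by rewrite gt_eqF// pi_gt0.
have pos (y : R) : 0 < y -> atan (y / en n) @[n --> \oo] --> pi / 2.
  move=> y0; apply: (@cvg_comp _ _ _ (fun n => y / en n) atan _ +oo); last exact: cvgy_atan.
  rewrite /en; under eq_fun do rewrite invrK.
  apply: (@cvg_comp _ _ _ (fun n => n.+1%:R : R) (fun v => y * v) _ +oo).
    by have := @cvgr_idn R; rewrite -(cvg_shiftS (fun n => n%:R : R)).
  by apply: gt0_cvgMry => //; exact: cvg_id.
have [x0|x0|->] := ltgtP x 0.
- rewrite (_ : 2^-1 * Num.sg x = pi^-1 * - (pi / 2)); last first.
    by rewrite ltr0_sg// mulrN1 mulrN mulrA mulVf// mul1r.
  apply: cvgM; first exact: cvg_cst.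
  rewrite (_ : (fun n => atan (x / en n)) = (fun n => - atan (- x / en n))); last first.
    by apply/funext => n; rewrite mulNr atanN opprK.
  by apply: cvgN; apply: pos; rewrite oppr_gt0.
- rewrite (_ : 2^-1 * Num.sg x = pi^-1 * (pi / 2)); last first.
    by rewrite gtr0_sg// mulr1 mulrA mulVf// mul1r.
  by apply: cvgM; [exact: cvg_cst|exact: pos].
- rewrite sgr0 mulr0; under eq_fun do rewrite mul0r atan0 mulr0.
  exact: cvg_cst.
Qed.

Let int_ke (a b y e : R) : a < b -> 0 < e ->
  (\int[mu]_(r in `[a, b]) (ke e (r - y))%:E =
   (pi^-1 * atan ((b - y) / e) - pi^-1 * atan ((a - y) / e))%:E)%E.
Proof.
move=> ab e0.
have dF (r : R) : is_derive r 1 (fun r => pi^-1 * atan ((r - y) / e)) (ke e (r - y)).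
  have dl : is_derive r 1 (fun r => (r - y) / e) e^-1.
    apply: (is_derive_eq (dM (dD (did r) (dN (dcst y r))) (dcst e^-1 r))).
    by ring.
  apply: (is_derive_eq (dZ pi^-1 (@dcomp R atan (fun r => (r - y) / e) r _ _ (is_derive1_atan _) dl))).
  have D0 : e ^+ 2 + (r - y) ^+ 2 != 0 by rewrite gt_eqF// ltr_wpDr ?sqr_ge0// exprn_gt0.
  by rewrite /ke; congr (_ * _); field; rewrite D0 gt_eqF.
rewrite (FTC_segment ab dF)//.
have cke : continuous (ke e).
  move=> x; apply: cvgM; first exact: cvg_cst.
  apply: cvgM; first exact: cvg_cst.
  apply: cvgV; first by rewrite gt_eqF// ltr_wpDr ?sqr_ge0// exprn_gt0.
  by apply: cvgD; [exact: cvg_cst|exact: exprn_continuous].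
move=> x; apply: (@continuous_comp _ _ _ (fun r : R => r - y) (ke e)); last exact: cke.
by apply: cvgB; [exact: cvg_id|exact: cvg_cst].
Qed.

Let M := (2 * pi)^-1 * \int[mu]_z (2 * k z).

Let feps_bound e r : 0 < e -> `|feps e r| <= M.
Proof.
move=> e0; have p0 : 0 <= (2 * pi)^-1 :> R by rewrite invr_ge0 mulr_ge0 ?pi_ge0.
rewrite /feps normrM (ger0_norm p0); apply: ler_wpM2l => //.
have m := measurable_funM (mexp e) (mCS r).
have b z : `|expR (- (e * `|z|)) * (C z * cos (z * r) + S z * sin (z * r))| <= 2 * k z.
  rewrite normrM (le_trans _ (bCS z r))// ler_piMl//.
  by rewrite ger0_norm ?expR_ge0// expRN_le1// mulr_ge0// ltW.
have i : mu.-integrable setT (EFin \o (fun z => expR (- (e * `|z|)) * (C z * cos (z * r) + S z * sin (z * r)))).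
  by apply: (integrable_dom _ _ i2k).
apply: (le_trans (le_normr_Rintegral measurableT i)).
by apply: (le_Rintegral measurableT _ i2k) => //; exact: (integrable_norm i).
Qed.

Let M0 : 0 <= M. Proof. exact: le_trans (feps_bound 0 ltr01). Qed.

Let fourier_inv_le r : fourier_inv r <= M.
Proof.
have h : feps (en n) r @[n --> \oo] --> fourier_inv r by exact: feps_cvg.
rewrite -(cvg_lim _ h)//; apply: limr_le; first by apply/cvg_ex; exists (fourier_inv r).
by apply: nearW => n; apply: le_trans (feps_bound r (en0 n)); exact: ler_norm.
Qed.

(** Two limits of the integral of [feps] over the segment: bounded convergence in [r] leads to
    [fourier_inv], while Tonelli and the arctangent primitive of the Cauchy kernel lead to [h_]. *)
Let seg_h a b : a < b ->
  (\int[P]_w (g w * h_ a b (Y w))%:E = \int[mu]_(r in `[a, b]) (fourier_inv r)%:E)%E.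
Proof.
move=> ab.
have iM : mu.-integrable `[a, b] (EFin \o (fun=> M)).
  by apply: measurable_bounded_integrable => //; [rewrite /= lebesgue_measure_itv/= lte_fin ab -EFinB ltry|exact: bounded_cst].
have mfeps n : measurable_fun setT (feps (en n)).
  have -> : feps (en n) = fun r => fine (\int[P]_w (g w * ke (en n) (r - Y w))%:E).
    by apply/funext => r; rewrite fepsE.
  apply: measurableT_comp => //.
  apply: (measurable_fun_fubini_tonelli_F (m2 := P) (fun rw : measurableTypeR R * T => (g rw.2 * ke (en n) (rw.1 - Y rw.2))%:E)).
    apply/measurable_EFinP; apply: measurable_funM; first exact: (measurableT_comp mg measurable_snd).
    apply: (measurableT_comp (mke (en0 n))); apply: measurable_funB; first exact: measurable_fst_R.
    exact: (measurableT_comp mY measurable_snd).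
  by move=> -[r w]; rewrite lee_fin mulr_ge0// ke_ge0.
have [_ c1] := @dct_EFin _ _ _ mu `[a, b] (fun n r => feps (en n) r) fourier_inv (fun=> M)
  ltac:(by []) (fun n => measurable_funTS (mfeps n)) (fun r _ => @feps_cvg r) iM
  (fun n r _ => feps_bound r (en0 n)).
have E n : (\int[mu]_(r in `[a, b]) (feps (en n) r)%:E =
   \int[P]_w (g w * (pi^-1 * atan ((b - Y w) / en n) - pi^-1 * atan ((a - Y w) / en n)))%:E)%E.
  pose F (rw : measurableTypeR R * T) : \bar R := (\1_(`[a, b]) rw.1 * (g rw.2 * ke (en n) (rw.1 - Y rw.2)))%:E.
  have mF : measurable_fun setT F.
    apply/measurable_EFinP; apply: measurable_funM.
      have mi : measurable_fun setT (\1_(`[a, b]) : R -> R) by exact: measurable_indic.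
      exact: (measurableT_comp mi (@measurable_fst_R R _ T)).
    apply: measurable_funM; first exact: (measurableT_comp mg measurable_snd).
    apply: (measurableT_comp (mke (en0 n))); apply: measurable_funB; first exact: measurable_fst_R.
    exact: (measurableT_comp mY measurable_snd).
  have F0 z : (0 <= F z)%E.
    by rewrite lee_fin mulr_ge0// mulr_ge0// ke_ge0.
  transitivity (\int[mu]_r \int[P]_w F (r, w))%E.
    rewrite integral_mkcond; apply: eq_integral => r _; rewrite patchE /F /= indicE.
    case: ifPn => rab; last by rewrite integral0_eq// => w _; rewrite mul0r.
    under eq_integral do rewrite mul1r.
    by rewrite fepsE// /Rintegral fineK//; exact: integrable_fin_num (ike r (en0 n)).
  rewrite (tonelli_swap mu P mF F0); apply: eq_integral => w _.
  transitivity (\int[mu]_(r in `[a, b]) ((g w)%:E * (ke (en n) (r - Y w))%:E))%E.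
    rewrite [RHS]integral_mkcond; apply: eq_integral => r _; rewrite patchE /F /= indicE.
    by case: ifPn => rab; rewrite ?mul1r ?mul0r.
  rewrite ge0_integralZl//.
  - by rewrite int_ke// -EFinM.
  - apply/measurable_EFinP; apply: measurable_funTS; apply: (measurableT_comp (mke (en0 n))).
    exact: measurable_funB.
  - by move=> r _; rewrite lee_fin ke_ge0.
  - by rewrite lee_fin.
have c2 : (\int[P]_w (g w * (pi^-1 * atan ((b - Y w) / en n) - pi^-1 * atan ((a - Y w) / en n)))%:E)%E @[n --> \oo]
    --> (\int[P]_w (g w * h_ a b (Y w))%:E)%E.
  have i1 : P.-integrable setT (EFin \o (fun=> 1 : R)) by exact: finite_measure_integrable_cst.
  apply: (proj2 (@dct_EFin _ _ _ P setT (fun n w => g w * (pi^-1 * atan ((b - Y w) / en n) - pi^-1 * atan ((a - Y w) / en n)))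
    (fun w => g w * h_ a b (Y w)) (fun=> 1) measurableT _ _ i1 _)).
  - move=> n; apply: measurable_funM => //.
    have ma (c : R) : measurable_fun setT (fun w => pi^-1 * atan ((c - Y w) / en n)).
      apply: measurable_funM => //; apply: (measurableT_comp (continuous_measurable_fun _)).
        exact: continuous_atan.
      by apply: measurable_funM => //; exact: measurable_funB.
    exact: measurable_funB.
  - move=> w _; apply: cvgM; first exact: cvg_cst.
    by rewrite /h_ mulrBr; apply: cvgB; exact: atan_cvg.
  - move=> n w _; rewrite normrM (ger0_norm (g0 w)) -[leRHS]mul1r; apply: ler_pM => //.
    have at2 (x : R) : `|pi^-1 * atan x| <= 2^-1.
      rewrite normrM ger0_norm ?invr_ge0 ?pi_ge0// ler_pdivrMl ?pi_gt0// ler_norml.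
      by rewrite (ltW (atan_gtNpi2 x)) (ltW (atan_ltpi2 x)).
    by rewrite (le_trans (ler_normB _ _))// (le_trans (lerD (at2 _) (at2 _)))//; lra.
rewrite -(cvg_lim _ c1)// -(cvg_lim _ c2)//; congr (limn _).
by apply/funext => n; rewrite E.
Qed.

Let ginj (f : R -> R) (c : R) : measurable_fun setT f -> (forall y, 0 <= f y <= c) ->
  measurable_fun setT (fun w => (g w * f (Y w))%:E) /\ forall w, (0 <= (g w * f (Y w))%:E)%E.
Proof.
move=> mf f0; split.
  by apply/measurable_EFinP; apply: measurable_funM => //; exact: measurableT_comp.
by move=> w; rewrite lee_fin mulr_ge0//; case/andP: (f0 (Y w)).
Qed.

Let msg (c : R) : measurable_fun setT (fun y : R => Num.sg (c - y)).
Proof.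
have -> : (fun y : R => Num.sg (c - y)) = (fun y => \1_(`]-oo, c[) y - \1_(`]c, +oo[) y).
  apply/funext => y; rewrite !indicE !mem_setE !in_itv/= andbT.
  have [yc|yc|->] := ltgtP y c.
  - by rewrite gtr0_sg ?subr_gt0// subr0.
  - by rewrite ltr0_sg ?subr_lt0// sub0r.
  - by rewrite subrr sgr0 subr0.
by apply: measurable_funB; exact: measurable_indic.
Qed.

Let sg_mono (x y : R) : x <= y -> Num.sg x <= Num.sg y.
Proof.
move=> xy; have [y0|y0] := ltP 0 y.
  by rewrite [leRHS]gtr0_sg// (le_trans (ler_norm _))// normr_sg; case: (_ != _).
have [x0|x0] := ltP x 0.
  rewrite [leLHS]ltr0_sg// lerNl (le_trans (ler_norm _))//.
  by rewrite normrN normr_sg; case: (_ != _).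
by rewrite (_ : x = y)//; lra.
Qed.

Let atomless a : (\int[P]_w (g w * \1_[set a] (Y w))%:E = 0)%E.
Proof.
apply/eqP; rewrite eq_le; apply/andP; split; last first.
  by apply: integral_ge0 => w _; rewrite lee_fin mulr_ge0// indicE.
apply/lee_addgt0Pr => e e0; rewrite add0e.
(* The point [a] enters [h_] with weight 1/2, hence the factor 2; [M + 1] instead of [M] keeps the
   divisor positive. *)
pose dl := e / (2 * (M + 1)).
have M1 : 0 < M + 1 by rewrite ltr_wpDl.
have dl0 : 0 < dl by rewrite divr_gt0// mulr_gt0.
have ab : a < a + dl by rewrite ltrDl.
apply: (@le_trans _ _ (\int[P]_w (2%:E * (g w * h_ a (a + dl) (Y w))%:E))%E).
  apply: ge0_le_integral => //.
  - by move=> w _; rewrite lee_fin mulr_ge0// indicE.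
  - by apply: (proj1 (@ginj \1_[set a] 1 _ _)); [exact: measurable_indic|move=> y; rewrite indicE; case: (_ \in _); rewrite ?lexx ?ler01].
  - apply: emeasurable_funM => //; apply/measurable_EFinP; apply: measurable_funM => //.
    apply: measurable_funM => //; apply: measurable_funB; exact: (measurableT_comp (msg _) mY).
  - move=> w _; rewrite -EFinM lee_fin mulrCA ler_wpM2l// /h_ mulrA mulfV// mul1r indicE.
    case: (boolP (_ \in _)) => [/set_mem/= ->|_].
      by rewrite subrr sgr0 subr0 gtr0_sg// addrAC subrr add0r.
    rewrite subr_ge0; have [yb|yb] := ltP (Y w) (a + dl).
      by rewrite [leRHS]gtr0_sg ?subr_gt0// (le_trans (ler_norm _))// normr_sg; case: (_ != _).
    rewrite [leLHS]ltr0_sg ?subr_lt0 ?(lt_le_trans ab)// lerNl (le_trans (ler_norm _))//.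
    by rewrite normrN normr_sg; case: (_ != _).
have mh : measurable_fun setT (fun w => (g w * h_ a (a + dl) (Y w))%:E).
  apply/measurable_EFinP; apply: measurable_funM => //.
  apply: measurable_funM => //; apply: measurable_funB; exact: (measurableT_comp (msg _) mY).
rewrite ge0_integralZl//; last first.
  by move=> w _; rewrite lee_fin !mulr_ge0// subr_ge0 sg_mono// lerB// ltW.
rewrite (seg_h ab).
have dlE : dl * (2 * (M + 1)) = e by rewrite mulfVK// gt_eqF// mulr_gt0.
have LE : (\int[mu]_(r in `[a, (a + dl)%R]) (fourier_inv r)%:E <= \int[mu]_(r in `[a, (a + dl)%R]) M%:E)%E.
  apply: ge0_le_integral => //.
  - by move=> r _; rewrite lee_fin fourier_inv_ge0.
  - by apply/measurable_EFinP; apply: measurable_funTS; exact: measurable_fourier_inv.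
  - by move=> r _; rewrite lee_fin fourier_inv_le.
apply: (le_trans (lee_pmul _ _ (lexx 2%:E) LE)) => //.
  by apply: integral_ge0 => r _; rewrite lee_fin fourier_inv_ge0.
rewrite integral_cst//= lebesgue_measure_itv/= lte_fin ab -EFinB -!EFinM lee_fin addrAC subrr add0r.
by move: M dlE dl0 => M' h1 h2; nra.
Qed.

(** [h_ a b] differs from the indicator of the half-open interval by half the indicators of the end
    points, and these carry no mass by [atomless]. Half-open intervals are then enough to determine
    the law. *)
Let seg_oc a b : a < b ->
  (\int[P]_w (g w * \1_(`]a, b]) (Y w))%:E = \int[mu]_(r in `]a, b]) (fourier_inv r)%:E)%E.
Proof.
move=> ab; rewrite integral_itv_obnd_cbnd; last first.
  by apply/measurable_EFinP; apply: measurable_funTS; exact: measurable_fourier_inv.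
rewrite -(seg_h ab).
have mi (A : set R) : measurable A -> measurable_fun setT (fun w => (g w * \1_A (Y w))%:E).
  move=> mA; apply/measurable_EFinP; apply: measurable_funM => //.
  have mA' : measurable_fun setT (\1_A : R -> R) by exact: measurable_indic.
  exact: (measurableT_comp mA' mY).
have at0 c : (\int[P]_w (2^-1%:E * (g w * \1_[set c] (Y w))%:E) = 0)%E.
  rewrite ge0_integralZl ?atomless ?mule0//; first exact: mi.
  by move=> w _; rewrite lee_fin mulr_ge0// indicE.
have mh : measurable_fun setT (fun w => (g w * h_ a b (Y w))%:E).
  apply/measurable_EFinP; apply: measurable_funM => //.
  apply: measurable_funM => //; apply: measurable_funB; exact: (measurableT_comp (msg _) mY).
rewrite -[LHS]adde0 -[RHS]adde0 -{1}(at0 a) -(at0 b).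
rewrite -!ge0_integralD//; last 7 first.
- by move=> w _; rewrite lee_fin !mulr_ge0// subr_ge0 sg_mono// lerB// ltW.
- by move=> w _; rewrite -EFinM lee_fin !mulr_ge0// ?indicE.
- by apply: emeasurable_funM => //; exact: mi.
- by move=> w _; rewrite lee_fin mulr_ge0// indicE.
- exact: mi.
- by move=> w _; rewrite -EFinM lee_fin !mulr_ge0// ?indicE.
- by apply: emeasurable_funM => //; exact: mi.
apply: eq_integral => w _; rewrite -!EFinM -!EFinD; congr EFin.
rewrite !(mulrCA 2^-1) -!mulrDr; congr (_ * _).
rewrite /h_ !indicE !mem_setE in_itv/=.
have -> : (Y w \in [set a]) = (Y w == a) by apply/idP/eqP => [/set_mem|] //= ->; exact: mem_set.
have -> : (Y w \in [set b]) = (Y w == b) by apply/idP/eqP => [/set_mem|] //= ->; exact: mem_set.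
have [ya|ya|ya] := ltgtP (Y w) a.
- have yb := lt_trans ya ab.
  by rewrite !gtr0_sg ?subr_gt0// lt_eqF// /=; ring.
- have [yb|yb|yb] := ltgtP (Y w) b.
  + by rewrite [Num.sg (a - _)]ltr0_sg ?subr_lt0// gtr0_sg ?subr_gt0//=; field.
  + by rewrite !ltr0_sg ?subr_lt0//=; ring.
  + by rewrite yb subrr sgr0 ltr0_sg ?subr_lt0//=; field.
- by rewrite ya subrr sgr0 gtr0_sg ?subr_gt0// (lt_eqF ab)/=; field.
Qed.

Theorem fourier_density (F : R -> \bar R) : measurable_fun setT F -> (forall r, (0 <= F r)%E) ->
  (\int[P]_w (F (Y w) * (g w)%:E) = \int[mu]_r (F r * (fourier_inv r)%:E))%E.
Proof.
move=> mF F0.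
have mEg : measurable_fun setT (EFin \o g) by exact/measurable_EFinP.
have mEf : measurable_fun setT (EFin \o fourier_inv).
  by apply/measurable_EFinP; exact: measurable_fourier_inv.
have Eg0 w : (0 <= (EFin \o g) w)%E by rewrite lee_fin.
have Ef0 r : (0 <= (EFin \o fourier_inv) r)%E by rewrite lee_fin fourier_inv_ge0.
pose m1 := density_measure P mEg Eg0.
pose m2 := density_measure mu mEf Ef0.
pose Y' : T -> measurableTypeR R := Y.
have mY' : measurable_fun setT Y' by exact: mY.
pose m3 := pushforward m1 Y'.
have m3E (A : set (measurableTypeR R)) : measurable A -> m3 A = (\int[P]_w (g w * \1_A (Y w))%:E)%E.
  move=> mA; rewrite /m3 /pushforward /m1 /density_measure integral_mkcond.
  apply: eq_integral => w _; rewrite patchE indicE /=.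
  have -> : (w \in Y' @^-1` A) = (Y w \in A) by apply/idP/idP => /set_mem ?; exact/mem_set.
  by case: ifPn => _; rewrite ?mulr1 ?mulr0.
have E (A : set (measurableTypeR R)) : measurable A -> m3 A = m2 A.
  have cov : \bigcup_n `](- n%:R), n%:R]%classic = [set: measurableTypeR R].
    apply/seteqP; split => // x _; exists (Num.bound `|x|) => //=; rewrite in_itv/=.
    have := archi_boundP (normr_ge0 x); rewrite ltr_norml => /andP[-> /ltW].
    exact.
  pose mm3 := @measure_function_pushforward__canonical__measure_function_Measure _ _ _ _ _ m1 Y' mY'.
  have H := @measure_unique _ _ (measurableTypeR R) (@ocitv R) (fun n => `](- n%:R), n%:R]%classic) erefl (@ocitvI R)
    (fun n => is_ocitv _ _) cov mm3 m2.
  apply: H.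
  - move=> B /ocitvP[->|[[a b] /= ab ->]]; first by rewrite !measure0.
    rewrite -[LHS]/(m3 _) m3E; last exact: measurable_itv.
    exact: seg_oc.
  - move=> n.
    apply: (@le_lt_trans _ _ (mm3 setT)).
      by apply: (le_measure mm3); rewrite ?inE//; exact: measurable_itv.
    rewrite -[mm3 _]/(m3 setT) m3E//; under eq_integral do rewrite indicE in_setT mulr1.
    apply: (@le_lt_trans _ _ (\int[P]_(w in setT) (cst 1%:E w))%E).
      by apply: ge0_le_integral => // w _; rewrite lee_fin.
    have -> : (\int[P]_(w in setT) (cst 1%:E w) = 1)%E.
      by rewrite (@integral_cst _ _ _ P setT measurableT 1%:E) mul1e; exact: probability_setT.
    exact: ltry.
transitivity (\int[m1]_w F (Y w))%E.
  rewrite (@ge0_integral_density _ _ _ P m1 g (fun w => F (Y w)))//.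
  exact: (measurableT_comp mF mY).
pose mm3 := @measure_function_pushforward__canonical__measure_function_Measure _ _ _ _ _ m1 Y' mY'.
transitivity (\int[m2]_r F r)%E; last first.
  rewrite (@ge0_integral_density _ _ _ mu m2 fourier_inv F)//; exact: measurable_fourier_inv.
transitivity (\int[mm3]_r F r)%E.
  rewrite ge0_integral_pushforward//.
apply: eq_measure_integral => A mA _; exact: E.
Qed.

End fourier_density.

(** * Changes of variables and the Brownian Green function *)

Section lebesgue_affine.
Context (R : realType).
Notation mu := (@lebesgue_measure R).

Lemma lebesgue_affine (a b : R) (F : R -> \bar R) : 0 < a ->
  measurable_fun setT F -> (forall x, (0 <= F x)%E) ->
  (\int[mu]_x F (a * x + b)%R = (a^-1)%:E * \int[mu]_x F x)%E.
Proof.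
move=> a0 mF F0.
pose aff : measurableTypeR R -> measurableTypeR R := fun x => a * x + b.
have maff : measurable_fun setT aff.
  by apply: (@measurable_funD _ _ _ _ (fun x : R => a * x) (fun=> b)) => //; exact: measurable_funM.
pose m1 := @measure_function_pushforward__canonical__measure_function_Measure _ _ _ _ _ mu aff maff.
have ia : 0 <= a^-1 by rewrite invr_ge0 ltW.
pose m2 := mscale (NngNum ia) mu.
have cov : \bigcup_n `](- n%:R), n%:R]%classic = [set: measurableTypeR R].
  apply/seteqP; split => // x _; exists (Num.bound `|x|) => //=; rewrite in_itv/=.
  by have := archi_boundP (normr_ge0 x); rewrite ltr_norml => /andP[-> /ltW]; exact.
have pre c d : aff @^-1` `]c, d]%classic = `]((c - b) / a), ((d - b) / a)]%classic.
  apply/seteqP; split => x /=; rewrite !in_itv/= /aff ltr_pdivrMr// ler_pdivlMr// mulrC;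
    by rewrite ltrBlDr lerBrDr.
have H : forall A, measurable A -> m1 A = m2 A.
  apply: (@measure_unique _ _ (measurableTypeR R) (@ocitv R) (fun n => `](- n%:R), n%:R]%classic) erefl (@ocitvI R)
    (fun n => is_ocitv _ _) cov m1 m2).
  - move=> B /ocitvP[->|[[c d] /= cd ->]]; first by rewrite !measure0.
    rewrite /m1 /m2 /= /pushforward /mscale /= pre !lebesgue_measure_itv/= !lte_fin cd.
    rewrite ltr_pM2r ?invr_gt0// ltrD2r cd -!EFinD -EFinM -mulrBl mulrC; congr (_ * _)%:E.
    by ring.
  - move=> n; rewrite /m1 /= /pushforward pre lebesgue_measure_itv/=.
    by case: ifP => // _; rewrite -EFinD ltry.
transitivity (\int[m1]_x F x)%E.
  by rewrite ge0_integral_pushforward//.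
rewrite -(@ge0_integral_mscale _ _ _ mu setT measurableT (NngNum ia))//.
by apply: eq_measure_integral => A mA _; exact: H.
Qed.

Lemma Rlebesgue_affine (a b : R) (F : R -> R) : 0 < a -> mu.-integrable setT (EFin \o F) ->
  \int[mu]_x F (a * x + b) = a^-1 * \int[mu]_x F x.
Proof.
move=> a0 iF.
have mF : measurable_fun setT (EFin \o F) by exact: measurable_int iF.
rewrite /Rintegral integralE [in RHS]integralE.
have h1 := lebesgue_affine b a0 (measurable_funepos mF) (fun x => funepos_ge0 _ x).
have h2 := lebesgue_affine b a0 (measurable_funeneg mF) (fun x => funeneg_ge0 _ x).
have f1 := integrable_pos_fin_num measurableT iF.
have f2 := integrable_neg_fin_num measurableT iF.
transitivity (fine (a^-1%:E * \int[mu]_x ((EFin \o F)^\+ x) - a^-1%:E * \int[mu]_x ((EFin \o F)^\- x))%E).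
  by rewrite -h1 -h2; congr (fine (_ - _)%E); apply: eq_integral => x _; rewrite ?funeposE ?funenegE.
by rewrite -(fineK f1) -(fineK f2) -!EFinM -!EFinB /= mulrBr.
Qed.

(** At 0 only a limit of [F] along [1 / n.+1] is required: the primitives used later contain square
    roots and are not differentiable there. Nonnegativity replaces integrability, through monotone
    convergence. *)
Lemma FTC_open_halfline (F f : R -> R) (l0 l : R) :
  (forall x : R, 0 < x -> is_derive x 1 F (f x)) ->
  (forall x : R, 0 < x -> {for x, continuous f}) -> (forall x : R, 0 < x -> 0 <= f x) ->
  F n.+1%:R^-1 @[n --> \oo] --> l0 -> F n.+1%:R @[n --> \oo] --> l ->
  (\int[mu]_(x in `]0%R, +oo[) (f x)%:E = (l - l0)%:E)%E.
Proof.
move=> dF cf f0 Fl0 Fl.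
have mf : measurable_fun (`]0, +oo[ : set R) f.
  by apply: open_continuous_measurable_fun => //; move=> x; rewrite inE/= in_itv/= andbT => /cf.
(* The index is [n.+2] because with [n.+1] the first segment would be reduced to the point 1. *)
pose g n x := (f x * \1_(`[n.+2%:R^-1, n.+2%:R]) x)%:E : \bar R.
have n2 n : (n.+2%:R^-1 < n.+2%:R :> R).
  by apply: (@lt_trans _ _ 1); rewrite ?invf_lt1 ?ltr1n.
have n20 n : 0 < n.+2%:R^-1 :> R by rewrite invr_gt0.
have E n : (\int[mu]_(x in `]0%R, +oo[) g n x = (F n.+2%:R - F n.+2%:R^-1)%:E)%E.
  rewrite EFinB -(@continuous_FTC2 _ f F _ _ (n2 n)).
  - rewrite integral_mkcond [RHS]integral_mkcond; apply: eq_integral => x _; rewrite !patchE /g indicE.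
    rewrite !mem_setE !in_itv/= andbT; case: (ltP 0 x) => x0.
      by case: ifP => _; rewrite ?mulr1 ?mulr0.
    case: ifP => // /andP[h _]; have := lt_le_trans (n20 n) h; by rewrite ltNge x0.
  - apply: continuous_in_subspaceT => x; rewrite inE/= in_itv/= => /andP[h _].
    by apply: cf; exact: lt_le_trans h.
  - split.
    + by move=> x; rewrite in_itv/= => /andP[h _]; case: (dF x (lt_trans (n20 n) h)).
    + by apply: cvg_at_right_filter; apply: differentiable_continuous; apply/derivable1_diffP; case: (dF _ (n20 n)).
    + by apply: cvg_at_left_filter; apply: differentiable_continuous; apply/derivable1_diffP; case: (dF _ (lt_trans (n20 n) (n2 n))).
  - move=> x; rewrite in_itv/= => /andP[h _]; rewrite derive1E; by case: (dF x (lt_trans (n20 n) h)).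
have cv1 : (\int[mu]_(x in `]0%R, +oo[) g n x)%E @[n --> \oo] --> (\int[mu]_(x in `]0%R, +oo[) (f x)%:E)%E.
  have -> : (\int[mu]_(x in `]0%R, +oo[) (f x)%:E = \int[mu]_(x in `]0%R, +oo[) limn (fun n => g n x))%E.
    apply: eq_integral => x; rewrite inE/= in_itv/= andbT => x0; apply/esym/cvg_lim => //.
    apply: cvg_near_cst.
    have [N1 N1P] : exists N : nat, x <= N%:R by exists (Num.bound x); exact/ltW/archi_boundP/ltW.
    have [N2 N2P] : exists N : nat, x^-1 <= N%:R.
      by exists (Num.bound x^-1); apply/ltW/archi_boundP; rewrite invr_ge0 ltW.
    near=> n; rewrite /g indicE mem_setE in_itv/=.
    have nN : (maxn N1 N2 <= n)%N by near: n; exact: nbhs_infty_ge.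
    rewrite (_ : (_ <= x <= _) = true) ?mulr1//; apply/andP; split.
      rewrite invf_ple ?posrE// (le_trans N2P)// ler_nat.
      by rewrite (leq_trans (leq_maxr N1 N2))// (leq_trans nN)// leqW.
    rewrite (le_trans N1P)// ler_nat.
    by rewrite (leq_trans (leq_maxl N1 N2))// (leq_trans nN)// leqW.
  apply: cvg_monotone_convergence => //.
  - move=> n; apply/measurable_EFinP; apply: measurable_funM => //; exact: measurable_indic.
  - move=> n x; rewrite /= in_itv/= andbT => x0; rewrite lee_fin mulr_ge0 ?f0//.
  - move=> x; rewrite /= in_itv/= andbT => x0 m n mn; rewrite lee_fin ler_wpM2l ?f0//.
    rewrite !indicE !mem_setE !in_itv/= ler_nat.
    case: (boolP (m.+2%:R^-1 <= x <= m.+2%:R)) => //= /andP[h1 h2]; rewrite lt0b.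
    have mn2 : m.+2%:R <= n.+2%:R :> R by rewrite ler_nat !ltnS.
    by rewrite (le_trans _ h1) ?(le_trans h2)// lef_pV2 ?posrE.
have cv2 : (\int[mu]_(x in `]0%R, +oo[) g n x)%E @[n --> \oo] --> (l - l0)%:E.
  under eq_fun do rewrite E.
  apply: cvg_EFin; first exact: nearW.
  apply: cvgB.
    by rewrite -(cvg_shiftS (fun n => F n.+1%:R)) in Fl.
  by rewrite -(cvg_shiftS (fun n => F n.+1%:R^-1)) in Fl0.
by rewrite -(cvg_lim _ cv1)// (cvg_lim _ cv2).
Unshelve. all: by end_near.
Qed.

(** The standard normal distribution function. *)
Let Nc (y : R) : R := \int[mu]_(t in `]-oo, y]) gaussd 1 t.

Let dNc (y : R) : is_derive y 1 Nc (gaussd 1 y).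
Proof.
have h : mu.-integrable [set` Interval -oo%O (BRight (y + 1))] (EFin \o gaussd 1).
  by apply: (integrableS measurableT) => //; exact: integrable_gaussd.
have y1 : y < y + 1 by rewrite ltrDl.
have [h1 h2] := @continuous_FTC1 R (gaussd 1) -oo%O y (y + 1) y1 h (ltNyr _) (continuous_gaussd ltr01 (x:=y)).
by constructor; [exact: h1|rewrite -derive1E; exact: h2].
Qed.

Let NcE (y : R) : Nc y = \int[mu]_t (gaussd 1 t * \1_(`]-oo, y]) t).
Proof.
rewrite /Nc /Rintegral integral_mkcond; congr fine; apply: eq_integral => t _.
by rewrite patchE indicE; case: ifP => _; rewrite ?mulr1 ?mulr0.
Qed.

Let Nc_cvg (u : nat -> R) (l : R -> R) : (forall t : R, \1_(`]-oo, u n]) t @[n --> \oo] --> l t) ->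
  Nc (u n) @[n --> \oo] --> \int[mu]_t (gaussd 1 t * l t).
Proof.
move=> ul; under eq_fun do rewrite NcE.
apply: (@dct_Rint _ _ _ mu setT _ _ (gaussd 1)) => //.
- by move=> n; apply: measurable_funM; [exact: measurable_gaussd|exact: measurable_indic].
- by move=> t _; apply: cvgM; [exact: cvg_cst|exact: ul].
- exact: integrable_gaussd.
- move=> n t _; rewrite normrM ger0_norm ?gaussd_ge0// ler_piMr ?gaussd_ge0// indicE.
  by case: (_ \in _); rewrite ?normr1 ?normr0.
Qed.

Let Ncy (u : nat -> R) : (forall A : R, \forall n \near \oo, A <= u n) -> Nc (u n) @[n --> \oo] --> (1 : R).
Proof.
move=> uy.
have -> : 1 = \int[mu]_t (gaussd 1 t * cst 1 t) :> R.
  under eq_Rintegral do rewrite mulr1.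
  by rewrite /Rintegral integral_gaussd.
apply: Nc_cvg => t; apply: cvg_near_cst; near=> n.
rewrite indicE mem_set//= in_itv/=; near: n; exact: uy.
Unshelve. all: by end_near.
Qed.

Let NcNy (u : nat -> R) : (forall A : R, \forall n \near \oo, A <= - u n) -> Nc (u n) @[n --> \oo] --> (0 : R).
Proof.
move=> uy.
have -> : 0 = \int[mu]_t (gaussd 1 t * cst 0 t) :> R.
  under eq_Rintegral do rewrite mulr0.
  by rewrite Rintegral_cst ?mul0r.
apply: Nc_cvg => t; apply: cvg_near_cst; near=> n.
have h : `|t| + 1 <= - u n by near: n; exact: uy.
rewrite indicE memNset//= in_itv/= => tu; move: h; rewrite lerNr => h.
by have := le_trans tu h; have := ler_norm (- t); rewrite normrN; lra.
Unshelve. all: by end_near.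
Qed.

(** Resolvent kernel of Brownian motion, as the Laplace transform in time of the heat kernel. The
    primitive [F] combines normal distribution functions in the manner of the inverse Gaussian law.
    At [h = 0] the arguments of [Nc] tend to opposite infinities, because [x] is not 0, and at
    infinity both tend to plus infinity; only the term in [expR (- (b * Q))] changes. *)
Lemma green_gaussd (Q x : R) : 0 < Q -> x != 0 ->
  (\int[mu]_(h in `]0%R, +oo[) (expR (- (Q ^+ 2 / 2 * h)) * gaussd h x)%:E = (expR (- (`|x| * Q)) / Q)%:E)%E.
Proof.
move=> Q0 x0; set b := `|x|; have b0 : 0 < b by rewrite normr_gt0.
pose F (h : R) := Q^-1 * (expR (b * Q) * Nc (Q * Num.sqrt h + b / Num.sqrt h) +
                    expR (- (b * Q)) * Nc (Q * Num.sqrt h - b / Num.sqrt h)).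
have dsqrt (h : R) : 0 < h -> is_derive h 1 Num.sqrt (2 * Num.sqrt h)^-1.
  by move=> h0; exact: is_derive1_sqrt.
have s0 (h : R) : 0 < h -> 0 < Num.sqrt h by rewrite sqrtr_gt0.
have sq (h : R) : 0 < h -> Num.sqrt h ^+ 2 = h by move=> h0; rewrite sqr_sqrtr// ltW.
have dsqrtV (h : R) : 0 < h -> is_derive h 1 (fun h => (Num.sqrt h)^-1) (- (2 * h * Num.sqrt h)^-1).
  move=> h0; apply: (is_derive_eq (is_deriveV _ (dsqrt _ h0))); first by rewrite gt_eqF// s0.
  rewrite /GRing.scale/= -[X in 2 * X * _](sq _ h0); have := s0 _ h0; move: (Num.sqrt h) => s sp.
  by field; rewrite gt_eqF.
have dF (h : R) : 0 < h -> is_derive h 1 F (expR (- (Q ^+ 2 / 2 * h)) * gaussd h x).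
  move=> h0.
  have dp : is_derive h 1 (fun h => Q * Num.sqrt h + b / Num.sqrt h) (Q * (2 * Num.sqrt h)^-1 + b * - (2 * h * Num.sqrt h)^-1).
    exact: (dD (dZ Q (dsqrt _ h0)) (dZ b (dsqrtV _ h0))).
  have dm : is_derive h 1 (fun h => Q * Num.sqrt h - b / Num.sqrt h) (Q * (2 * Num.sqrt h)^-1 - b * - (2 * h * Num.sqrt h)^-1).
    exact: (dD (dZ Q (dsqrt _ h0)) (dN (dZ b (dsqrtV _ h0)))).
  apply: (is_derive_eq (dZ Q^-1 (dD (dZ (expR (b * Q)) (dcomp (dNc _) dp)) (dZ (expR (- (b * Q))) (dcomp (dNc _) dm))))).
  have sh : Num.sqrt h != 0 by rewrite gt_eqF// s0.
  have sp : Num.sqrt (2 * pi) != 0 :> R by rewrite gt_eqF// sqrtr_gt0 mulr_gt0// pi_gt0.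
  have xb : x ^+ 2 = b ^+ 2 by rewrite real_normK// num_real.
  have gh : gaussd h x = (Num.sqrt (2 * pi))^-1 / Num.sqrt h * expR (- b ^+ 2 / (2 * Num.sqrt h ^+ 2)).
    by rewrite /gaussd sqrtrM ?mulr_ge0 ?pi_ge0// invfM xb sq.
  (* Completing the square: the cross term of the Gaussian exponent is [b * Q], which the prefactor
     cancels. [E2] is the same with the other sign, so in the derivative the terms in [b] cancel and
     those in [Q] add up. *)
  have E1 : expR (b * Q) * gaussd 1 (Q * Num.sqrt h + b / Num.sqrt h) = Num.sqrt h * (expR (- (Q ^+ 2 / 2 * h)) * gaussd h x).
    rewrite gh /gaussd !mulr1.
    transitivity ((Num.sqrt (2 * pi))^-1 * expR (b * Q + - (Q * Num.sqrt h + b / Num.sqrt h) ^+ 2 / 2)).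
      by rewrite expRD; ring.
    have -> : b * Q + - (Q * Num.sqrt h + b / Num.sqrt h) ^+ 2 / 2 = - (Q ^+ 2 / 2 * h) + - b ^+ 2 / (2 * Num.sqrt h ^+ 2).
      by rewrite -[X in _ / 2 * X](sq _ h0); move: (Num.sqrt h) sh => s sh'; field.
    rewrite expRD; move: (Num.sqrt h) sh (Num.sqrt (2 * pi)) sp => s sh' p sp'.
    by field; rewrite sh' sp'.
  have E2 : expR (- (b * Q)) * gaussd 1 (Q * Num.sqrt h - b / Num.sqrt h) = Num.sqrt h * (expR (- (Q ^+ 2 / 2 * h)) * gaussd h x).
    rewrite gh /gaussd !mulr1.
    transitivity ((Num.sqrt (2 * pi))^-1 * expR (- (b * Q) + - (Q * Num.sqrt h - b / Num.sqrt h) ^+ 2 / 2)).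
      by rewrite expRD; ring.
    have -> : - (b * Q) + - (Q * Num.sqrt h - b / Num.sqrt h) ^+ 2 / 2 = - (Q ^+ 2 / 2 * h) + - b ^+ 2 / (2 * Num.sqrt h ^+ 2).
      by rewrite -[X in _ / 2 * X](sq _ h0); move: (Num.sqrt h) sh => s sh'; field.
    rewrite expRD; move: (Num.sqrt h) sh (Num.sqrt (2 * pi)) sp => s sh' p sp'.
    by field; rewrite sh' sp'.
  rewrite ![expR _ * (gaussd _ _ * _)]mulrA E1 E2 -[X in (2 * X * _)^-1](sq _ h0).
  move: (expR _ * gaussd h x) (Num.sqrt h) sh => G s sh.
  by field; rewrite sh gt_eqF.
have ccont (h : R) : 0 < h -> {for h, continuous (fun h => expR (- (Q ^+ 2 / 2 * h)) * gaussd h x)}.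
  move=> h0; apply: cvgM.
    apply: (@continuous_comp _ _ _ (fun h : R => - (Q ^+ 2 / 2 * h)) expR); last exact: continuous_expR.
    by apply: cvgN; apply: cvgM; [exact: cvg_cst|exact: cvg_id].
  apply: cvgM.
    apply: cvgV; first by rewrite gt_eqF// sqrtr_gt0 !mulr_gt0// pi_gt0.
    apply: (@continuous_comp _ _ _ (fun h : R => 2 * pi * h) Num.sqrt); last exact: sqrt_continuous.
    by apply: cvgM; [exact: cvg_cst|exact: cvg_id].
  apply: (@continuous_comp _ _ _ (fun h : R => - x ^+ 2 / (2 * h)) expR); last exact: continuous_expR.
  apply: cvgM; first exact: cvg_cst.
  apply: cvgV; first by rewrite gt_eqF// mulr_gt0.
  by apply: cvgM; [exact: cvg_cst|exact: cvg_id].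
have big (c A : R) : 0 < c -> \forall n \near \oo, A <= c * Num.sqrt n.+1%:R.
  move=> c0; near=> n; rewrite -ler_pdivrMl//.
  apply: (le_trans (ler_norm _)); rewrite -sqrtr_sqr ler_wsqrtr//.
  apply: (@le_trans _ _ n%:R); last by rewrite ler_nat.
  by near: n; exact: nbhs_infty_ger.
have inv n : Num.sqrt n.+1%:R^-1 = (Num.sqrt n.+1%:R)^-1 :> R by rewrite sqrtrV.
have i1 n : (Num.sqrt n.+1%:R)^-1 <= 1 :> R.
  by rewrite invf_le1 ?sqrtr_gt0// -[leLHS]sqrtr1 ler_wsqrtr// ler1n.
have i0 n : 0 <= (Num.sqrt n.+1%:R)^-1 :> R by rewrite invr_ge0 sqrtr_ge0.
rewrite (@FTC_open_halfline F _ (Q^-1 * (expR (b * Q) * 1 + expR (- (b * Q)) * 0)) (Q^-1 * (expR (b * Q) * 1 + expR (- (b * Q)) * 1)))//.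
- by congr EFin; rewrite !mulr1 mulr0 addr0 -mulrBr addrAC subrr add0r mulrC.
- by move=> h _; rewrite mulr_ge0 ?expR_ge0// gaussd_ge0.
- apply: cvgM; first exact: cvg_cst.
  apply: cvgD; apply: cvgM; (try exact: cvg_cst).
    apply: Ncy => A; near=> n; rewrite inv invrK.
    have h : A <= b * Num.sqrt n.+1%:R by near: n; exact: big.
    by rewrite (le_trans h)// lerDr mulr_ge0// ltW.
  apply: NcNy => A; near=> n; rewrite inv invrK.
  have h : A + Q <= b * Num.sqrt n.+1%:R by near: n; exact: big.
  by have := ler_wpM2l (ltW Q0) (i1 n); move: h; rewrite mulr1; lra.
- apply: cvgM; first exact: cvg_cst.
  apply: cvgD; apply: cvgM; (try exact: cvg_cst); apply: Ncy => A; near=> n.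
    have h : A <= Q * Num.sqrt n.+1%:R by near: n; exact: big.
    by rewrite (le_trans h)// lerDl mulr_ge0// ltW.
  have h : A + b <= Q * Num.sqrt n.+1%:R by near: n; exact: big.
  by have := ler_wpM2l (ltW b0) (i1 n); move: h; rewrite mulr1; lra.
Unshelve. all: by end_near.
Qed.

End lebesgue_affine.

(** * The characteristic function of the gamma law *)

Lemma is_derive_under (R : realType) d (T : measurableType d) (m : {measure set T -> \bar R})
    (f f' : R -> T -> R) (G : T -> R) (a u v : R) : u < a < v ->
  (forall x, u < x < v -> m.-integrable setT (EFin \o f x)) ->
  (forall x y, u < x < v -> is_derive x 1 (f ^~ y) (f' x y)) ->
  (forall y, 0 <= G y) -> m.-integrable setT (EFin \o G) ->
  (forall x y, u < x < v -> `|f' x y| <= G y) ->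
  is_derive a 1 (fun x => \int[m]_y f x y) (\int[m]_y f' a y).
Proof.
move=> auv intf df G0 iG fG.
have I x : (`]u, v[%classic : set R) x -> u < x < v by rewrite /= in_itv.
have Ia : (`]u, v[%classic : set R) a by rewrite /= in_itv.
have d1 x y : u < x < v -> partial1of2 f x y = f' x y.
  by move=> h; rewrite partial1of2E; have [_ ->] := df x y h.
have dfx x y : (`]u, v[%classic : set R) x -> setT y -> derivable (f ^~ y) x 1.
  by move=> /I h _; case: (df x y h).
have D1 := @derivable_under_integral R _ _ m f setT measurableT a u v Ia (fun x h => intf x (I x h)) dfx G G0 iG.
have D2 := @differentiation_under_integral R _ _ m f setT measurableT a u v Ia (fun x h => intf x (I x h)) dfx G G0 iG.
have b x y : (`]u, v[%classic : set R) x -> setT y -> `|partial1of2 f x y| <= G y.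
  by move=> /I h _; rewrite d1// fG.
constructor; first exact: D1.
rewrite -derive1E D2//; apply: eq_Rintegral => y _; exact: d1.
Qed.

Section gamma_cf.
Context (R : realType) d (T : measurableType d) (P : probability T R) (Y : T -> R).
Notation mu := (@lebesgue_measure R).
Variables (nu k : R).
Hypotheses (mY : measurable_fun setT Y) (Y0 : forall w, 0 <= Y w) (nu0 : 0 < nu) (k0 : 0 <= k).
Hypothesis lapY : forall u, 0 <= u ->
  (\int[P]_w (expR (- (u * Y w)))%:E = ((1 + nu * u) `^ (- k))%:E)%E.

Let mexpY u : measurable_fun setT (fun w => expR (- (u * Y w))).
Proof. by apply: measurableT_comp => //; apply: measurableT_comp => //; exact: measurable_funM. Qed.

Let yexp (u y : R) : 0 < u -> 0 <= y -> y * expR (- (u * y)) <= u^-1.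
Proof.
move=> u0 y0; rewrite -ler_pdivlMr ?expR_gt0// -expRN opprK -ler_pdivrMl ?invr_gt0// invrK.
by apply: le_trans (expR_ge1Dx _); rewrite lerDr.
Qed.

Let iconst (c : R) : P.-integrable setT (EFin \o (fun=> c)).
Proof. exact: finite_measure_integrable_cst. Qed.

Let bounded_int (f : T -> R) (c : R) : measurable_fun setT f -> (forall w, `|f w| <= c) ->
  P.-integrable setT (EFin \o f).
Proof. by move=> mf fc; apply: (integrable_dom _ _ (iconst c)). Qed.

Let meanexp (u : R) : 0 < u ->
  (\int[P]_w (Y w * expR (- (u * Y w)))%:E = (k * nu * (1 + nu * u) `^ (- k - 1))%:E)%E.
Proof.
move=> u0.
have h : u / 2 < u < u + 1 by apply/andP; split; lra.
have int1 x : u / 2 < x < u + 1 -> P.-integrable setT (EFin \o (fun w => expR (- (x * Y w)))).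
  move=> /andP[ux _]; apply: (bounded_int (c := 1)) => // w.
  rewrite ger0_norm ?expR_ge0// expRN_le1// mulr_ge0// ltW// (lt_trans _ ux)//; lra.
have dd : is_derive u 1 (fun x => \int[P]_w expR (- (x * Y w))) (\int[P]_w (- Y w * expR (- (u * Y w)))).
  apply: (@is_derive_under _ _ _ P _ (fun x w => - Y w * expR (- (x * Y w))) (fun=> (u / 2)^-1) u (u / 2) (u + 1)) => //.
  - move=> x w _; apply: (is_derive_eq (dexpR (dN (dM (did x) (dcst (Y w) x))))).
    by ring.
  - by move=> w; rewrite invr_ge0; lra.
  - move=> x w /andP[ux _]; rewrite mulNr normrN ger0_norm ?mulr_ge0 ?expR_ge0//.
    rewrite (le_trans (yexp (lt_trans _ ux) (Y0 w)))//; first lra.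
    by rewrite lef_pV2 ?posrE; lra.
have d2 : is_derive u 1 (fun x => (1 + nu * x) `^ (- k)) (nu * (- k * (1 + nu * u) `^ (- k - 1))).
  have p : 0 < 1 + nu * u by rewrite addr_gt0// mulr_gt0.
  have h0 : is_derive u 1 (fun x : R => (1 + nu * x) `^ (- k)) _ :=
    @dcomp R (fun y : R => y `^ (- k)) (fun x => 1 + nu * x) u _ _ (is_derive1_powR _ p) (dD (dcst 1 u) (dZ nu (did u))).
  apply: (is_derive_eq h0).
  by ring.
have E : \int[P]_w (- Y w * expR (- (u * Y w))) = nu * (- k * (1 + nu * u) `^ (- k - 1)).
  have [d1 <-] := dd; have [_ <-] := d2.
  apply: near_eq_derive => //.
  near=> x.
  rewrite /Rintegral lapY//.
  apply: ltW; near: x; exact: lt_nbhsr.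
have iY : P.-integrable setT (EFin \o (fun w => Y w * expR (- (u * Y w)))).
  apply: (bounded_int (c := u^-1)); first exact: measurable_funM.
  by move=> w; rewrite ger0_norm ?mulr_ge0 ?expR_ge0// yexp.
have -> : (\int[P]_w (Y w * expR (- (u * Y w)))%:E = (\int[P]_w (Y w * expR (- (u * Y w))))%:E)%E.
  by rewrite /Rintegral fineK//; exact: integrable_fin_num iY.
congr EFin; have := @RintegralZl _ _ _ P setT _ (-1) measurableT iY.
rewrite (_ : (fun w => -1 * _) = (fun w => - Y w * expR (- (u * Y w)))); last by apply/funext => w; ring.
rewrite E; lra.
Unshelve. all: by end_near.
Qed.

Let T2 := (measurableTypeR R * T)%type.
Let r2 (z : T2) : R := Y z.2 + `|z.1|.
(** [k] times the kernel [expR (- x / nu)] on the half-line, tilted by [expR (- r2)]. The tilt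
    provides integrability, since the mean of [Y] is not yet known to be finite. *)
Let g2 (z : T2) : R := k * expR (- (nu^-1 * `|z.1|)) * \1_(`[0, +oo[) (z.1 : R) * expR (- r2 z).

Let mz1 : measurable_fun [set: T2] (fun z : T2 => `|z.1| : R).
Proof. by apply: (measurableT_comp (@normr_measurable R setT)); exact: measurable_fst_R. Qed.

Let mr2 : measurable_fun setT r2.
Proof. by apply: measurable_funD => //; exact: (measurableT_comp mY measurable_snd). Qed.

Let mg2 : measurable_fun setT g2.
Proof.
have mi : measurable_fun setT (\1_(`[0, +oo[) : R -> R) by exact: measurable_indic.
apply: measurable_funM; last by apply: measurableT_comp => //; exact: measurableT_comp.
apply: measurable_funM; last exact: (measurableT_comp mi (@measurable_fst_R R _ T)).
apply: measurable_funM => //; apply: measurableT_comp => //; apply: measurableT_comp => //.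
exact: measurable_funM.
Qed.

Let r20 z : 0 <= r2 z. Proof. by rewrite addr_ge0. Qed.

Let g20 z : 0 <= g2 z.
Proof. by rewrite /g2 !mulr_ge0 ?expR_ge0// indicE. Qed.

Let lap2 (u : R) : 0 <= u ->
  (\int[mu \x P]_z (expR (- (u * r2 z)) * g2 z)%:E = (k * nu * (1 + nu * (u + 1)) `^ (- k - 1))%:E)%E.
Proof.
move=> u0; have m : measurable_fun setT (fun z => (expR (- (u * r2 z)) * g2 z)%:E).
  apply/measurable_EFinP; apply: measurable_funM => //; apply: measurableT_comp => //.
  by apply: measurableT_comp => //; exact: measurable_funM.
have p0 z : (0 <= (expR (- (u * r2 z)) * g2 z)%:E)%E by rewrite lee_fin mulr_ge0 ?expR_ge0.
have u1 : 0 <= u + 1 by rewrite addr_ge0.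
pose c := nu^-1 + (u + 1).
have c0 : 0 < c by rewrite /c addr_gt0 ?invr_gt0// ltr_wpDl.
rewrite (@fubini_tonelli1 _ _ _ _ _ mu P _ m)//= /fubini_F.
have E (x : R) : (\int[P]_w (expR (- (u * r2 (x, w))) * g2 (x, w))%:E =
   (k * (1 + nu * (u + 1)) `^ (- k))%:E * ((\1_(`[0, +oo[) x)%:E * (expR (- (c * x)))%:E))%E.
  transitivity (\int[P]_w ((k * (\1_(`[0, +oo[) x * expR (- (c * x))))%:E * (expR (- ((u + 1) * Y w)))%:E))%E.
    apply: eq_integral => w _; rewrite -EFinM; congr EFin; rewrite /g2 /r2 /=.
    have [x0|x0] := leP 0 (x : R); last first.
      have i1 : \1_(`[0, +oo[) x = 0 :> R by rewrite indicE memNset//= in_itv/= andbT leNgt x0.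
      by rewrite !i1; ring.
    have i1 : \1_(`[0, +oo[) x = 1 :> R by rewrite indicE mem_set//= in_itv/= x0.
    rewrite !i1.
    rewrite ger0_norm// !mulr1 mul1r.
    rewrite (_ : expR (- (c * x)) = expR (- (u * x)) * expR (- (nu^-1 * x)) * expR (- x)); last first.
      by rewrite -!expRD; congr expR; rewrite /c; ring.
    rewrite (_ : - (u * (Y w + x)) = - (u * Y w) + - (u * x)); last by ring.
    rewrite (_ : - ((u + 1) * Y w) = - (u * Y w) + - Y w); last by ring.
    by rewrite opprD !expRD; ring.
  rewrite ge0_integralZl//.
  - by rewrite lapY// -!EFinM; congr EFin; ring.
  - exact/measurable_EFinP.
  - by rewrite lee_fin !mulr_ge0 ?expR_ge0// indicE.
under eq_integral do rewrite E.
have mi : measurable_fun setT (\1_(`[0, +oo[) : R -> R) by exact: measurable_indic.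
have mex : measurable_fun setT (fun x : R => expR (- (c * x))).
  by apply: measurableT_comp => //; apply: measurableT_comp => //; exact: measurable_funM.
rewrite ge0_integralZl//; last 2 first.
- by apply: emeasurable_funM; exact/measurable_EFinP.
- by rewrite lee_fin mulr_ge0// powR_ge0.
have -> : (\int[mu]_x ((\1_(`[0%R, +oo[) x)%:E * (expR (- (c * x)))%:E) = (c^-1)%:E)%E.
  have [_ <-] := integrable_expRN_halfline c0; rewrite [RHS]integral_mkcond.
  by apply: eq_integral => x _; rewrite patchE indicE; case: ifP => _; rewrite ?mul1e ?mul0e.
rewrite -EFinM; congr EFin; have p : 0 < 1 + nu * (u + 1) by rewrite addr_gt0// mulr_gt0// ltr_wpDl.
rewrite powRD; last by apply/implyP => _; rewrite gt_eqF.
rewrite powR_inv1 ?(ltW p)// /c.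
move: (_ `^ _) => M; field.
by rewrite !gt_eqF//= addr_gt0// mulr_gt0// ltr_wpDl.
Qed.

(** The derivative of [(1 + nu * u)] to the power [- k] is, up to sign, [k] times the transform of
    [Y] times [nu / (1 + nu * u)], the transform of [expR (- x / nu)]. By uniqueness of Laplace
    transforms, weighting the law by [Y] amounts to adding an independent variable [x] with that
    kernel. Bounded trigonometric [F] can now be inserted, which transports the information from
    real exponents to the characteristic function. *)
Let size_bias (F : R -> \bar R) : measurable_fun setT F -> (forall y, (0 <= F y)%E) ->
  (\int[P]_w (F (Y w) * (Y w)%:E) =
   \int[P]_w \int[mu]_(x in `[0%R, +oo[) (F (Y w + x)%R * (k * expR (- (nu^-1 * x)))%:E))%E.
Proof.
move=> mF F0.
have mE : measurable_fun setT (fun y : R => (expR y)%:E) by exact/measurable_EFinP.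
have mG : measurable_fun setT (fun z : R * (R * R) => F z.1 * (expR z.1)%:E)%E.
  by apply: emeasurable_funM; [exact: (measurableT_comp mF measurable_fst)|exact: (measurableT_comp mE measurable_fst)].
have ig1 : P.-integrable setT (EFin \o (fun w => Y w * expR (- Y w))).
  apply: (bounded_int (c := 1)).
    by apply: measurable_funM => //; have := mexpY 1; under eq_fun do rewrite mul1r.
  by move=> w; rewrite ger0_norm ?mulr_ge0 ?expR_ge0//; have := yexp ltr01 (Y0 w); rewrite mul1r invr1.
have ig2 : (mu \x P)%E.-integrable setT (EFin \o g2).
  apply/integrableP; split; first exact/measurable_EFinP.
  rewrite (eq_integral (fun z => (expR (- (0 * r2 z)) * g2 z)%:E)); first by rewrite lap2// ltry.
  by move=> z _; rewrite /= mul0r oppr0 expR0 mul1r ger0_norm.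
have H := @laplace3_unique R _ _ _ _ P (mu \x P)%E Y (fun=> 0) (fun=> 0) (fun w => Y w * expR (- Y w))
  r2 (fun=> 0) (fun=> 0) g2 (fun z => F z.1 * (expR z.1)%:E)%E.
transitivity (\int[P]_w (F (Y w) * (expR (Y w))%:E * (Y w * expR (- Y w))%:E))%E.
  apply: eq_integral => w _; rewrite -muleA -EFinM mulrCA -expRD subrr expR0 mulr1//.
rewrite H//; last 3 first.
- by move=> w; split=> //; rewrite mulr_ge0 ?expR_ge0.
- move=> u v w u0 v0 w0; rewrite !mulr0 oppr0 expR0.
  under eq_integral do rewrite !mul1r.
  under [RHS]eq_integral do rewrite !mul1r.
  rewrite lap2// -meanexp ?ltr_wpDl//.
  apply: eq_integral => y _; congr EFin; rewrite mulrCA -expRD; congr (_ * expR _); ring.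
- by move=> z; rewrite mule_ge0// lee_fin expR_ge0.
pose F2 (z : T2) := (F (r2 z) * (expR (r2 z))%:E * (g2 z)%:E)%E.
have mF2 : measurable_fun setT F2.
  apply: emeasurable_funM; last exact/measurable_EFinP.
  by apply: emeasurable_funM; [exact: (measurableT_comp mF mr2)|exact: (measurableT_comp mE mr2)].
have F20 z : (0 <= F2 z)%E by rewrite !mule_ge0 ?lee_fin ?expR_ge0.
rewrite -[LHS]/(\int[mu \x P]_z F2 z)%E (fubini_tonelli2 _ mF2 F20); apply: eq_integral => w _.
rewrite /fubini_G [RHS]integral_mkcond; apply: eq_integral => x _; rewrite patchE /F2 /g2 /r2 /= indicE.
case: (boolP (x \in `[0, +oo[%classic)) => [|_]; last by rewrite !(mulr0, mul0r) mule0.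
rewrite inE/= in_itv/= andbT => x0; rewrite ger0_norm// mulr1 -muleA -EFinM; congr (_ * EFin _)%E.
by rewrite mulrCA -expRD subrr expR0 mulr1.
Qed.

Notation c := (nu^-1).
Let c0 : 0 < c. Proof. by rewrite invr_gt0. Qed.

Let mtrig (f : R -> R) z : continuous f -> measurable_fun setT (fun y : R => f (z * y)).
Proof. by move=> cf; apply: (measurableT_comp (continuous_measurable_fun cf)); exact: measurable_funM. Qed.

Let m0y : measurable (`[0, +oo[%classic : set (measurableTypeR R)).
Proof. exact: measurable_itv. Qed.

Let iexpt (f : R -> R) z : continuous f -> (forall x, `|f x| <= 1) ->
  mu.-integrable `[0, +oo[ (EFin \o (fun x => expR (- (c * x)) * f (z * x))).
Proof.
move=> cf f1; have [ih _] := integrable_expRN_halfline c0.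
apply: (integrable_dom _ _ ih) => //.
  apply: measurable_funTS; apply: measurable_funM; last exact: mtrig.
  by apply: measurableT_comp => //; apply: measurableT_comp => //; exact: measurable_funM.
by move=> x _; rewrite normrM ger0_norm ?expR_ge0// ler_piMr ?expR_ge0.
Qed.

Let cos1 (x : R) : `|cos x| <= 1. Proof. by rewrite ler_norml cos_geN1 cos_le1. Qed.
Let sin1 (x : R) : `|sin x| <= 1. Proof. by rewrite ler_norml sin_geN1 sin_le1. Qed.

Let aux (f : R -> R) (h : T -> R) : (forall y, 0 <= f y <= 2) -> continuous f ->
  (forall w, (\int[mu]_(x in `[0, +oo[) (f (Y w + x) * (k * expR (- (c * x)))) = h w)%R) ->
  (\int[P]_w (f (Y w) * Y w)%:E = \int[P]_w (h w)%:E)%E.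
Proof.
move=> f02 cf hE; have f0 y : 0 <= f y by case/andP: (f02 y).
have mf := continuous_measurable_fun cf.
transitivity (\int[P]_w ((EFin \o f) (Y w) * (Y w)%:E))%E; first by [].
rewrite size_bias; last 2 first.
- exact/measurable_EFinP.
- by move=> y; rewrite lee_fin.
apply: eq_integral => w _; rewrite -hE /Rintegral fineK//.
apply: (@integrable_fin_num _ _ _ mu) => //.
have [ih _] := integrable_expRN_halfline c0.
have i2 : mu.-integrable `[0, +oo[ (EFin \o (fun x => 2 * k * expR (- (c * x)))).
  by have := integrableZl m0y (2 * k) ih.
apply: (integrable_dom _ _ i2) => //.
  apply: measurable_funTS; apply: measurable_funM.
    by apply: (measurableT_comp mf); exact: measurable_funD.
  by apply: measurable_funM => //; apply: measurableT_comp => //; apply: measurableT_comp => //.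
move=> x _; rewrite ger0_norm; last by rewrite !mulr_ge0 ?expR_ge0.
by rewrite mulrA ler_wpM2r ?expR_ge0// ler_wpM2r//; case/andP: (f02 (Y w + x)).
Qed.

Let iexp1 : mu.-integrable `[0, +oo[ (EFin \o (fun x => expR (- (c * x)))) /\
  \int[mu]_(x in `[0, +oo[) expR (- (c * x)) = nu.
Proof.
have [ih e] := integrable_expRN_halfline c0; split => //.
by rewrite /Rintegral e invrK.
Qed.

Let D z := c ^+ 2 + z ^+ 2.

Let lin p a b z : \int[mu]_(x in `[0, +oo[) (p * expR (- (c * x)) +
    (a * (expR (- (c * x)) * cos (z * x)) + b * (expR (- (c * x)) * sin (z * x)))) =
  p * nu + (a * (c / D z) + b * (z / D z)).
Proof.
have [i1 e1] := iexp1; have [e2 e3] := expcos_halfline z c0.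
have m := m0y.
have i2 := iexpt z (@continuous_cos R) cos1.
have i3 := iexpt z (@continuous_sin R) sin1.
have sc (f : R -> R) (x : R) : mu.-integrable `[0, +oo[ (EFin \o f) -> mu.-integrable `[0, +oo[ (EFin \o (fun y => x * f y)).
  by move=> h; have := integrableZl m x h.
have i23 : mu.-integrable `[0, +oo[ (EFin \o (fun x => a * (expR (- (c * x)) * cos (z * x)) + b * (expR (- (c * x)) * sin (z * x)))).
  by have := integrableD m (sc _ a i2) (sc _ b i3).
rewrite (RintegralD m (sc _ p i1) i23) (RintegralD m (sc _ a i2) (sc _ b i3)).
by rewrite (@RintegralZl _ _ _ mu _ _ p m i1) (@RintegralZl _ _ _ mu _ _ a m i2) (@RintegralZl _ _ _ mu _ _ b m i3) e1 e2 e3.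
Qed.

Let icst (x : R) : (\int[P]_w x%:E = x%:E)%E.
Proof.
transitivity (x%:E * P setT)%E; first exact: integral_cst.
by rewrite probability_setT mule1.
Qed.

Let EY : \int[P]_w Y w = k * nu /\ P.-integrable setT (EFin \o Y).
Proof.
have E : (\int[P]_w (Y w)%:E = (k * nu)%:E)%E.
  rewrite -[RHS]icst -(@aux (fun=> 1) (fun=> k * nu)).
  - by under [RHS]eq_integral do rewrite mul1r.
  - by move=> _; rewrite ler01 ler1n.
  - by move=> x; exact: cvg_cst.
  - move=> w; rewrite -[RHS]addr0 -[X in _ + X](_ : 0 * (c / D 0) + 0 * (0 / D 0) = 0); last by ring.
    by rewrite -lin; apply: eq_Rintegral => x _; ring.
split; first by rewrite /Rintegral E.
apply/integrableP; split; first exact/measurable_EFinP.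
by under eq_integral do rewrite /= ger0_norm//; rewrite E ltry.
Qed.

Let itrig (f : R -> R) z : continuous f -> (forall x, `|f x| <= 1) ->
  P.-integrable setT (EFin \o (fun w => f (z * Y w))).
Proof.
move=> cf f1; apply: (bounded_int (c := 1)) => //.
by apply: (measurableT_comp (continuous_measurable_fun cf)); exact: measurable_funM.
Qed.

Let iYtrig (f : R -> R) z : continuous f -> (forall x, `|f x| <= 1) ->
  P.-integrable setT (EFin \o (fun w => Y w * f (z * Y w))).
Proof.
move=> cf f1; have [_ iY] := EY; apply: (integrable_dom _ _ iY) => //.
  apply: measurable_funM => //; apply: (measurableT_comp (continuous_measurable_fun cf)).
  exact: measurable_funM.
by move=> w _; rewrite normrM ger0_norm// ler_piMr.
Qed.

(** Size bias is applied to the nonnegative function [1 + f], and the contribution [k * nu] of the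
    constant is removed. The last hypothesis is the addition formula: [(a, b)] is [(0, -1)] for the
    cosine and [(1, 0)] for the sine. *)
Let EYtrig (f : R -> R) (z a b : R) : continuous f -> (forall x, `|f x| <= 1) ->
  (forall y x, f (z * (y + x)) =
     f (z * y) * cos (z * x) + (a * cos (z * y) + b * sin (z * y)) * sin (z * x)) ->
  \int[P]_w (Y w * f (z * Y w)) =
  k * (c * \int[P]_w f (z * Y w) + z * (a * \int[P]_w cos (z * Y w) + b * \int[P]_w sin (z * Y w))) / D z.
Proof.
move=> cf f1 fD; have [eY iY] := EY; have iYf := iYtrig z cf f1.
have i2 := itrig z (@continuous_cos R) cos1; have i3 := itrig z (@continuous_sin R) sin1.
have i1 := itrig z cf f1.
have H := @aux (fun y => 1 + f (z * y))
  (fun w => k * nu + (k * (c / D z) * f (z * Y w) + (k * (z / D z) * a * cos (z * Y w) + k * (z / D z) * b * sin (z * Y w)))) _ _ _.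
have {}H : (\int[P]_w ((1 + f (z * Y w)) * Y w) = \int[P]_w (k * nu + (k * (c / D z) * f (z * Y w) + (k * (z / D z) * a * cos (z * Y w) + k * (z / D z) * b * sin (z * Y w)))))%R.
  rewrite /Rintegral H//.
  - by move=> y; have := f1 (z * y); rewrite ler_norml; lra.
  - move=> y; apply: cvgD; first exact: cvg_cst.
    by apply: (@continuous_comp _ _ _ (fun y : R => z * y) f); [apply: cvgM; [exact: cvg_cst|exact: cvg_id]|exact: cf].
  - move=> w.
    transitivity (\int[mu]_(x in `[0, +oo[) (k * expR (- (c * x)) + (k * f (z * Y w) * (expR (- (c * x)) * cos (z * x)) + k * (a * cos (z * Y w) + b * sin (z * Y w)) * (expR (- (c * x)) * sin (z * x))))).
      by apply: eq_Rintegral => x _; rewrite fD; ring.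
    by rewrite lin; ring.
have sc (g : T -> R) (x : R) : P.-integrable setT (EFin \o g) -> P.-integrable setT (EFin \o (fun y => x * g y)).
  by move=> h; have := integrableZl measurableT x h.
have s23 : P.-integrable setT (EFin \o (fun w => k * (z / D z) * a * cos (z * Y w) + k * (z / D z) * b * sin (z * Y w))).
  by have := integrableD measurableT (sc _ (k * (z / D z) * a) i2) (sc _ (k * (z / D z) * b) i3).
have s123 : P.-integrable setT (EFin \o (fun w => k * (c / D z) * f (z * Y w) + (k * (z / D z) * a * cos (z * Y w) + k * (z / D z) * b * sin (z * Y w)))).
  by have := integrableD measurableT (sc _ (k * (c / D z)) i1) s23.
move: H; rewrite (RintegralD measurableT (iconst (k * nu)) s123).
rewrite (RintegralD measurableT (sc _ _ i1) s23) (RintegralD measurableT (sc _ _ i2) (sc _ _ i3)).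
rewrite (@RintegralZl _ _ _ P _ _ _ measurableT i1) (@RintegralZl _ _ _ P _ _ _ measurableT i2) (@RintegralZl _ _ _ P _ _ _ measurableT i3).
rewrite [X in _ = X + _]/Rintegral icst /=.
have -> : \int[P]_w ((1 + f (z * Y w)) * Y w) = \int[P]_w Y w + \int[P]_w (Y w * f (z * Y w)).
  by rewrite -RintegralD//; apply: eq_Rintegral => w _; ring.
rewrite eY; have D0 : D z != 0 by rewrite gt_eqF// /D ltr_wpDr ?sqr_ge0// exprn_gt0.
by move=> /addrI ->; move: (D z) D0 (nu^-1) => d0 hd cc; field.
Qed.

Let EYcos z : \int[P]_w (Y w * cos (z * Y w)) =
  k * (c * \int[P]_w cos (z * Y w) - z * \int[P]_w sin (z * Y w)) / D z.
Proof.
rewrite (@EYtrig cos z 0 (-1))//; first by rewrite mul0r add0r mulN1r mulrN.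
- exact: continuous_cos.
- by move=> y x; rewrite mulrDr cosD; ring.
Qed.

Let EYsin z : \int[P]_w (Y w * sin (z * Y w)) =
  k * (c * \int[P]_w sin (z * Y w) + z * \int[P]_w cos (z * Y w)) / D z.
Proof.
rewrite (@EYtrig sin z 1 0)//; first by rewrite mul0r addr0 mul1r.
- exact: continuous_sin.
- by move=> y x; rewrite mulrDr sinD; ring.
Qed.

Let C z := \int[P]_w cos (z * Y w).
Let S z := \int[P]_w sin (z * Y w).

Let dC (z : R) : is_derive z 1 C (- (\int[P]_w (Y w * sin (z * Y w)))).
Proof.
have [_ iY] := EY.
have -> : - (\int[P]_w (Y w * sin (z * Y w))) = \int[P]_w (- sin (z * Y w) * Y w).
  have iYs : P.-integrable setT (EFin \o (fun w => Y w * sin (z * Y w))).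
    apply: (integrable_dom _ _ iY) => //.
      by apply: measurable_funM => //; apply: (measurableT_comp (continuous_measurable_fun (@continuous_sin R))); exact: measurable_funM.
    by move=> w _; rewrite normrM ger0_norm// ler_piMr.
  have := @RintegralZl _ _ _ P setT _ (-1) measurableT iYs.
  by rewrite mulN1r => <-; apply: eq_Rintegral => w _; ring.
apply: (@is_derive_under _ _ _ P _ (fun x w => - sin (x * Y w) * Y w) Y z (z - 1) (z + 1)) => //.
- by apply/andP; split; lra.
- by move=> x _; apply: itrig => //; exact: continuous_cos.
- move=> x w _; apply: (is_derive_eq (dcos (dM (did x) (dcst (Y w) x)))).
  by ring.
- by move=> x w _; rewrite normrM normrN (ger0_norm (Y0 w)) ler_piMl.
Qed.

Let dS (z : R) : is_derive z 1 S (\int[P]_w (Y w * cos (z * Y w))).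
Proof.
have [_ iY] := EY.
have -> : \int[P]_w (Y w * cos (z * Y w)) = \int[P]_w (cos (z * Y w) * Y w).
  by apply: eq_Rintegral => w _; rewrite mulrC.
apply: (@is_derive_under _ _ _ P _ (fun x w => cos (x * Y w) * Y w) Y z (z - 1) (z + 1)) => //.
- by apply/andP; split; lra.
- by move=> x _; apply: itrig => //; exact: continuous_sin.
- move=> x w _; apply: (is_derive_eq (dsin (dM (did x) (dcst (Y w) x)))).
  by ring.
- by move=> x w _; rewrite normrM (ger0_norm (Y0 w)) ler_piMl.
Qed.

Let rho z := (1 + (nu * z) ^+ 2) `^ (k / 2).
Let th z := k * atan (nu * z).

Let q0 z : 0 < 1 + (nu * z) ^+ 2. Proof. by rewrite ltr_wpDr ?sqr_ge0. Qed.

Let drho (z : R) : is_derive z 1 rho (k * nu ^+ 2 * z / (1 + (nu * z) ^+ 2) * rho z).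
Proof.
have h0 : is_derive z 1 rho _ :=
  @dcomp R (fun y : R => y `^ (k / 2)) (fun x => 1 + (nu * x) ^+ 2) z _ _ (is_derive1_powR _ (q0 z))
    (dD (dcst 1 z) (dX 2 (dZ nu (did z)))).
apply: (is_derive_eq h0).
rewrite /rho powRD; last by apply/implyP => _; rewrite gt_eqF.
rewrite powR_inv1 ?(ltW (q0 z))//; move: (_ `^ _) => M /=.
by field; rewrite gt_eqF.
Qed.

Let dth (z : R) : is_derive z 1 th (k * nu / (1 + (nu * z) ^+ 2)).
Proof.
apply: (is_derive_eq (dZ k (@dcomp R atan (fun x => nu * x) z _ _ (is_derive1_atan _) (dZ nu (did z))))).
by field; rewrite gt_eqF.
Qed.

Let DE z : D z = (1 + (nu * z) ^+ 2) / nu ^+ 2.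
Proof. by rewrite /D; field; rewrite gt_eqF. Qed.

(** [G1 + 'i * G2] is the characteristic function times the [k]-th power of [1 - 'i * nu * z],
    written in polar form with [rho] and [th]. The linear differential system given by [EYcos] and
    [EYsin] makes both parts constant, hence equal to their values 1 and 0 at [z = 0]. *)
Let G1 z := rho z * (C z * cos (th z) + S z * sin (th z)).
Let G2 z := rho z * (S z * cos (th z) - C z * sin (th z)).

Let dG1 (z : R) : is_derive z 1 G1 0.
Proof.
apply: (is_derive_eq (dM (drho z) (dD (dM (dC z) (dcos (dth z))) (dM (dS z) (dsin (dth z)))))).
rewrite EYcos EYsin -/(C z) -/(S z) DE.
move: (C z) (S z) (cos (th z)) (sin (th z)) (rho z) => a b c' s r.
by field; rewrite !gt_eqF//=.
Qed.

Let dG2 (z : R) : is_derive z 1 G2 0.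
Proof.
apply: (is_derive_eq (dM (drho z) (dD (dM (dS z) (dcos (dth z))) (dN (dM (dC z) (dsin (dth z))))))).
rewrite EYcos EYsin -/(C z) -/(S z) DE.
move: (C z) (S z) (cos (th z)) (sin (th z)) (rho z) => a b c' s r.
by field; rewrite !gt_eqF//=.
Qed.

Theorem gamma_cf z :
  \int[P]_w cos (z * Y w) = (1 + (nu * z) ^+ 2) `^ (- (k / 2)) * cos (k * atan (nu * z)) /\
  \int[P]_w sin (z * Y w) = (1 + (nu * z) ^+ 2) `^ (- (k / 2)) * sin (k * atan (nu * z)).
Proof.
have C0 : C 0 = 1.
  rewrite /C; under eq_Rintegral do rewrite mul0r cos0.
  by rewrite /Rintegral icst.
have S0 : S 0 = 0.
  by rewrite /S; under eq_Rintegral do rewrite mul0r sin0; rewrite /Rintegral icst.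
have e1 : G1 z = 1.
  rewrite (@is_derive_0_is_cst _ _ z 0 dG1) /G1 C0 S0 /rho /th mulr0 atan0 mulr0 cos0 sin0 expr0n/= addr0 powR1; ring.
have e2 : G2 z = 0.
  rewrite (@is_derive_0_is_cst _ _ z 0 dG2) /G2 C0 S0 /th mulr0 atan0 mulr0 cos0 sin0; ring.
rewrite -/(C z) -/(S z) -/(th z) powRN -/(rho z).
have r0 : rho z != 0 by rewrite gt_eqF// powR_gt0.
have cs := cos2Dsin2 (th z).
split.
  have -> : C z = (rho z)^-1 * (G1 z * cos (th z) - G2 z * sin (th z)).
    rewrite -[LHS]mulr1 -cs /G1 /G2; move: (cos _) (sin _) => a b; by field; rewrite r0.
  by rewrite e1 e2; ring.
have -> : S z = (rho z)^-1 * (G1 z * sin (th z) + G2 z * cos (th z)).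
  rewrite -[LHS]mulr1 -cs /G1 /G2; move: (cos _) (sin _) => a b; by field; rewrite r0.
by rewrite e1 e2; ring.
Qed.

End gamma_cf.

(** * The Markov property at the hitting time *)

Lemma indep_pi_gen d1 d2 d3 (T : measurableType d1) (X : measurableType d2)
  (Y : measurableType d3) (R : realType) (P : probability T R) (U : T -> X) (V : T -> Y)
  (GX : set (set X)) (GY : set (set Y)) :
  measurable_fun setT U -> measurable_fun setT V -> pi_gen GX -> pi_gen GY ->
  (forall A B, GX A -> GY B ->
     P (U @^-1` A `&` V @^-1` B) = (P (U @^-1` A) * P (V @^-1` B))%E) ->
  (forall A B, measurable A -> measurable B ->
     P (U @^-1` A `&` V @^-1` B) = (P (U @^-1` A) * P (V @^-1` B))%E).
Proof.
move=> /mfun_ex[u uE] /mfun_ex[v vE]; subst U V => gX gY ind.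
have muv : measurable_fun setT (fun w => (u w, v w)) by exact/measurable_fun_pair.
have [uv uvE] := mfun_ex muv.
have H : forall A, measurable A -> distribution P uv A = (distribution P u \x distribution P v)%E A.
  apply: (pi_gen_prod gX gY).
  - by apply: (@le_lt_trans _ _ 1%E); [exact: probability_le1|exact: ltry].
  - move=> A B GA GB.
    have mA : measurable A by case: gX => -> _ _; exact: sub_sigma_algebra.
    have mB : measurable B by case: gY => -> _ _; exact: sub_sigma_algebra.
    apply: eq_trans (esym (product_measure1E (distribution P u) (distribution P v) mA mB)).
    by rewrite /= /distribution /pushforward uvE; exact: ind.
move=> A B mA mB; have := H (A `*` B) (measurableX mA mB).
by rewrite product_measure1E// /= /distribution /pushforward uvE.
Qed.

Lemma preimage_inE (T U : Type) (f : T -> U) (A : set U) : [set w | f w \in A] = f @^-1` A.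
Proof. by apply/seteqP; split => w /=; rewrite inE. Qed.

Lemma integral_prob_cst d (T : measurableType d) (R : realType) (P : probability T R) (x : R) :
  (\int[P]_w x%:E = x%:E)%E.
Proof.
transitivity (x%:E * P setT)%E; first exact: integral_cst.
by rewrite probability_setT mule1.
Qed.

Section cylinders.
Context (R : realType) d (Omega : measurableType d).
Variables (n : nat) (D : nat -> Omega -> R).

(** The sigma-algebra generated by [D 0, ..., D n.-1] is placed on [Omega] itself. Conditioning on
    the past up to a fixed grid then becomes independence of the identity map into this space. *)
Definition cylinders : set (set Omega) :=
  [set B | exists A : nat -> set R, (forall i, measurable (A i)) /\
     B = finite_inter n (fun i => [set w | D i w \in A i])].

Lemma cylinders_setI : setI_closed cylinders.
Proof.
move=> _ _ [A [mA ->]] [B [mB ->]]; exists (fun i => A i `&` B i); split.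
  by move=> i; exact: measurableI.
rewrite /finite_inter -big_split/=; apply: eq_bigr => i _.
by rewrite !preimage_inE preimage_setI.
Qed.

Lemma cylinders_setT : cylinders setT.
Proof.
exists (fun=> setT); split; first by [].
rewrite /finite_inter big1// => i _; rewrite preimage_inE preimage_setT //.
Qed.

Notation X := (g_sigma_algebraType cylinders).

Lemma pi_gen_cylinders : @pi_gen _ X cylinders.
Proof.
split; [by []|exact: cylinders_setI|exists (fun=> setT)].
by split; [move=> _; exact: cylinders_setT|rewrite bigcup_const].
Qed.

Lemma measurable_cylinder_coord i : (i < n)%N -> measurable_fun [set: X] (D i : X -> R).
Proof.
move=> ni _ B mB; rewrite setTI; apply: sub_sigma_algebra.
exists (fun j => if j == i then B else setT); split; first by move=> j; case: ifP.
rewrite /finite_inter (bigD1 (Ordinal ni))//= eqxx preimage_inE big1 ?setIT// => j ji.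
rewrite (negbTE (_ : nat_of_ord j != i)) ?preimage_inE ?preimage_setT//.
Qed.

Lemma measurable_to_cylinders : (forall i, measurable_fun setT (D i)) ->
  measurable_fun [set: Omega] (idfun : Omega -> X).
Proof.
move=> mD; apply: (@measurability _ _ Omega X setT (idfun : Omega -> X) cylinders).
  by [].
move=> _ [_ [A [mA ->]] <-]; rewrite setTI preimage_id /finite_inter.
apply: bigsetI_measurable => i _; rewrite preimage_inE -[X in measurable X]setTI; exact: mD.
Qed.

End cylinders.

Section brownian_markov.
Context (R : realType) d (Omega : measurableType d) (P : probability Omega R)
  (W : R -> Omega -> R).
Hypothesis BM : standard_BM P W.
Notation mu := (@lebesgue_measure R).

Let mW t : measurable_fun setT (W t). Proof. by case: BM. Qed.
Let W0 w : W 0 w = 0. Proof. by case: BM. Qed.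

Lemma bm_increment_law (s t : R) (F : R -> \bar R) : 0 <= s -> s < t ->
  measurable_fun setT F -> (forall y, (0 <= F y)%E) ->
  (\int[P]_w F (W t w - W s w)%R = \int[mu]_y (F y * (gaussd (t - s) y)%:E))%E.
Proof.
move=> s0 st mF F0.
pose Z : Omega -> measurableTypeR R := fun w => W t w - W s w.
have mZ : measurable_fun setT Z by apply: (@measurable_funB _ _ _ _ (W t) (W s)).
pose m := @measure_function_pushforward__canonical__measure_function_Measure _ _ _ _ _ P Z mZ.
transitivity (\int[m]_y F y)%E; first by rewrite ge0_integral_pushforward.
apply: ge0_integral_density => //.
- exact: measurable_gaussd.
- exact: gaussd_ge0.
- move=> A mA; case: BM => _ _ _ _ /(_ s t A s0 st mA).
  by rewrite preimage_inE.
Qed.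

Lemma bm_increment_stationary (s t : R) (F : R -> \bar R) : 0 <= s -> s <= t ->
  measurable_fun setT F -> (forall y, (0 <= F y)%E) ->
  (\int[P]_w F (W t w - W s w)%R = \int[P]_w F (W (t - s)%R w))%E.
Proof.
move=> s0; rewrite le_eqVlt => /predU1P[<- mF F0|st mF F0].
  by apply: eq_integral => w _; rewrite !subrr W0.
rewrite bm_increment_law//.
transitivity (\int[P]_w F (W (t - s)%R w - W 0 w)%R)%E.
  have h : 0 < t - s by rewrite subr_gt0.
  by have := bm_increment_law (lexx 0) h mF F0; rewrite subr0 => ->.
by apply: eq_integral => w _; rewrite W0 subr0.
Qed.

Section past.
Variables (t v : R) (m : nat).
Hypotheses (t0 : 0 < t) (tv : t < v).
Let s (i : nat) : R := i%:R * (t / m.+1%:R).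
Let D i w := W (s i.+1) w - W (s i) w.
Let mD i : measurable_fun setT (D i). Proof. exact: measurable_funB. Qed.
Notation X := (g_sigma_algebraType (cylinders m.+1 D)).

Let st : s m.+1 = t. Proof. by rewrite /s mulrCA mulfV ?mulr1. Qed.

Lemma measurable_grid i : (i <= m.+1)%N -> measurable_fun [set: X] (W (s i) : X -> R).
Proof.
elim: i => [|i IH] im.
  by rewrite (_ : W (s 0) = fun=> 0)//; apply/funext => w; rewrite /s mul0r W0.
rewrite (_ : (W (s i.+1)) = (fun w => D i w + W (s i) w)); last first.
  by apply/funext => w; rewrite /D subrK.
apply: measurable_funD; last exact: IH (ltnW im).
exact: measurable_cylinder_coord.
Qed.

Lemma past_indep (F : X * R -> \bar R) : measurable_fun setT F -> (forall z, (0 <= F z)%E) ->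
  (\int[P]_w F (w, W v w - W t w)%R = \int[P]_w1 \int[P]_w2 F (w1, W v w2 - W t w2)%R)%E.
Proof.
move=> mF F0.
have mU : measurable_fun [set: Omega] (idfun : Omega -> X) by exact: measurable_to_cylinders.
have mV : measurable_fun setT (fun w => W v w - W t w) by exact: measurable_funB.
apply: (indep_fubini (U := (idfun : Omega -> X)) mU mV _ mF F0).
apply: (indep_pi_gen mU mV (@pi_gen_cylinders _ _ _ _ _) (@pi_gen_measurable _ _)).
move=> _ B [A [mA ->]] mB; rewrite preimage_id.
(* [indep_increments] takes an infinite increasing sequence of times: the grid up to [t], then [v],
   then the filler times [v + 1, v + 2, ...]. *)
pose tt i := if (i <= m.+1)%N then s i else v + (i - m.+2)%:R.
case: BM => _ _ _ ind _.
have lt i : tt i < tt i.+1.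
  rewrite /tt; case: (leqP i.+1 m.+1) => [h|h].
    by rewrite (ltnW h) /s ltr_pM2r ?divr_gt0// ltr_nat.
  case: (leqP i m.+1) => [h2|h2].
    have -> : i = m.+1 by apply/eqP; rewrite eqn_leq h2.
    by rewrite st subnn addr0.
  by rewrite ltrD2l ltr_nat subSn.
pose A' i := if (i < m.+1)%N then A i else B.
have mA' i : measurable (A' i) by rewrite /A'; case: ifP.
have tt0 : 0 <= tt 0%N by rewrite /tt /s mul0r.
have inc i : (i < m.+1)%N -> [set w | W (tt i.+1) w - W (tt i) w \in A' i] = [set w | D i w \in A i].
  by move=> h; rewrite /tt /A' h (ltnW h).
have last : [set w | W (tt m.+2) w - W (tt m.+1) w \in A' m.+1] = (fun w => W v w - W t w) @^-1` B.
  by rewrite /tt ltnn leqnn subnn addr0 st /A' ltnn preimage_inE.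
(* Independence is used without and with the last increment: the first instance recognises the
   product of the first [m.+1] factors in the second as one probability. *)
have I1 := ind m.+1 tt A' tt0 lt mA'.
have I2 := ind m.+2 tt A' tt0 lt mA'.
have F1 : finite_inter m.+1 (fun i => [set w | W (tt i.+1) w - W (tt i) w \in A' i]) =
   finite_inter m.+1 (fun i => [set w | D i w \in A i]).
  by rewrite /finite_inter; apply: eq_bigr => i _; rewrite inc.
have FS (E : nat -> set Omega) : finite_inter m.+2 E = finite_inter m.+1 E `&` E m.+1.
  by rewrite /finite_inter big_ord_recr.
by move: I2; rewrite big_ord_recr/= FS last F1 => ->; rewrite -I1 F1.
Qed.

End past.

Lemma bm_path_cvg (u : nat -> R) (l : R) w : (forall n, 0 <= u n) -> u n @[n --> \oo] --> l ->
  W (u n) w @[n --> \oo] --> W l w.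
Proof.
move=> u0 ul; have l0 : 0 <= l.
  by rewrite -(cvg_lim _ ul)//; apply: limr_ge; [apply/cvg_ex; exists l|exact: nearW].
case: BM => _ _ /(_ w)/subspace_continuousP/(_ l) c _ _.
have {}c : W S w @[S --> within (`[0, +oo[%classic : set R) (nbhs l)] --> W l w.
  by apply: c; rewrite /= in_itv/= l0.
apply: (cvg_comp _ _ _ c) => B; rewrite /within/= nearE => hB.
have : \forall n \near \oo, (u n \in `[0, +oo[ -> B (u n)) := ul _ hB.
by apply: filterS => n; apply; rewrite in_itv/= u0.
Qed.

Variables (x0 beta : R).
Notation Wt := (Wtilde x0 beta W).

Lemma Wtilde_cvg (u : nat -> R) (l : R) w : (forall n, 0 <= u n) -> u n @[n --> \oo] --> l ->
  Wt (u n) w @[n --> \oo] --> Wt l w.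
Proof.
move=> u0 ul; apply: cvgD; last by apply: cvgM; [exact: cvg_cst|].
by apply: cvgD; [exact: cvg_cst|exact: bm_path_cvg].
Qed.

Lemma measurable_Wtilde t : measurable_fun setT (Wt t).
Proof. by apply: measurable_funD => //; exact: measurable_funD. Qed.

Lemma Wtilde0 w : Wt 0 w = x0.
Proof. by rewrite /Wtilde W0 mulr0 !addr0. Qed.

Lemma Wtilde_within a w : {within `[0, a], continuous (fun S => Wt S w)}.
Proof.
have h : {within `[0%R, +oo[, continuous (fun S => W S w)} by case: BM.
have {}h : {within `[0, a], continuous (fun S => W S w)}.
  by apply: continuous_subspaceW h => x /=; rewrite !in_itv/= => /andP[->].
move=> x; apply: cvgD; last first.
  by apply: continuous_subspaceT => y; apply: cvgM; [exact: cvg_cst|exact: cvg_id].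
by apply: cvgD; [exact: cvg_cst|exact: h].
Qed.

Variables (psi : R -> R) (M : R).
Hypotheses (cpsi : continuous psi) (psiM : forall x, 0 <= psi x <= M).

(* Only meaningful for [0 <= h], the range where [W] is constrained. *)
Definition bm_semigroup (h x : R) : R := \int[P]_w psi (x + beta * h + W h w).
Notation sg := bm_semigroup.

Let psi0 x : 0 <= psi x. Proof. by case/andP: (psiM x). Qed.
Let psi1 x : psi x <= M. Proof. by case/andP: (psiM x). Qed.
Let mpsi : measurable_fun setT psi. Proof. exact: continuous_measurable_fun. Qed.
Let iM : P.-integrable setT (EFin \o (fun=> M)).
Proof. exact: finite_measure_integrable_cst. Qed.

Let mint h x : measurable_fun setT (fun w => psi (x + beta * h + W h w)).
Proof. by apply: (measurableT_comp mpsi); exact: measurable_funD. Qed.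

Let iint h x : P.-integrable setT (EFin \o (fun w => psi (x + beta * h + W h w))).
Proof. by apply: (integrable_dom _ _ iM) => // w _; rewrite ger0_norm. Qed.

Lemma bm_semigroup_ge0 h x : 0 <= sg h x.
Proof. exact: Rintegral_ge0. Qed.

Lemma bm_semigroup_le h x : sg h x <= M.
Proof.
have -> : M = \int[P]_w cst M w.
  by rewrite /Rintegral integral_prob_cst.
by apply: le_Rintegral.
Qed.

Lemma bm_semigroup_cvg (h_ x_ : nat -> R) (h x : R) : (forall n, 0 <= h_ n) ->
  h_ n @[n --> \oo] --> h -> x_ n @[n --> \oo] --> x -> sg (h_ n) (x_ n) @[n --> \oo] --> sg h x.
Proof.
move=> h0 hh xx; apply: (@dct_Rint _ _ _ P setT _ _ (fun=> M)) => //; last first.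
  by move=> n w _; rewrite ger0_norm.
move=> w _; apply: continuous_cvg; first exact: cpsi.
apply: cvgD; last exact: bm_path_cvg.
by apply: cvgD => //; apply: cvgM => //; exact: cvg_cst.
Qed.

Lemma measurable_bm_semigroup h : measurable_fun setT (sg h).
Proof.
rewrite /bm_semigroup /Rintegral; apply: measurableT_comp => //.
apply: (measurable_fun_fubini_tonelli_F (m2 := P) (fun xw : R * Omega => (psi (xw.1 + beta * h + W h xw.2))%:E)).
  apply/measurable_EFinP; apply: (measurableT_comp mpsi); apply: measurable_funD.
    by apply: measurable_funD => //; exact: measurable_fst.
  exact: (measurableT_comp (mW h) measurable_snd).
by move=> xw; rewrite lee_fin.
Qed.

Section grid.
Variables (t v a e : R).
Hypotheses (t0 : 0 < t) (tv : t < v) (a0t : 0 <= a <= t).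

Let s m (i : nat) : R := i%:R * (t / m.+1%:R).

Definition below_grid m : set Omega :=
  \big[setU/set0]_(i < m.+2) (if s m i <= a then [set w | Wt (s m i) w < e] else set0).

(** The strict inequality makes this an open condition on a continuous path, which fine grids
    detect. The closed event [hit_by] is recovered afterwards as the limit over [e = 1 / n.+1]. *)
Definition below : set Omega := [set w | exists r, [/\ 0 <= r, r <= a & Wt r w < e]].

Notation X m := (g_sigma_algebraType (cylinders m.+1 (fun i w => W (s m i.+1) w - W (s m i) w))).

Let mWt_grid m i : (i <= m.+1)%N -> measurable_fun [set: X m] (Wt (s m i) : X m -> R).
Proof.
move=> im; apply: measurable_funD => //; apply: measurable_funD => //.
exact: measurable_grid.
Qed.

Let mbelow_grid m : measurable (below_grid m : set (X m)).
Proof.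
apply: bigsetU_measurable => i _; case: ifP => // _.
have := @mWt_grid m i (ltn_ord i) measurableT `]-oo, e[%classic (measurable_itv _).
rewrite setTI; congr measurable; apply/seteqP; split => w /=; rewrite in_itv//=.
Qed.

Let mbelow_grid' m : measurable (below_grid m).
Proof.
apply: bigsetU_measurable => i _; case: ifP => // _.
have := @measurable_Wtilde (s m i) measurableT `]-oo, e[%classic (measurable_itv _).
by rewrite setTI; congr measurable; apply/seteqP; split => w /=; rewrite in_itv.
Qed.

Let mi m : measurable_fun setT (\1_(below_grid m) : Omega -> R).
Proof. by apply: measurable_indic; exact: mbelow_grid'. Qed.

Let below_gridE m w :
  below_grid m w <-> exists i, [/\ (i < m.+2)%N, s m i <= a & Wt (s m i) w < e].
Proof.
rewrite /below_grid -(bigcup_mkord m.+2 (fun i => if s m i <= a then [set w | Wt (s m i) w < e] else set0)).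
split=> [[i /= im]|[i [im sa h]]]; first by case: ifP => // sa h; exists i.
by exists i => //=; rewrite sa.
Qed.

(** The grid event and [Wt t] are functions of the increments before [t], hence independent of the
    increment from [t] to [v], and [bm_semigroup] is the average over the latter. *)
Lemma markov_grid m : \int[P]_w (\1_(below_grid m) w * psi (Wt v w)) =
  \int[P]_w (\1_(below_grid m) w * sg (v - t) (Wt t w)).
Proof.
pose F (z : X m * R) : \bar R := (\1_(below_grid m) z.1 * psi (Wt t (z.1 : Omega) + beta * (v - t) + z.2))%:E.
have st : s m m.+1 = t by rewrite /s mulrCA mulfV ?mulr1.
have mWt : measurable_fun [set: X m] (Wt t : X m -> R) by rewrite -st; exact: mWt_grid.
have miX : measurable_fun [set: X m] (\1_(below_grid m) : X m -> R) by exact: measurable_indic.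
have mF : measurable_fun setT F.
  apply/measurable_EFinP; apply: measurable_funM; first exact: (measurableT_comp miX measurable_fst).
  apply: (measurableT_comp mpsi); apply: measurable_funD; last exact: measurable_snd.
  by apply: measurable_funD => //; exact: (measurableT_comp mWt measurable_fst).
have F0 z : (0 <= F z)%E by rewrite lee_fin mulr_ge0// indicE.
have := @past_indep t v m t0 tv F mF F0.
rewrite /Rintegral => H; congr fine; transitivity (\int[P]_w F (w, W v w - W t w)%R)%E.
  apply: eq_integral => w _; rewrite /F /=; congr (_ * psi _)%:E.
  by rewrite /Wtilde; ring.
rewrite H; apply: eq_integral => w _.
have mFw : measurable_fun setT (fun y => F (w, y)) by apply: (measurableT_comp mF); apply: (@measurable_fun_pair _ _ _ R (X m) R (fun=> w) idfun); [exact: measurable_cst|exact: measurable_id].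
rewrite (@bm_increment_stationary t v (fun y => F (w, y)) (ltW t0) (ltW tv) mFw)//.
rewrite /F /=; under eq_integral do rewrite EFinM.
rewrite ge0_integralZl//; last 2 first.
- exact/measurable_EFinP.
- by move=> w2 _; rewrite lee_fin.
by rewrite EFinM /bm_semigroup /Rintegral fineK//; exact: integrable_fin_num (iint _ _).
Qed.

Lemma below_grid_cvg w : (\1_(below_grid m) w : R) @[m --> \oo] --> (\1_below w : R).
Proof.
have [|nb] := pselect (below w); last first.
  apply: cvg_near_cst; apply: nearW => m; rewrite !indicE (memNset nb).
  rewrite memNset// => /below_gridE[i [im sa h]]; apply: nb; exists (s m i); split => //.
  by rewrite mulr_ge0// divr_ge0// ltW.
move=> [r [r0 ra re]].
(* The grid point just below [r]: it respects the bound [a] and converges to [r]. *)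
pose u m : R := (Num.truncn (r * m.+1%:R / t))%:R * (t / m.+1%:R).
have c0 m : 0 <= r * m.+1%:R / t by rewrite divr_ge0 ?mulr_ge0// ltW.
have p m : 0 < t / m.+1%:R :> R by rewrite divr_gt0.
have eqr m : r = (r * m.+1%:R / t) * (t / m.+1%:R).
  by rewrite mulrA mulfVK ?gt_eqF// mulfK.
have ur m : u m <= r.
  by rewrite [leRHS](eqr m) ler_pM2r// ; have /andP[] := truncn_itv (c0 m).
have ru m : r - t / m.+1%:R <= u m.
  rewrite lerBlDr -[t / _]mul1r -mulrDl [leLHS](eqr m) ler_pM2r//.
  by rewrite natr1 ltW//; have /andP[] := truncn_itv (c0 m).
have u0 m : 0 <= u m by rewrite mulr_ge0// ltW.
have ucvg : u m @[m --> \oo] --> r.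
  apply: (@squeeze_cvgr _ _ _ _ (fun m => r - t / m.+1%:R) (fun=> r)).
  - by apply: nearW => m; rewrite ru ur.
  - rewrite -[Y in _ --> Y]subr0 -(mulr0 t); apply: cvgB; first exact: cvg_cst.
    by apply: cvgM; [exact: cvg_cst|exact: cvg_harmonic].
  - exact: cvg_cst.
have Wc := Wtilde_cvg (w := w) u0 ucvg.
apply: cvg_near_cst; near=> m.
rewrite !indicE !mem_set//.
  by exists r.
apply/below_gridE; exists (Num.truncn (r * m.+1%:R / t)); split.
- rewrite ltnS -(@ler_nat R).
  have /andP[h _] := truncn_itv (c0 m); rewrite (le_trans h)//.
  rewrite ler_pdivrMr// mulrC ler_wpM2l//; case/andP: a0t => _; exact: le_trans.
- exact: le_trans (ur m) ra.
- by near: m; apply: (cvgr_lt (Wt r w)).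
Unshelve. all: by end_near.
Qed.

Lemma measurable_below : measurable_fun setT (\1_below : Omega -> R).
Proof.
apply: (@measurable_fun_cvg _ _ _ _ (fun m w => \1_(below_grid m) w)) => [m|w _].
  exact: mi.
exact: below_grid_cvg.
Qed.

Lemma markov_below : \int[P]_w (\1_below w * psi (Wt v w)) =
  \int[P]_w (\1_below w * sg (v - t) (Wt t w)).
Proof.
have i01 (A : set Omega) w : `|\1_A w : R| <= 1 by rewrite indicE; case: (_ \in _); rewrite ?normr1 ?normr0.
have lim (f : Omega -> R) : measurable_fun setT f -> (forall w, 0 <= f w <= M) ->
    \int[P]_w (\1_(below_grid m) w * f w) @[m --> \oo] --> \int[P]_w (\1_below w * f w).
  move=> mf fM; apply: (@dct_Rint _ _ _ P setT _ _ (fun=> M)) => //.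
  - by move=> m; exact: measurable_funM.
  - by move=> w _; apply: cvgM; [exact: below_grid_cvg|exact: cvg_cst].
  - by move=> m w _; case/andP: (fM w) => f0 f1; rewrite normrM (ger0_norm f0) -[leRHS]mul1r ler_pM.
have h1 := lim _ (measurableT_comp mpsi (measurable_Wtilde v)) (fun w => psiM _).
have h2 := lim _ (measurableT_comp (measurable_bm_semigroup (v - t)) (measurable_Wtilde t))
  (fun w => introT andP (conj (bm_semigroup_ge0 _ _) (bm_semigroup_le _ _))).
rewrite -(cvg_lim _ h1)// -(cvg_lim _ h2)//; congr (limn _).
by apply/funext => m; exact: markov_grid.
Qed.

End grid.

Definition hit_by a : set Omega := [set w | exists r, [/\ 0 <= r, r <= a & Wt r w <= 0]].

Lemma below_cvg a w : 0 <= a ->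
  (\1_(below a n.+1%:R^-1) w : R) @[n --> \oo] --> (\1_(hit_by a) w : R).
Proof.
move=> a0; have [h|nh] := pselect (hit_by a w).
  apply: cvg_near_cst; apply: nearW => n; rewrite !indicE !mem_set//.
  by case: h => r [r0 ra re]; exists r; split => //; rewrite (le_lt_trans re)// invr_gt0.
(* A path that has not hit 0 by time [a] has a positive minimum there, which excludes the events
   [below] with a smaller threshold. *)
have [c cin cmin] := EVT_min a0 (Wtilde_within (a := a) (w := w)).
have cpos : 0 < Wt c w.
  rewrite ltNge; apply/negP => c0; apply: nh; exists c; split => //;
    by move: cin; rewrite in_itv/= => /andP[].
apply: cvg_near_cst; near=> n; rewrite !indicE (memNset nh) memNset// => -[r [r0 ra]].
apply/negP; rewrite -leNgt (le_trans _ (cmin r _)) ?in_itv/= ?r0//.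
apply: ltW; near: n; exact: (near_infty_natSinv_lt (PosNum cpos)).
Unshelve. all: by end_near.
Qed.

Lemma measurable_hit_by a : 0 <= a -> measurable_fun setT (\1_(hit_by a) : Omega -> R).
Proof.
move=> a0; apply: (@measurable_fun_cvg _ _ _ _ (fun n w => \1_(below a n.+1%:R^-1) w)) => [n|w _].
  have h1 : 0 < a + 1 by lra.
  have h3 : 0 <= a <= a + 1 by apply/andP; split; lra.
  exact: (measurable_below n.+1%:R^-1 h1 h3).
exact: below_cvg.
Qed.

Lemma markov_hit a t v : 0 <= a -> a <= t -> 0 < t -> t <= v ->
  \int[P]_w (\1_(hit_by a) w * psi (Wt v w)) =
  \int[P]_w (\1_(hit_by a) w * sg (v - t) (Wt t w)).
Proof.
move=> a0 at_ t0; rewrite le_eqVlt => /predU1P[<-|tv].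
  apply: eq_Rintegral => w _; rewrite subrr /bm_semigroup mulr0 addr0.
  under eq_Rintegral do rewrite W0 addr0.
  by rewrite /Rintegral integral_prob_cst.
have i01 (A : set Omega) w : `|\1_A w : R| <= 1 by rewrite indicE; case: (_ \in _); rewrite ?normr1 ?normr0.
have lm (f : Omega -> R) : measurable_fun setT f -> (forall w, 0 <= f w <= M) ->
    \int[P]_w (\1_(below a n.+1%:R^-1) w * f w) @[n --> \oo] --> \int[P]_w (\1_(hit_by a) w * f w).
  move=> mf fM; apply: (@dct_Rint _ _ _ P setT _ _ (fun=> M)) => //.
  - move=> n; apply: measurable_funM => //; apply: (measurable_below n.+1%:R^-1 t0).
    exact/andP.
  - by move=> w _; apply: cvgM; [exact: below_cvg|exact: cvg_cst].
  - by move=> n w _; case/andP: (fM w) => f0 f1; rewrite normrM (ger0_norm f0) -[leRHS]mul1r ler_pM.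
have h1 := lm _ (measurableT_comp mpsi (measurable_Wtilde v)) (fun w => psiM _).
have h2 := lm _ (measurableT_comp (measurable_bm_semigroup (v - t)) (measurable_Wtilde t))
  (fun w => introT andP (conj (bm_semigroup_ge0 _ _) (bm_semigroup_le _ _))).
rewrite -(cvg_lim _ h1)// -(cvg_lim _ h2)//; congr (limn _).
by apply/funext => n; apply: markov_below => //; exact/andP.
Qed.

End brownian_markov.

(** For a monotone sequence of booleans the difference weights vanish except at the single switch.
    With [b i] saying that a passage has occurred by the [i]-th grid time, the sum evaluates [c] at
    the discretised passage. *)
Lemma sum_boolD_select (R : realType) (b : nat -> bool) (c : nat -> R) N :
  (forall i, b i -> b i.+1) -> ~~ b 0%N ->
  (b N -> exists k, [/\ (k < N)%N, ~~ b k, b k.+1 &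
     \sum_(i < N) ((b i.+1)%:R - (b i)%:R) * c i = c k]) /\
  (~~ b N -> \sum_(i < N) ((b i.+1)%:R - (b i)%:R) * c i = 0).
Proof.
move=> bS b0; elim: N => [|N [IH1 IH2]]; first by rewrite (negbTE b0); split => //; rewrite big_ord0.
rewrite big_ord_recr/=; case bN: (b N).
  have [k [kN bk bk1 ->]] := IH1 bN; rewrite (bS _ bN); split => // _.
  by exists k; rewrite subrr mul0r addr0; split => //; exact: ltnW.
rewrite IH2 ?bN// add0r subr0; case bN1: (b N.+1); split => //.
  by move=> _; exists N; rewrite bN bN1 mul1r ltnSn.
by rewrite mul0r.
Qed.

Lemma Rintegral_sum_ord d (T : measurableType d) (R : realType) (m : {measure set T -> \bar R})
    N (f : nat -> T -> R) : (forall i, m.-integrable setT (EFin \o f i)) ->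
  m.-integrable setT (EFin \o (fun x => \sum_(i < N) f i x)) /\
  \int[m]_x \sum_(i < N) f i x = \sum_(i < N) \int[m]_x f i x.
Proof.
move=> fi; elim: N => [|N [IH1 IH2]].
  rewrite big_ord0; under eq_Rintegral do rewrite big_ord0.
  rewrite (_ : (fun x => _) = fun=> 0); last by apply/funext => x; rewrite big_ord0.
  by split; [exact: integrable0|rewrite /Rintegral integral0].
rewrite big_ord_recr/= -IH2; under eq_Rintegral do rewrite big_ord_recr/=.
rewrite (_ : (fun x => _) = fun x => \sum_(i < N) f i x + f N x); last first.
  by apply/funext => x; rewrite big_ord_recr.
by split; [have := integrableD measurableT IH1 (fi N)|rewrite (RintegralD measurableT IH1 (fi N))].
Qed.

(** * First hitting time of 0 and the strong Markov property *)

Section hitting.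
Context (R : realType) d (Omega : measurableType d) (P : probability Omega R)
  (W : R -> Omega -> R).
Hypothesis BM : standard_BM P W.
Notation mu := (@lebesgue_measure R).
Variables (x0 beta : R).
Hypothesis x00 : 0 < x0.
Notation Wt := (Wtilde x0 beta W).

Let Zset w : set R := [set S | 0 <= S /\ Wt S w <= 0].

Definition hit w : Prop := Zset w !=set0.
Definition tau w : R := inf (Zset w).

Let lbZ w : has_lbound (Zset w).
Proof. by exists 0 => S [S0 _]. Qed.

Let tau_ge0 w : hit w -> 0 <= tau w.
Proof. by move=> h; apply: lb_le_inf => // S []. Qed.

Let tau_in w : hit w -> Wt (tau w) w <= 0.
Proof.
move=> h; have /choice[u uP] (n : nat) : exists S, Zset w S /\ S < tau w + n.+1%:R^-1.
  have [S ZS lt] : exists2 S, Zset w S & S < tau w + n.+1%:R^-1.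
    by apply: inf_adherent; [rewrite invr_gt0|split].
  by exists S.
have ucv : u n @[n --> \oo] --> tau w.
  apply: (@squeeze_cvgr _ _ _ _ (fun=> tau w) (fun n => tau w + n.+1%:R^-1)).
  - apply: nearW => n; have [Z lt] := uP n; rewrite (ltW lt) andbT.
    exact: ge_inf.
  - exact: cvg_cst.
  - rewrite -[X in _ --> X]addr0; apply: cvgD; [exact: cvg_cst|exact: cvg_harmonic].
have Wc := Wtilde_cvg (x0 := x0) (beta := beta) BM (w := w) (fun n => proj1 (proj1 (uP n))) ucv.
rewrite -(cvg_lim _ Wc)//; apply: limr_le; first by apply/cvg_ex; eexists; exact: Wc.
by apply: nearW => n; case: (uP n) => -[].
Qed.

Lemma tau_gt0 w : hit w -> 0 < tau w.
Proof.
move=> h; rewrite lt_neqAle tau_ge0// andbT; apply/eqP => t0.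
by have := tau_in h; rewrite -t0 (Wtilde0 BM) leNgt x00.
Qed.

Lemma Wtilde_tau w : hit w -> Wt (tau w) w = 0.
Proof.
move=> h; apply/eqP; rewrite eq_le tau_in//=.
have t0 := tau_gt0 h.
(* Times before [tau w], at which the path is still positive; the value at the limit is therefore
   nonnegative. *)
pose u n := tau w * (1 - n.+1%:R^-1).
have n1 (n : nat) : n.+1%:R^-1 <= 1 :> R by rewrite invf_le1// ler1n.
have u0 n : 0 <= u n by rewrite mulr_ge0 ?(ltW t0)// subr_ge0.
have ucv : u n @[n --> \oo] --> tau w.
  rewrite -[X in _ --> X]mulr1 -[X in _ * X]subr0; apply: cvgM; first exact: cvg_cst.
  by apply: cvgB; [exact: cvg_cst|exact: cvg_harmonic].
have Wc := Wtilde_cvg (x0 := x0) (beta := beta) BM (w := w) u0 ucv.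
rewrite -(cvg_lim _ Wc)//; apply: limr_ge; first by apply/cvg_ex; eexists; exact: Wc.
apply: nearW => n; rewrite leNgt; apply/negP => /ltW un.
have := ge_inf (lbZ w) (conj (u0 n) un : Zset w (u n)).
by rewrite -/(tau w) leNgt /u gtr_pMr// ltrBlDr ltrDl invr_gt0 ltr0n.
Qed.

Lemma hit_byP a w : hit_by W x0 beta a w <-> hit w /\ tau w <= a.
Proof.
split=> [[r [r0 ra re]]|[h ta]].
  by split; [exists r|apply: le_trans ra; exact: ge_inf].
by exists (tau w); rewrite (Wtilde_tau h); split => //; exact: tau_ge0.
Qed.

Lemma Tstar_hit w : hit w -> Tstar x0 beta W w = (tau w)%:E.
Proof.
move=> h; rewrite /Tstar; apply/eqP; rewrite eq_le; apply/andP; split.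
  by apply: ereal_inf_lbound; exists (tau w) => //; split; [exact: tau_ge0|exact: tau_in].
by apply: le_ereal_inf_tmp => _ [S ZS <-]; rewrite lee_fin; exact: ge_inf.
Qed.

Lemma Tstar_nohit w : ~ hit w -> Tstar x0 beta W w = +oo%E.
Proof.
move=> nh; rewrite /Tstar (_ : [set S%:E | S in _] = set0) ?ereal_inf0//.
by apply/seteqP; split => t //= [S ZS _]; apply: nh; exists S.
Qed.

Lemma hit_by_cvg w : (\1_(hit_by W x0 beta n%:R) w : R) @[n --> \oo] --> (\1_hit w : R).
Proof.
apply: cvg_near_cst; have [h|nh] := pselect (hit w).
  near=> n; rewrite !indicE !mem_set//; apply/hit_byP; split => //.
  by near: n; exact: nbhs_infty_ger.
by apply: nearW => n; rewrite !indicE !memNset// => /hit_byP[].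
Unshelve. all: by end_near.
Qed.

Lemma measurable_hit : measurable_fun setT (\1_hit : Omega -> R).
Proof.
apply: (@measurable_fun_cvg _ _ _ _ (fun n w => \1_(hit_by W x0 beta n%:R) w)) => [n|w _].
  exact: (measurable_hit_by BM).
exact: hit_by_cvg.
Qed.

Lemma measurable_set_hit : measurable hit.
Proof.
have := measurable_hit measurableT (measurable_set1 1); rewrite setTI; congr measurable.
apply/seteqP; split => w /=; rewrite indicE.
  by have [//|nh] := pselect (hit w); rewrite memNset// => /esym/eqP; rewrite oner_eq0.
by move=> h; rewrite mem_set.
Qed.

Lemma measurable_set_hit_by a : 0 <= a -> measurable (hit_by W x0 beta a).
Proof.
move=> a0; have := measurable_hit_by BM x0 beta a0 measurableT (measurable_set1 1); rewrite setTI; congr measurable.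
apply/seteqP; split => w /=; rewrite indicE.
  by have [//|nh] := pselect (hit_by W x0 beta a w); rewrite memNset// => /esym/eqP; rewrite oner_eq0.
by move=> h; rewrite mem_set.
Qed.

(* [tau] is the infimum of an empty set off [hit]; [tau0] fixes the value [0]
   there, which makes it measurable. *)
Definition tau0 w : R := \1_hit w * tau w.

Lemma measurable_tau0 : measurable_fun setT tau0.
Proof.
apply: (measurability _ (RGenOInfty.measurableE R)) => //.
move=> _ [_ [x ->] <-]; rewrite setTI.
have tE w : tau0 w = if pselect (hit w) then tau w else 0.
  by rewrite /tau0 indicE; case: pselect => h; rewrite ?(mem_set h) ?(memNset h) ?mul1r ?mul0r.
have [x0'|x0'] := ltP x 0.
  rewrite (_ : _ @^-1` _ = setT) ?measurableT//; apply/seteqP; split => // w _ /=.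
  rewrite in_itv/= andbT tE; case: pselect => h //.
  by rewrite (lt_le_trans x0')// ltW// tau_gt0.
rewrite (_ : _ @^-1` _ = hit `\` hit_by W x0 beta x).
  by apply: measurableD; [exact: measurable_set_hit|exact: measurable_set_hit_by].
apply/seteqP; split => w /=; rewrite in_itv/= andbT tE; case: pselect => h //=.
- by move=> xt; split => // /hit_byP[_]; rewrite leNgt xt.
- by move=> /(le_lt_trans x0'); rewrite ltxx.
- by move=> [_ nh]; rewrite ltNge; apply/negP => tx; apply: nh; apply/hit_byP.
- by case.
Qed.

Lemma tau0E w : hit w -> tau0 w = tau w.
Proof. by move=> h; rewrite /tau0 indicE mem_set ?mul1r. Qed.

Section strong_markov.
Variables (psi : R -> R) (M : R).
Hypotheses (cpsi : continuous psi) (psiM : forall x, 0 <= psi x <= M).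
Notation sg := (bm_semigroup P W beta psi).

Let i01 (A : set Omega) w : 0 <= (\1_A w : R) <= 1.
Proof. by rewrite indicE; case: (_ \in _); rewrite ?lexx ?ler01. Qed.

Let bint (f : Omega -> R) (c : R) : measurable_fun setT f -> (forall w, `|f w| <= c) ->
  P.-integrable setT (EFin \o f).
Proof.
have ic : P.-integrable setT (EFin \o (fun=> c)) by exact: finite_measure_integrable_cst.
by move=> mf fc; apply: (integrable_dom _ _ ic).
Qed.

(** The time [tau] is rounded up to the grid [t n i] of the segment from 0 to [a]. Membership in a
    cell is the difference of two events [hit_by], to each of which [markov_hit] applies at the
    right end of the cell. As the mesh tends to 0 the starting point of the semigroup tends to
    [Wt (tau w) w = 0]. *)
Lemma strong_markov a v : 0 < a -> a <= v ->
  \int[P]_w (\1_(hit_by W x0 beta a) w * psi (Wt v w)) =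
  \int[P]_w (\1_(hit_by W x0 beta a) w * sg (v - tau w) 0).
Proof.
move=> a0 av; have v0 := lt_le_trans a0 av.
have mpsi := continuous_measurable_fun cpsi.
pose t n i : R := i%:R * (a / n.+1%:R).
have p n : 0 < a / n.+1%:R :> R by rewrite divr_gt0.
have tn n : t n n.+1 = a by rewrite /t mulrCA mulfV ?mulr1.
have tS n i : t n i < t n i.+1 by rewrite /t ltr_pM2r// ltr_nat.
have t0 n i : 0 <= t n i by rewrite /t mulr_ge0// ltW.
have tle n i : (i <= n.+1)%N -> t n i <= a by move=> h; rewrite -(tn n) /t ler_pM2r// ler_nat.
pose hb n i (w : Omega) : R := \1_(hit_by W x0 beta (t n i)) w.
have mhb n i : measurable_fun setT (hb n i) by exact: (measurable_hit_by BM).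
have M0 : 0 <= M by case/andP: (psiM 0) => h1 h2; exact: le_trans h2.
pose G n w := \sum_(i < n.+1) (hb n i.+1 w - hb n i w) * sg (v - t n i.+1) (Wt (t n i.+1) w).
have hb01 n i w : 0 <= hb n i w <= 1 by exact: i01.
have sgM h x : 0 <= sg h x <= M by rewrite (bm_semigroup_ge0 P W beta psiM) (bm_semigroup_le BM beta cpsi psiM).
have b1 n i (f : Omega -> R) w : 0 <= f w <= M -> `|(hb n i.+1 w - hb n i w) * f w| <= M.
  move=> /andP[f0 fM]; rewrite normrM (ger0_norm f0) -[leRHS]mul1r ler_pM// ler_norml.
  by have := hb01 n i w; have := hb01 n i.+1 w; lra.
have m1 n i (f : Omega -> R) : measurable_fun setT f -> measurable_fun setT (fun w => (hb n i.+1 w - hb n i w) * f w).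
  by move=> mf; apply: measurable_funM => //; exact: measurable_funB.
have mpsiv : measurable_fun setT (fun w => psi (Wt v w)).
  exact: (measurableT_comp mpsi (measurable_Wtilde BM _ _ _)).
have msg n i : measurable_fun setT (fun w => sg (v - t n i.+1) (Wt (t n i.+1) w)).
  exact: (measurableT_comp (measurable_bm_semigroup BM _ cpsi psiM _) (measurable_Wtilde BM _ _ _)).
have LE n : \int[P]_w (\1_(hit_by W x0 beta a) w * psi (Wt v w)) = \int[P]_w G n w.
  have -> : (fun w => \1_(hit_by W x0 beta a) w * psi (Wt v w)) =
      (fun w => \sum_(i < n.+1) (hb n i.+1 w - hb n i w) * psi (Wt v w)).
    apply/funext => w; rewrite -mulr_suml -(big_mkord xpredT (fun i => hb n i.+1 w - hb n i w)) telescope_sumr//.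
    rewrite /hb tn (_ : \1_(hit_by W x0 beta (t n 0%N)) w = 0) ?subr0//.
    rewrite indicE memNset// => /hit_byP[h]; rewrite /t mul0r leNgt tau_gt0//.
  have [_ ->] := @Rintegral_sum_ord _ _ _ P n.+1 (fun i w => (hb n i.+1 w - hb n i w) * psi (Wt v w))
    (fun i => bint (m1 n i _ mpsiv) (fun w => b1 n i (fun w => psi (Wt v w)) w (psiM _))).
  have [_ ->] := @Rintegral_sum_ord _ _ _ P n.+1 (fun i w => (hb n i.+1 w - hb n i w) * sg (v - t n i.+1) (Wt (t n i.+1) w))
    (fun i => bint (m1 n i _ (msg n i)) (fun w => b1 n i (fun w => sg (v - t n i.+1) (Wt (t n i.+1) w)) w (sgM _ _))).
  apply: eq_bigr => -[i iN] _ /=.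
  have bi j (f : Omega -> R) : measurable_fun setT f -> (forall w, 0 <= f w <= M) ->
      P.-integrable setT (EFin \o (fun w => hb n j w * f w)).
    move=> mf fM; apply: (bint (c := M)); first exact: measurable_funM.
    move=> w; have /andP[f0 f1] := fM w; have /andP[h0 h1] := hb01 n j w.
    by rewrite normrM !ger0_norm// -[leRHS]mul1r ler_pM.
  under eq_Rintegral do rewrite mulrBl.
  under [RHS]eq_Rintegral do rewrite mulrBl.
  rewrite (RintegralB measurableT (bi i.+1 _ mpsiv (fun w => psiM _)) (bi i _ mpsiv (fun w => psiM _))).
  rewrite (RintegralB measurableT (bi i.+1 _ (msg n i) (fun w => sgM _ _)) (bi i _ (msg n i) (fun w => sgM _ _))).
  have tp : 0 < t n i.+1 by apply: le_lt_trans (tS n i).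
  have tv := le_trans (tle n i.+1 iN) av.
  by congr (_ - _); apply: (markov_hit BM _ _ cpsi psiM) => //; exact: ltW.
have iM : P.-integrable setT (EFin \o (fun=> M)) by exact: finite_measure_integrable_cst.
pose b w n i := w \in hit_by W x0 beta (t n i).
have GE w n : G n w = \sum_(i < n.+1) ((b w n i.+1)%:R - (b w n i)%:R) * sg (v - t n i.+1) (Wt (t n i.+1) w).
  by apply: eq_bigr => i _; rewrite /hb !indicE.
have bS w n i : b w n i -> b w n i.+1.
  rewrite /b => /set_mem/hit_byP[h ti]; apply/mem_set/hit_byP; split => //.
  by rewrite (le_trans ti)// ltW.
have b0 w n : ~~ b w n 0%N.
  by apply/negP => /set_mem/hit_byP[h]; rewrite /t mul0r leNgt tau_gt0.
have sel w n := sum_boolD_select (fun i => sg (v - t n i.+1) (Wt (t n i.+1) w)) n.+1 (bS w n) (b0 w n).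
have Gc w : G n w @[n --> \oo] --> \1_(hit_by W x0 beta a) w * sg (v - tau w) 0.
  have [ha|nha] := pselect (hit_by W x0 beta a w); last first.
    apply: cvg_near_cst; apply: nearW => n; rewrite GE indicE (memNset nha) mul0r.
    by apply: (proj2 (sel w n)); rewrite /b tn (memNset nha).
  rewrite indicE (mem_set ha) mul1r.
  have /choice[k kP] n : exists k, [/\ (k < n.+1)%N, ~~ b w n k, b w n k.+1 & G n w = sg (v - t n k.+1) (Wt (t n k.+1) w)].
    rewrite GE; apply: (proj1 (sel w n)); by rewrite /b tn; exact/mem_set.
  have /hit_byP[h ta] := ha.
  (* Right end of the cell containing [tau w]. It exceeds [tau w] by at most one mesh and does not
     exceed [a <= v], so the remaining time [v - u n] stays nonnegative. *)
  pose u n := t n (k n).+1.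
  have u1 n : tau w <= u n by have [_ _ /set_mem/hit_byP[]] := kP n.
  have u2 n : u n <= tau w + a / n.+1%:R.
    have [_ nb _ _] := kP n; rewrite /u /t -natr1 mulrDl mul1r lerD2r leNgt.
    by apply: contra nb => tt; apply/mem_set/hit_byP; split => //; exact: ltW.
  have u3 n : u n <= a by have [kn _ _ _] := kP n; exact: tle.
  have uc : u n @[n --> \oo] --> tau w.
    apply: (@squeeze_cvgr _ _ _ _ (fun=> tau w) (fun n => tau w + a / n.+1%:R)).
    - by apply: nearW => n; rewrite u1 u2.
    - exact: cvg_cst.
    - rewrite -[X in _ --> X]addr0 -[in X in _ --> X](mulr0 a).
      by apply: cvgD; [exact: cvg_cst|apply: cvgM; [exact: cvg_cst|exact: cvg_harmonic]].
  have -> : (fun n => G n w) = (fun n => sg (v - u n) (Wt (u n) w)).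
    by apply/funext => n; case: (kP n).
  apply: (bm_semigroup_cvg BM cpsi psiM).
  - by move=> n; rewrite subr_ge0 (le_trans (u3 n)).
  - by apply: cvgB; [exact: cvg_cst|].
  - rewrite -(Wtilde_tau h); apply: (Wtilde_cvg BM) => // n.
    by rewrite (le_trans _ (u1 n))// ltW// tau_gt0.
have GM n w : `|G n w| <= M.
  rewrite GE; case bn: (b w n n.+1).
    have [k [_ _ _ ->]] := proj1 (sel w n) bn.
    by rewrite ger0_norm; [case/andP: (sgM (v - t n k.+1) (Wt (t n k.+1) w))|exact: (bm_semigroup_ge0 P W beta psiM)].
  by rewrite (proj2 (sel w n)) ?bn// normr0.
have mG n : measurable_fun setT (G n).
  have [iG _] := @Rintegral_sum_ord _ _ _ P n.+1 (fun i w => (hb n i.+1 w - hb n i w) * sg (v - t n i.+1) (Wt (t n i.+1) w))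
    (fun i => bint (m1 n i _ (msg n i)) (fun w => b1 n i (fun w => sg (v - t n i.+1) (Wt (t n i.+1) w)) w (sgM _ _))).
  by apply/measurable_EFinP; exact: measurable_int iG.
have lm := @dct_Rint _ _ _ P setT G _ (fun=> M) measurableT mG (fun w _ => Gc w)
  iM (fun n w _ => GM n w).
have LE' : (fun n => \int[P]_w G n w) = fun=> \int[P]_w (\1_(hit_by W x0 beta a) w * psi (Wt v w)).
  by apply/funext => n; rewrite -LE.
by rewrite LE' in lm; apply: (cvg_unique _ _ lm) => //; exact: cvg_cst.
Qed.

End strong_markov.

(** Adding a constant reduces bounded functions of either sign to nonnegative ones, for which the
    Markov property was proved. *)
Lemma bm_semigroup_shift (psi : R -> R) (M c h x : R) : continuous psi -> (forall x, `|psi x| <= M) ->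
  bm_semigroup P W beta (fun y => psi y + c) h x = bm_semigroup P W beta psi h x + c.
Proof.
move=> cpsi psiM; have mpsi := continuous_measurable_fun cpsi.
have mW : measurable_fun setT (W h) by case: BM.
have iM (e : R) : P.-integrable setT (EFin \o (fun=> e)) by exact: finite_measure_integrable_cst.
have i1 : P.-integrable setT (EFin \o (fun w => psi (x + beta * h + W h w))).
  apply: (integrable_dom _ _ (iM M)) => //.
  by apply: (measurableT_comp mpsi); exact: measurable_funD.
rewrite /bm_semigroup (RintegralD measurableT i1 (iM c)); congr (_ + _).
by rewrite /Rintegral integral_prob_cst.
Qed.

(** The absolute value keeps the time in the range where paths are continuous, and turns continuity
    on the half-line into continuity on the whole line. *)
Lemma bm_semigroup_continuous (psi : R -> R) (M x : R) : continuous psi -> (forall x, `|psi x| <= M) ->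
  continuous (fun h : R => bm_semigroup P W beta psi `|h| x).
Proof.
move=> cpsi psiM h; apply/continuous_withinNx; apply/cvgr_dnbhsP => u [_ uh].
have c' : continuous (fun y => psi y + M) by move=> y; apply: cvgD; [exact: cpsi|exact: cvg_cst].
have M' y : 0 <= psi y + M <= 2 * M by have := psiM y; rewrite ler_norml; lra.
have -> : (fun n => bm_semigroup P W beta psi `|u n| x) =
    (fun n => bm_semigroup P W beta (fun y => psi y + M) `|u n| x - M).
  by apply/funext => n; rewrite (bm_semigroup_shift M _ _ cpsi psiM) addrK.
rewrite -[X in _ --> X](addrK M) -(bm_semigroup_shift M _ _ cpsi psiM).
apply: cvgB; last exact: cvg_cst.
apply: (bm_semigroup_cvg BM c' M') => //; last exact: cvg_cst.
exact: cvg_norm.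
Qed.

Lemma measurable_hit_semigroup (psi : R -> R) (M a v : R) : continuous psi -> (forall x, `|psi x| <= M) ->
  0 <= a -> a <= v ->
  measurable_fun setT (fun w => \1_(hit_by W x0 beta a) w * bm_semigroup P W beta psi (v - tau w) 0).
Proof.
move=> cpsi psiM a0 av.
have -> : (fun w => \1_(hit_by W x0 beta a) w * bm_semigroup P W beta psi (v - tau w) 0) =
    (fun w => \1_(hit_by W x0 beta a) w * bm_semigroup P W beta psi `|v - tau0 w| 0).
  apply/funext => w; rewrite indicE; case: (boolP (w \in _)) => [/set_mem/hit_byP[h ta]|_]; last by rewrite !mul0r.
  by rewrite tau0E// ger0_norm// subr_ge0 (le_trans ta).
apply: measurable_funM; first exact: (measurable_hit_by BM).
have := continuous_measurable_fun (@bm_semigroup_continuous psi M 0 cpsi psiM) => m.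
by apply: (measurableT_comp m); apply: measurable_funB => //; exact: measurable_tau0.
Qed.

Lemma bm_semigroup_norm (psi : R -> R) (M h x : R) : continuous psi -> (forall x, `|psi x| <= M) ->
  `|bm_semigroup P W beta psi h x| <= M.
Proof.
move=> cpsi psiM.
have c' : continuous (fun y => psi y + M) by move=> y; apply: cvgD; [exact: cpsi|exact: cvg_cst].
have M' y : 0 <= psi y + M <= 2 * M by have := psiM y; rewrite ler_norml; lra.
have := bm_semigroup_ge0 P W beta M' h x; have := bm_semigroup_le BM beta c' M' h x.
by rewrite (bm_semigroup_shift M _ _ cpsi psiM) ler_norml; lra.
Qed.

Lemma strong_markov_bounded (psi : R -> R) (M a v : R) : continuous psi -> (forall x, `|psi x| <= M) ->
  0 < a -> a <= v ->
  \int[P]_w (\1_(hit_by W x0 beta a) w * psi (Wt v w)) =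
  \int[P]_w (\1_(hit_by W x0 beta a) w * bm_semigroup P W beta psi (v - tau w) 0).
Proof.
move=> cpsi psiM a0 av.
have c' : continuous (fun y => psi y + M) by move=> y; apply: cvgD; [exact: cpsi|exact: cvg_cst].
have M' y : 0 <= psi y + M <= 2 * M by have := psiM y; rewrite ler_norml; lra.
have := strong_markov c' M' a0 av.
have iM (e : R) : P.-integrable setT (EFin \o (fun=> e)) by exact: finite_measure_integrable_cst.
have m1 := measurable_hit_by BM x0 beta (ltW a0).
have i01 w : `|\1_(hit_by W x0 beta a) w : R| <= 1 by rewrite indicE; case: (_ \in _); rewrite ?normr1 ?normr0.
have mf : measurable_fun setT (fun w => psi (Wt v w)).
  exact: (measurableT_comp (continuous_measurable_fun cpsi) (measurable_Wtilde BM _ _ _)).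
have if1 : P.-integrable setT (EFin \o (fun w => \1_(hit_by W x0 beta a) w * psi (Wt v w))).
  apply: (integrable_dom _ _ (iM M)) => //; first exact: measurable_funM.
  by move=> w _; rewrite normrM -[leRHS]mul1r ler_pM.
have if2 : P.-integrable setT (EFin \o (fun w => \1_(hit_by W x0 beta a) w * bm_semigroup P W beta psi (v - tau w) 0)).
  apply: (integrable_dom _ _ (iM M)) => //; first exact: (measurable_hit_semigroup cpsi psiM (ltW a0)).
  by move=> w _; rewrite normrM -[leRHS]mul1r ler_pM// bm_semigroup_norm.
have ic : P.-integrable setT (EFin \o (fun w => \1_(hit_by W x0 beta a) w * M)).
  apply: (integrable_dom _ _ (iM `|M|)) => //; first exact: measurable_funM.
  by move=> w _; rewrite normrM -[leRHS]mul1r ler_pM.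
under eq_Rintegral do rewrite mulrDr.
under [X in _ = X -> _]eq_Rintegral do rewrite (bm_semigroup_shift M _ _ cpsi psiM) mulrDr.
by rewrite (RintegralD measurableT if1 ic) (RintegralD measurableT if2 ic) => /addIr.
Qed.

End hitting.

(** * The Fourier transform of the hitting time *)

Section gaussian_transform.
Context (R : realType).
Notation mu := (@lebesgue_measure R).

Let mcos (u v : R) : measurable_fun setT (fun y => cos (u * y + v)).
Proof.
apply: (measurableT_comp (continuous_measurable_fun (@continuous_cos R))).
exact: measurable_funD.
Qed.

Let cos1 (x : R) : `|cos x| <= 1. Proof. by rewrite ler_norml cos_geN1 cos_le1. Qed.
Let sin1 (x : R) : `|sin x| <= 1. Proof. by rewrite ler_norml sin_geN1 sin_le1. Qed.

(* The rescaled transform [h l] has zero derivative in [l]: its derivative in [l]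
   is the derivative in [y] of [E l * (b * S) * sin (l * b * y + c) * gaussd S y]. *)
Lemma gauss_cf S (b c : R) : 0 < S ->
  \int[mu]_y (cos (b * y + c) * gaussd S y) = expR (- (b ^+ 2 / 2 * S)) * cos c.
Proof.
move=> S0; set B := b ^+ 2 / 2 * S.
have B0 : 0 <= B by rewrite mulr_ge0 ?(ltW S0)// divr_ge0// sqr_ge0.
pose E (l : R) := expR (l ^+ 2 * B).
pose h (l y : R) := E l * cos (l * b * y + c) * gaussd S y.
pose k (l y : R) := E l * (l * b ^+ 2 * S * cos (l * b * y + c) - b * y * sin (l * b * y + c)).
pose M (l : R) := expR ((`|l| + 1) ^+ 2 * B) * ((`|l| + 1) * b ^+ 2 * S + `|b|).
have kM (l x y : R) : `|x| <= `|l| + 1 -> `|k x y| <= M l * expR (1 * `|y|).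
  move=> xl; have ey : 1 <= expR (1 * `|y|) by rewrite -[leLHS]expR0 ler_expR mul1r.
  have yy : `|y| <= expR (1 * `|y|) by rewrite mul1r (le_trans _ (expR_ge1Dx _))// lerDr.
  have b0 : 0 <= b ^+ 2 * S by rewrite mulr_ge0 ?sqr_ge0 ?ltW.
  rewrite /k /M -[leRHS]mulrA normrM (ger0_norm (expR_ge0 _)).
  apply: (ler_pM (expR_ge0 _) (normr_ge0 _)).
    by rewrite ler_expR ler_wpM2r// -(real_normK (num_real x)) lerXn2r// nnegrE ?addr_ge0.
  apply: (le_trans (ler_normB _ _)); rewrite mulrDl -(mulrA x) -(mulrA (`|l| + 1)).
  rewrite normrM (normrM x) (ger0_norm b0) (normrM (b * y)) (normrM b); apply: lerD.
    apply: (ler_pM (mulr_ge0 (normr_ge0 _) b0) (normr_ge0 _)); first exact: ler_wpM2r.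
    exact: le_trans (cos1 _) ey.
  by rewrite -mulrA ler_wpM2l// (le_trans (ler_piMr _ (sin1 _))).
have kMl (l y : R) : `|k l y| <= M l * expR (1 * `|y|) by apply: kM; rewrite lerDl.
have kM0 (l y : R) : 0 <= M l * expR (1 * `|y|) by exact: le_trans (normr_ge0 _) (kMl l y).
have mk l : measurable_fun setT (k l).
  apply: measurable_funM => //; apply: measurable_funB; first exact: measurable_funM.
  apply: measurable_funM; first exact: measurable_funM.
  apply: (measurableT_comp (continuous_measurable_fun (@continuous_sin R))).
  exact: measurable_funD.
have dl (l : R) : is_derive l 1 (fun l => \int[mu]_y h l y) (\int[mu]_y (k l y * gaussd S y)).
  apply: (@is_derive_under _ _ _ mu h (fun l y => k l y * gaussd S y)
    (fun y => M l * expR (1 * `|y|) * gaussd S y) l (l - 1) (l + 1)).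
  - by apply/andP; split; lra.
  - move=> x _; apply: (@integrable_gauss_dom _ _ 0 (E x) (fun y => E x * cos (x * b * y + c))) => // [|y].
      exact: measurable_funM.
    by rewrite mul0r expR0 mulr1 normrM (ger0_norm (expR_ge0 _)) ler_piMr ?expR_ge0.
  - move=> x y _.
    apply: (is_derive_eq (dM (dM (dexpR (dM (dX 2 (did x)) (dcst B x)))
      (dcos (dD (dM (dM (did x) (dcst b x)) (dcst y x)) (dcst c x)))) (dcst (gaussd S y) x))).
    by rewrite /k /E /B /=; field.
  - by move=> y; rewrite mulr_ge0 ?gaussd_ge0.
  - apply: (@integrable_gauss_dom _ _ 1 (M l) (fun y => M l * expR (1 * `|y|))) => // [|y].
      apply: measurable_funM => //; apply: measurableT_comp => //; exact: measurable_funM.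
    by rewrite ger0_norm.
  - move=> x y /andP[x1 x2]; rewrite normrM (ger0_norm (gaussd_ge0 _ _)) ler_wpM2r ?gaussd_ge0//.
    by apply: kM; have := ler_norm l; have := ler_norm (- l); rewrite normrN ler_norml; lra.
have k0 (l : R) : \int[mu]_y (k l y * gaussd S y) = 0.
  pose f (y : R) := E l * (b * S) * sin (l * b * y + c).
  have dF (y : R) : is_derive y 1 (fun y => f y * gaussd S y) (k l y * gaussd S y).
    apply: (is_derive_eq (dM (dM (dcst (E l * (b * S)) y) (dsin (dD (dZ (l * b) (did y)) (dcst c y))))
      (is_derive_gaussd y S0))).
    by rewrite /f /k; field; rewrite gt_eqF.
  have [|l1 l2] := @gaussd_cvg0 _ S 0 `|E l * (b * S)| f S0.
    by move=> y; rewrite mul0r expR0 mulr1 /f normrM ler_piMr.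
  rewrite (FTC_line dF _ _ l1 l2) ?subr0//; last first.
    exact: (@integrable_gauss_dom _ _ 1 (M l) (k l) S0 (mk l) (kMl l)).
  have clin : continuous (fun y : R => l * b * y + c).
    by move=> y; apply: cvgD; [apply: cvgM; [exact: cvg_cst|exact: cvg_id]|exact: cvg_cst].
  move=> y; apply: cvgM; last exact: continuous_gaussd.
  apply: cvgM; first exact: cvg_cst.
  apply: cvgB; apply: cvgM.
  - exact: cvg_cst.
  - by apply: (continuous_comp (clin y)); exact: continuous_cos.
  - by apply: cvgM; [exact: cvg_cst|exact: cvg_id].
  - by apply: (continuous_comp (clin y)); exact: continuous_sin.
have d0 (l : R) : is_derive l 1 (fun l => \int[mu]_y h l y) 0 by rewrite -(k0 l).
have := is_derive_0_is_cst 1 0 d0; rewrite /h /E expr0n/= mul0r expR0.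
under [X in _ = X -> _]eq_Rintegral do rewrite !mul0r add0r mul1r.
under [X in X = _ -> _]eq_Rintegral do rewrite expr1n !mul1r -mulrA.
rewrite RintegralZl//; last first.
  by apply: (@integrable_gauss_dom _ _ 0 1 (fun y => cos (b * y + c))) => // y; rewrite mul0r expR0 mulr1.
rewrite RintegralZl//; last exact: integrable_gaussd.
rewrite [X in _ = _ * X -> _]/Rintegral integral_gaussd//= mulr1 => <-.
by rewrite mulrA -expRD addNr expR0 mul1r.
Qed.

Lemma gauss_mgf S (a b c : R) : 0 < S ->
  mu.-integrable setT (EFin \o (fun y => expR (a * y) * cos (b * y + c) * gaussd S y)) /\
  \int[mu]_y (expR (a * y) * cos (b * y + c) * gaussd S y) =
    expR ((a ^+ 2 - b ^+ 2) / 2 * S) * cos (a * b * S + c).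
Proof.
move=> S0.
have i : mu.-integrable setT (EFin \o (fun y => expR (a * y) * cos (b * y + c) * gaussd S y)).
  apply: (@integrable_gauss_dom _ _ `|a| 1) => //.
    by apply: measurable_funM => //; apply: measurableT_comp => //; exact: measurable_funM.
  move=> y; rewrite mul1r normrM (ger0_norm (expR_ge0 _)) (le_trans (ler_piMr _ (cos1 _)))//.
  by rewrite ler_expR -normrM ler_norm.
(* Translation by [a * S] absorbs [expR (a * y)] in the Gaussian and shifts the phase by
   [a * b * S]. *)
split => //; have := Rlebesgue_affine (a * S) ltr01 i; rewrite invr1 mul1r => <-.
transitivity (\int[mu]_y (expR (a ^+ 2 / 2 * S) * (cos (b * y + (a * b * S + c)) * gaussd S y))).
  apply: eq_Rintegral => y _; rewrite mul1r /gaussd.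
  have -> : b * (y + a * S) + c = b * y + (a * b * S + c) by ring.
  have e : expR (a * (y + a * S)) * expR (- (y + a * S) ^+ 2 / (2 * S)) =
      expR (a ^+ 2 / 2 * S) * expR (- y ^+ 2 / (2 * S)).
    by rewrite -!expRD; congr expR; field; rewrite gt_eqF.
  move: e; move: (expR _) (expR _) (expR _) (expR _) (cos _) (Num.sqrt _)^-1 => e1 e2 e3 e4 C n e.
  by transitivity ((e4 * e3) * (C * n)); [|rewrite e]; ring.
rewrite RintegralZl//; last first.
  by apply: (@integrable_gauss_dom _ _ 0 1 (fun y => cos (b * y + _))) => // y; rewrite mul0r expR0 mulr1.
by rewrite gauss_cf// mulrA -expRD; congr (expR _ * _); ring.
Qed.

End gaussian_transform.

Section bm_moments.
Context (R : realType) d (Omega : measurableType d) (P : probability Omega R)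
  (W : R -> Omega -> R).
Hypothesis BM : standard_BM P W.
Notation mu := (@lebesgue_measure R).

Let mW h : measurable_fun setT (W h). Proof. by case: BM. Qed.
Let W0 w : W 0 w = 0. Proof. by case: BM. Qed.

Lemma bm_law (h : R) (F : R -> \bar R) : 0 < h -> measurable_fun setT F -> (forall y, (0 <= F y)%E) ->
  (\int[P]_w F (W h w) = \int[mu]_y (F y * (gaussd h y)%:E))%E.
Proof.
move=> h0 mF F0; have := bm_increment_law BM (lexx 0) h0 mF F0; rewrite subr0 => <-.
by apply: eq_integral => w _; rewrite W0 subr0.
Qed.

(** A signed [F] is written as [F + |F|] minus [|F|], two nonnegative functions to which [bm_law]
    applies. *)
Lemma bm_law_Rint (h : R) (F : R -> R) : 0 < h -> measurable_fun setT F ->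
  mu.-integrable setT (EFin \o (fun y => F y * gaussd h y)) ->
  P.-integrable setT (EFin \o (fun w => F (W h w))) /\
  \int[P]_w F (W h w) = \int[mu]_y (F y * gaussd h y).
Proof.
move=> h0 mF iF.
have mA : measurable_fun setT (fun y => `|F y|) by exact: measurableT_comp.
have iA : mu.-integrable setT (EFin \o (fun y => `|F y| * gaussd h y)).
  have := integrable_norm iF; apply: eq_integrable => // y _ /=.
  by rewrite normrM (ger0_norm (gaussd_ge0 h y)).
have key (f : R -> R) : measurable_fun setT f -> (forall y, 0 <= f y) ->
    mu.-integrable setT (EFin \o (fun y => f y * gaussd h y)) ->
    P.-integrable setT (EFin \o (fun w => f (W h w))) /\
    \int[P]_w f (W h w) = \int[mu]_y (f y * gaussd h y).
  move=> mf f0 iff; have E : (\int[P]_w (f (W h w))%:E = \int[mu]_y (f y * gaussd h y)%:E)%E.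
    by rewrite (@bm_law h (EFin \o f))//; exact/measurable_EFinP.
  split; last by rewrite /Rintegral E.
  apply/integrableP; split; first by apply/measurable_EFinP; exact: (measurableT_comp mf (mW h)).
  under eq_integral do rewrite /= ger0_norm//.
  rewrite E; have /integrableP[_] := iff.
  by under eq_integral do rewrite /= ger0_norm ?mulr_ge0 ?gaussd_ge0//.
have iS : mu.-integrable setT (EFin \o (fun y => (F y + `|F y|) * gaussd h y)).
  by have := integrableD measurableT iF iA; apply: eq_integrable => // y _ /=; rewrite mulrDl EFinD.
have [i1 e1] := key _ mA (fun y => normr_ge0 _) iA.
have p0 y : 0 <= F y + `|F y| by have := ler_norm (- F y); rewrite normrN; lra.
have [i2 e2] := key (fun y => F y + `|F y|) (measurable_funD mF mA) p0 iS.
have FE w : F (W h w) = (F (W h w) + `|F (W h w)|) - `|F (W h w)| by rewrite addrK.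
split.
  by have := integrableB measurableT i2 i1; apply: eq_integrable => // w _ /=; rewrite -EFinB addrK.
under eq_Rintegral do rewrite FE.
rewrite (RintegralB measurableT i2 i1) e1 e2 -(RintegralB measurableT iS iA).
by apply: eq_Rintegral => y _; ring.
Qed.

Lemma bm_mgf_phase (a b c k h : R) : 0 <= h ->
  P.-integrable setT (EFin \o (fun w => expR (a * (c + W h w)) * cos (b * (c + W h w) + k))) /\
  \int[P]_w (expR (a * (c + W h w)) * cos (b * (c + W h w) + k)) =
    expR (a * c + (a ^+ 2 - b ^+ 2) / 2 * h) * cos (b * c + a * b * h + k).
Proof.
rewrite le_eqVlt => /predU1P[<-|h0].
  have -> : (fun w => expR (a * (c + W 0 w)) * cos (b * (c + W 0 w) + k)) =
      fun=> expR (a * c) * cos (b * c + k).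
    by apply/funext => w; rewrite W0 addr0.
  split; first exact: finite_measure_integrable_cst.
  by rewrite /Rintegral integral_prob_cst/= !mulr0 !addr0.
have [i e] := gauss_mgf a b (b * c + k) h0.
have E y : expR (a * (c + y)) * cos (b * (c + y) + k) * gaussd h y =
    expR (a * c) * (expR (a * y) * cos (b * y + (b * c + k)) * gaussd h y).
  rewrite mulrDr expRD (_ : b * (c + y) + k = b * y + (b * c + k)); last by ring.
  by rewrite !mulrA.
have [||j ->] := @bm_law_Rint h (fun y => expR (a * (c + y)) * cos (b * (c + y) + k)) h0.
- apply: measurable_funM.
    apply: measurableT_comp => //; apply: measurable_funM => //; exact: measurable_funD.
  apply: (measurableT_comp (continuous_measurable_fun (@continuous_cos R))).
  by apply: measurable_funD => //; apply: measurable_funM => //; exact: measurable_funD.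
- under eq_fun do rewrite E.
  by have := integrableZl measurableT (expR (a * c)) i.
split => //; under eq_Rintegral do rewrite E.
rewrite RintegralZl// e mulrA -expRD; congr (_ * cos _); ring.
Qed.

Lemma bm_mgf_shift (a b c h : R) : 0 <= h ->
  [/\ P.-integrable setT (EFin \o (fun w => expR (a * (c + W h w)) * cos (b * (c + W h w)))),
      P.-integrable setT (EFin \o (fun w => expR (a * (c + W h w)) * sin (b * (c + W h w)))),
      \int[P]_w (expR (a * (c + W h w)) * cos (b * (c + W h w))) =
        expR (a * c + (a ^+ 2 - b ^+ 2) / 2 * h) * cos (b * c + a * b * h) &
      \int[P]_w (expR (a * (c + W h w)) * sin (b * (c + W h w))) =
        expR (a * c + (a ^+ 2 - b ^+ 2) / 2 * h) * sin (b * c + a * b * h)].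
Proof.
move=> h0; have [] := bm_mgf_phase a b c 0 h0; have [] := bm_mgf_phase a b c (- (pi / 2)) h0.
rewrite cosBpihalf addr0; under eq_fun do rewrite cosBpihalf.
by under [in X in _ = _ -> X]eq_fun do rewrite addr0; split.
Qed.

Lemma bm_exp_moment (a c h : R) : 0 <= h ->
  P.-integrable setT (EFin \o (fun w => expR (a * (c + W h w)))) /\
  \int[P]_w expR (a * (c + W h w)) = expR (a * c + a ^+ 2 / 2 * h).
Proof.
move=> h0; have [i1 _ e1 _] := bm_mgf_shift a 0 c h0.
have E : (fun w => expR (a * (c + W h w)) * cos (0 * (c + W h w))) = fun w => expR (a * (c + W h w)).
  by apply/funext => w; rewrite mul0r cos0 mulr1.
by move: i1 e1; rewrite E => i1 ->; split => //; rewrite mulr0 !mul0r addr0 cos0 mulr1 expr0n/= subr0.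
Qed.

End bm_moments.

(** * Exponential martingale at the hitting time *)

Section tau_cf.
Context (R : realType) d (Omega : measurableType d) (P : probability Omega R)
  (W : R -> Omega -> R).
Hypothesis BM : standard_BM P W.
Notation mu := (@lebesgue_measure R).
Variables (x0 beta rho sigma z : R).
Hypotheses (x00 : 0 < x0) (A0 : 0 < beta + rho)
  (q1 : rho ^+ 2 - sigma ^+ 2 = beta ^+ 2) (q2 : rho * sigma = - z).
Notation Wt := (Wtilde x0 beta W).
Notation hb v := (hit_by W x0 beta v).
Notation tau := (tau W x0 beta).
Let A := beta + rho.

Let mW h : measurable_fun setT (W h). Proof. by case: BM. Qed.

Let i01 (B : set Omega) w : `|\1_B w : R| <= 1.
Proof. by rewrite indicE; case: (_ \in _); rewrite ?normr1 ?normr0. Qed.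

Section exp_markov.
Variable f : R -> R.
Hypotheses (cf : continuous f) (f1 : forall x, `|f x| <= 1).

(** The maximum of [x] and [- n], in a form whose continuity is immediate. The exponential
    [expR (- A * x)] is unbounded below 0; truncating it at [expR (A * n)] makes the bounded strong
    Markov property applicable, and the truncation is removed by dominated convergence. *)
Let m (n : nat) (x : R) : R := (x - n%:R + `|x + n%:R|) / 2.
Let m_ge n x : - n%:R <= m n x.
Proof. by rewrite /m; have := ler_norm (- (x + n%:R)); rewrite normrN; lra. Qed.
Let m_gex n x : x <= m n x.
Proof. by rewrite /m; have := ler_norm (x + n%:R); lra. Qed.

Let psi n x := expR (- A * m n x) * f (sigma * x).

Let cpsi n : continuous (psi n).
Proof.
move=> x; apply: cvgM.
  apply: (@continuous_comp _ _ _ (fun x => - A * m n x) expR); last exact: continuous_expR.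
  apply: cvgM; first exact: cvg_cst.
  apply: cvgM; last exact: cvg_cst.
  apply: cvgD; first by apply: cvgB; [exact: cvg_id|exact: cvg_cst].
  by apply: cvg_norm; apply: cvgD; [exact: cvg_id|exact: cvg_cst].
apply: (@continuous_comp _ _ _ (fun x : R => sigma * x) f); last exact: cf.
by apply: cvgM; [exact: cvg_cst|exact: cvg_id].
Qed.

Let psiM n x : `|psi n x| <= expR (A * n%:R).
Proof.
rewrite normrM ger0_norm ?expR_ge0// (le_trans (ler_piMr (expR_ge0 _) (f1 _)))//.
by rewrite ler_expR; have := ler_wpM2l (ltW A0) (m_ge n x); rewrite -/A; lra.
Qed.

Let psi_dom n x : `|psi n x| <= expR (- A * x).
Proof.
rewrite normrM ger0_norm ?expR_ge0// (le_trans (ler_piMr (expR_ge0 _) (f1 _)))//.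
by rewrite ler_expR; have := ler_wpM2l (ltW A0) (m_gex n x); rewrite -/A; lra.
Qed.

Let psi_cvg x : psi n x @[n --> \oo] --> expR (- A * x) * f (sigma * x).
Proof.
apply: cvg_near_cst; near=> n; rewrite /psi /m ger0_norm; last first.
  rewrite -lerBlDl sub0r; near: n; exact: nbhs_infty_ger.
by congr (expR (_ * _) * _); lra.
Unshelve. all: by end_near.
Qed.

Let K (h : R) := \int[P]_w (expR (- A * (beta * h + W h w)) * f (sigma * (beta * h + W h w))).

Lemma exp_strong_markov v : 0 < v ->
  \int[P]_w (\1_(hb v) w * (expR (- A * Wt v w) * f (sigma * Wt v w))) =
  \int[P]_w (\1_(hb v) w * K (v - tau w)).
Proof.
move=> v0.
have WtE w : Wt v w = (x0 + beta * v) + W v w by rewrite /Wtilde addrAC.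
have mWt := measurable_Wtilde BM x0 beta v.
have mhb := measurable_hit_by BM x0 beta (ltW v0).
have [ie _] := bm_exp_moment BM (- A) (x0 + beta * v) (ltW v0).
have l1 : \int[P]_w (\1_(hb v) w * psi n (Wt v w)) @[n --> \oo] -->
    \int[P]_w (\1_(hb v) w * (expR (- A * Wt v w) * f (sigma * Wt v w))).
  apply: (@dct_Rint _ _ _ P setT _ _ (fun w => expR (- A * (x0 + beta * v + W v w)))) => //.
  - by move=> n; apply: measurable_funM => //; exact: (measurableT_comp (continuous_measurable_fun (@cpsi n)) mWt).
  - by move=> w _; apply: cvgM; [exact: cvg_cst|exact: psi_cvg].
  - by move=> n w _; rewrite normrM -[leRHS]mul1r -WtE ler_pM.
have sgc h : 0 <= h -> bm_semigroup P W beta (psi n) h 0 @[n --> \oo] --> K h /\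
    forall n, `|bm_semigroup P W beta (psi n) h 0| <= expR (- A * (beta * h) + A ^+ 2 / 2 * h).
  move=> h0; have [ih eh] := bm_exp_moment BM (- A) (beta * h) h0.
  have mb : measurable_fun setT (fun w => beta * h + W h w) by exact: measurable_funD.
  have mps n : measurable_fun setT (fun w => psi n (beta * h + W h w)).
    exact: (measurableT_comp (continuous_measurable_fun (@cpsi n)) mb).
  rewrite /bm_semigroup /K; split.
    apply: (@dct_Rint _ _ _ P setT _ _ (fun w => expR (- A * (beta * h + W h w)))) => //.
    - by move=> n; under eq_fun do rewrite add0r; exact: mps.
    - by move=> w _; under eq_fun do rewrite add0r; exact: psi_cvg.
    - by move=> n w _; rewrite add0r.
  move=> n; under eq_Rintegral do rewrite add0r.
  have ips : P.-integrable setT (EFin \o (fun w => psi n (beta * h + W h w))).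
    by apply: (integrable_dom _ _ ih).
  rewrite (le_trans (le_normr_Rintegral measurableT ips))//.
  rewrite -[X in X / 2]sqrrN -eh; apply: (le_Rintegral measurableT _ ih) => //.
  exact: (integrable_norm ips).
pose B := expR ((`|A * beta| + A ^+ 2) * v).
have l2 : \int[P]_w (\1_(hb v) w * bm_semigroup P W beta (psi n) (v - tau w) 0) @[n --> \oo] -->
    \int[P]_w (\1_(hb v) w * K (v - tau w)).
  apply: (@dct_Rint _ _ _ P setT _ _ (fun=> B)) => //.
  - move=> n; have := measurable_hit_semigroup BM beta x00 (@cpsi n) (@psiM n) (ltW v0) (lexx v). exact.
  - move=> w _; rewrite indicE; case: (boolP (w \in _)) => [/set_mem/(hit_byP BM beta x00)[h tv]|_].
      by apply: cvgM; [exact: cvg_cst|apply: (proj1 (sgc _ _)); rewrite subr_ge0].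
    by rewrite mul0r; under eq_fun do rewrite mul0r; exact: cvg_cst.
  - exact: finite_measure_integrable_cst.
  - move=> n w _; rewrite indicE; case: (boolP (w \in _)) => [/set_mem/(hit_byP BM beta x00)[h tv]|_]; last first.
      by rewrite mul0r normr0 expR_ge0.
    have h0 : 0 <= v - tau w by rewrite subr_ge0.
    have t0 := tau_gt0 BM x00 h.
    rewrite mul1r (le_trans (proj2 (sgc _ h0) n))// ler_expR.
    have := ler_norm (- (A * beta)); rewrite normrN => nb.
    apply: (@le_trans _ _ ((`|A * beta| + A ^+ 2) * (v - tau w))).
      rewrite (_ : - A * _ + _ = (- (A * beta) + A ^+ 2 / 2) * (v - tau w)); last by ring.
      by rewrite ler_wpM2r// lerD//; have := sqr_ge0 A; lra.
    by rewrite ler_wpM2l ?addr_ge0 ?sqr_ge0//; lra.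
apply: (cvg_unique _ l1); rewrite //.
rewrite (_ : (fun n => _) = (fun n => \int[P]_w (\1_(hb v) w * bm_semigroup P W beta (psi n) (v - tau w) 0)))//.
apply/funext => n; have := strong_markov_bounded BM beta x00 (@cpsi n) (@psiM n) v0 (lexx v). exact.
Qed.

End exp_markov.

(** Put [q = rho + 'i * sigma] and [l = beta + q]. The hypotheses [q1] and [q2] say
    [q ^+ 2 = beta ^+ 2 - 2 * 'i * z], so [l ^+ 2 / 2 - l * beta = - 'i * z]: after the hitting time
    the mean of the exponential keeps modulus 1 and only its phase rotates. *)
Let K_cos h : 0 <= h ->
  \int[P]_w (expR (- A * (beta * h + W h w)) * cos (sigma * (beta * h + W h w))) = cos (z * h).
Proof.
move=> h0; have [_ _ -> _] := bm_mgf_shift BM (- A) sigma (beta * h) h0.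
have -> : - A * (beta * h) + ((- A) ^+ 2 - sigma ^+ 2) / 2 * h =
   (rho ^+ 2 - sigma ^+ 2 - beta ^+ 2) / 2 * h by rewrite /A; field.
have -> : sigma * (beta * h) + - A * sigma * h = - (rho * sigma) * h by rewrite /A; ring.
by rewrite q1 q2 subrr !mul0r expR0 mul1r opprK.
Qed.

Let K_sin h : 0 <= h ->
  \int[P]_w (expR (- A * (beta * h + W h w)) * sin (sigma * (beta * h + W h w))) = sin (z * h).
Proof.
move=> h0; have [_ _ _ ->] := bm_mgf_shift BM (- A) sigma (beta * h) h0.
have -> : - A * (beta * h) + ((- A) ^+ 2 - sigma ^+ 2) / 2 * h =
   (rho ^+ 2 - sigma ^+ 2 - beta ^+ 2) / 2 * h by rewrite /A; field.
have -> : sigma * (beta * h) + - A * sigma * h = - (rho * sigma) * h by rewrite /A; ring.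
by rewrite q1 q2 subrr !mul0r expR0 mul1r opprK.
Qed.

Let WtE v w : Wt v w = (x0 + beta * v) + W v w.
Proof. by rewrite /Wtilde addrAC. Qed.

Let total v : 0 <= v ->
  [/\ P.-integrable setT (EFin \o (fun w => expR (- A * Wt v w) * cos (sigma * Wt v w))),
      P.-integrable setT (EFin \o (fun w => expR (- A * Wt v w) * sin (sigma * Wt v w))),
      \int[P]_w (expR (- A * Wt v w) * cos (sigma * Wt v w)) = expR (- A * x0) * cos (sigma * x0 + z * v) &
      \int[P]_w (expR (- A * Wt v w) * sin (sigma * Wt v w)) = expR (- A * x0) * sin (sigma * x0 + z * v)].
Proof.
move=> v0; have [i1 i2 e1 e2] := bm_mgf_shift BM (- A) sigma (x0 + beta * v) v0.
have E1 : - A * (x0 + beta * v) + ((- A) ^+ 2 - sigma ^+ 2) / 2 * v = - A * x0.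
  rewrite (_ : _ + _ = - A * x0 + (rho ^+ 2 - sigma ^+ 2 - beta ^+ 2) / 2 * v); last by rewrite /A; field.
  by rewrite q1 subrr !mul0r addr0.
have E2 : sigma * (x0 + beta * v) + - A * sigma * v = sigma * x0 + z * v.
  rewrite (_ : _ + _ = sigma * x0 + - (rho * sigma) * v); last by rewrite /A; ring.
  by rewrite q2 opprK.
have F (f : R -> R) : (fun w => expR (- A * Wt v w) * f (sigma * Wt v w)) =
    (fun w => expR (- A * (x0 + beta * v + W v w)) * f (sigma * (x0 + beta * v + W v w))).
  by apply/funext => w; rewrite WtE.
by rewrite !F e1 e2 E1 E2; split.
Qed.

(** Bounds the contribution at time [v] of the paths that have not hit yet. These are at a positive
    position, the density of that position is at most [1 / sqrt (2 * pi * v)], and [expR (- A * x)]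
    has mass [1 / A] on the half-line. The bound tends to 0 whatever the sign of the drift, so it
    also covers the case where 0 may never be hit. *)
Let eps (v : R) : R := (A * Num.sqrt (2 * pi * v))^-1.

Let tail v : 0 < v -> (\int[P]_w (\1_(`]0, +oo[) (Wt v w) * expR (- A * Wt v w))%:E <= (eps v)%:E)%E.
Proof.
move=> v0; pose G (u : R) : \bar R := (\1_(`]0, +oo[) u * expR (- A * u))%:E.
have mG : measurable_fun setT G.
  apply/measurable_EFinP; apply: measurable_funM; first exact: measurable_indic.
  by apply: measurableT_comp => //; exact: measurable_funM.
have G0 u : (0 <= G u)%E by rewrite lee_fin mulr_ge0 ?expR_ge0// indicE.
have maff : measurable_fun setT (fun y : R => 1 * y + (x0 + beta * v)) by apply: measurable_funD => //; exact: measurable_funM.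
have mF : measurable_fun setT (fun y : R => G (1 * y + (x0 + beta * v))) by exact: (measurableT_comp mG maff).
have -> : (\int[P]_w (\1_(`]0%R, +oo[) (Wt v w) * expR (- A * Wt v w))%:E =
   \int[mu]_y (G (1 * y + (x0 + beta * v))%R * (gaussd v y)%:E))%E.
  have := @bm_law _ _ _ _ _ BM v (fun y => G (1 * y + (x0 + beta * v))%R) v0 mF (fun y => G0 _).
  move=> <-; by apply: eq_integral => w _; rewrite /G WtE mul1r (addrC (W v w)).
have s0 : 0 < Num.sqrt (2 * pi * v) by rewrite sqrtr_gt0 !mulr_gt0// pi_gt0.
apply: (@le_trans _ _ (\int[mu]_y (((Num.sqrt (2 * pi * v))^-1)%:E * G (1 * y + (x0 + beta * v))%R))%E).
  apply: ge0_le_integral => //.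
  - by move=> y _; rewrite mule_ge0// lee_fin gaussd_ge0.
  - by apply: emeasurable_funM => //; apply/measurable_EFinP; exact: measurable_gaussd.
  - exact: emeasurable_funM.
  - move=> y _; rewrite muleC lee_wpmul2r// lee_fin /gaussd.
    have h : expR (- y ^+ 2 / (2 * v)) <= 1.
      by rewrite -[leRHS]expR0 ler_expR mulNr oppr_le0 divr_ge0 ?sqr_ge0// mulr_ge0// ltW.
    by rewrite ler_piMr// invr_ge0 ltW.
rewrite ge0_integralZl//.
rewrite (lebesgue_affine (x0 + beta * v) ltr01 mG G0) invr1 mul1e.
have [_ E] := integrable_expRN_halfline A0.
have GA : (\int[mu]_x G x <= (A^-1)%:E)%E.
  rewrite -E [leRHS]integral_mkcond; apply: ge0_le_integral => //.
  - apply/(measurable_restrictT _ _).1 => //; apply/measurable_EFinP; apply: measurable_funTS.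
    by apply: measurableT_comp => //; apply: measurableT_comp => //; exact: measurable_funM.
  - move=> u _; rewrite patchE /G; have [u0|u0] := ltP 0 (u : R).
      have -> : (u \in `[0, +oo[%classic) by rewrite mem_set//= in_itv/= ltW.
      have -> : \1_(`]0, +oo[) u = 1 :> R by rewrite indicE mem_set//= in_itv/= u0.
      by rewrite mul1r mulNr.
    have -> : \1_(`]0, +oo[) u = 0 :> R by rewrite indicE memNset//= in_itv/= andbT ltNge u0.
    by rewrite mul0r; case: ifP => _ //; rewrite lee_fin expR_ge0.
have -> : eps v = (Num.sqrt (2 * pi * v))^-1 * A^-1 by rewrite /eps invfM mulrC.
rewrite EFinM; apply: lee_pmul => //.
by apply: integral_ge0 => u _; exact: G0.
Qed.

Let rest (f : R -> R) v : continuous f -> (forall x, `|f x| <= 1) -> 0 < v ->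
  P.-integrable setT (EFin \o (fun w => expR (- A * Wt v w) * f (sigma * Wt v w))) ->
  `|\int[P]_w (expR (- A * Wt v w) * f (sigma * Wt v w)) -
    \int[P]_w (\1_(hb v) w * (expR (- A * Wt v w) * f (sigma * Wt v w)))| <= eps v.
Proof.
move=> cf f1 v0 i1.
have mWt := measurable_Wtilde BM x0 beta v.
have mhb := measurable_hit_by BM x0 beta (ltW v0).
have mg := measurable_int _ i1.
have {}mg : measurable_fun setT (fun w => expR (- A * Wt v w) * f (sigma * Wt v w)) by apply/measurable_EFinP.
have i2 : P.-integrable setT (EFin \o (fun w => \1_(hb v) w * (expR (- A * Wt v w) * f (sigma * Wt v w)))).
  apply: (integrable_dom _ _ (integrable_norm i1)) => //; first exact: measurable_funM.
  by move=> w _; rewrite normrM -[leRHS]mul1r ler_pM.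
rewrite -(RintegralB measurableT i1 i2).
have i12 : P.-integrable setT (EFin \o (fun w => expR (- A * Wt v w) * f (sigma * Wt v w) - \1_(hb v) w * (expR (- A * Wt v w) * f (sigma * Wt v w)))).
  by have := integrableB measurableT i1 i2.
apply: (le_trans (le_normr_Rintegral measurableT i12)).
have mt : measurable_fun setT (fun w => \1_(`]0, +oo[) (Wt v w) * expR (- A * Wt v w)).
  have mi : measurable_fun setT (\1_(`]0, +oo[) : R -> R) by exact: measurable_indic.
  apply: measurable_funM; first exact: (measurableT_comp mi mWt).
  by apply: measurableT_comp => //; exact: measurable_funM.
rewrite -lee_fin /Rintegral fineK; last by exact: integrable_fin_num (integrable_norm i12).
apply: le_trans (tail v0); apply: ge0_le_integral => //.
- by have /measurable_int := integrable_norm i12.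
- exact/measurable_EFinP.
- move=> w _; rewrite lee_fin !indicE; case: (boolP (w \in hb v)) => wh.
    by rewrite mul1r subrr normr0 mulr_ge0 ?expR_ge0.
  rewrite mul0r subr0 mem_set ?mul1r; last first.
    rewrite /= in_itv/= andbT ltNge; apply: contra wh => W0; apply/mem_set.
    by exists v; rewrite lexx ltW.
  by rewrite normrM ger0_norm ?expR_ge0// ler_piMr ?expR_ge0.
Qed.

Let eps_cvg : eps n.+1%:R @[n --> \oo] --> (0 : R).
Proof.
have s0 : 0 < A * Num.sqrt (2 * pi) by rewrite mulr_gt0// sqrtr_gt0 mulr_gt0// pi_gt0.
have -> : (fun n => eps n.+1%:R) = (fun n => (A * Num.sqrt (2 * pi))^-1 * Num.sqrt (n.+1%:R^-1)).
  by apply/funext => n; rewrite /eps sqrtrM ?mulr_ge0 ?pi_ge0// mulrA invfM sqrtrV.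
rewrite -(mulr0 (A * Num.sqrt (2 * pi))^-1); apply: cvgM; first exact: cvg_cst.
rewrite -[X in _ --> X]sqrtr0; apply: continuous_cvg; first exact: sqrt_continuous.
exact: cvg_harmonic.
Qed.

Let cos1 (x : R) : `|cos x| <= 1. Proof. by rewrite ler_norml cos_geN1 cos_le1. Qed.
Let sin1 (x : R) : `|sin x| <= 1. Proof. by rewrite ler_norml sin_geN1 sin_le1. Qed.

Let mtau (f : R -> R) v : continuous f -> 0 <= v ->
  measurable_fun setT (fun w => \1_(hb v) w * f (tau w)).
Proof.
move=> cf v0.
have -> : (fun w => \1_(hb v) w * f (tau w)) = (fun w => \1_(hb v) w * f (tau0 W x0 beta w)).
  apply/funext => w; rewrite indicE; case: (boolP (w \in _)) => [/set_mem/(hit_byP BM beta x00)[h _]|_]; last by rewrite !mul0r.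
  by rewrite tau0E.
apply: measurable_funM; first exact: (measurable_hit_by BM).
exact: (measurableT_comp (continuous_measurable_fun cf) (measurable_tau0 BM beta x00)).
Qed.

Let ctrig (f : R -> R) (a b : R) : continuous f -> continuous (fun x : R => f (a * x + b)).
Proof.
move=> cf x; apply: (@continuous_comp _ _ _ (fun x : R => a * x + b) f); last exact: cf.
by apply: cvgD; [apply: cvgM; [exact: cvg_cst|exact: cvg_id]|exact: cvg_cst].
Qed.

(* [f (z t) = a cos (z (v - t)) + b sin (z (v - t))] with [(f, a, b)] either
   [(cos, cos (z v), sin (z v))] or [(sin, sin (z v), - cos (z v))]. *)
Let cf_by (f : R -> R) (a b v : R) : continuous f -> 0 < v -> `|a| <= 1 -> `|b| <= 1 ->
  (forall t, f (z * t) = a * cos (z * (v - t)) + b * sin (z * (v - t))) ->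
  `|\int[P]_w (\1_(hb v) w * f (z * tau w)) -
    expR (- A * x0) * (a * cos (sigma * x0 + z * v) + b * sin (sigma * x0 + z * v))| <= 2 * eps v.
Proof.
move=> cf v0 a1 b1 fE; have [i1 i2 e1 e2] := total (ltW v0).
have r1 := rest (@continuous_cos R) cos1 v0 i1; have r2 := rest (@continuous_sin R) sin1 v0 i2.
move: r1 r2; rewrite e1 e2 (exp_strong_markov (@continuous_cos R) cos1 v0) (exp_strong_markov (@continuous_sin R) sin1 v0).
have KE (g h : R -> R) : (forall t, 0 <= t -> g t = h t) ->
    \int[P]_w (\1_(hb v) w * g (v - tau w)) = \int[P]_w (\1_(hb v) w * h (v - tau w)).
  move=> gh; apply: eq_Rintegral => w _; rewrite indicE; case: (boolP (w \in _)) => [/set_mem/(hit_byP BM beta x00)[_ tv]|_]; last by rewrite !mul0r.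
  by rewrite gh// subr_ge0.
rewrite (KE _ (fun t => cos (z * t)) K_cos) (KE _ (fun t => sin (z * t)) K_sin).
have it (g : R -> R) : continuous g -> (forall x, `|g x| <= 1) ->
    P.-integrable setT (EFin \o (fun w => \1_(hb v) w * g (z * (v - tau w)))).
  have i1c : P.-integrable setT (EFin \o (fun=> 1 : R)) by exact: finite_measure_integrable_cst.
  move=> cg g1; apply: (integrable_dom _ _ i1c) => //.
    have -> : (fun w => \1_(hb v) w * g (z * (v - tau w))) = (fun w => \1_(hb v) w * g (- z * tau w + z * v)).
      by apply/funext => w; congr (_ * g _); ring.
    by apply: (@mtau (fun t => g (- z * t + z * v))); [exact: ctrig|exact: ltW].
  by move=> w _; rewrite normrM -[leRHS]mul1r ler_pM.
have sc (g : Omega -> R) (x : R) : P.-integrable setT (EFin \o g) -> P.-integrable setT (EFin \o (fun y => x * g y)).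
  by move=> i; have := integrableZl measurableT x i.
have j1 := it _ (@continuous_cos R) cos1; have j2 := it _ (@continuous_sin R) sin1.
have -> : \int[P]_w (\1_(hb v) w * f (z * tau w)) =
    a * \int[P]_w (\1_(hb v) w * cos (z * (v - tau w))) + b * \int[P]_w (\1_(hb v) w * sin (z * (v - tau w))).
  rewrite -(@RintegralZl _ _ _ P _ _ a measurableT j1) -(@RintegralZl _ _ _ P _ _ b measurableT j2).
  rewrite -(RintegralD measurableT (sc _ a j1) (sc _ b j2)).
  by apply: eq_Rintegral => w _; rewrite fE; ring.
move: (\int[P]_w _) (\int[P]_w _) => Es Ec; set E := expR _; set c := cos _; set s := sin _ => r1 r2.
rewrite (_ : _ - _ = - (a * (E * c - Ec) + b * (E * s - Es))); last by ring.
rewrite normrN (le_trans (ler_normD _ _))// !normrM mulr_natl mulr2n lerD//.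
  by rewrite -[leRHS]mul1r ler_pM.
by rewrite -[leRHS]mul1r ler_pM.
Qed.

Let cf_lim (f : R -> R) (l : R) : continuous f -> (forall x, `|f x| <= 1) ->
  (forall n : nat, `|\int[P]_w (\1_(hb n.+1%:R) w * f (z * tau w)) - l| <= 2 * eps n.+1%:R) ->
  \int[P]_w (\1_(hit W x0 beta) w * f (z * tau0 W x0 beta w)) = l.
Proof.
move=> cf f1 H.
have l1 : \int[P]_w (\1_(hb n.+1%:R) w * f (z * tau w)) @[n --> \oo] -->
    \int[P]_w (\1_(hit W x0 beta) w * f (z * tau0 W x0 beta w)).
  apply: (@dct_Rint _ _ _ P setT _ _ (fun=> 1)) => //.
  - move=> n; have := @mtau (fun t => f (z * t + 0)) n.+1%:R (@ctrig f z 0 cf) (ler0n _ _).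
    by under eq_fun do rewrite addr0.
  - move=> w _; have [h|nh] := pselect (hit W x0 beta w).
      rewrite tau0E//; apply: cvgM; last exact: cvg_cst.
      by have := hit_by_cvg BM (beta := beta) x00 (w := w); rewrite -(cvg_shiftS (fun n => \1_(hb n%:R) w : R)).
    rewrite indicE (memNset nh) mul0r.
    have -> : (fun n => \1_(hb n.+1%:R) w * f (z * tau w)) = fun=> 0; last exact: cvg_cst.
    by apply/funext => n; rewrite indicE memNset ?mul0r// => /(hit_byP BM beta x00)[].
  - exact: finite_measure_integrable_cst.
  - by move=> n w _; rewrite normrM -[leRHS]mul1r ler_pM.
have l2 : \int[P]_w (\1_(hb n.+1%:R) w * f (z * tau w)) @[n --> \oo] --> l.
  apply/cvgrPdist_le => e e0.
  have e2 : 0 < e / 2 by rewrite divr_gt0.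
  move/cvgrPdist_le: eps_cvg => /(_ _ e2); apply: filterS => n.
  rewrite sub0r normrN => h; rewrite distrC (le_trans (H n))//.
  by have := ler_norm (eps n.+1%:R); lra.
exact: (cvg_unique _ l1 l2).
Qed.

(** The estimate [cf_by] holds at each horizon [v]. By the addition formulas the phase [z * v]
    cancels from its main term, so the limit along [v = n.+1] leaves only the initial value of the
    martingale. *)
Theorem tau_cf :
  \int[P]_w (\1_(hit W x0 beta) w * cos (z * tau0 W x0 beta w)) = expR (- A * x0) * cos (sigma * x0) /\
  \int[P]_w (\1_(hit W x0 beta) w * sin (z * tau0 W x0 beta w)) = - (expR (- A * x0) * sin (sigma * x0)).
Proof.
split.
- apply: cf_lim => // [|n]; first exact: continuous_cos.
  have -> : cos (sigma * x0) = cos (z * n.+1%:R) * cos (sigma * x0 + z * n.+1%:R) + sin (z * n.+1%:R) * sin (sigma * x0 + z * n.+1%:R).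
    by rewrite -cosB -[LHS]cosN; congr cos; ring.
  by apply: cf_by => // [|t]; [exact: continuous_cos|rewrite -cosB; congr cos; ring].
- apply: cf_lim => // [|n]; first exact: continuous_sin.
  have -> : - (expR (- A * x0) * sin (sigma * x0)) = expR (- A * x0) * (sin (z * n.+1%:R) * cos (sigma * x0 + z * n.+1%:R) + (- cos (z * n.+1%:R)) * sin (sigma * x0 + z * n.+1%:R)).
    have -> : sin (z * n.+1%:R) * cos (sigma * x0 + z * n.+1%:R) + - cos (z * n.+1%:R) * sin (sigma * x0 + z * n.+1%:R) = sin (z * n.+1%:R - (sigma * x0 + z * n.+1%:R)).
      by rewrite mulNr sinB.
    by rewrite -mulrN -sinN; congr (_ * sin _); ring.
  by apply: cf_by => // [||t]; [exact: continuous_sin|rewrite normrN|rewrite mulNr -sinB; congr sin; ring].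
Qed.

End tau_cf.

(** * Real and imaginary parts of the complex square root *)

Section sqrt_parts.
Context (R : realType).
Variables (beta z : R).
Hypothesis z0 : z != 0.

(* [qre + 'i * qim] is the principal square root of [beta ^+ 2 - 2 * 'i * z]. *)
Definition qre : R := Num.sqrt ((beta ^+ 2 + Num.sqrt (beta ^+ 4 + 4 * z ^+ 2)) / 2).
Definition qim : R := - z / qre.

Let s : R := Num.sqrt (beta ^+ 4 + 4 * z ^+ 2).

Let b4 : beta ^+ 4 = (beta ^+ 2) ^+ 2. Proof. by rewrite -exprM. Qed.

Let s_sq : s ^+ 2 = beta ^+ 4 + 4 * z ^+ 2.
Proof. by rewrite /s sqr_sqrtr// b4 addr_ge0 ?sqr_ge0// mulr_ge0 ?sqr_ge0. Qed.

Let s0 : 0 <= s. Proof. exact: sqrtr_ge0. Qed.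

Let z2 : 0 < z ^+ 2. Proof. by rewrite lt_neqAle eq_sym sqrf_eq0 z0 sqr_ge0. Qed.

Let sb : beta ^+ 2 < s.
Proof. by rewrite -(@ltr_pXn2r _ 2) ?nnegrE ?sqr_ge0// s_sq b4 ltrDl mulr_gt0. Qed.

Let sz : 2 * `|z| <= s.
Proof.
rewrite -(@ler_pXn2r _ 2) ?nnegrE ?mulr_ge0// s_sq exprMn real_normK ?num_real//.
by rewrite b4; have := sqr_ge0 (beta ^+ 2); lra.
Qed.

Lemma qre_sq : qre ^+ 2 = (beta ^+ 2 + s) / 2.
Proof. by rewrite sqr_sqrtr// divr_ge0// addr_ge0 ?sqr_ge0. Qed.

Lemma qre_gt0 : 0 < qre.
Proof. by rewrite sqrtr_gt0 divr_gt0// ltr_wpDl ?sqr_ge0// (le_lt_trans (sqr_ge0 beta)). Qed.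

Lemma qre_qim : qre * qim = - z.
Proof. by rewrite /qim mulrC divfK// gt_eqF// qre_gt0. Qed.

Lemma qre_qim_sq : qre ^+ 2 - qim ^+ 2 = beta ^+ 2.
Proof.
have q0 := qre_gt0.
have : qre ^+ 2 * (qre ^+ 2 - qim ^+ 2) = qre ^+ 2 * beta ^+ 2.
  have qq : qre ^+ 2 * qim ^+ 2 = z ^+ 2 by rewrite -exprMn qre_qim sqrrN.
  rewrite mulrBr qq qre_sq.
  have := s_sq; rewrite b4 => h; apply/eqP; rewrite -subr_eq0; apply/eqP.
  rewrite (_ : _ - _ = (s ^+ 2 - (beta ^+ 2) ^+ 2 - 4 * z ^+ 2) / 4); last by field.
  by rewrite h; ring.
by apply: mulfI; rewrite gt_eqF// exprn_gt0.
Qed.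

(** Gives [0 < beta + qre], the decay towards plus infinity that [tau_cf] requires for drifts of
    both signs. *)
Lemma qre_gt_beta : `|beta| < qre.
Proof.
rewrite -(@ltr_pXn2r _ 2) ?nnegrE ?(ltW qre_gt0)// qre_sq real_normK ?num_real//.
by have := sb; lra.
Qed.

(** This lower bound makes the transform of [tau] decay like the exponential of [- x0 * sqrt |z|],
    hence integrable, which is where [x0 > 0] enters the Fourier inversion. *)
Lemma qre_ge_sqrt : Num.sqrt `|z| <= qre.
Proof.
rewrite -(@ler_pXn2r _ 2) ?nnegrE ?(ltW qre_gt0) ?sqrtr_ge0// qre_sq sqr_sqrtr//.
by have := sz; have := sqr_ge0 beta; lra.
Qed.

End sqrt_parts.

Section exp_sqrt.
Context (R : realType).
Notation mu := (@lebesgue_measure R).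

Lemma integrable_exp_sqrt (c : R) : 0 < c ->
  mu.-integrable setT (EFin \o (fun z => expR (- (c * Num.sqrt `|z|)))).
Proof.
move=> c0.
have cf : continuous (fun z : R => expR (- (c * Num.sqrt `|z|))).
  move=> z; apply: continuous_comp; last exact: continuous_expR.
  apply: cvgN; apply: cvgM; first exact: cvg_cst.
  by apply: (@continuous_comp _ _ _ (fun z : R => `|z|) Num.sqrt); [exact: norm_continuous|exact: sqrt_continuous].
apply/integrableP; split; first by apply/measurable_EFinP; exact: continuous_measurable_fun.
under eq_integral do rewrite /= ger0_norm ?expR_ge0//.
rewrite ge0_symfun_integralT//; last by move=> z /=; rewrite normrN.
rewrite (_ : [set x | 0 <= x] = `[0, +oo[%classic); last first.
  by apply/seteqP; split => x /=; rewrite in_itv/= andbT.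
rewrite -integral_itv_obnd_cbnd; last first.
  by apply/measurable_EFinP; apply: measurable_funTS; exact: continuous_measurable_fun.
(* Found by the substitution [y = Num.sqrt z], which turns the integrand into
   [2 * y * expR (- (c * y))]. *)
pose F (z : R) := - (2 / c ^+ 2) * ((1 + c * Num.sqrt z) * expR (- (c * Num.sqrt z))).
have big : (fun n : nat => Num.sqrt n.+1%:R : R) @ \oo --> +oo.
  apply/cvgryPge => A; near=> n.
  apply: (le_trans (ler_norm _)); rewrite -sqrtr_sqr ler_wsqrtr//.
  apply: (@le_trans _ _ n%:R); last by rewrite ler_nat.
  by near: n; exact: nbhs_infty_ger.
have E : (\int[mu]_(z in `]0%R, +oo[) (expR (- (c * Num.sqrt `|z|)))%:E = (0 - F 0)%:E)%E.
  have -> : (\int[mu]_(z in `]0%R, +oo[) (expR (- (c * Num.sqrt `|z|)))%:E =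
             \int[mu]_(z in `]0%R, +oo[) (expR (- (c * Num.sqrt z)))%:E)%E.
    by apply: eq_integral => z; rewrite inE/= in_itv/= andbT => z0; rewrite gtr0_norm.
  have cF : continuous F.
    have c1 : continuous (fun z : R => c * Num.sqrt z).
      by move=> z; apply: cvgM; [exact: cvg_cst|exact: sqrt_continuous].
    move=> z; apply: cvgM; first exact: cvg_cst.
    apply: cvgM; first by apply: cvgD; [exact: cvg_cst|exact: c1].
    apply: (@continuous_comp _ _ _ (fun z : R => - (c * Num.sqrt z)) expR); last exact: continuous_expR.
    by apply: cvgN; exact: c1.
  apply: (@FTC_open_halfline R F (fun z => expR (- (c * Num.sqrt z))) (F 0) 0).
  - move=> z z0; have s0 : Num.sqrt z != 0 by rewrite gt_eqF// sqrtr_gt0.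
    have ds := is_derive1_sqrt z0; have dcs := dZ c ds.
    apply: (is_derive_eq (dZ (- (2 / c ^+ 2)) (dM (dD (dcst 1 z) dcs) (dexpR (dN dcs))))).
    move: (Num.sqrt z) (expR _) s0 => s e s0.
    by field; rewrite s0 gt_eqF.
  - move=> z z0; apply: (@continuous_comp _ _ _ (fun z : R => - (c * Num.sqrt z)) expR); last exact: continuous_expR.
    by apply: cvgN; apply: cvgM; [exact: cvg_cst|exact: sqrt_continuous].
  - by move=> z _; rewrite expR_ge0.
  - by apply: continuous_cvg; [exact: cF|exact: cvg_harmonic].
  - rewrite -[X in _ --> X](mulr0 (- (2 / c ^+ 2))); apply: cvgM; first exact: cvg_cst.
    apply: (@squeeze_cvgr _ _ _ _ (fun=> 0) (fun n => 2 * expR (- (c / 2 * Num.sqrt n.+1%:R)))).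
    + apply: nearW => n; have y0 : 0 <= c * Num.sqrt n.+1%:R by rewrite mulr_ge0 ?sqrtr_ge0// ltW.
      rewrite mulr_ge0 ?expR_ge0 ?addr_ge0//=.
      set y := c * _; rewrite (_ : - (c / 2 * Num.sqrt n.+1%:R) = y / 2 + - y); last by rewrite /y; field.
      rewrite expRD mulrA ler_wpM2r ?expR_ge0//; have := expR_ge1Dx (y / 2); lra.
    + exact: cvg_cst.
    + rewrite -(mulr0 2); apply: cvgM; first exact: cvg_cst.
      have c2 : 0 < c / 2 by rewrite divr_gt0.
      exact: (cvg_comp _ _ big (cvg_expRN_pinfty c2)).
by rewrite E -EFinM ltry.
Unshelve. all: by end_near.
Qed.

End exp_sqrt.

(** * Density of the hitting time *)

Section tau_density.
Context (R : realType) d (Omega : measurableType d) (P : probability Omega R)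
  (W : R -> Omega -> R).
Hypothesis BM : standard_BM P W.
Notation mu := (@lebesgue_measure R).
Variables (x0 beta : R).
Hypothesis x00 : 0 < x0.
Notation hitI := (\1_(hit W x0 beta) : Omega -> R).
Notation tau0 := (tau0 W x0 beta).

Definition tau_pdf : R -> R := fourier_inv P tau0 hitI.

Definition cos_tau (z : R) := \int[P]_w (hitI w * cos (z * tau0 w)).
Definition sin_tau (z : R) := \int[P]_w (hitI w * sin (z * tau0 w)).

Definition tau_dom (z : R) := (1 + expR (- x0 * beta)) * expR (- (x0 * Num.sqrt `|z|)).

Lemma cos_tauE (z : R) : z != 0 -> cos_tau z = expR (- (beta + qre beta z) * x0) * cos (qim beta z * x0).
Proof.
move=> z0; have A0 : 0 < beta + qre beta z.
  by have := qre_gt_beta beta z0; have := ler_norm (- beta); rewrite normrN; lra.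
by case: (tau_cf BM x00 A0 (qre_qim_sq beta z0) (qre_qim beta z0)).
Qed.

Lemma sin_tauE (z : R) : z != 0 -> sin_tau z = - (expR (- (beta + qre beta z) * x0) * sin (qim beta z * x0)).
Proof.
move=> z0; have A0 : 0 < beta + qre beta z.
  by have := qre_gt_beta beta z0; have := ler_norm (- beta); rewrite normrN; lra.
by case: (tau_cf BM x00 A0 (qre_qim_sq beta z0) (qre_qim beta z0)).
Qed.

Lemma integrable_tau_dom : mu.-integrable setT (EFin \o tau_dom).
Proof.
have i := integrable_exp_sqrt x00.
by have := integrableZl measurableT (1 + expR (- x0 * beta)) i.
Qed.

Let hit01 w : 0 <= hitI w <= 1.
Proof. by rewrite indicE; case: (_ \in _); rewrite ?lexx ?ler01. Qed.

Let dom_bound (f : R -> R) (F z : R) : (forall x, `|f x| <= 1) ->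
  (z != 0 -> `|F| <= expR (- (beta + qre beta z) * x0)) ->
  (F = \int[P]_w (hitI w * f (z * tau0 w))) -> continuous f -> `|F| <= tau_dom z.
Proof.
move=> f1 Fz FE cf; have [z0|z0] := eqVneq z 0.
  rewrite z0 /tau_dom normr0 sqrtr0 mulr0 oppr0 expR0 mulr1.
  apply: (@le_trans _ _ 1); last by rewrite lerDl expR_ge0.
  have mf : measurable_fun setT (fun w => hitI w * f (z * tau0 w)).
    apply: measurable_funM; first exact: (measurable_hit BM).
    apply: (measurableT_comp (continuous_measurable_fun cf)); apply: measurable_funM => //.
    exact: (measurable_tau0 BM).
  have b w : `|hitI w * f (z * tau0 w)| <= 1.
    by rewrite normrM -[leRHS]mul1r ler_pM//; case/andP: (hit01 w) => h0 h1; rewrite ger0_norm.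
  have i1 : P.-integrable setT (EFin \o (fun=> 1 : R)) by exact: finite_measure_integrable_cst.
  have i : P.-integrable setT (EFin \o (fun w => hitI w * f (z * tau0 w))).
    exact: (integrable_dom _ _ i1).
  rewrite FE (le_trans (le_normr_Rintegral measurableT i))//.
  have -> : 1 = \int[P]_w (fun=> 1 : R) w by rewrite /Rintegral integral_prob_cst.
  by apply: (le_Rintegral measurableT _ i1) => //; exact: (integrable_norm i).
rewrite (le_trans (Fz z0))// /tau_dom.
rewrite (_ : - _ * x0 = - x0 * beta + - (x0 * qre beta z)); last by ring.
rewrite expRD; apply: ler_pM; rewrite ?expR_ge0//; first by rewrite lerDr.
by rewrite ler_expR lerN2 ler_wpM2l ?(ltW x00)// qre_ge_sqrt.
Qed.

Let cos1 (x : R) : `|cos x| <= 1. Proof. by rewrite ler_norml cos_geN1 cos_le1. Qed.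
Let sin1 (x : R) : `|sin x| <= 1. Proof. by rewrite ler_norml sin_geN1 sin_le1. Qed.

Lemma cos_tau_le z : `|cos_tau z| <= tau_dom z.
Proof.
apply: (dom_bound cos1 _ (erefl _)); last exact: continuous_cos.
by move=> z0; rewrite -/(cos_tau z) cos_tauE// normrM ger0_norm ?expR_ge0// ler_piMr ?expR_ge0.
Qed.

Lemma sin_tau_le z : `|sin_tau z| <= tau_dom z.
Proof.
apply: (dom_bound sin1 _ (erefl _)); last exact: continuous_sin.
by move=> z0; rewrite -/(sin_tau z) sin_tauE// normrN normrM ger0_norm ?expR_ge0// ler_piMr ?expR_ge0.
Qed.

Lemma tau_pdf_ge0 r : 0 <= tau_pdf r.
Proof.
exact: (fourier_inv_ge0 (measurable_tau0 BM beta x00) (measurable_hit BM beta x00) hit01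
  integrable_tau_dom cos_tau_le sin_tau_le).
Qed.

Lemma measurable_tau_pdf : measurable_fun setT tau_pdf.
Proof.
exact: (measurable_fourier_inv (measurable_tau0 BM beta x00) (measurable_hit BM beta x00) hit01
  integrable_tau_dom cos_tau_le sin_tau_le).
Qed.

Theorem tau_density (F : R -> \bar R) : measurable_fun setT F -> (forall r, (0 <= F r)%E) ->
  (\int[P]_w (F (tau0 w) * (hitI w)%:E) = \int[mu]_r (F r * (tau_pdf r)%:E))%E.
Proof.
exact: (fourier_density (measurable_tau0 BM beta x00) (measurable_hit BM beta x00) hit01
  integrable_tau_dom cos_tau_le sin_tau_le).
Qed.

End tau_density.

(** * Level crossings of a subordinator *)

Section path_crossing.
Context (R : realType) (p : R -> R).
Hypotheses (p0 : p 0 = 0) (pmon : forall s t, 0 <= s -> s <= t -> p s <= p t)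
  (prc : forall t, 0 <= t -> p x @[x --> t^'+] --> p t).

Definition reaches (r : R) : Prop := exists t, 0 <= t /\ r <= p t.

Definition cross (r : R) : R := inf [set t | 0 <= t /\ r <= p t].

Lemma cross_ge0 r : 0 <= cross r.
Proof.
rewrite /cross; have [[t [t0 rt]]|nr] := pselect (reaches r).
  by apply: lb_le_inf; [exists t|move=> u []].
by rewrite inf_out// => -[[t ht] _]; apply: nr; exists t.
Qed.

Let cross_lb r t : 0 <= t -> r <= p t -> cross r <= t.
Proof. by move=> t0 rt; apply: ge_inf => //; exists 0 => u []. Qed.

Let cross_above r t : reaches r -> cross r < t -> r <= p t.
Proof.
move=> [u [u0 ru]] ct.
have [|v [v0 rv] vt] := @inf_lt R [set t | 0 <= t /\ r <= p t] t _ ct; first by exists u.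
by rewrite (le_trans rv)// pmon// ltW.
Qed.

(** Right continuity makes the infimum attained; this is the nontrivial half of the equivalence
    [crossP] between values and passage times. *)
Lemma cross_in r : reaches r -> r <= p (cross r).
Proof.
move=> h; have c0 := cross_ge0 r.
have /cvgrPdist_lt H := prc c0.
rewrite leNgt; apply/negP => lt.
have e0 : 0 < r - p (cross r) by rewrite subr_gt0.
have [x] : exists x, cross r < x /\ `|p (cross r) - p x| < r - p (cross r).
  have : \forall x \near (cross r)^'+, cross r < x /\ `|p (cross r) - p x| < r - p (cross r).
    near=> x; split; [near: x; exact: nbhs_right_gt|near: x; exact: H].
  by move=> /filter_ex.
move=> [cx]; rewrite distrC ltr_norml => /andP[_].
by rewrite ltrD2r ltNge (cross_above h cx).
Unshelve. all: by end_near.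
Qed.

Lemma crossP r a : 0 <= a -> (r <= p a) <-> (reaches r /\ cross r <= a).
Proof.
move=> a0; split=> [ra|[h ca]]; first by split; [exists a|exact: cross_lb].
by rewrite (le_trans (cross_in h))// pmon// cross_ge0.
Qed.

(** Mesh [1 / n.+1]. With the [n.+1 * n.+1] cells of [crossing_sum] the grid extends to time [n.+1],
    so that a single index refines the mesh and lengthens the horizon. *)
Definition grid (n k : nat) : R := k%:R / n.+1%:R.

Lemma grid_ge0 n k : 0 <= grid n k. Proof. by rewrite divr_ge0. Qed.

Lemma gridS n k : grid n k.+1 = grid n k + n.+1%:R^-1.
Proof. by rewrite /grid -natr1 mulrDl mul1r. Qed.

Lemma grid0 n : grid n 0 = 0. Proof. by rewrite /grid mul0r. Qed.

Lemma gridN n : grid n (n.+1 * n.+1) = n.+1%:R.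
Proof. by rewrite /grid natrM mulfK. Qed.

(** By [sum_boolD_select] this is [H] at the first grid time at which [p] is at least [r], or 0 if
    the horizon is too short. Being a sum of terms at fixed times, it can be measured and integrated
    term by term. *)
Definition crossing_sum (H : R -> R) (n : nat) (r : R) : R :=
  \sum_(k < (n.+1 * n.+1)%N)
    ((r <= p (grid n k.+1))%R%:R - (r <= p (grid n k))%R%:R) * H (grid n k.+1).

Let bS (n : nat) (r : R) (k : nat) : r <= p (grid n k) -> r <= p (grid n k.+1).
Proof.
move=> h; rewrite (le_trans h)// pmon ?grid_ge0// gridS lerDl.
by rewrite invr_ge0.
Qed.

Lemma crossing_sum_select (H : R -> R) (n : nat) (r : R) : 0 < r ->
  crossing_sum H n r = 0 /\ ~~ (r <= p n.+1%:R) \/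
  exists k, [/\ cross r <= grid n k.+1, grid n k <= cross r, r <= p n.+1%:R & crossing_sum H n r = H (grid n k.+1)].
Proof.
move=> r0.
have b0 : ~~ (r <= p (grid n 0)) by rewrite grid0 p0 -ltNge.
have [h1 h2] := @sum_boolD_select R (fun k => r <= p (grid n k)) (fun k => H (grid n k.+1))
  (n.+1 * n.+1) (bS (n := n) (r := r)) b0.
move: h1 h2; rewrite gridN; have [rn h1 _|rn _ h2] := boolP (r <= p n.+1%:R); last by left; split => //; exact: h2.
have [k [_ bk bk1 E]] := h1 isT; right; exists k.
have [rr ck] := (crossP r (grid_ge0 n k.+1)).1 bk1.
split => //; rewrite leNgt; apply/negP => lt.
by move: bk; rewrite (cross_above rr lt).
Qed.

Lemma crossing_sum_nreach (H : R -> R) (n : nat) (r : R) : 0 < r -> ~ reaches r -> crossing_sum H n r = 0.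
Proof.
move=> r0 nr; have [[]//|[k [_ _ rp _]]] := crossing_sum_select H n r0.
by exfalso; apply: nr; exists n.+1%:R.
Qed.

Lemma crossing_sum_cvg (H : R -> R) (r : R) : 0 < r -> reaches r ->
  H x @[x --> (cross r)^'+] --> H (cross r) ->
  crossing_sum H n r @[n --> \oo] --> H (cross r).
Proof.
move=> r0 rr HH; apply/cvgrPdist_lt => e e0.
have /cvgrPdist_lt/(_ _ e0) := HH.
rewrite near_withinE near_simpl => /nbhs_ballP[dl /= dl0 B].
near=> n.
have [[_ rn]|[k [ck kc _ ->]]] := crossing_sum_select H n r0.
  exfalso; move/negP: rn; apply; apply/(crossP r (ler0n _ _)); split => //.
  rewrite (@le_trans _ _ n%:R) ?ler_nat//.
  by near: n; exact: nbhs_infty_ger.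
move: ck; rewrite le_eqVlt => /predU1P[<-|ck]; first by rewrite subrr normr0.
apply: (B (grid n k.+1)) => //=.
rewrite /ball/= ltr0_norm ?subr_lt0// opprB ltrBlDr gridS.
rewrite (@le_lt_trans _ _ (cross r + n.+1%:R^-1))// ?lerD2r// addrC ltrD2r.
by near: n; exact: (near_infty_natSinv_lt (PosNum dl0)).
Unshelve. all: by end_near.
Qed.

Lemma crossing_sum_bound (H : R -> R) (M : R) (n : nat) (r : R) : 0 < r -> (forall x, 0 <= x -> `|H x| <= M) ->
  `|crossing_sum H n r| <= M.
Proof.
move=> r0 HM; have M0 := le_trans (normr_ge0 _) (HM 0 (lexx 0)).
have [[-> _]|[k [_ _ _ ->]]] := crossing_sum_select H n r0; first by rewrite normr0.
by apply: HM; exact: grid_ge0.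
Qed.

End path_crossing.

(** * Crossings as functions of the level and the path *)

Section subordinator_crossing.
Context (R : realType) d (Omega : measurableType d) (P : probability Omega R)
  (T : R -> Omega -> R) (nu : R).
Hypothesis GS : gamma_subordinator P nu T.
Notation mu := (@lebesgue_measure R).
Notation RO := (measurableTypeR R * Omega)%type.

Lemma sub_measurable t : measurable_fun setT (T t). Proof. by case: GS. Qed.

Lemma sub_0 w : T 0 w = 0. Proof. by case: GS => _ []. Qed.

Lemma sub_mon w s t : 0 <= s -> s <= t -> T s w <= T t w.
Proof. by case: GS => _ [_ + _ _ _]; apply. Qed.

Lemma sub_rc w t : 0 <= t -> T x w @[x --> t^'+] --> T t w.
Proof. by case: GS => _ [_ _ + _ _]; apply. Qed.

Lemma sub_ge0 w t : 0 <= t -> 0 <= T t w.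
Proof. by move=> t0; rewrite -(sub_0 w); exact: sub_mon. Qed.

(* A level need not be reached, since paths are not assumed unbounded. *)
Definition reach_set : set RO := [set z | reaches (T^~ z.2) z.1].

Lemma measurable_level (a : R) : measurable ([set z | (z.1 : R) <= T a z.2] : set RO).
Proof.
have mf : measurable_fun [set: RO] (fun z : RO => T a z.2 - z.1).
  apply: measurable_funB; last exact: measurable_fst_R.
  apply: (measurableT_comp (sub_measurable a)); exact: measurable_snd.
have := mf measurableT _ (measurable_itv `[(0:R), +oo[); rewrite setTI; congr measurable.
by apply/seteqP; split => z /=; rewrite in_itv/= andbT subr_ge0.
Qed.

Lemma measurable_reach_set : measurable reach_set.
Proof.
have -> : reach_set = \bigcup_n ([set z | (z.1 : R) <= T n%:R z.2] : set RO).
  apply/seteqP; split => [z [t [t0 zt]]|z [n _ /= zn]]; last by exists n%:R.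
  exists (Num.truncn t).+1 => //=; rewrite (le_trans zt)// sub_mon//.
  by rewrite ltW// truncnS_gt.
by apply: bigcup_measurable => n _; exact: measurable_level.
Qed.

Definition cross0 (z : RO) : R := \1_reach_set z * cross (T^~ z.2) z.1.

Lemma cross0E z : reach_set z -> cross0 z = cross (T^~ z.2) z.1.
Proof. by move=> h; rewrite /cross0 indicE mem_set// mul1r. Qed.

Lemma cross0_ge0 z : 0 <= cross0 z.
Proof. by rewrite mulr_ge0// cross_ge0. Qed.

Lemma cross0P z (a : R) : 0 <= a -> ((z.1 : R) <= T a z.2) <-> (reach_set z /\ cross0 z <= a).
Proof.
move=> a0; have H := crossP (@sub_mon z.2) (@sub_rc z.2) z.1 a0.
split => [/H[h ca]|[h]]; first by rewrite cross0E.
by rewrite cross0E// => ca; apply/H.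
Qed.

Lemma measurable_cross0 : measurable_fun [set: RO] cross0.
Proof.
apply: (measurability _ (RGenOInfty.measurableE R)) => //.
move=> _ [_ [a ->] <-]; rewrite setTI; have [a0|a0] := ltP a 0.
  rewrite (_ : _ @^-1` _ = setT)//; apply/seteqP; split => z //= _.
  by rewrite in_itv/= andbT (lt_le_trans a0)// cross0_ge0.
rewrite (_ : _ @^-1` _ = reach_set `\` [set z | (z.1 : R) <= T a z.2]); last first.
  apply/seteqP; split => z /=; rewrite in_itv/= andbT.
    move=> az; have h : reach_set z.
      apply: contrapT => nh; move: az; rewrite /cross0 indicE memNset// mul0r.
      by rewrite ltNge a0.
    by split => // /(cross0P _ a0)[_]; rewrite leNgt az.
  by move=> [h nz]; rewrite ltNge; apply/negP => ca; apply: nz; apply/(cross0P _ a0).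
by apply: measurableD; [exact: measurable_reach_set|exact: measurable_level].
Qed.

(** For a positive level [a], [T s w >= a] holds exactly when the level is reached and its crossing
    time is at most [s]. Joint measurability in [(s, w)] thus follows from that of the crossing time
    of a fixed level. *)
Lemma measurable_sub_joint :
  measurable_fun [set: RO] (fun z : RO => \1_(`]0, +oo[) (z.1 : R) * T z.1 z.2 : R).
Proof.
apply: (measurability _ (RGenCInfty.measurableE R)) => //.
move=> _ [_ [a ->] <-]; rewrite setTI.
have ge0 (z : RO) : 0 <= \1_(`]0, +oo[) (z.1 : R) * T z.1 z.2 :> R.
  rewrite indicE; case: (boolP (_ \in _)); last by rewrite mul0r.
  by rewrite inE/= in_itv/= andbT mul1r => /ltW; exact: sub_ge0.
have [a0|a0] := leP a 0.
  rewrite (_ : _ @^-1` _ = setT)//; apply/seteqP; split => z //= _.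
  by rewrite in_itv/= andbT (le_trans a0)// ge0.
have mp : measurable_fun [set: RO] (fun z : RO => (a, z.2) : RO).
  by apply/measurable_fun_pair; [exact: measurable_cst|exact: measurable_snd].
have m1 : measurable ((fun z : RO => (a, z.2) : RO) @^-1` reach_set).
  by rewrite -[X in measurable X]setTI; exact: (mp measurableT _ measurable_reach_set).
have m2 : measurable [set z : RO | cross0 (a, z.2) <= z.1].
  have mf : measurable_fun [set: RO] (fun z : RO => z.1 - cross0 (a, z.2)).
    by apply: measurable_funB; [exact: measurable_fst_R|exact: (measurableT_comp measurable_cross0 mp)].
  have := mf measurableT _ (measurable_itv `[(0:R), +oo[); rewrite setTI; congr measurable.
  by apply/seteqP; split => z /=; rewrite in_itv/= andbT subr_ge0.
have m3 : measurable [set z : RO | 0 < (z.1 : R)].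
  have := @measurable_fst_R R _ Omega measurableT _ (measurable_itv `](0:R), +oo[); rewrite setTI; congr measurable.
  by apply/seteqP; split => z /=; rewrite in_itv/= andbT.
rewrite (_ : _ @^-1` _ = [set z : RO | 0 < (z.1 : R)] `&`
   ((fun z : RO => (a, z.2) : RO) @^-1` reach_set `&` [set z : RO | cross0 (a, z.2) <= z.1])).
  by apply: measurableI => //; exact: measurableI.
apply/seteqP; split => z /=; rewrite in_itv/= andbT.
  have [z0|z0] := ltP 0 (z.1 : R); last first.
    by rewrite indicE memNset ?mul0r ?leNgt ?a0//= in_itv/= andbT ltNge z0.
  rewrite indicE mem_set ?mul1r//= ?in_itv/= ?andbT// => az.
  by have /(_ az)[h1 h2] := (cross0P (a, z.2) (ltW z0)).1; split.
move=> [z0 [h1 h2]]; rewrite indicE mem_set ?mul1r//= ?in_itv/= ?andbT//.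
exact: ((cross0P (a, z.2) (ltW z0)).2 (conj h1 h2)).
Qed.

Definition crossing_sumT (H : R -> Omega -> R) n (z : RO) :=
  crossing_sum (T^~ z.2) (H^~ z.2) n z.1.

Lemma measurable_crossing_sumT (H : R -> Omega -> R) n :
  (forall t, measurable_fun setT (H t)) -> measurable_fun setT (crossing_sumT H n).
Proof.
move=> mH; apply: (@measurable_sum _ _ _ _ _ _ (fun k z => _)) => k.
have ml (a : R) : measurable_fun [set: RO] (fun z : RO => ((z.1 : R) <= T a z.2)%R%:R : R).
  have : measurable_fun [set: RO] (\1_([set z : RO | (z.1 : R) <= T a z.2]) : RO -> R).
    by apply: measurable_indic; exact: measurable_level.
  congr measurable_fun.
  by apply/funext => z; rewrite indicE; congr (nat_of_bool _)%:R; apply/idP/idP; rewrite inE.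
apply: measurable_funM; first exact: measurable_funB.
apply: (measurableT_comp (mH _)); exact: measurable_snd.
Qed.

(** The value of the subordinator after the crossing; the overshoot proper is this value minus the
    level [z.1]. *)
Definition overshoot0 (z : RO) : R := \1_reach_set z * T (cross (T^~ z.2) z.1) z.2.

Lemma overshoot0E z : reach_set z -> overshoot0 z = T (cross (T^~ z.2) z.1) z.2.
Proof. by move=> h; rewrite /overshoot0 indicE mem_set// mul1r. Qed.

Lemma overshoot0_ge0 z : 0 <= overshoot0 z.
Proof. by rewrite mulr_ge0// sub_ge0// cross_ge0. Qed.

Lemma crossing_sumT_cvg (H : R -> Omega -> R) (z : RO) : 0 < (z.1 : R) ->
  (forall t, 0 <= t -> H x z.2 @[x --> t^'+] --> H t z.2) ->
  crossing_sumT H n z @[n --> \oo] --> \1_reach_set z * H (cross (T^~ z.2) z.1) z.2.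
Proof.
move=> z0 HH; have [h|h] := pselect (reach_set z).
  rewrite indicE mem_set// mul1r.
  apply: (crossing_sum_cvg (sub_0 z.2) (@sub_mon z.2) (@sub_rc z.2) z0 h).
  by apply: HH; exact: cross_ge0.
rewrite indicE memNset// mul0r; apply: cvg_near_cst; apply: nearW => n.
exact: (crossing_sum_nreach (sub_0 z.2) (@sub_mon z.2) (@sub_rc z.2) _ _ z0 h).
Qed.

Lemma measurable_overshoot0 :
  measurable_fun [set: RO] (fun z => \1_(`]0, +oo[) (z.1 : R) * overshoot0 z : R).
Proof.
have m1 : measurable_fun [set: RO] (fun z : RO => \1_(`]0, +oo[) (z.1 : R) : R).
  apply: (measurableT_comp (_ : measurable_fun setT (\1_(`]0, +oo[) : R -> R))).
    by apply: measurable_indic; exact: measurable_itv.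
  exact: measurable_fst_R.
apply: (@measurable_fun_cvg _ _ _ _ (fun n z => \1_(`]0, +oo[) (z.1 : R) * crossing_sumT T n z)) => [n|z _].
  by apply: measurable_funM => //; apply: measurable_crossing_sumT; exact: sub_measurable.
have [z0|z0] := ltP 0 (z.1 : R).
  by apply: cvgM; [exact: cvg_cst|apply: crossing_sumT_cvg => // t t0; exact: sub_rc].
rewrite (_ : \1_(`]0, +oo[) (z.1 : R) = 0 :> R).
  by rewrite mul0r; under eq_fun do rewrite mul0r; exact: cvg_cst.
by rewrite indicE memNset//= in_itv/= andbT ltNge z0.
Qed.

End subordinator_crossing.

Section tonelli_product.
Context d1 d2 (T1 : measurableType d1) (T2 : measurableType d2) (R : realType).
Context (m1 : {sigma_finite_measure set T1 -> \bar R}) (m2 : {sigma_finite_measure set T2 -> \bar R}).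
Variable f : T1 * T2 -> \bar R.
Hypotheses (mf : measurable_fun setT f) (f0 : forall z, (0 <= f z)%E).

Lemma tonelli_fst : (\int[(m1 \x m2)%E]_z f z = \int[m1]_x \int[m2]_y f (x, y))%E.
Proof. exact: (fubini_tonelli1 f mf f0). Qed.

Lemma tonelli_snd : (\int[(m1 \x m2)%E]_z f z = \int[m2]_y \int[m1]_x f (x, y))%E.
Proof. exact: (fubini_tonelli2 f mf f0). Qed.

End tonelli_product.
Arguments tonelli_fst {d1 d2 T1 T2 R m1 m2 f}.
Arguments tonelli_snd {d1 d2 T1 T2 R m1 m2 f}.

Section increments.
Context (R : realType).

Lemma cvg_natr_1BexpR (c : R) : 0 <= c ->
  n.+1%:R * (1 - expR (- (c / n.+1%:R))) @[n --> \oo] --> c.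
Proof.
move=> c0.
apply: (@squeeze_cvgr _ _ _ _ (fun n => c - c ^+ 2 * n.+1%:R^-1) (fun=> c)).
- apply: nearW => n; have n0 : 0 < n.+1%:R :> R by rewrite ltr0n.
  set y := c / n.+1%:R; have y0 : 0 <= y by rewrite divr_ge0.
  have cE : c = n.+1%:R * y by rewrite /y mulrC divfK// gt_eqF.
  have -> : c - c ^+ 2 * n.+1%:R^-1 = n.+1%:R * (y - y ^+ 2).
    by rewrite /y; field; rewrite ?nat1r gt_eqF.
  apply/andP; split; last first.
    rewrite [leRHS]cE ler_pM2l//; by have := expR_ge1Dx (- y); lra.
  rewrite ler_pM2l//; have e1 : expR (- y) <= (1 + y)^-1.
    by rewrite expRN lef_pV2 ?posrE ?expR_gt0 ?expR_ge1Dx//; lra.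
  have e2 : (1 + y)^-1 <= 1 - y + y ^+ 2.
    rewrite -[leLHS]mul1r ler_pdivrMr; last lra.
    have y3 : 0 <= y ^+ 3 by rewrite exprn_ge0.
    have -> : (1 - y + y ^+ 2) * (1 + y) = 1 + y ^+ 3 by ring.
    by lra.
  lra.
- rewrite -[X in _ --> X]subr0; apply: cvgB; first exact: cvg_cst.
  by rewrite -(mulr0 (c ^+ 2)); apply: cvgM; [exact: cvg_cst|exact: cvg_harmonic].
- exact: cvg_cst.
Qed.

(** Mass, under the density [expR (- (ze * r))], of the levels passed while the subordinator goes
    from [a] to [b]. *)
Lemma integral_exp_slice (ze a b : R) : 0 < ze -> 0 <= a -> a <= b ->
  (\int[@lebesgue_measure R]_r (\1_(`]0, +oo[) r * expR (- (ze * r)) *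
     ((r <= b)%R%:R - (r <= a)%R%:R))%:E = ((expR (- (ze * a)) - expR (- (ze * b))) / ze)%:E)%E.
Proof.
move=> ze0 a0; rewrite le_eqVlt => /predU1P[<-|ab].
  by rewrite subrr mul0r; apply: integral0_eq => r _; rewrite subrr mulr0.
pose F (r : R) := - ze^-1 * expR (- (ze * r)).
have E : (\int[@lebesgue_measure R]_(r in `]a, b]) (expR (- (ze * r)))%:E = (F b - F a)%:E)%E.
  have cf : continuous (fun r : R => expR (- (ze * r))).
    move=> r; apply: continuous_comp; last exact: continuous_expR.
    by apply: cvgN; apply: cvgM; [exact: cvg_cst|exact: cvg_id].
  rewrite integral_itv_obnd_cbnd; last first.
    by apply: measurable_funTS; apply/measurable_EFinP; exact: continuous_measurable_fun.
  apply: FTC_segment => // r.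
  apply: (is_derive_eq (dZ (- ze^-1) (dexpR (dN (dZ ze (did r)))))).
  by move: (expR _) => e; field; rewrite gt_eqF.
transitivity (\int[@lebesgue_measure R]_(r in `]a, b]) (expR (- (ze * r)))%:E)%E; last first.
  by rewrite E; congr EFin; rewrite /F; field; rewrite gt_eqF.
rewrite [RHS]integral_mkcond; apply: eq_integral => r _; rewrite patchE mem_setE in_itv/=.
have [ar|ra] := ltP a r; last first.
  by rewrite (le_trans ra (ltW ab)) subrr mulr0.
have i1 : \1_(`]0, +oo[) r = 1 :> R.
  by rewrite indicE mem_set//= in_itv/= andbT (le_lt_trans a0).
by rewrite i1 subr0 mul1r; case: (r <= b) => /=; rewrite ?mulr1 ?mulr0.
Qed.

End increments.

(** * Laplace transform of a crossing over exponentially weighted levels *)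

Section crossing_laplace.
Context (R : realType) d (Omega : measurableType d) (P : probability Omega R)
  (T : R -> Omega -> R) (nu : R).
Hypotheses (nu0 : 0 < nu) (GS : gamma_subordinator P nu T).
Notation mu := (@lebesgue_measure R).
Notation RO := (measurableTypeR R * Omega)%type.

Definition laplace_exp (u : R) : R := ln (1 + nu * u) / nu.
Notation Psi := laplace_exp.

Let nu1 u : 0 <= u -> 0 < 1 + nu * u.
Proof. by move=> u0; rewrite ltr_wpDr// mulr_ge0// ltW. Qed.

Lemma laplace_exp_ge0 u : 0 <= u -> 0 <= Psi u.
Proof. by move=> u0; apply: divr_ge0; [apply: ln_ge0; rewrite lerDl mulr_ge0// ltW|exact: ltW]. Qed.

Lemma laplace_exp_lt u v : 0 <= u -> u < v -> Psi u < Psi v.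
Proof.
move=> u0 uv; rewrite ltr_pM2r ?invr_gt0// ltr_ln ?posrE ?nu1//; last by rewrite (le_trans u0)// ltW.
by rewrite ltrD2l ltr_pM2l.
Qed.

Lemma sub_laplace (u a b : R) : 0 <= u -> 0 <= a -> a <= b ->
  (\int[P]_w (expR (- (u * (T b w - T a w))))%:E = (expR (- ((b - a) * Psi u)))%:E)%E.
Proof.
move=> u0 a0 ab; case: GS => _ [_ _ _ _ /(_ u a (b - a) u0 a0)].
rewrite subr_ge0 subrKC => /(_ ab) H.
under eq_integral do rewrite -mulNr; rewrite H /powR gt_eqF ?nu1//.
by congr (expR _)%:E; rewrite /Psi; field; rewrite gt_eqF.
Qed.

Lemma sub_increment_indep (a b : R) (f g : R -> \bar R) : 0 <= a -> a <= b ->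
  measurable_fun setT f -> measurable_fun setT g ->
  (forall x, (0 <= f x)%E) -> (forall x, (0 <= g x)%E) ->
  (\int[P]_w (f (T a w) * g (T b w - T a w)%R) =
   \int[P]_w f (T a w) * \int[P]_w g (T b w - T a w)%R)%E.
Proof.
move=> a0 ab mf mg f0 g0.
have mTa := sub_measurable GS a.
have mI : measurable_fun setT (fun w => T b w - T a w).
  by apply: measurable_funB => //; exact: (sub_measurable GS).
have ind A B : measurable A -> measurable B ->
    P (T a @^-1` A `&` (fun w => T b w - T a w)%R @^-1` B) =
    (P (T a @^-1` A) * P ((fun w => T b w - T a w)%R @^-1` B))%E.
  move=> mA mB.
  (* [indep_increments] wants strictly increasing times. In the degenerate cases [a = 0] and [a = b]
     one of the two variables is constant, and independence is immediate. *)
  have cstE (X : Omega -> R) (c : R) (C : set R) (D : set Omega) :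
      (forall w, X w = c) -> P (X @^-1` C `&` D) = (P (X @^-1` C) * P D)%E.
    move=> Xc; have [Cc|Cc] := pselect (C c).
      have -> : X @^-1` C = setT by apply/seteqP; split => w //= _; rewrite Xc.
      by rewrite setTI probability_setT mul1e.
    have -> : X @^-1` C = set0 by apply/seteqP; split => w //=; rewrite Xc.
    by rewrite set0I measure0 mul0e.
  move: a0; rewrite le_eqVlt => /predU1P[a0|a0].
    by apply: (cstE _ 0) => w; rewrite -a0 (sub_0 GS).
  move: ab; rewrite le_eqVlt => /predU1P[ab|ab].
    by rewrite setIC muleC; apply: (cstE _ 0) => w; rewrite ab subrr.
  case: (GS) => _ [_ _ _ IND _].
  (* The times 0, [a], [b], continued by [b + 1, b + 2, ...] to an infinite increasing sequence. *)
  pose t (i : nat) := if i is i'.+1 then (if i' is i''.+1 then b + i''%:R else a) else 0.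
  have tS i : t i < t i.+1.
    case: i => [//|[|i]] /=; first by rewrite addr0.
    by rewrite ltrD2l ltr_nat.
  have := IND 2%N t (fun i => if i is 0%N then A else B) (lexx 0) tS.
  rewrite /finite_inter !big_ord_recl !big_ord0/= setIT mule1 addr0.
  have -> : [set w | T a w - T 0 w \in A] = T a @^-1` A.
    by rewrite preimage_inE; apply/seteqP; split => w /=; rewrite (sub_0 GS) subr0.
  by rewrite preimage_inE; apply; case.
pose F (z : R * R) := (f z.1 * g z.2)%E.
have mF : measurable_fun setT F.
  by apply: emeasurable_funM; [exact: (measurableT_comp mf)|exact: (measurableT_comp mg)].
have F0 z : (0 <= F z)%E by rewrite mule_ge0.
rewrite (@indep_fubini _ _ _ _ _ _ _ P (T a) (fun w => T b w - T a w) F mTa mI ind mF F0).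
rewrite /F /=; under eq_integral => w _.
  rewrite ge0_integralZl//; last exact: (measurableT_comp mg).
  over.
rewrite ge0_integralZr//; first exact: (measurableT_comp mf).
by apply: integral_ge0.
Qed.

Lemma sub_laplace2 (ze ka a b : R) : 0 <= ze -> 0 <= ka -> 0 <= a -> a <= b ->
  (\int[P]_w (expR (- (ze * T a w)) * expR (- (ka * T b w)))%:E =
   (expR (- (a * Psi (ze + ka))) * expR (- ((b - a) * Psi ka)))%:E)%E.
Proof.
move=> ze0 ka0 a0 ab.
have mexp (c : R) : measurable_fun setT (fun x : R => (expR (- (c * x)))%:E).
  apply/measurable_EFinP; apply: measurableT_comp => //; apply: measurableT_comp => //.
have e0 (c x : R) : (0 <= (expR (- (c * x)))%:E)%E by rewrite lee_fin expR_ge0.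
have := @sub_increment_indep a b (fun x => (expR (- ((ze + ka) * x)))%:E) (fun x => (expR (- (ka * x)))%:E) a0 ab
  (mexp _) (mexp _) (e0 _) (e0 _).
rewrite sub_laplace// => H; rewrite EFinM.
have h0 : (\int[P]_w (expR (- ((ze + ka) * T a w)))%:E = (expR (- (a * Psi (ze + ka))))%:E)%E.
  have := @sub_laplace (ze + ka) 0 a (addr_ge0 ze0 ka0) (lexx 0) a0; rewrite subr0 => <-.
  by apply: eq_integral => w _; rewrite (sub_0 GS) subr0.
rewrite -h0 -H.
apply: eq_integral => w _; rewrite -EFinM -!expRD; congr (expR _)%:E; ring.
Qed.

Definition pos_level (z : RO) : R := \1_(`]0, +oo[) (z.1 : R).

Lemma measurable_pos_level : measurable_fun [set: RO] pos_level.
Proof.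
apply: (measurableT_comp (_ : measurable_fun setT (\1_(`]0, +oo[) : R -> R))).
  by apply: measurable_indic; exact: measurable_itv.
exact: measurable_fst_R.
Qed.

Lemma pos_level01 z : 0 <= pos_level z <= 1.
Proof. by rewrite /pos_level indicE; case: (_ \in _); rewrite ?lexx ?ler01. Qed.

Section laplace_parameters.
Variables (lam ze ka : R).
Hypotheses (lam0 : 0 <= lam) (ze0 : 0 < ze) (ka0 : 0 <= ka).

Let H t w := expR (- (lam * t)) * expR (- (ka * T t w)).

Let mexp (f : Omega -> R) (c : R) : measurable_fun setT f ->
  measurable_fun setT (fun w => expR (- (c * f w))).
Proof.
by move=> mf; apply: measurableT_comp => //; apply: measurableT_comp => //; exact: measurable_funM.
Qed.

Let mexpz : measurable_fun [set: RO] (fun z : RO => expR (- (ze * z.1))).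
Proof.
apply: measurableT_comp => //; apply: measurableT_comp => //.
by apply: measurable_funM => //; exact: measurable_fst_R.
Qed.

Let mH t : measurable_fun setT (H t).
Proof. by apply: measurable_funM => //; apply: mexp; exact: (sub_measurable GS). Qed.

Let H01 t w : 0 <= t -> 0 <= H t w <= 1.
Proof.
move=> t0; rewrite mulr_ge0 ?expR_ge0//=.
have h1 := expRN_le1 (mulr_ge0 lam0 t0).
have h2 := expRN_le1 (mulr_ge0 ka0 (sub_ge0 GS w t0)).
by rewrite -[leRHS]mul1r ler_pM ?expR_ge0.
Qed.

(** Contribution of the levels crossed between times [a] and [b]. The functional [H] is taken at the
    right end [b], so each cell involves the subordinator at two fixed times only. *)
Let cell a b (z : RO) : R := pos_level z * expR (- (ze * z.1)) *
  (((z.1 <= T b z.2)%R%:R - (z.1 <= T a z.2)%R%:R) * H b z.2).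

Let cell_ge0 a b z : 0 <= a -> a <= b -> 0 <= cell a b z.
Proof.
move=> a0 ab; case/andP: (pos_level01 z) => i0 _; case/andP: (H01 z.2 (le_trans a0 ab)) => h0 _.
rewrite !mulr_ge0 ?expR_ge0// subr_ge0 ler_nat.
have [za|//] := boolP (z.1 <= T a z.2).
by rewrite (le_trans za (sub_mon GS _ a0 ab)).
Qed.

Let mcell0 a b : measurable_fun [set: RO] (fun z : RO => pos_level z * expR (- (ze * z.1)) *
  ((z.1 <= T b z.2)%R%:R - (z.1 <= T a z.2)%R%:R)).
Proof.
have ml (c : R) : measurable_fun [set: RO] (fun z : RO => ((z.1 : R) <= T c z.2)%R%:R : R).
  have : measurable_fun [set: RO] (\1_([set z : RO | (z.1 : R) <= T c z.2]) : RO -> R).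
    by apply: measurable_indic; exact: (measurable_level GS).
  congr measurable_fun.
  by apply/funext => z; rewrite indicE; congr (nat_of_bool _)%:R; apply/idP/idP; rewrite inE.
apply: measurable_funM; first by apply: measurable_funM; [exact: measurable_pos_level|].
exact: measurable_funB.
Qed.

Let mcell a b : measurable_fun [set: RO] (cell a b).
Proof.
rewrite (_ : cell a b = fun z : RO => (pos_level z * expR (- (ze * z.1)) *
  ((z.1 <= T b z.2)%R%:R - (z.1 <= T a z.2)%R%:R)) * H b z.2); last first.
  by apply/funext => z; rewrite /cell mulrA.
apply: measurable_funM; first exact: mcell0.
apply: (measurableT_comp (mH _)); exact: measurable_snd.
Qed.

Let integral_cell a b : 0 <= a -> a <= b ->
  (\int[(mu \x P)%E]_z (cell a b z)%:E = (expR (- (lam * b)) *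
    ((expR (- (a * Psi (ze + ka))) * expR (- ((b - a) * Psi ka)) - expR (- (b * Psi (ze + ka)))) / ze))%:E)%E.
Proof.
move=> a0 ab; have b0 := le_trans a0 ab.
have mc : measurable_fun [set: RO] (EFin \o cell a b) by exact/measurable_EFinP.
have c0 z : (0 <= (EFin \o cell a b) z)%E by rewrite /= lee_fin cell_ge0.
rewrite (tonelli_snd mc c0) /=.
have bd (c : R) : 0 <= c -> P.-integrable setT (EFin \o (fun w => expR (- (ze * T c w)) * expR (- (ka * T b w)))).
  move=> c0'; have i1 : P.-integrable setT (EFin \o (fun=> 1 : R)) by exact: finite_measure_integrable_cst.
  apply: (integrable_dom _ _ i1) => //; first by apply: measurable_funM; apply: mexp; exact: (sub_measurable GS).
  move=> w _; rewrite ger0_norm ?mulr_ge0 ?expR_ge0// -[leRHS]mul1r ler_pM ?expR_ge0//.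
    by apply: expRN_le1; rewrite mulr_ge0 ?(ltW ze0)// (sub_ge0 GS).
  by apply: expRN_le1; rewrite mulr_ge0// (sub_ge0 GS).
have iB := RintegralB measurableT (bd a a0) (bd b b0).
have L (c : R) (c0' : 0 <= c) (cb : c <= b) :
    \int[P]_w (expR (- (ze * T c w)) * expR (- (ka * T b w))) =
    expR (- (c * Psi (ze + ka))) * expR (- ((b - c) * Psi ka)).
  by rewrite /Rintegral (sub_laplace2 (ltW ze0) ka0 c0' cb).
rewrite (L _ a0 ab) (L _ b0 (lexx _)) subrr mul0r oppr0 expR0 mulr1 in iB.
have ii : P.-integrable setT (EFin \o (fun w => expR (- (ze * T a w)) * expR (- (ka * T b w)) -
     expR (- (ze * T b w)) * expR (- (ka * T b w)))).
  by have := integrableB measurableT (bd a a0) (bd b b0).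
transitivity (\int[P]_w ((expR (- (lam * b)) / ze) * (expR (- (ze * T a w)) * expR (- (ka * T b w)) -
     expR (- (ze * T b w)) * expR (- (ka * T b w))))%:E)%E; last first.
  have i2 := integrableZl measurableT (expR (- (lam * b)) / ze) ii.
  rewrite -[LHS]fineK; last by apply: integrable_fin_num => //; exact: i2.
  have := @RintegralZl _ _ _ P _ _ (expR (- (lam * b)) / ze) measurableT ii.
  rewrite /Rintegral => ->; rewrite -/(Rintegral P setT _) iB; congr EFin.
  by field; rewrite gt_eqF.
apply: eq_integral => w _.
have Ta := sub_ge0 GS w a0; have Tab := sub_mon GS w a0 ab.
transitivity ((H b w)%:E * \int[mu]_r (\1_(`]0, +oo[) r * expR (- (ze * r)) *
     ((r <= T b w)%R%:R - (r <= T a w)%R%:R))%:E)%E; last first.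
  rewrite integral_exp_slice// -EFinM; congr EFin; rewrite /H.
  by field; rewrite gt_eqF.
rewrite -ge0_integralZl//; last 3 first.
- apply/measurable_EFinP.
  have mp : measurable_fun [set: measurableTypeR R] (fun r => (r, w) : RO).
    by apply/measurable_fun_pair; [exact: measurable_id|exact: measurable_cst].
  exact: (measurableT_comp (mcell0 a b) mp).
- move=> r _; rewrite lee_fin mulr_ge0// subr_ge0 ler_nat; have [ra|//] := boolP (r <= T a w).
  by rewrite (le_trans ra Tab).
- by rewrite lee_fin; case/andP: (H01 w b0).
by apply: eq_integral => r _; rewrite -EFinM; congr EFin; rewrite /cell/=; ring.
Qed.

Let sumE n z : pos_level z * expR (- (ze * z.1)) * crossing_sumT T H n z =
  \sum_(k < (n.+1 * n.+1)%N) cell (grid R n k) (grid R n k.+1) z.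
Proof. by rewrite /crossing_sumT /crossing_sum mulr_sumr. Qed.

Notation mp := (mu \x P)%E.

Let icell a b : 0 <= a -> a <= b -> mp.-integrable setT (EFin \o cell a b).
Proof.
move=> a0 ab; apply/integrableP; split; first by apply/measurable_EFinP.
under eq_integral do rewrite /= ger0_norm ?cell_ge0//.
by rewrite integral_cell// ltry.
Qed.

Let grid_le n k : grid R n k <= grid R n k.+1.
Proof. by rewrite gridS lerDl invr_ge0. Qed.

Let L := lam + Psi (ze + ka).

(** The increments are stationary, so the cells form a geometric progression of ratio
    [expR (- (L / n.+1))]. Its sum is arranged into expressions [n.+1 * (1 - expR (- (c / n.+1)))],
    whose limit is [c] by [cvg_natr_1BexpR]. *)
Let integral_sum n : \int[mp]_z (pos_level z * expR (- (ze * z.1)) * crossing_sumT T H n z) =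
  expR (- (lam * n.+1%:R^-1)) / ze *
  (n.+1%:R * (1 - expR (- (Psi (ze + ka) / n.+1%:R))) - n.+1%:R * (1 - expR (- (Psi ka / n.+1%:R)))) *
  ((1 - expR (- (L * n.+1%:R))) / (n.+1%:R * (1 - expR (- (L / n.+1%:R))))).
Proof.
under eq_Rintegral do rewrite sumE.
have [_ ->] := @Rintegral_sum_ord _ _ R mp (n.+1 * n.+1) (fun k => cell (grid R n k) (grid R n k.+1))
  (fun k => icell (grid_ge0 R n k) (grid_le n k)).
have n0 : 0 < n.+1%:R :> R by rewrite ltr0n.
have L0 : 0 < L.
  rewrite /L ltr_wpDl// (le_lt_trans (laplace_exp_ge0 (lexx 0)))// laplace_exp_lt//.
  by rewrite ltr_wpDr.
set x := expR (- (L / n.+1%:R)).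
have x1 : x < 1 by rewrite -expR0 ltr_expR oppr_lt0 divr_gt0.
pose c := expR (- (lam * n.+1%:R^-1)) *
  (expR (- (n.+1%:R^-1 * Psi ka)) - expR (- (n.+1%:R^-1 * Psi (ze + ka)))) / ze.
have tE (k : nat) : \int[mp]_z cell (grid R n k) (grid R n k.+1) z = c * x ^+ k.
  rewrite /Rintegral integral_cell ?grid_ge0//= gridS /c.
  rewrite (_ : grid R n k + _ - _ = n.+1%:R^-1); last by ring.
  have -> : x ^+ k = expR (- (lam * grid R n k)) * expR (- (grid R n k * Psi (ze + ka))).
    rewrite /x -expRM_natl -expRD /L /grid; congr expR; ring.
  rewrite [in LHS]mulrDr [in LHS]opprD [in LHS]expRD.
  rewrite [in LHS](mulrDl (grid R n k)) [in LHS]opprD [in LHS]expRD.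
  by field; rewrite gt_eqF.
under eq_bigr do rewrite tE.
rewrite -mulr_sumr.
have geo : \sum_(i < (n.+1 * n.+1)%N) x ^+ i = (1 - x ^+ (n.+1 * n.+1)%N) / (1 - x).
  have x10 : 1 - x != 0 by rewrite subr_eq0 eq_sym lt_eqF.
  by apply: (mulfI x10); rewrite mulrCA divff// mulr1 -[RHS]opprB subrX1 -mulNr opprB.
rewrite geo (_ : x ^+ _ = expR (- (L * n.+1%:R))); last first.
  by rewrite /x -expRM_natl natrM; congr expR; field; rewrite ?nat1r gt_eqF.
have x1' : expR (- (L / n.+1%:R)) < 1 by exact: x1.
rewrite /c /x; move: (expR (- (L * _))) (expR (- (L / _))) x1' => e1 e2 e21.
rewrite ![n.+1%:R^-1 * _]mulrC; field.
by rewrite ?nat1r (gt_eqF n0) (gt_eqF ze0) subr_eq0 eq_sym lt_eqF.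
Qed.

Lemma integrable_exp_prod : mp.-integrable setT (EFin \o (fun z : RO => pos_level z * expR (- (ze * z.1)))).
Proof.
    pose q (z : RO) : R := pos_level z * expR (- (ze * z.1)).
    have m0 : measurable_fun [set: RO] (EFin \o q).
      by apply/measurable_EFinP; apply: measurable_funM => //; exact: measurable_pos_level.
    have p0 z : (0 <= (EFin \o q) z)%E.
      by rewrite /= lee_fin /q mulr_ge0 ?expR_ge0//; case/andP: (pos_level01 z).
    apply/integrableP; split => //.
    under eq_integral => z _ do rewrite gee0_abs//.
    rewrite (tonelli_snd m0 p0) /=.
    have [_ E] := integrable_expRN_halfline ze0.
    have -> : (fun y : Omega => \int[mu]_x (pos_level (x, y) * expR (- (ze * x)))%:E)%E = (fun=> (ze^-1)%:E).
      apply/funext => y; rewrite -E -integral_itv_obnd_cbnd; last first.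
        apply: measurable_funTS; apply/measurable_EFinP; apply: measurableT_comp => //.
        by apply: measurableT_comp => //; exact: measurable_funM.
      rewrite [RHS]integral_mkcond; apply: eq_integral => r _.
      rewrite patchE /pos_level/= indicE; case: ifP => _; rewrite ?mul1r ?mul0r//.
    by rewrite integral_prob_cst ltry.
Qed.

(** Integrating the level against [expR (- (ze * r))] makes the jump over it enter only through a
    difference of values of [expR (- (ze * T))]. The mean of that difference times
    [expR (- (ka * T))] is known from the Laplace exponent, so no description of the jumps is
    needed. *)
Lemma crossing_laplace :
  \int[mp]_z (pos_level z * expR (- (ze * z.1)) * (\1_(reach_set T) z *
     (expR (- (lam * cross (T^~ z.2) z.1)) * expR (- (ka * T (cross (T^~ z.2) z.1) z.2))))) =
  (Psi (ze + ka) - Psi ka) / (ze * (lam + Psi (ze + ka))).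
Proof.
have h1 : \int[mp]_z (pos_level z * expR (- (ze * z.1)) * crossing_sumT T H n z) @[n --> \oo] -->
  \int[mp]_z (pos_level z * expR (- (ze * z.1)) * (\1_(reach_set T) z * H (cross (T^~ z.2) z.1) z.2)).
  apply: (dct_Rint measurableT _ _ integrable_exp_prod).
  - move=> n; apply: measurable_funM.
      by apply: measurable_funM => //; exact: measurable_pos_level.
    exact: (measurable_crossing_sumT GS).
  - move=> z _; have [z0|z0] := ltP 0 (z.1 : R).
      apply: cvgM; first exact: cvg_cst.
      apply: (crossing_sumT_cvg GS) => // t t0; apply: cvgM.
        apply: cvg_at_right_filter; apply: continuous_cvg; first exact: continuous_expR.
        by apply: cvgN; apply: cvgM; [exact: cvg_cst|exact: cvg_id].
      apply: continuous_cvg; first exact: continuous_expR.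
      by apply: cvgN; apply: cvgM; [exact: cvg_cst|exact: (sub_rc GS)].
    have -> : pos_level z = 0 by rewrite /pos_level indicE memNset//= in_itv/= andbT ltNge z0.
    by rewrite !mul0r; under eq_fun do rewrite !mul0r; exact: cvg_cst.
  - move=> n z _; case/andP: (pos_level01 z) => i0 i1.
    have [z0|z0] := ltP 0 (z.1 : R); last first.
      have -> : pos_level z = 0 by rewrite /pos_level indicE memNset//= in_itv/= andbT ltNge z0.
      by rewrite !mul0r normr0.
    rewrite normrM ger0_norm ?mulr_ge0 ?expR_ge0// ler_piMr ?mulr_ge0 ?expR_ge0//.
    have Hb (t : R) : 0 <= t -> `|H t z.2| <= 1.
      by move=> t0; case/andP: (H01 z.2 t0) => h0 h1; rewrite ger0_norm.
    have B := @crossing_sum_bound R (T^~ z.2) (sub_0 GS z.2) (sub_mon GS z.2) (@sub_rc _ _ _ _ _ _ GS z.2)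
      (H^~ z.2) 1 n z.1 z0 Hb.
    exact: B.
have L0 : 0 < L.
  rewrite /L ltr_wpDl// (le_lt_trans (laplace_exp_ge0 (lexx 0)))// laplace_exp_lt//.
  by rewrite ltr_wpDr.
have P0 : 0 <= Psi (ze + ka) by apply: laplace_exp_ge0; rewrite addr_ge0// ltW.
apply: (cvg_unique _ h1) => //=.
under eq_fun do rewrite integral_sum.
have -> : (Psi (ze + ka) - Psi ka) / (ze * (lam + Psi (ze + ka))) =
    1 / ze * (Psi (ze + ka) - Psi ka) * ((1 - 0) / L).
  by rewrite /L; field; rewrite !gt_eqF.
apply: cvgM.
  apply: cvgM; last by apply: cvgB; apply: cvg_natr_1BexpR => //; exact: laplace_exp_ge0.
  apply: cvgM; last exact: cvg_cst.
  rewrite -[X in _ --> X]expR0; apply: continuous_cvg; first exact: continuous_expR.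
  rewrite -[X in _ --> X]oppr0; apply: cvgN; rewrite -[X in _ --> X](mulr0 lam); apply: cvgM; first exact: cvg_cst.
  exact: cvg_harmonic.
apply: cvgM; last first.
  by apply: cvgV; [rewrite gt_eqF|exact: (cvg_natr_1BexpR (ltW L0))].
apply: cvgB; first exact: cvg_cst.
have big : (fun n : nat => n.+1%:R : R) @ \oo --> +oo.
  by apply/cvgryPge => A; near=> n; rewrite (@le_trans _ _ n%:R) ?ler_nat//; near: n; exact: nbhs_infty_ger.
exact: (cvg_comp _ _ big (cvg_expRN_pinfty L0)).
Unshelve. all: by end_near.
Qed.

End laplace_parameters.

End crossing_laplace.

Lemma measurable_invr (R : realType) : measurable_fun setT (fun x : R => x^-1).
Proof.
have -> : [set: R] = [set x | x != 0] `|` [set 0].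
  by apply/seteqP; split => // x _ /=; have [->|x0] := eqVneq x 0; [right|left].
have mo : open [set x : R | x != 0] by exact: open_neq.
apply/measurable_funU => //; first exact: open_measurable.
split; last exact: measurable_fun_set1.
apply: open_continuous_measurable_fun => // x; rewrite inE/= => x0.
exact: inv_continuous.
Qed.

Section half_line.
Context (R : realType).
Notation mu := (@lebesgue_measure R).

(** Writing the half-line as a factor keeps all integrals over the whole line, as iterated product
    measures require, and sets to 0 whatever would involve negative times or lengths. *)
Definition pos (x : R) : R := \1_(`]0, +oo[) x.

Lemma pos_gt0 x : 0 < x -> pos x = 1.
Proof. by move=> x0; rewrite /pos indicE mem_set//= in_itv/= andbT. Qed.

Lemma pos_le0 x : x <= 0 -> pos x = 0.
Proof. by move=> x0; rewrite /pos indicE memNset//= in_itv/= andbT ltNge x0. Qed.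

Lemma pos_ge0 x : 0 <= pos x. Proof. by rewrite /pos indicE. Qed.

Lemma measurable_pos : measurable_fun setT pos.
Proof. by apply: measurable_indic; exact: measurable_itv. Qed.

Lemma integral_pos (f : R -> R) :
  (\int[mu]_x (pos x * f x)%:E = \int[mu]_(x in `]0%R, +oo[) (f x)%:E)%E.
Proof.
rewrite [RHS]integral_mkcond; apply: eq_integral => x _.
rewrite patchE /pos indicE; case: ifP => _; rewrite ?mul1r ?mul0r//.
Qed.

Lemma integral_pos_exp (c : R) : 0 < c -> (\int[mu]_x (pos x * expR (- (c * x)))%:E = (c^-1)%:E)%E.
Proof.
move=> c0; have [_ <-] := integrable_expRN_halfline c0.
rewrite integral_pos integral_itv_obnd_cbnd//.
apply: measurable_funTS; apply/measurable_EFinP; apply: measurableT_comp => //.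
by apply: measurableT_comp => //; exact: measurable_funM.
Qed.

End half_line.

Lemma integral_scale d (T : measurableType d) (R : realType) (m : {measure set T -> \bar R})
    (c I : R) (f : T -> R) : 0 <= c -> measurable_fun setT f -> (forall x, 0 <= f x) ->
  (\int[m]_x (f x)%:E = I%:E)%E -> (\int[m]_x (c * f x)%:E = (c * I)%:E)%E.
Proof.
move=> c0 mf f0 E; under eq_integral do rewrite EFinM.
by rewrite ge0_integralZl_EFin//; [rewrite E|move=> x _; rewrite lee_fin|exact/measurable_EFinP].
Qed.

Section sigma_finite_product.
Context d1 d2 (T1 : measurableType d1) (T2 : measurableType d2) (R : realType).
Variables (m1 : {sigma_finite_measure set T1 -> \bar R}) (m2 : {sigma_finite_measure set T2 -> \bar R}).

Lemma product_sigma_finite : sigma_finite setT (m1 \x m2)%E.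
Proof.
have /sigma_finiteP[F [TF ndF Foo]] := sigma_finiteT m1.
have /sigma_finiteP[G [TG ndG Goo]] := sigma_finiteT m2.
exists (fun n => F n `*` G n) => [|k].
  rewrite -setXTT TF TG; apply/seteqP; split => -[x y].
    move=> [/= [n _ Fnx] [k _ Gky]]; exists (maxn n k) => //; split.
      by move: x Fnx; exact/subsetPset/ndF/leq_maxl.
    by move: y Gky; exact/subsetPset/ndG/leq_maxr.
  by move=> [n _ []/= ? ?]; split; exists n.
have [mF oF] := Foo k; have [mG oG] := Goo k.
split; first exact: measurableX.
by rewrite product_measure1E// lte_mul_pinfty// ge0_fin_numE.
Qed.

Definition prodm : {sigma_finite_measure set (T1 * T2)%type -> \bar R} :=
  HB.pack (m1 \x m2)%E (Measure_isSigmaFinite.Build _ _ _ (m1 \x m2)%E product_sigma_finite).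

End sigma_finite_product.

Section product5.
Context d (Omega : measurableType d) (R : realType) (P : probability Omega R).
Local Notation mu := (@lebesgue_measure R).
Local Notation T1 := (measurableTypeR R * Omega)%type.
Local Notation T2 := (measurableTypeR R * T1)%type.
Local Notation T3 := (measurableTypeR R * T2)%type.
Local Notation T4 := (measurableTypeR R * T3)%type.

Definition prod1 : {sigma_finite_measure set T1 -> \bar R} := prodm mu P.
Definition prod2 : {sigma_finite_measure set T2 -> \bar R} := prodm mu prod1.
Definition prod3 : {sigma_finite_measure set T3 -> \bar R} := prodm mu prod2.
Definition prod4 : {sigma_finite_measure set T4 -> \bar R} := prodm mu prod3.

Lemma tonelli5 (f : T4 -> \bar R) :
  measurable_fun setT f -> (forall z, (0 <= f z)%E) ->
  (\int[prod4]_z f z =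
   \int[mu]_s \int[mu]_r \int[mu]_v \int[mu]_h \int[P]_w f (s, (r, (v, (h, w)))))%E.
Proof.
move=> mf f0; apply: eq_trans (tonelli_fst (m1 := mu) (m2 := prod3) mf f0) _.
apply: eq_integral => s _.
have m1 := measurableT_comp mf (pair1_measurable s).
apply: eq_trans (tonelli_fst (m1 := mu) (m2 := prod2) m1 (fun z => f0 (s, z))) _.
apply: eq_integral => r _.
have m2 := measurableT_comp m1 (pair1_measurable r).
apply: eq_trans (tonelli_fst (m1 := mu) (m2 := prod1) m2 (fun z => f0 (s, (r, z)))) _.
apply: eq_integral => v _.
have m3 := measurableT_comp m2 (pair1_measurable v).
exact: (tonelli_fst (m1 := mu) (m2 := P) m3 (fun z => f0 (s, (r, (v, z))))).
Qed.

End product5.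

(** * The gamma exponent as a mixture of exponentials *)

Section rate.
Context (R : realType).
Notation mu := (@lebesgue_measure R).
Variables (nu beta : R).
Hypothesis nu0 : 0 < nu.

(* [rate] is chosen so that [rate 0 = 1 / nu] and [rate' r = alpha + r]. *)
Definition alpha : R := Num.sqrt (2 / nu + beta ^+ 2).
Definition rate (r : R) : R := ((alpha + r) ^+ 2 - beta ^+ 2) / 2.

Lemma alpha_sq : alpha ^+ 2 = 2 / nu + beta ^+ 2.
Proof. by rewrite sqr_sqrtr// addr_ge0 ?sqr_ge0// divr_ge0// ltW. Qed.

Lemma alpha_gt0 : 0 < alpha.
Proof. by rewrite sqrtr_gt0 ltr_wpDr ?sqr_ge0// divr_gt0. Qed.

Lemma rate0 : rate 0 = nu^-1.
Proof. by rewrite /rate addr0 alpha_sq; field; rewrite gt_eqF. Qed.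

Lemma rate_gt0 r : 0 <= r -> 0 < rate r.
Proof.
move=> r0; have n1 : 0 < nu^-1 by rewrite invr_gt0.
rewrite (lt_le_trans n1)// -rate0 /rate ler_pM2r ?invr_gt0// lerD2r addr0.
by rewrite ler_pXn2r ?nnegrE ?addr_ge0 ?(ltW alpha_gt0)// lerDl.
Qed.

Lemma continuous_rate : continuous rate.
Proof.
move=> r; apply: cvgM; last exact: cvg_cst.
apply: cvgB; last exact: cvg_cst.
apply: (@continuous_comp _ _ _ (fun r => alpha + r) (fun x => x ^+ 2)); last exact: exprn_continuous.
by apply: cvgD; [exact: cvg_cst|exact: cvg_id].
Qed.

(** The numerator [alpha + r] is the derivative of [rate], so partial fractions give a logarithmic
    primitive. It vanishes at infinity, and its value at [r = 0], where [rate] is [1 / nu], is a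
    difference of Laplace exponents. *)
Lemma integral_rate (ze ka : R) : 0 < ze -> 0 <= ka ->
  (\int[mu]_r (pos r * ((alpha + r) / nu * ((ze + ka + rate r)^-1 * (ka + rate r)^-1)))%:E =
   ((laplace_exp nu (ze + ka) - laplace_exp nu ka) / ze)%:E)%E.
Proof.
move=> ze0 ka0; rewrite integral_pos.
have p1 r : 0 <= r -> 0 < ka + rate r by move=> r0; rewrite ltr_wpDl// rate_gt0.
have p2 r : 0 <= r -> 0 < ze + ka + rate r by move=> r0; rewrite -addrA addr_gt0 ?p1.
pose F r := (nu * ze)^-1 * (ln (ka + rate r) - ln (ze + ka + rate r)).
have cF r : 0 <= r -> {for r, continuous F}.
  move=> r0; apply: cvgM; first exact: cvg_cst.
  apply: cvgB.
    apply: (@continuous_comp _ _ _ (fun r => ka + rate r) (@ln R)); last exact: continuous_ln (p1 _ r0).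
    by apply: cvgD; [exact: cvg_cst|exact: continuous_rate].
  apply: (@continuous_comp _ _ _ (fun r => ze + ka + rate r) (@ln R)); last exact: continuous_ln (p2 _ r0).
  by apply: cvgD; [exact: cvg_cst|exact: continuous_rate].
transitivity ((0 - F 0)%:E); last first.
  congr EFin; rewrite /F rate0 sub0r -mulrN opprB /laplace_exp.
  have e (u : R) : 0 <= u -> ln (u + nu^-1) = ln (1 + nu * u) - ln nu.
    move=> u0; rewrite -lnV ?posrE// -lnM ?posrE ?invr_gt0//; last by rewrite ltr_wpDr// mulr_ge0// ltW.
    by congr ln; field; rewrite gt_eqF.
  rewrite !e//; last by rewrite addr_ge0// ltW.
  by field; rewrite !gt_eqF.
apply: (@FTC_open_halfline R F
    (fun r => (alpha + r) / nu * ((ze + ka + rate r)^-1 * (ka + rate r)^-1)) (F 0) 0).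
- move=> r r0; have := p1 _ (ltW r0); have := p2 _ (ltW r0) => h2 h1.
  have dr : is_derive r 1 rate (alpha + r).
    apply: (is_derive_eq (dM (dD (dX 2 (dD (dcst alpha r) (did r))) (dcst (- beta ^+ 2) r)) (dcst 2^-1 r))).
    by rewrite /=; field.
  have d1 := @dcomp R (@ln R) (fun r => ka + rate r) r _ _ (is_derive1_ln h1) (dD (dcst ka r) dr).
  have d2 := @dcomp R (@ln R) (fun r => ze + ka + rate r) r _ _ (is_derive1_ln h2) (dD (dcst (ze + ka) r) dr).
  apply: (is_derive_eq (dZ (nu * ze)^-1 (dD d1 (dN d2)))).
  by field; rewrite !gt_eqF.
- move=> r r0; have := p1 _ (ltW r0); have := p2 _ (ltW r0) => h2 h1.
  apply: cvgM.
    by apply: cvgM; [apply: cvgD; [exact: cvg_cst|exact: cvg_id]|exact: cvg_cst].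
  apply: cvgM; (apply: cvgV; first by rewrite gt_eqF).
    by apply: cvgD; [exact: cvg_cst|exact: continuous_rate].
  by apply: cvgD; [exact: cvg_cst|exact: continuous_rate].
- move=> r r0; have h1 := ltW (p1 _ (ltW r0)); have h2 := ltW (p2 _ (ltW r0)).
  have h3 : 0 <= alpha + r by rewrite addr_ge0 ?(ltW alpha_gt0) ?(ltW r0).
  by apply: mulr_ge0; [rewrite divr_ge0// ltW|rewrite mulr_ge0// invr_ge0].
- exact: (cvg_comp _ _ (@cvg_harmonic R) (cF 0 (lexx 0))).
- have -> : (fun n : nat => F n.+1%:R) = fun n : nat => (nu * ze)^-1 * ln (1 - ze / (ze + ka + rate n.+1%:R)).
    apply/funext => n; have h1 := p1 _ (ler0n R n.+1); have h2 := p2 _ (ler0n R n.+1).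
    rewrite /F -lnV ?posrE// -lnM ?posrE ?invr_gt0//; congr (_ * ln _).
    by field; rewrite !gt_eqF.
  rewrite -[X in _ --> X](mulr0 (nu * ze)^-1); apply: cvgM; first exact: cvg_cst.
  rewrite -ln1; apply: continuous_cvg; first exact: continuous_ln.
  rewrite -[X in _ --> X]subr0; apply: cvgB; first exact: cvg_cst.
  (* For [x >= 1] one has [rate x >= x ^+ 2 / 2 >= x / 2], which bounds the quotient by
     [2 * ze / x]. *)
  apply: (@squeeze_cvgr _ _ _ _ (fun=> 0) (fun n => ze * (2 * n.+1%:R^-1))).
  + apply: nearW => n; have h2 := p2 _ (ler0n R n.+1).
    rewrite divr_ge0 ?(ltW ze0) ?(ltW h2)//= ler_pM2l//.
    rewrite -invf_div lef_pV2 ?posrE ?divr_gt0//.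
    have a2 := alpha_sq; have a0 := alpha_gt0.
    have n1 : 1 <= n.+1%:R :> R by rewrite ler1n.
    have nn : 0 < 2 / nu by rewrite divr_gt0.
    rewrite /rate; move: n.+1%:R n1 => x x1; nra.
  + exact: cvg_cst.
  + rewrite -(mulr0 ze); apply: cvgM; first exact: cvg_cst.
    by rewrite -(mulr0 2); apply: cvgM; [exact: cvg_cst|exact: cvg_harmonic].
Qed.

End rate.

Section crossing_law.
Context (R : realType) d (Omega : measurableType d) (P : probability Omega R)
  (T : R -> Omega -> R) (nu beta lam : R).
Hypotheses (nu0 : 0 < nu) (lam0 : 0 <= lam) (GS : gamma_subordinator P nu T).
Notation mu := (@lebesgue_measure R).
Notation RO := (measurableTypeR R * Omega)%type.
Notation T4 := (measurableTypeR R * (measurableTypeR R * (measurableTypeR R * RO)))%type.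
Notation Psi := (laplace_exp nu).
Notation alpha := (alpha nu beta).
Notation rate := (rate nu beta).

(* Vanishes at negative times, where nothing is known about [T]. *)
Definition subT (s : R) (w : Omega) : R := pos s * T s w.

Lemma subT_ge0 s w : 0 <= subT s w.
Proof.
rewrite /subT; have [s0|s0] := ltP 0 s; last by rewrite pos_le0// mul0r.
by rewrite pos_gt0// mul1r (sub_ge0 GS)// ltW.
Qed.

Lemma measurable_subT : measurable_fun [set: RO] (fun z : RO => subT z.1 z.2).
Proof. exact: (measurable_sub_joint GS). Qed.

Let zs (z : T4) : R := z.1.
Let zr (z : T4) : R := z.2.1.
Let zv (z : T4) : R := z.2.2.1.
Let zh (z : T4) : R := z.2.2.2.1.
Let zT (z : T4) : R := subT z.1 z.2.2.2.2.

Let mzs : measurable_fun setT zs. Proof. exact: measurable_fst_R. Qed.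
Let m2 : measurable_fun setT (fun z : T4 => z.2). Proof. exact: measurable_snd. Qed.
Let m22 : measurable_fun setT (fun z : T4 => z.2.2).
Proof. by apply: (measurableT_comp (f := snd) _ m2); exact: measurable_snd. Qed.
Let m222 : measurable_fun setT (fun z : T4 => z.2.2.2).
Proof. by apply: (measurableT_comp (f := snd) _ m22); exact: measurable_snd. Qed.
Let mzr : measurable_fun setT zr.
Proof. by apply: (measurableT_comp _ m2); exact: measurable_fst_R. Qed.
Let mzv : measurable_fun setT zv.
Proof. by apply: (measurableT_comp _ m22); exact: measurable_fst_R. Qed.
Let mzh : measurable_fun setT zh.
Proof. by apply: (measurableT_comp _ m222); exact: measurable_fst_R. Qed.
Let mzT : measurable_fun setT zT.
Proof.
apply: (@measurableT_comp _ _ _ _ _ _ (fun y : RO => subT y.1 y.2) _ (fun z : T4 => ((z.1, z.2.2.2.2) : RO))).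
  exact: measurable_subT.
apply/measurable_fun_pair; first exact: measurable_fst.
by apply: (measurableT_comp (f := snd) _ m222); exact: measurable_snd.
Qed.

(* [v] and [h] are the distances from the level before and after the jump. *)
Definition crossing_weight (s r v h : R) : R :=
  pos s * expR (- (lam * s)) * (pos r * ((alpha + r) / nu)) *
  (pos v * pos h * expR (- (rate r * (v + h)))).

Lemma crossing_weight_ge0 s r v h : 0 <= crossing_weight s r v h.
Proof.
have [r0|r0] := ltP 0 r; last by rewrite /crossing_weight (pos_le0 r0) mul0r mulr0 mul0r.
have h3 : 0 <= alpha + r by rewrite addr_ge0 ?(ltW (alpha_gt0 _ _)) ?(ltW r0).
by rewrite !mulr_ge0 ?expR_ge0 ?pos_ge0 ?invr_ge0 ?(ltW nu0).
Qed.

Let mpos (f : T4 -> R) : measurable_fun setT f -> measurable_fun setT (fun z => pos (f z)).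
Proof. by move=> mf; apply: (measurableT_comp (@measurable_pos R) mf). Qed.

Let mexp (f : T4 -> R) : measurable_fun setT f -> measurable_fun setT (fun z => expR (- f z)).
Proof. by move=> mf; apply: measurableT_comp => //; exact: measurableT_comp. Qed.

Let mW : measurable_fun setT (fun z : T4 => crossing_weight (zs z) (zr z) (zv z) (zh z)).
Proof.
have mrate : measurable_fun setT (fun z : T4 => rate (zr z)).
  by apply: (measurableT_comp _ mzr); apply: continuous_measurable_fun; exact: continuous_rate.
apply: measurable_funM; first apply: measurable_funM.
- by apply: measurable_funM; [exact: mpos|apply: mexp; exact: measurable_funM].
- apply: measurable_funM; first exact: mpos.
  by apply: measurable_funM => //; exact: measurable_funD.
- apply: measurable_funM; first by apply: measurable_funM; exact: mpos.
  by apply: mexp; apply: measurable_funM => //; exact: measurable_funD.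
Qed.

(** The variables are integrated out from the inside: [w] gives [expR (- (s * Psi (ze + ka)))], [h]
    and [v] give the two reciprocals of [integral_rate], [r] gives the difference of exponents, and
    [s] gives [1 / (lam + Psi (ze + ka))]. The product is the value in [crossing_laplace]. *)
Lemma crossing_weight_laplace (ze ka : R) : 0 < ze -> 0 <= ka ->
  (\int[prod4 P]_z (crossing_weight (zs z) (zr z) (zv z) (zh z) *
     (expR (- (ze * (zT z + zv z))) * expR (- (ka * (zT z + zv z + zh z)))))%:E =
  ((Psi (ze + ka) - Psi ka) / (ze * (lam + Psi (ze + ka))))%:E)%E.
Proof.
move=> ze0 ka0.
have L0 : 0 < lam + Psi (ze + ka).
  rewrite ltr_wpDl// (le_lt_trans (laplace_exp_ge0 nu0 (lexx 0)))// laplace_exp_lt//.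
  by rewrite ltr_wpDr.
have zk0 : 0 <= ze + ka by rewrite addr_ge0// ltW.
rewrite tonelli5; last 2 first.
- apply/measurable_EFinP; apply: measurable_funM; first exact: mW.
  apply: measurable_funM; apply: mexp; apply: measurable_funM => //; first exact: measurable_funD.
  by apply: measurable_funD => //; exact: measurable_funD.
- by move=> z; rewrite lee_fin mulr_ge0 ?crossing_weight_ge0// mulr_ge0 ?expR_ge0.
rewrite /zs/zr/zv/zh/zT/=.
pose As s := pos s * expR (- ((lam + Psi (ze + ka)) * s)).
pose Ar r := pos r * ((alpha + r) / nu).
pose Av r v := pos v * expR (- ((ze + ka + rate r) * v)).
pose Ah r h := pos h * expR (- ((ka + rate r) * h)).
have As0 s : 0 <= As s by rewrite mulr_ge0 ?expR_ge0 ?pos_ge0.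
have Av0 r v : 0 <= Av r v by rewrite mulr_ge0 ?expR_ge0 ?pos_ge0.
have Ah0 r v : 0 <= Ah r v by rewrite mulr_ge0 ?expR_ge0 ?pos_ge0.
have Ar0 r : 0 <= Ar r.
  rewrite /Ar; have [r0|r0] := ltP 0 r; last by rewrite pos_le0// mul0r.
  by rewrite mulr_ge0 ?pos_ge0// divr_ge0 ?addr_ge0 ?(ltW (alpha_gt0 _ _)) ?(ltW r0) ?(ltW nu0).
have mpe (c : R) : measurable_fun setT (fun v : R => pos v * expR (- (c * v))).
  apply: measurable_funM; first exact: measurable_pos.
  by apply: measurableT_comp => //; apply: measurableT_comp => //; exact: measurable_funM.
have E1 s r v h : (\int[P]_w (crossing_weight s r v h *
     (expR (- (ze * (subT s w + v))) * expR (- (ka * (subT s w + v + h)))))%:E =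
     ((As s * Ar r * Av r v) * Ah r h)%:E)%E.
  have [s0|s0] := leP s 0.
    rewrite /As /crossing_weight pos_le0// !mul0r.
    by apply: integral0_eq => w _; rewrite !mul0r.
  have := @sub_laplace _ _ _ P T nu nu0 GS (ze + ka) 0 s zk0 (lexx 0) (ltW s0).
  rewrite subr0 => HL.
  transitivity (\int[P]_w ((pos s * expR (- (lam * s)) * Ar r * Av r v * Ah r h) *
      expR (- ((ze + ka) * (T s w - T 0 w))))%:E)%E.
    apply: eq_integral => w _; congr EFin; rewrite /crossing_weight /Ar /Av /Ah /subT.
    rewrite (pos_gt0 s0) (sub_0 GS) subr0 !mul1r.
    have E : expR (- (rate r * (v + h))) * (expR (- (ze * (T s w + v))) * expR (- (ka * (T s w + v + h)))) =
      expR (- ((ze + ka + rate r) * v)) * expR (- ((ka + rate r) * h)) * expR (- ((ze + ka) * T s w)).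
      by rewrite -!expRD; congr expR; ring.
    transitivity (expR (- (lam * s)) * (pos r * ((alpha + r) / nu)) * (pos v * pos h) *
      (expR (- (rate r * (v + h))) * (expR (- (ze * (T s w + v))) * expR (- (ka * (T s w + v + h)))))).
      by rewrite !mulrA.
    rewrite E; move: (expR _) (expR _) (expR _) (expR _) => e1 e2 e3 e4.
    by move: (_ / nu) (pos r) (pos v) (pos h) => a1 a2 a3 a4; ring.
  have C0 : 0 <= pos s * expR (- (lam * s)) * Ar r * Av r v * Ah r h.
    by have := mulr_ge0 (mulr_ge0 (mulr_ge0 (mulr_ge0 (pos_ge0 s) (expR_ge0 (- (lam * s)))) (Ar0 r)) (Av0 r v)) (Ah0 r h).
  have mf : measurable_fun setT (fun w => expR (- ((ze + ka) * (T s w - T 0 w)))).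
    apply: measurableT_comp => //; apply: measurableT_comp => //; apply: measurable_funM => //.
    by apply: measurable_funB; exact: (sub_measurable GS).
  apply: eq_trans (integral_scale C0 mf (fun w => expR_ge0 _) HL) _.
  congr EFin; rewrite /As (_ : - ((lam + Psi (ze + ka)) * s) = - (lam * s) + - (s * Psi (ze + ka))); last by ring.
  rewrite expRD; move: (expR _) (expR _) (pos s) (Ar r) (Av r v) (Ah r h) => e1 e2 a1 a2 a3 a4; ring.
have E2 s r v : (\int[mu]_h ((As s * Ar r * Av r v) * Ah r h)%:E =
    ((As s * Ar r * (ka + rate r)^-1) * Av r v)%:E)%E.
  have [r0|r0] := leP r 0.
    by rewrite /Ar (pos_le0 r0) !(mul0r, mulr0); apply: integral0_eq => h _; rewrite !(mul0r, mulr0).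
  have kr : 0 < ka + rate r by rewrite ltr_wpDl// rate_gt0// ltW.
  have C0 : 0 <= As s * Ar r * Av r v by exact: (mulr_ge0 (mulr_ge0 (As0 s) (Ar0 r)) (Av0 r v)).
  have H := @integral_scale _ _ R mu (As s * Ar r * Av r v) (ka + rate r)^-1 (Ah r) C0 (mpe _) (Ah0 r) (integral_pos_exp kr).
  apply: eq_trans H _.
  by congr EFin; ring.
have E3 s r : (\int[mu]_v ((As s * Ar r * (ka + rate r)^-1) * Av r v)%:E =
    (As s * (pos r * ((alpha + r) / nu * ((ze + ka + rate r)^-1 * (ka + rate r)^-1))))%:E)%E.
  have [r0|r0] := leP r 0.
    by rewrite /Ar (pos_le0 r0) !(mul0r, mulr0); apply: integral0_eq => h _; rewrite !(mul0r, mulr0).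
  have kr : 0 < ka + rate r by rewrite ltr_wpDl// rate_gt0// ltW.
  have zr' : 0 < ze + ka + rate r by rewrite -addrA addr_gt0.
  have C0 : 0 <= As s * Ar r * (ka + rate r)^-1.
    by apply: mulr_ge0; [exact: (mulr_ge0 (As0 s) (Ar0 r))|rewrite invr_ge0 ltW].
  have H := @integral_scale _ _ R mu (As s * Ar r * (ka + rate r)^-1) (ze + ka + rate r)^-1 (Av r) C0 (mpe _) (Av0 r) (integral_pos_exp zr').
  apply: eq_trans H _.
  by congr EFin; rewrite /Ar; ring.
have mJ : measurable_fun setT (fun r => pos r * ((alpha + r) / nu * ((ze + ka + rate r)^-1 * (ka + rate r)^-1))).
  have mrate : measurable_fun setT rate by apply: continuous_measurable_fun; exact: continuous_rate.
  have mi (c : R) : measurable_fun setT (fun r => (c + rate r)^-1).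
    by apply: (measurableT_comp (@measurable_invr R)); exact: measurable_funD.
  apply: measurable_funM; first exact: measurable_pos.
  apply: measurable_funM; last by apply: measurable_funM; exact: mi.
  by apply: measurable_funM => //; exact: measurable_funD.
have J0 r : 0 <= pos r * ((alpha + r) / nu * ((ze + ka + rate r)^-1 * (ka + rate r)^-1)).
  have [r0|r0] := leP r 0; first by rewrite (pos_le0 r0) mul0r.
  have kr : 0 < ka + rate r by rewrite ltr_wpDl// rate_gt0// ltW.
  have zr' : 0 < ze + ka + rate r by rewrite -addrA addr_gt0.
  by rewrite mulrA mulr_ge0 ?Ar0// mulr_ge0// invr_ge0 ltW.
have E4 s : (\int[mu]_r (As s * (pos r * ((alpha + r) / nu * ((ze + ka + rate r)^-1 * (ka + rate r)^-1))))%:E =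
    (((Psi (ze + ka) - Psi ka) / ze) * As s)%:E)%E.
  have H := @integral_scale _ _ R mu (As s) _ _ (As0 s) mJ J0 (integral_rate beta nu0 ze0 ka0).
  apply: eq_trans H _.
  by rewrite mulrC.
transitivity (\int[mu]_s (((Psi (ze + ka) - Psi ka) / ze) * As s)%:E)%E.
  apply: eq_integral => s _; rewrite -E4; apply: eq_integral => r _; rewrite -E3.
  by apply: eq_integral => v _; rewrite -E2; apply: eq_integral => h _; rewrite -E1.
have C0 : 0 <= (Psi (ze + ka) - Psi ka) / ze.
  by rewrite divr_ge0 ?(ltW ze0)// subr_ge0 ltW// laplace_exp_lt// ltrDr.
have H := @integral_scale _ _ R mu _ _ As C0 (mpe _) As0 (integral_pos_exp L0).
apply: eq_trans H _.
by congr EFin; field; rewrite !gt_eqF.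
Qed.

Theorem crossing_law (F : R * R -> \bar R) :
  measurable_fun setT F -> (forall z, (0 <= F z)%E) ->
  (\int[(mu \x P)%E]_z (F (z.1 : R, pos z.1 * overshoot0 T z)%R *
      (pos z.1 * (\1_(reach_set T) z * expR (- (lam * cross0 T z))))%:E) =
   \int[prod4 P]_z (F (zT z + zv z, zT z + zv z + zh z)%R *
      (crossing_weight (zs z) (zr z) (zv z) (zh z))%:E))%E.
Proof.
move=> mF F0.
(* For [lam = 0] the two measures are infinite. Both are tilted by the negative exponential of the
   level, which shifts its Laplace variable to [u + 1], and [F'] undoes the tilt. *)
pose g1 (z : RO) : R := pos z.1 * expR (- (1 * z.1)) * (\1_(reach_set T) z * expR (- (lam * cross0 T z))).
pose g2 (z : T4) : R := crossing_weight (zs z) (zr z) (zv z) (zh z) * expR (- (1 * (zT z + zv z))).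
pose F' (z : R * (R * R)) : \bar R := (F (z.1, z.2.2) * (expR z.1)%:E)%E.
have mR : measurable_fun setT (\1_(reach_set T) : RO -> R).
  by apply: measurable_indic; exact: (measurable_reach_set GS).
have mfst : measurable_fun setT (fun z : RO => z.1 : R) by exact: measurable_fst_R.
have mexp1 (f : RO -> R) : measurable_fun setT f -> measurable_fun setT (fun z => expR (- f z)).
  by move=> mf; apply: measurableT_comp => //; exact: measurableT_comp.
have mp1 : measurable_fun setT (fun z : RO => pos z.1) by apply: (measurableT_comp (@measurable_pos R)).
have mg1 : measurable_fun setT g1.
  apply: measurable_funM.
    by apply: measurable_funM => //; apply: mexp1; exact: measurable_funM.
  apply: measurable_funM => //; apply: mexp1; apply: measurable_funM => //.
  exact: (measurable_cross0 GS).
have mS1 : measurable_fun setT (fun z : RO => pos z.1 * overshoot0 T z).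
  exact: (measurable_overshoot0 GS).
have mg2 : measurable_fun setT g2.
  by apply: measurable_funM => //; apply: mexp; apply: measurable_funM => //; exact: measurable_funD.
have g10 z : 0 <= g1 z by rewrite !mulr_ge0 ?pos_ge0 ?expR_ge0.
have g20 z : 0 <= g2 z by rewrite mulr_ge0 ?crossing_weight_ge0 ?expR_ge0.
have ig1 : (mu \x P)%E.-integrable setT (EFin \o g1).
  apply: (integrable_dom _ _ (integrable_exp_prod P (ltr01 : 0 < 1 :> R))) => // z _.
  rewrite ger0_norm// ler_piMr ?mulr_ge0 ?pos_ge0 ?expR_ge0//.
  by rewrite -[leRHS]mul1r ler_pM ?expR_ge0// expRN_le1// mulr_ge0// cross0_ge0.
have ig2 : (prod4 P).-integrable setT (EFin \o g2).
  apply/integrableP; split; first exact/measurable_EFinP.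
  have := @crossing_weight_laplace 1 0 ltr01 (lexx 0).
  set J := (X in _ = X%:E) => HJ.
  apply: (@le_lt_trans _ _ J%:E); last exact: ltry.
  rewrite -HJ le_eqVlt; apply/orP; left; apply/eqP; apply: eq_integral => z _.
  by rewrite /= ger0_norm// /g2 mul0r oppr0 expR0 mulr1.
have LT (u v w : R) : 0 <= u -> 0 <= v -> 0 <= w ->
  (\int[(mu \x P)%E]_x (expR (- (u * `|x.1 : R|)) * (expR (- (v * (fun=> 0) x)) *
       (expR (- (w * (pos x.1 * overshoot0 T x))) * g1 x)))%:E =
   \int[prod4 P]_x (expR (- (u * `|zT x + zv x|)) * (expR (- (v * (fun=> 0) x)) *
       (expR (- (w * `|zT x + zv x + zh x|)) * g2 x)))%:E)%E.
  move=> u0 v0 w0; have ze0 : 0 < u + 1 by rewrite ltr_wpDl.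
  transitivity (((Psi (u + 1 + w) - Psi w) / ((u + 1) * (lam + Psi (u + 1 + w))))%:E); last first.
    rewrite -(crossing_weight_laplace ze0 w0); apply: eq_integral => z _; congr EFin.
    have [v1|v1] := leP (zv z) 0.
      by rewrite /g2 /crossing_weight (pos_le0 v1) !(mul0r, mulr0).
    have [h1|h1] := leP (zh z) 0.
      by rewrite /g2 /crossing_weight (pos_le0 h1) !(mul0r, mulr0).
    have t0 : 0 <= zT z by exact: subT_ge0.
    rewrite !ger0_norm ?addr_ge0 ?(ltW v1) ?(ltW h1)//.
    rewrite mulr0 oppr0 expR0 mul1r /g2 mulrDl opprD expRD.
    by move: (crossing_weight _ _ _ _) (expR _) (expR _) (expR _) => a b c e; ring.
  rewrite -(crossing_laplace nu0 GS lam0 ze0 w0).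
  pose f1 (z : RO) : R := pos z.1 * expR (- ((u + 1) * z.1)) * (\1_(reach_set T) z *
     (expR (- (lam * cross (T^~ z.2) z.1)) * expR (- (w * T (cross (T^~ z.2) z.1) z.2)))).
  have fE (z : RO) : expR (- (u * `|z.1 : R|)) * (expR (- (v * (fun=> 0) z)) *
       (expR (- (w * (pos z.1 * overshoot0 T z))) * g1 z)) = f1 z.
    rewrite /f1 /g1; have [z0|z0] := leP (z.1 : R) 0; first by rewrite (pos_le0 z0) !(mul0r, mulr0).
    rewrite (pos_gt0 z0) !mul1r mulr0 oppr0 expR0 mul1r ger0_norm ?(ltW z0)// mulrDl opprD expRD.
    have [h|h] := pselect (reach_set T z); last by rewrite indicE memNset// !(mul0r, mulr0).
    rewrite cross0E// overshoot0E// mul1r; move: (expR _) (expR _) (expR _) (expR _) (\1__ _) => a b c e f; ring.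
  have mf1 : measurable_fun setT f1.
    rewrite (_ : f1 = fun z : RO => expR (- (u * `|z.1 : R|)) * (expR (- (w * (pos z.1 * overshoot0 T z))) * g1 z)).
      apply: measurable_funM; first by apply: mexp1; apply: measurable_funM => //; exact: measurableT_comp.
      by apply: measurable_funM => //; apply: mexp1; apply: measurable_funM.
    by apply/funext => z; rewrite -fE mulr0 oppr0 expR0 mul1r.
  have if1 : (mu \x P)%E.-integrable setT (EFin \o f1).
    apply: (integrable_dom _ _ ig1) => // z _.
    rewrite -fE mulr0 oppr0 expR0 mul1r ger0_norm ?mulr_ge0 ?expR_ge0//.
    rewrite mulrA ler_piMl// -[leRHS]mul1r ler_pM ?expR_ge0//; first by rewrite expRN_le1// mulr_ge0.
    rewrite expRN_le1//; apply: mulr_ge0 => //.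
    by apply: mulr_ge0; [exact: pos_ge0|exact: (overshoot0_ge0 GS)].
  under eq_integral do rewrite fE.
  by rewrite /Rintegral fineK//; exact: (integrable_fin_num _ if1).
have mF' : measurable_fun setT F'.
  apply: emeasurable_funM.
    apply: (measurableT_comp mF); apply/measurable_fun_pair; first exact: measurable_fst.
    by apply: (measurableT_comp (f := snd)); [exact: measurable_snd|exact: measurable_snd].
  by apply/measurable_EFinP; apply: measurableT_comp => //; exact: measurable_fst.
have F'0 z : (0 <= F' z)%E by rewrite mule_ge0// lee_fin expR_ge0.
have mzTv : measurable_fun setT (fun x => zT x + zv x) by exact: measurable_funD.
have mzTvh : measurable_fun setT (fun x => zT x + zv x + zh x) by exact: measurable_funD.
(* Only two of the three variables are used, the middle one being 0. Absolute values supply the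
   required nonnegativity; they change nothing where the weights are nonzero. *)
have H := @laplace3_unique R _ _ _ _ (mu \x P)%E (prod4 P) (fun x => `|x.1 : R|) (fun=> 0)
  (fun x => pos x.1 * overshoot0 T x) g1 (fun x => `|zT x + zv x|) (fun=> 0)
  (fun x => `|zT x + zv x + zh x|) g2 F' _ _ mS1 _ _ _ _ _ ig1 ig2 LT mF' F'0.
transitivity (\int[(mu \x P)%E]_x (F' (`|x.1 : R|%R, (0%R, pos x.1 * overshoot0 T x)%R) * (g1 x)%:E))%E.
  apply: eq_integral => z _; rewrite /F' /g1 /=.
  have [z0|z0] := leP (z.1 : R) 0; first by rewrite (pos_le0 z0) !mul0r !mule0.
  rewrite -muleA -EFinM ger0_norm ?(ltW z0)//; congr (_ * _%:E)%E.
  have e1 : expR z.1 * expR (- z.1) = 1 :> R by rewrite -expRD subrr expR0.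
  have aux (a b c e : R) : a * b = 1 -> c * e = a * (c * b * e).
    by move=> ab; rewrite -[LHS]mul1r -ab; ring.
  by rewrite mul1r; exact: aux.
rewrite H.
- apply: eq_integral => z _; rewrite /F' /g2 /=.
  have [v1|v1] := leP (zv z) 0.
    by rewrite /crossing_weight (pos_le0 v1) !(mul0r, mulr0) !mule0.
  have [h1|h1] := leP (zh z) 0.
    by rewrite /crossing_weight (pos_le0 h1) !(mul0r, mulr0) !mule0.
  have t0 : 0 <= zT z by exact: subT_ge0.
  rewrite !ger0_norm ?addr_ge0 ?(ltW v1) ?(ltW h1)// -muleA -EFinM; congr (_ * _%:E)%E.
  by rewrite mul1r mulrCA -expRD subrr expR0 mulr1.
- exact: measurableT_comp.
- exact: measurable_cst.
- exact: measurableT_comp.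
- exact: measurable_cst.
- exact: measurableT_comp.
- by move=> x; split => //; rewrite mulr_ge0 ?pos_ge0// (overshoot0_ge0 GS).
- by move=> x; split.
Qed.

Lemma crossing_law_iterated (F : R * R -> \bar R) :
  measurable_fun setT F -> (forall z, (0 <= F z)%E) ->
  (\int[(mu \x P)%E]_z (F (z.1 : R, pos z.1 * overshoot0 T z)%R *
      (pos z.1 * (\1_(reach_set T) z * expR (- (lam * cross0 T z))))%:E) =
   \int[mu]_s \int[mu]_r \int[mu]_v \int[mu]_h \int[P]_w
     (F (subT s w + v, subT s w + v + h)%R * (crossing_weight s r v h)%:E))%E.
Proof.
move=> mF F0; rewrite (crossing_law mF F0) tonelli5//.
  apply: emeasurable_funM; last by apply/measurable_EFinP; exact: mW.
  apply: (measurableT_comp mF); apply/measurable_fun_pair; first exact: measurable_funD.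
  by apply: measurable_funD => //; exact: measurable_funD.
by move=> z; rewrite mule_ge0// lee_fin crossing_weight_ge0.
Qed.

End crossing_law.

(** * The law of the first passage *)

Section all_times.
Context (R : realType) d (Omega : measurableType d).
Variable Z : R -> Omega -> R.

Definition all_cylinders : set (set Omega) :=
  [set B | exists (n : nat) (s : nat -> R) (A : nat -> set R), (forall i, measurable (A i)) /\
     B = finite_inter n (fun i => [set w | Z (s i) w \in A i])].

Lemma all_cylinders_setI : setI_closed all_cylinders.
Proof.
move=> _ _ [n1 [s1 [A1 [m1 ->]]]] [n2 [s2 [A2 [m2 ->]]]].
exists (n1 + n2)%N, (fun i => if (i < n1)%N then s1 i else s2 (i - n1)%N),
  (fun i => if (i < n1)%N then A1 i else A2 (i - n1)%N); split.
  by move=> i; case: ifP.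
rewrite /finite_inter big_split_ord/=; congr (_ `&` _); apply: eq_bigr => i _ /=.
  by rewrite ltn_ord.
by rewrite ltnNge leq_addr/= addKn.
Qed.

Lemma all_cylinders_setT : all_cylinders setT.
Proof.
exists 0%N, (fun=> 0), (fun=> setT); split; first by [].
by rewrite /finite_inter big_ord0.
Qed.

(* Paths take values in an arbitrary measurable space; re-equipping [Omega] with
   the sigma-algebra generated by one process turns the independence of finite
   cylinders into a product law on [history W * history T]. *)
Definition history := g_sigma_algebraType all_cylinders.

Lemma pi_gen_all_cylinders : @pi_gen _ history all_cylinders.
Proof.
split; [by []|exact: all_cylinders_setI|exists (fun=> setT)].
by split; [move=> _; exact: all_cylinders_setT|rewrite bigcup_const].
Qed.

Lemma measurable_history t : measurable_fun [set: history] (Z t : history -> R).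
Proof.
move=> _ B mB; rewrite setTI; apply: sub_sigma_algebra.
exists 1%N, (fun=> t), (fun=> B); split => //.
by rewrite /finite_inter big_ord_recl big_ord0 preimage_inE setIT.
Qed.

Lemma measurable_to_history : (forall t, measurable_fun setT (Z t)) ->
  measurable_fun [set: Omega] (idfun : Omega -> history).
Proof.
move=> mZ; apply: (@measurability _ _ Omega history setT (idfun : Omega -> history) all_cylinders).
  by [].
move=> _ [_ [n [s [A [mA ->]]]] <-]; rewrite setTI preimage_id /finite_inter.
by apply: bigsetI_measurable => i _; rewrite preimage_inE -[X in measurable X]setTI; exact: mZ.
Qed.

Lemma history_probability (P : probability Omega R) : (forall t, measurable_fun setT (Z t)) ->
  exists Q : probability history R, forall A, Q A = P A.
Proof.
move=> mZ; have [u uE] := mfun_ex (measurable_to_history mZ).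
exists (distribution P u) => A; change (P (u @^-1` A) = P A).
by rewrite uE preimage_id.
Qed.

End all_times.

Section independent_histories.
Context (R : realType) d (Omega : measurableType d) (P : probability Omega R)
  (W T : R -> Omega -> R).
Hypotheses (mW : forall t, measurable_fun setT (W t)) (mT : forall t, measurable_fun setT (T t)).
Hypothesis ind : forall (n m : nat) (s t : nat -> R) (A B : nat -> set R),
  (forall i, measurable (A i)) -> (forall j, measurable (B j)) ->
    P (finite_inter n (fun i => [set w | W (s i) w \in A i]) `&`
       finite_inter m (fun j => [set w | T (t j) w \in B j]))
    = (P (finite_inter n (fun i => [set w | W (s i) w \in A i])) *
      P (finite_inter m (fun j => [set w | T (t j) w \in B j])))%E.

Lemma indep_histories (F : history W * history T -> \bar R) :
  measurable_fun setT F -> (forall z, (0 <= F z)%E) ->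
  (\int[P]_w F (w, w) = \int[P]_w1 \int[P]_w2 F (w1, w2))%E.
Proof.
move=> mF F0.
apply: (indep_fubini (measurable_to_history mW) (measurable_to_history mT) _ mF F0).
apply: (indep_pi_gen (measurable_to_history mW) (measurable_to_history mT)
  (pi_gen_all_cylinders W) (pi_gen_all_cylinders T)).
by move=> _ _ [n [s [A [mA ->]]]] [m [t [B [mB ->]]]]; exact: ind.
Qed.

Lemma history_BM : standard_BM P W -> exists Q : probability (history W) R, standard_BM Q W.
Proof.
move=> [_ W0 cW ii law]; have [Q QE] := history_probability P mW; exists Q; split => //.
- exact: measurable_history.
- by move=> n t A t0 tS mA; rewrite QE ii//; apply: eq_bigr => i _; rewrite QE.
- by move=> s t A s0 st mA; rewrite QE law.
Qed.

Lemma history_sub nu : gamma_subordinator P nu T ->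
  exists Q : probability (history T) R, gamma_subordinator Q nu T.
Proof.
move=> [_ [T0 mon rc ii lap]].
have [u uE] := mfun_ex (measurable_to_history mT).
pose Q : probability (history T) R := distribution P u.
have QE A : Q A = P A by change (P (u @^-1` A) = P A); rewrite uE preimage_id.
exists Q; split; first exact: measurable_history.
split => //.
- by move=> n t A t0 tS mA; rewrite QE ii//; apply: eq_bigr => i _; rewrite QE.
- move=> v t h v0 t0 h0; rewrite -(lap v t h v0 t0 h0).
  have mf : measurable_fun [set: history T] (fun w => (expR (- v * (T (t + h) w - T t w)))%:E).
    apply/measurable_EFinP; apply: measurableT_comp => //; apply: measurable_funM => //.
    by apply: measurable_funB; exact: measurable_history.
  rewrite /Q ge0_integral_distribution//.
  by apply: eq_integral => w _ /=; rewrite uE.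
Qed.

End independent_histories.

Lemma measurable_le_indicator d (X : measurableType d) (R : realType) (f g : X -> R) :
  measurable_fun setT f -> measurable_fun setT g ->
  measurable_fun setT (fun x => (f x <= g x)%R%:R : R).
Proof.
move=> mf mg; have mfg : measurable [set x | f x <= g x].
  have := measurable_funB mg mf measurableT (measurable_itv `[(0:R), +oo[); rewrite setTI; congr measurable.
  by apply/seteqP; split => x /=; rewrite in_itv/= andbT subr_ge0.
have : measurable_fun setT (\1_[set x | f x <= g x] : X -> R) by exact: measurable_indic.
congr measurable_fun; apply/funext => x; rewrite indicE; congr (nat_of_bool _)%:R.
by apply/idP/idP; rewrite inE.
Qed.

(** * Brownian motion evaluated at the subordinator *)

Section joint_path.
Context (R : realType) d (Omega : measurableType d) (P : probability Omega R)
  (W : R -> Omega -> R).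
Hypothesis BM : standard_BM P W.
Notation RO := (measurableTypeR R * Omega)%type.

(** The crossing sum for the path [id] evaluates [W] at the first grid time at or after [z.1].
    Continuity of the path gives convergence to [W z.1], so joint measurability comes from that at
    fixed times. *)
Lemma measurable_path : measurable_fun [set: RO] (fun z : RO => pos z.1 * W z.1 z.2).
Proof.
have [mW W0 cW _ _] := BM.
have idmon (s t : R) : 0 <= s -> s <= t -> s <= t by [].
have idrc (t : R) : 0 <= t -> x @[x --> t^'+] --> t by move=> _; apply: cvg_at_right_filter; exact: cvg_id.
apply: (@measurable_fun_cvg _ _ _ _ (fun n z => pos z.1 * crossing_sum id (W^~ z.2) n z.1)) => [n|z _].
  have mfst : measurable_fun setT (fun z : RO => z.1 : R) by exact: measurable_fst_R.
  apply: measurable_funM; first by apply: (measurableT_comp (@measurable_pos R)).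
  apply: (@measurable_sum _ _ _ _ _ _ (fun k z => _)) => k.
  apply: measurable_funM.
    by apply: measurable_funB; apply: measurable_le_indicator => //; exact: measurable_cst.
  by apply: (measurableT_comp (mW _)); exact: measurable_snd.
have [z0|z0] := ltP 0 (z.1 : R); last first.
  by rewrite (pos_le0 z0) mul0r; under eq_fun do rewrite mul0r; exact: cvg_cst.
apply: cvgM; first exact: cvg_cst.
have r1 : reaches id (z.1 : R) by exists z.1; rewrite ltW.
have c1 : cross id z.1 = z.1 :> R.
  apply/eqP; rewrite eq_le; apply/andP; split; last exact: (cross_in idmon idrc r1).
  by have [] := (crossP idmon idrc z.1 (ltW z0)).1 (lexx _).
have := @crossing_sum_cvg R id erefl idmon idrc (W^~ z.2) z.1 z0 r1; rewrite c1; apply.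
have /continuous_within_itvcyP[+ _] := cW z.2.
by move=> /(_ z.1); rewrite in_itv/= andbT => /(_ z0) c; apply: cvg_at_right_filter.
Qed.

End joint_path.

Section interval_strong_markov.
Context (R : realType) d (Omega : measurableType d) (P : probability Omega R)
  (W : R -> Omega -> R).
Hypothesis BM : standard_BM P W.
Notation mu := (@lebesgue_measure R).
Variables (x0 beta : R).
Hypothesis x00 : 0 < x0.
Notation Wt := (Wtilde x0 beta W).
Notation hitI := (\1_(hit W x0 beta) : Omega -> R).
Notation tau0 := (tau0 W x0 beta).
Notation tau := (tau W x0 beta).
Notation tau_pdf := (tau_pdf P W x0 beta).
Variables (psi : R -> R) (M : R).
Hypotheses (cpsi : continuous psi) (psiM : forall x, 0 <= psi x <= M).
Notation sg := (bm_semigroup P W beta psi).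

Let psiN x : `|psi x| <= M.
Proof. by case/andP: (psiM x) => p0 pM; rewrite ger0_norm. Qed.

Let M0 : 0 <= M. Proof. by have := psiN 0; apply: le_trans. Qed.

Let mpsi : measurable_fun setT psi. Proof. exact: continuous_measurable_fun. Qed.

Lemma hit_by_tau0 (a : R) w : \1_(hit_by W x0 beta a) w = hitI w * (tau0 w <= a)%R%:R :> R.
Proof.
have [h|nh] := pselect (hit W x0 beta w); last first.
  rewrite !indicE (memNset nh) mul0r memNset//.
  by move=> /(hit_byP BM beta x00)[].
rewrite !indicE (mem_set h) mul1r tau0E//.
congr (nat_of_bool _)%:R; apply/idP/idP; rewrite inE; first by move=> /(hit_byP BM beta x00)[].
by move=> ta; apply/(hit_byP BM beta x00).
Qed.

Let iM (f : Omega -> R) : measurable_fun setT f -> (forall w, `|f w| <= M) ->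
  P.-integrable setT (EFin \o f).
Proof.
move=> mf fM; have i1 : P.-integrable setT (EFin \o (fun=> M)) by exact: finite_measure_integrable_cst.
exact: (integrable_dom _ _ i1).
Qed.

Let ind_bound (A : set Omega) (x : R) w : `|x| <= M -> `|(\1_A w : R) * x| <= M.
Proof.
by move=> xM; rewrite normrM indicE; case: (_ \in _); rewrite ?normr1 ?mul1r// normr0 mul0r.
Qed.

Let msg (q : R) : measurable_fun setT (fun r : R => sg `|q - r| 0).
Proof.
apply: continuous_measurable_fun => r.
apply: (@continuous_comp _ _ _ (fun r : R => q - r) (fun h : R => sg `|h| 0)).
  by apply: cvgB; [exact: cvg_cst|exact: cvg_id].
exact: (bm_semigroup_continuous BM).
Qed.

(** The strong Markov property with horizon [q] is used on [tau <= q] and on [tau <= p], and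
    subtracted; the density of [tau] then replaces the expectation. In the application [p] and [q]
    are the values of the subordinator at two neighbouring grid times. *)
Lemma interval_strong_markov p q : 0 <= p -> p <= q ->
  (\int[P]_w (hitI w * (((tau0 w <= q)%R%:R - (tau0 w <= p)%R%:R) * psi (Wt q w)))%:E =
   \int[mu]_r (tau_pdf r * (((r <= q)%R%:R - (r <= p)%R%:R) * sg `|q - r| 0))%:E)%E.
Proof.
move=> p0; rewrite le_eqVlt => /predU1P[<-|pq].
  by rewrite !integral0_eq// => x _; rewrite subrr mul0r mulr0.
have q0 := le_lt_trans p0 pq.
pose I a w : R := \1_(hit_by W x0 beta a) w.
have mI a : 0 <= a -> measurable_fun setT (I a).
  by move=> a0; apply: measurable_indic; exact: (measurable_set_hit_by BM).
have mWq : measurable_fun setT (fun w => psi (Wt q w)).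
  by apply: (measurableT_comp mpsi); exact: (measurable_Wtilde BM).
have i1 a : 0 <= a -> P.-integrable setT (EFin \o (fun w => I a w * psi (Wt q w))).
  by move=> a0; apply: iM => [|w]; [apply: measurable_funM => //; exact: mI|exact: ind_bound].
have i2 a : 0 <= a -> a <= q -> P.-integrable setT (EFin \o (fun w => I a w * sg (q - tau w) 0)).
  move=> a0 aq; apply: iM => [|w]; first exact: (measurable_hit_semigroup BM _ x00 cpsi psiN).
  exact/ind_bound/(bm_semigroup_norm BM).
have SM a : 0 <= a -> a <= q ->
    \int[P]_w (I a w * psi (Wt q w)) = \int[P]_w (I a w * sg (q - tau w) 0).
  rewrite le_eqVlt => /predU1P[<- _|a0 aq]; last exact: (strong_markov_bounded BM _ x00 cpsi psiN).
  have I0 w : I 0 w = 0.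
    by rewrite /I indicE memNset// => /(hit_byP BM beta x00)[h]; rewrite leNgt (tau_gt0 BM x00 h).
  by congr fine; rewrite !integral0_eq// => w _; rewrite I0 mul0r.
have R1 := RintegralB measurableT (i1 q (ltW q0)) (i1 p p0).
have R2 := RintegralB measurableT (i2 q (ltW q0) (lexx q)) (i2 p p0 (ltW pq)).
have E : \int[P]_w (I q w * psi (Wt q w) - I p w * psi (Wt q w)) =
         \int[P]_w (I q w * sg (q - tau w) 0 - I p w * sg (q - tau w) 0).
  by rewrite R1 R2 (SM q (ltW q0) (lexx q)) (SM p p0 (ltW pq)).
have LI := integrableB measurableT (i1 q (ltW q0)) (i1 p p0).
have RI := integrableB measurableT (i2 q (ltW q0) (lexx q)) (i2 p p0 (ltW pq)).
transitivity (\int[P]_w (I q w * psi (Wt q w) - I p w * psi (Wt q w)))%:E.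
  rewrite /Rintegral fineK; last exact: (integrable_fin_num _ LI).
  apply: eq_integral => w _; congr EFin; rewrite /I !hit_by_tau0.
  by move: (hitI w) (psi _) (_%:R) (_%:R) => a b c e; ring.
rewrite E /Rintegral fineK; last exact: (integrable_fin_num _ RI).
have F0 r : (0 <= (((r <= q)%R%:R - (r <= p)%R%:R) * sg `|q - r| 0)%:E)%E.
  rewrite lee_fin mulr_ge0 ?(bm_semigroup_ge0 P W beta psiM)// subr_ge0 ler_nat.
  by have [rp|//] := boolP (r <= p); rewrite (le_trans rp (ltW pq)).
have mF : measurable_fun setT (fun r : R => (((r <= q)%R%:R - (r <= p)%R%:R) * sg `|q - r| 0)%:E).
  apply/measurable_EFinP; apply: measurable_funM => //.
  by apply: measurable_funB; apply: measurable_le_indicator => //; exact: measurable_cst.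
transitivity (\int[P]_w ((((tau0 w <= q)%R%:R - (tau0 w <= p)%R%:R) * sg `|q - tau0 w| 0)%:E * (hitI w)%:E))%E.
  apply: eq_integral => w _; rewrite -EFinM; congr EFin; rewrite /I !hit_by_tau0.
  have [h|nh] := pselect (hit W x0 beta w); last by rewrite indicE (memNset nh) !mul0r mulr0 subrr.
  rewrite indicE (mem_set h) !mul1r mulr1 (tau0E h) mulrBl.
  have [tq|tq] := boolP (tau w <= q); first by rewrite ger0_norm ?subr_ge0.
  by have [tp|tp] := boolP (tau w <= p); [rewrite (le_trans tp (ltW pq)) in tq|rewrite !mul0r].
rewrite (tau_density BM beta x00 mF F0); apply: eq_integral => r _.
by rewrite -EFinM mulrC.
Qed.

End interval_strong_markov.

Lemma dct_Rint_integrable d (T : measurableType d) (R : realType) (mu : {measure set T -> \bar R})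
    (f_ : nat -> T -> R) (f g : T -> R) :
  mu.-integrable setT (EFin \o g) ->
  (forall n, measurable_fun setT (f_ n)) ->
  (forall x, setT x -> f_ n x @[n --> \oo] --> f x) ->
  (forall n x, setT x -> `|f_ n x| <= g x) ->
  mu.-integrable setT (EFin \o f) /\
  (\int[mu]_x f_ n x) @[n --> \oo] --> \int[mu]_x f x.
Proof.
move=> ig mf fc fg; split; last exact: (dct_Rint measurableT mf fc ig fg).
by have [] := dct_EFin measurableT mf fc ig fg.
Qed.

(** * Transform of the passage time and of the position at passage *)

Section passage_transform.
Context (R : realType) d (Omega : measurableType d) (P : probability Omega R)
  (W T : R -> Omega -> R) (nu beta x0 lam : R).
Hypotheses (nu0 : 0 < nu) (x00 : 0 < x0) (lam0 : 0 <= lam).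
Hypotheses (BM : standard_BM P W) (GS : gamma_subordinator P nu T).
Hypothesis ind : forall (n m : nat) (s t : nat -> R) (A B : nat -> set R),
  (forall i, measurable (A i)) -> (forall j, measurable (B j)) ->
    P (finite_inter n (fun i => [set w | W (s i) w \in A i]) `&`
       finite_inter m (fun j => [set w | T (t j) w \in B j]))
    = (P (finite_inter n (fun i => [set w | W (s i) w \in A i])) *
      P (finite_inter m (fun j => [set w | T (t j) w \in B j])))%E.
Notation mu := (@lebesgue_measure R).
Notation mp := (mu \x P)%E.
Notation RO := (measurableTypeR R * Omega)%type.
Notation Wt := (Wtilde x0 beta W).
Notation hitI := (\1_(hit W x0 beta) : Omega -> R).
Notation tau0 := (tau0 W x0 beta).
Notation tau_pdf := (tau_pdf P W x0 beta).
Variables (psi : R -> R) (M : R).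
Hypotheses (cpsi : continuous psi) (psiM : forall x, 0 <= psi x <= M).
Notation sg := (bm_semigroup P W beta psi).

Let psi0 x : 0 <= psi x. Proof. by case/andP: (psiM x). Qed.
Let psiN x : `|psi x| <= M.
Proof. by rewrite ger0_norm//; case/andP: (psiM x). Qed.
Let M0 : 0 <= M. Proof. by have := psiN 0; apply: le_trans. Qed.
Let mpsi : measurable_fun setT psi. Proof. exact: continuous_measurable_fun. Qed.
Let sg0 h x : 0 <= sg h x. Proof. exact: (bm_semigroup_ge0 P W beta psiM). Qed.
Let sgM h x : sg h x <= M. Proof. exact: (bm_semigroup_le BM beta cpsi psiM). Qed.
Let mW t : measurable_fun setT (W t). Proof. by case: BM. Qed.
Let mT t : measurable_fun setT (T t). Proof. exact: (sub_measurable GS). Qed.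

Let csg : continuous (fun h : R => sg `|h| 0).
Proof. exact: (bm_semigroup_continuous BM). Qed.

Let jumpL a b w : R := (tau0 w <= T b w)%R%:R - (tau0 w <= T a w)%R%:R.
Let jumpR a b (z : RO) : R := (z.1 <= T b z.2)%R%:R - (z.1 <= T a z.2)%R%:R.
Let cellL a b w : R := hitI w * (jumpL a b w * psi (Wt (T b w) w)).
Let cellR a b (z : RO) : R := tau_pdf z.1 * (jumpR a b z * sg `|T b z.2 - z.1| 0).

(** The factor [pos] makes the composed path accessible to [measurable_path]. It does no harm:
    values of [T] are nonnegative, and at 0 both sides vanish because [W 0 w = 0]. *)
Let posT b w : 0 <= b -> pos (T b w) * W (T b w) w = W (T b w) w.
Proof.
move=> b0; have := sub_ge0 GS w b0; rewrite le_eqVlt => /predU1P[<-|p]; last by rewrite pos_gt0// mul1r.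
by case: BM => _ -> _ _ _; rewrite mulr0.
Qed.

Let jumpL_ge0 a b w : 0 <= a -> a <= b -> 0 <= jumpL a b w.
Proof.
move=> a0 ab; rewrite subr_ge0 ler_nat; have [h|//] := boolP (tau0 w <= T a w).
by rewrite (le_trans h (sub_mon GS _ a0 ab)).
Qed.

Let jumpR_ge0 a b z : 0 <= a -> a <= b -> 0 <= jumpR a b z.
Proof.
move=> a0 ab; rewrite subr_ge0 ler_nat; have [h|//] := boolP (z.1 <= T a z.2).
by rewrite (le_trans h (sub_mon GS _ a0 ab)).
Qed.

Let mjumpR a b : measurable_fun setT (jumpR a b).
Proof.
have mf : measurable_fun setT (fun z : RO => z.1 : R) by exact: measurable_fst_R.
have mTs t : measurable_fun setT (fun z : RO => T t z.2).
  by apply: (measurableT_comp (mT t)); exact: measurable_snd.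
by apply: measurable_funB; exact: measurable_le_indicator.
Qed.

Let mcellR a b : measurable_fun setT (cellR a b).
Proof.
have mf : measurable_fun setT (fun z : RO => z.1 : R) by exact: measurable_fst_R.
apply: measurable_funM.
  by apply: (measurableT_comp (measurable_tau_pdf BM beta x00) mf).
apply: measurable_funM; first exact: mjumpR.
apply: (measurableT_comp (continuous_measurable_fun csg)); apply: measurable_funB => //.
by apply: (measurableT_comp (mT b)); exact: measurable_snd.
Qed.

Let cellR_ge0 a b z : 0 <= a -> a <= b -> 0 <= cellR a b z.
Proof.
move=> a0 ab; apply: mulr_ge0; first exact: (tau_pdf_ge0 BM beta x00).
by apply: mulr_ge0; [exact: jumpR_ge0|].
Qed.

(** With the path of [T] frozen, its values at times [a] and [b] are the constants of
    [interval_strong_markov]; independence of the two histories integrates the identity over [T].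
    The random level [tau0] is thereby exchanged for a Lebesgue level weighted by [tau_pdf]. *)
Let cell_law a b : 0 <= a -> a <= b ->
  (\int[P]_w (cellL a b w)%:E = \int[mp]_z (cellR a b z)%:E)%E.
Proof.
move=> a0 ab; have b0 := le_trans a0 ab.
have [QW BMQ] := history_BM mW BM; have [QT GSQ] := history_sub mT GS.
pose F (z : history T * history W) : \bar R := (hitI z.2 *
  (((tau0 z.2 <= T b z.1)%R%:R - (tau0 z.2 <= T a z.1)%R%:R) *
   psi (x0 + pos (T b z.1) * W (T b z.1) z.2 + beta * T b z.1)))%:E.
have F0 z : (0 <= F z)%E.
  rewrite lee_fin; apply: mulr_ge0; first by rewrite indicE.
  apply: mulr_ge0 => //; rewrite subr_ge0 ler_nat; have [h|//] := boolP (tau0 z.2 <= T a z.1).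
  by rewrite (le_trans h (sub_mon GS _ a0 ab)).
have mF : measurable_fun setT F.
  have m1 t : measurable_fun setT (fun z : history T * history W => T t z.1).
    by apply: (measurableT_comp (sub_measurable GSQ t)); exact: measurable_fst.
  have m2 : measurable_fun setT (fun z : history T * history W => tau0 z.2).
    by apply: (measurableT_comp (measurable_tau0 BMQ beta x00)); exact: measurable_snd.
  apply/measurable_EFinP; apply: measurable_funM.
    by apply: (measurableT_comp (measurable_hit BMQ beta x00)); exact: measurable_snd.
  apply: measurable_funM; first by apply: measurable_funB; exact: measurable_le_indicator.
  apply: (measurableT_comp mpsi); apply: measurable_funD; last exact: measurable_funM.
  apply: measurable_funD; first exact: measurable_cst.
  apply: (@measurableT_comp _ _ _ _ _ _ (fun y : measurableTypeR R * history W => pos y.1 * W y.1 y.2) _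
    (fun z : history T * history W => (T b z.1 : measurableTypeR R, z.2))).
    exact: (measurable_path BMQ).
  by apply/measurable_fun_pair; [exact: m1|exact: measurable_snd].
have ind' n m (s t : nat -> R) (A B : nat -> set R) :
  (forall i, measurable (A i)) -> (forall j, measurable (B j)) ->
    P (finite_inter n (fun i => [set w | T (s i) w \in A i]) `&`
       finite_inter m (fun j => [set w | W (t j) w \in B j]))
    = (P (finite_inter n (fun i => [set w | T (s i) w \in A i])) *
      P (finite_inter m (fun j => [set w | W (t j) w \in B j])))%E.
  by move=> mA mB; rewrite setIC ind// muleC.
transitivity (\int[P]_w F (w, w))%E.
  by apply: eq_integral => w _; rewrite /F /cellL /jumpL /= posT.
rewrite (indep_histories mT mW ind' mF F0).
rewrite (tonelli_snd (m1 := mu) (m2 := P)); last 2 first.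
- by apply/measurable_EFinP; exact: mcellR.
- by move=> z; rewrite lee_fin cellR_ge0.
apply: eq_integral => w _.
have := interval_strong_markov BM beta x00 cpsi psiM (sub_ge0 GS w a0) (sub_mon GS w a0 ab).
rewrite /cellR /jumpR /= => <-; apply: eq_integral => w' _; rewrite /F /=.
congr (_ * (_ * psi _))%:E; rewrite /Wtilde; congr (x0 + _ + _).
have := sub_ge0 GS w b0; rewrite le_eqVlt => /predU1P[<-|p]; last by rewrite pos_gt0// mul1r.
by case: BM => _ -> _ _ _; rewrite mulr0.
Qed.

Let mcellL a b : 0 <= b -> measurable_fun setT (cellL a b).
Proof.
move=> b0; have mt0 := measurable_tau0 BM beta x00.
apply: measurable_funM; first exact: (measurable_hit BM beta x00).
apply: measurable_funM; first by apply: measurable_funB; exact: measurable_le_indicator.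
apply: (measurableT_comp mpsi).
rewrite (_ : (fun w => Wt (T b w) w) = fun w => x0 + pos (T b w) * W (T b w) w + beta * T b w); last first.
  by apply/funext => w; rewrite posT.
apply: measurable_funD; last exact: measurable_funM.
apply: measurable_funD; first exact: measurable_cst.
apply: (@measurableT_comp _ _ _ _ _ _ (fun y : RO => pos y.1 * W y.1 y.2) _
    (fun w => (T b w : measurableTypeR R, w))).
  exact: (measurable_path BM).
by apply/measurable_fun_pair; [exact: mT|exact: measurable_id].
Qed.

Let cellL_ge0 a b w : 0 <= a -> a <= b -> 0 <= cellL a b w.
Proof.
move=> a0 ab; apply: mulr_ge0; first by rewrite indicE.
by apply: mulr_ge0; [exact: jumpL_ge0|].
Qed.

Let jump01 (x p q : R) : p <= q -> 0 <= ((x <= q)%R%:R - (x <= p)%R%:R : R) <= 1.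
Proof.
move=> pq; have [xp|xp] := boolP (x <= p); first by rewrite (le_trans xp pq) subrr lexx ler01.
by rewrite subr0; case: (x <= q); rewrite ?lexx ?ler01.
Qed.

Let icellL a b : 0 <= a -> a <= b -> P.-integrable setT (EFin \o cellL a b).
Proof.
move=> a0 ab; have iM : P.-integrable setT (EFin \o (fun=> M)) by exact: finite_measure_integrable_cst.
apply: (integrable_dom _ _ iM) => //; first exact: mcellL (le_trans a0 ab).
move=> w _; rewrite ger0_norm ?cellL_ge0//.
have /andP[j0 j1] := jump01 (tau0 w) (sub_mon GS w a0 ab).
have h1 : hitI w <= 1 by rewrite indicE; case: (_ \in _); rewrite ?lexx ?ler01.
have h0 : 0 <= hitI w by rewrite indicE.
have /andP[p0 pM] := psiM (Wt (T b w) w).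
rewrite -[leRHS]mul1r; apply: ler_pM => //; first exact: mulr_ge0.
by rewrite -[leRHS]mul1r; apply: ler_pM.
Qed.

Let icellR a b : 0 <= a -> a <= b ->
  mp.-integrable setT (EFin \o cellR a b) /\ \int[P]_w cellL a b w = \int[mp]_z cellR a b z.
Proof.
move=> a0 ab; have E := cell_law a0 ab; split; last by rewrite /Rintegral E.
apply/integrableP; split; first by apply/measurable_EFinP; exact: mcellR.
under eq_integral => z _ do rewrite /= ger0_norm ?cellR_ge0//.
rewrite -E ltey_eq; apply/orP; left.
exact: (integrable_fin_num _ (icellL a0 ab)).
Qed.

Let Hl t w : R := expR (- (lam * t)) * psi (Wt (T t w) w).
Let Kr (r t : R) w : R := expR (- (lam * t)) * sg `|T t w - r| 0.

Let ek n k : R := expR (- (lam * grid R n k.+1)).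

Let sumLE n w : hitI w * crossing_sumT T Hl n (tau0 w, w) =
  \sum_(k < (n.+1 * n.+1)%N) (ek n k * cellL (grid R n k) (grid R n k.+1) w).
Proof.
rewrite /crossing_sumT /crossing_sum mulr_sumr; apply: eq_bigr => k _.
rewrite /cellL /jumpL /Hl /ek /=; move: (hitI w) (expR _) (psi _) (_%:R) (_%:R) => a b c f g; ring.
Qed.

Let sumRE n (z : RO) : tau_pdf z.1 * crossing_sumT T (Kr z.1) n z =
  \sum_(k < (n.+1 * n.+1)%N) (ek n k * cellR (grid R n k) (grid R n k.+1) z).
Proof.
rewrite /crossing_sumT /crossing_sum mulr_sumr; apply: eq_bigr => k _.
rewrite /cellR /jumpR /Kr /ek /=; move: (tau_pdf _) (expR _) (sg _ _) (_%:R) (_%:R) => a b c f g; ring.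
Qed.

Let gle n k : grid R n k <= grid R n k.+1. Proof. by rewrite gridS lerDl invr_ge0. Qed.
Let g0 n k : 0 <= grid R n k := grid_ge0 R n k.

Let sum_law n :
  \int[P]_w (hitI w * crossing_sumT T Hl n (tau0 w, w)) =
  \int[mp]_z (tau_pdf z.1 * crossing_sumT T (Kr z.1) n z).
Proof.
under [LHS]eq_Rintegral do rewrite sumLE.
under [RHS]eq_Rintegral do rewrite sumRE.
have iL k : P.-integrable setT (EFin \o (fun w => ek n k * cellL (grid R n k) (grid R n k.+1) w)).
  by have := integrableZl measurableT (ek n k) (icellL (g0 n k) (gle n k)).
have iR k : mp.-integrable setT (EFin \o (fun z => ek n k * cellR (grid R n k) (grid R n k.+1) z)).
  by have := integrableZl measurableT (ek n k) (icellR (g0 n k) (gle n k)).1.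
have [_ ->] := Rintegral_sum_ord (n.+1 * n.+1) iL.
have [_ ->] := Rintegral_sum_ord (n.+1 * n.+1) iR.
apply: eq_bigr => k _.
rewrite (@RintegralZl _ _ _ P _ _ (ek n k) measurableT (icellL (g0 n k) (gle n k))).
rewrite (@RintegralZl _ _ _ mp _ _ (ek n k) measurableT (icellR (g0 n k) (gle n k)).1).
by rewrite (icellR (g0 n k) (gle n k)).2.
Qed.

Let crossL w := cross (T^~ w) (tau0 w).

Let Wt_cvg_right t w : 0 <= t -> Wt (T x w) w @[x --> t^'+] --> Wt (T t w) w.
Proof.
move=> t0; apply/cvg_at_rightP => u [ut ucv].
apply: (Wtilde_cvg BM) => [n|]; first by rewrite (sub_ge0 GS)// (le_trans t0)// ltW.
have /cvg_at_rightP := @sub_rc _ _ _ _ _ _ GS w _ t0; apply; by split.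
Qed.

Let Hl_cvg t w : 0 <= t -> Hl x w @[x --> t^'+] --> Hl t w.
Proof.
move=> t0; apply: cvgM.
  apply: cvg_at_right_filter; apply: continuous_cvg; first exact: continuous_expR.
  by apply: cvgN; apply: cvgM; [exact: cvg_cst|exact: cvg_id].
by apply: continuous_cvg; [exact: cpsi|exact: Wt_cvg_right].
Qed.

Let Kr_cvg r t w : 0 <= t -> Kr r x w @[x --> t^'+] --> Kr r t w.
Proof.
move=> t0; apply: cvgM.
  apply: cvg_at_right_filter; apply: continuous_cvg; first exact: continuous_expR.
  by apply: cvgN; apply: cvgM; [exact: cvg_cst|exact: cvg_id].
have Hc : T x w - r @[x --> t^'+] --> T t w - r.
  by apply: cvgB; [exact: (@sub_rc _ _ _ _ _ _ GS)|exact: cvg_cst].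
have Hs : sg `|h| 0 @[h --> T t w - r] --> sg `|T t w - r| 0 by exact: csg.
exact: (@cvg_comp _ _ _ (fun x => T x w - r) (fun h => sg `|h| 0) _ _ _ Hc Hs).
Qed.

Let Hl_bound t w : 0 <= t -> `|Hl t w| <= M.
Proof.
move=> t0; rewrite normrM ger0_norm ?expR_ge0// -[leRHS]mul1r ler_pM ?expR_ge0//.
by rewrite expRN_le1// mulr_ge0.
Qed.

Let Kr_bound r t w : 0 <= t -> `|Kr r t w| <= M.
Proof.
move=> t0; rewrite normrM (ger0_norm (expR_ge0 _)) (ger0_norm (sg0 _ _)).
by rewrite -[leRHS]mul1r ler_pM ?expR_ge0// expRN_le1// mulr_ge0.
Qed.

Let itau_pdf : mu.-integrable setT (EFin \o tau_pdf).
Proof.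
have mf := measurable_tau_pdf BM beta x00.
apply/integrableP; split; first exact/measurable_EFinP.
have := @tau_density _ _ _ _ _ BM x0 beta x00 (fun=> 1%E) (@measurable_cst _ _ _ _ _ _) (fun=> lee01).
under [in RHS]eq_integral do rewrite mul1e.
under [in LHS]eq_integral do rewrite mul1e.
under [X in (X < _)%E]eq_integral => r _ do rewrite /= ger0_norm ?(tau_pdf_ge0 BM beta x00)//.
move=> <-; rewrite integral_indic//; last exact: (measurable_set_hit BM beta x00).
by rewrite (le_lt_trans (probability_le1 _ _)) ?ltry// setIT; exact: (measurable_set_hit BM beta x00).
Qed.

Let itau_prod : mp.-integrable setT (EFin \o (fun z : RO => tau_pdf z.1)).
Proof.
have mf : measurable_fun setT (EFin \o (fun z : RO => tau_pdf z.1)).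
  apply/measurable_EFinP; apply: (measurableT_comp (measurable_tau_pdf BM beta x00)).
  exact: measurable_fst_R.
have f0 z : (0 <= (EFin \o (fun z : RO => tau_pdf z.1)%R) z)%E.
  by rewrite lee_fin (tau_pdf_ge0 BM beta x00).
apply/integrableP; split => //.
under eq_integral => z _ do rewrite gee0_abs//.
rewrite (tonelli_fst mf f0) /=.
under eq_integral do rewrite integral_prob_cst.
rewrite ltey_eq; apply/orP; left; exact: (integrable_fin_num _ itau_pdf).
Qed.

Let LA w : R := hitI w * (\1_(reach_set T) (tau0 w, w) * Hl (crossL w) w).
Let LB (z : RO) : R := tau_pdf z.1 * (pos z.1 * (\1_(reach_set T) z * Kr z.1 (cross (T^~ z.2) z.1) z.2)).

Let limit_law : [/\ P.-integrable setT (EFin \o LA), mp.-integrable setT (EFin \o LB) &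
  \int[P]_w LA w = \int[mp]_z LB z].
Proof.
have mtau := measurable_tau0 BM beta x00.
have [iA h1] : P.-integrable setT (EFin \o LA) /\
    \int[P]_w (hitI w * crossing_sumT T Hl n (tau0 w, w)) @[n --> \oo] --> \int[P]_w LA w.
  have iM : P.-integrable setT (EFin \o (fun=> M)) by exact: finite_measure_integrable_cst.
  apply: (dct_Rint_integrable iM).
  - move=> n; rewrite (_ : (fun w => _) = fun w =>
        \sum_(k < (n.+1 * n.+1)%N) (ek n k * cellL (grid R n k) (grid R n k.+1) w)); last first.
      by apply/funext => w; rewrite sumLE.
    by apply: measurable_sum => k; apply: measurable_funM => //; exact: mcellL (g0 _ _).
  - move=> w _; rewrite /LA; have [h|h] := pselect (hit W x0 beta w); last first.
      by rewrite indicE memNset// mul0r; under eq_fun do rewrite mul0r; exact: cvg_cst.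
    apply: cvgM; first exact: cvg_cst.
    apply: (crossing_sumT_cvg GS (z := (tau0 w, w))); last by move=> t t0; exact: Hl_cvg.
    by rewrite /= (tau0E h) (tau_gt0 BM x00 h).
  - move=> n w _; have [h|h] := pselect (hit W x0 beta w); last by rewrite indicE memNset// mul0r normr0.
    have t0 : 0 < tau0 w by rewrite (tau0E h) (tau_gt0 BM x00 h).
    rewrite indicE mem_set// mul1r.
    exact: (@crossing_sum_bound R (T^~ w) (sub_0 GS w) (sub_mon GS w) (@sub_rc _ _ _ _ _ _ GS w)
      (Hl^~ w) M n (tau0 w) t0 (fun t => @Hl_bound t w)).
have [iB h2] : mp.-integrable setT (EFin \o LB) /\
  \int[mp]_z (tau_pdf z.1 * crossing_sumT T (Kr z.1) n z) @[n --> \oo] --> \int[mp]_z LB z.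
  have iM : mp.-integrable setT (EFin \o (fun z : RO => M * tau_pdf z.1)).
    by have := integrableZl measurableT M itau_prod.
  (* A level at most 0 lies below [T] at every grid time, so no cell contains a switch and the sum
     is 0. *)
  have Iz0 n (z : RO) : (z.1 : R) <= 0 -> crossing_sumT T (Kr z.1) n z = 0.
    move=> z0; rewrite /crossing_sumT /crossing_sum big1// => k _.
    have h j : (z.1 : R) <= T (grid R n j) z.2 by rewrite (le_trans z0)// (sub_ge0 GS)// g0.
    by rewrite !h subrr mul0r.
  apply: (dct_Rint_integrable iM).
  - move=> n; rewrite (_ : (fun w => _) = fun z =>
        \sum_(k < (n.+1 * n.+1)%N) (ek n k * cellR (grid R n k) (grid R n k.+1) z)); last first.
      by apply/funext => z; rewrite sumRE.
    by apply: measurable_sum => k; apply: measurable_funM => //; exact: mcellR.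
  - move=> z _; apply: cvgM; first exact: cvg_cst.
    have [z0|z0] := leP (z.1 : R) 0.
      by rewrite (pos_le0 z0) mul0r; under eq_fun do rewrite Iz0//; exact: cvg_cst.
    rewrite (pos_gt0 z0) mul1r.
    by apply: (crossing_sumT_cvg GS) => // t t0; exact: Kr_cvg.
  - move=> n z _; have f0 := tau_pdf_ge0 BM beta x00 z.1.
    have [z0|z0] := leP (z.1 : R) 0; first by rewrite Iz0// mulr0 normr0 mulr_ge0.
    rewrite normrM (ger0_norm f0) mulrC ler_wpM2r//.
    exact: (@crossing_sum_bound R (T^~ z.2) (sub_0 GS z.2) (sub_mon GS z.2) (@sub_rc _ _ _ _ _ _ GS z.2)
      ((Kr z.1)^~ z.2) M n z.1 z0 (fun t => @Kr_bound z.1 t z.2)).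
split => //; apply: (cvg_unique _ h1) => //=.
by under eq_fun do rewrite sum_law.
Qed.

Notation subT := (subT T).

(** [limit_law] lets the mesh tend to 0 in [sum_law]; the level then has density [tau_pdf], and
    [crossing_law_iterated] replaces the path functional by the explicit weight. The factor
    [sg |h| 0] is the mean of [psi] at the position reached from 0 after the overshoot [h]. *)
Lemma passage_transform :
  (\int[P]_w (hitI w * (\1_(reach_set T) (tau0 w, w) *
     (expR (- (lam * cross (T^~ w) (tau0 w))) * psi (LSBM x0 beta W T (cross (T^~ w) (tau0 w)) w))))%:E =
   \int[mu]_s \int[mu]_r \int[mu]_v \int[mu]_h \int[P]_w
     (tau_pdf (subT s w + v) * sg `|h| 0 * crossing_weight nu beta lam s r v h)%:E)%E.
Proof.
have mtau := measurable_tau0 BM beta x00.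
pose F (z : R * R) : \bar R := (tau_pdf z.1 * sg `|z.2 - z.1| 0)%:E.
have F0 z : (0 <= F z)%E by rewrite lee_fin mulr_ge0// (tau_pdf_ge0 BM beta x00).
have mF : measurable_fun setT F.
  apply/measurable_EFinP; apply: measurable_funM.
    by apply: (measurableT_comp (measurable_tau_pdf BM beta x00)); exact: measurable_fst.
  apply: (measurableT_comp (continuous_measurable_fun csg)); apply: measurable_funB.
    exact: measurable_snd.
  exact: measurable_fst.
have := @crossing_law_iterated R d Omega P T nu beta lam nu0 lam0 GS F mF F0.
set A := (X in X = _ -> _); set B := (X in _ = X -> _) => AB.
transitivity A; last first.
  rewrite AB /B.
  apply: eq_integral => s _; apply: eq_integral => r _; apply: eq_integral => v _.
  apply: eq_integral => h _; apply: eq_integral => w _; rewrite /F /= -EFinM; congr (_ * sg `|_| 0 * _)%:E.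
  ring.
have [iA iB AB'] := limit_law.
transitivity ((\int[P]_w (hitI w * (\1_(reach_set T) (tau0 w, w) * Hl (crossL w) w)))%:E).
  by rewrite /Rintegral fineK//; exact: (integrable_fin_num _ iA).
rewrite -/LA AB' /Rintegral fineK; last exact: (integrable_fin_num _ iB).
rewrite /A; apply: eq_integral => z _; rewrite /F /= -EFinM; congr EFin.
rewrite /LB; have [z0|z0] := leP (z.1 : R) 0; first by rewrite (pos_le0 z0) !(mul0r, mulr0).
rewrite (pos_gt0 z0) !mul1r; have [h|h] := pselect (reach_set T z); last first.
  by rewrite indicE memNset// !(mul0r, mulr0).
rewrite /LB /Kr cross0E// overshoot0E//.
move: (\1__ _) (expR _) (sg _ _) (tau_pdf _) => a b c e; ring.
Qed.

End passage_transform.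

Lemma integral_off_point (R : realType) (a : R) (f g : R -> \bar R)
    (mu := @lebesgue_measure R) :
  measurable_fun setT f -> measurable_fun setT g ->
  (forall x, (0 <= f x)%E) -> (forall x, (0 <= g x)%E) ->
  (forall x, x != a -> f x = g x) -> (\int[mu]_x f x = \int[mu]_x g x)%E.
Proof.
move=> mf mg f0 g0 fg; apply: ge0_ae_eq_integral => //.
exists [set a]; split => //; first exact: lebesgue_measure_set1.
move=> x /= h; have [//|xa] := eqVneq x a.
by exfalso; apply: h => _; exact: fg.
Qed.

Lemma measurable_gaussd2 (R : realType) :
  measurable_fun [set: measurableTypeR R * measurableTypeR R] (fun z => gaussd z.1 z.2).
Proof.
have m1 : measurable_fun [set: measurableTypeR R * measurableTypeR R] (fun z => z.1 : R).
  exact: measurable_fst_R.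
have m2 : measurable_fun [set: measurableTypeR R * measurableTypeR R] (fun z => z.2 : R).
  exact: measurable_snd_R.
apply: measurable_funM.
  apply: (measurableT_comp (@measurable_invr R)).
  apply: (measurableT_comp (continuous_measurable_fun (@sqrt_continuous R))).
  exact: measurable_funM.
apply: measurableT_comp => //; apply: measurable_funM.
  by apply: measurableT_comp => //; exact: measurable_funX.
by apply: (measurableT_comp (@measurable_invr R)); exact: measurable_funM.
Qed.

(** * Position after the overshoot *)

Section resolvent.
Context (R : realType) d (Omega : measurableType d) (P : probability Omega R)
  (W : R -> Omega -> R) (nu beta : R).
Hypotheses (nu0 : 0 < nu) (BM : standard_BM P W).
Notation mu := (@lebesgue_measure R).
Variables (psi : R -> R) (M : R).
Hypotheses (cpsi : continuous psi) (psiM : forall x, 0 <= psi x <= M).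
Notation sg := (bm_semigroup P W beta psi).
Notation alpha := (alpha nu beta).
Notation rate := (rate nu beta).

Let psi0 x : 0 <= psi x. Proof. by case/andP: (psiM x). Qed.
Let mpsi : measurable_fun setT psi. Proof. exact: continuous_measurable_fun. Qed.

(** Translating by [beta * h] and completing the square moves the drift into the factor
    [expR (beta * y - beta ^+ 2 / 2 * h)], as in the Cameron-Martin formula. *)
Lemma bm_semigroup_density (h : R) : 0 < h ->
  ((sg h 0)%:E = \int[mu]_y (psi y * (expR (beta * y - beta ^+ 2 / 2 * h) * gaussd h y))%:E)%E.
Proof.
move=> h0; have [mW _ _ _ _] := BM.
have mA : measurable_fun setT (fun w => psi (0 + beta * h + W h w)).
  by apply: (measurableT_comp mpsi); exact: measurable_funD.
have iA : P.-integrable setT (EFin \o (fun w => psi (0 + beta * h + W h w))).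
  have iM : P.-integrable setT (EFin \o (fun=> M)) by exact: finite_measure_integrable_cst.
  apply: (integrable_dom _ _ iM) => // w _; rewrite ger0_norm//.
  by case/andP: (psiM (0 + beta * h + W h w)).
rewrite /bm_semigroup /Rintegral fineK; last exact: (integrable_fin_num _ iA).
pose F (x : R) : \bar R := (psi (0 + beta * h + x))%:E.
have mF : measurable_fun setT F.
  by apply/measurable_EFinP; apply: (measurableT_comp mpsi); exact: measurable_funD.
have F0 x : (0 <= F x)%E by rewrite lee_fin.
rewrite (bm_law BM h0 mF F0).
pose H (y : R) : \bar R := (psi y * (expR (beta * y - beta ^+ 2 / 2 * h) * gaussd h y))%:E.
have mH : measurable_fun setT H.
  apply/measurable_EFinP; apply: measurable_funM => //; apply: measurable_funM; last exact: measurable_gaussd.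
  by apply: measurableT_comp => //; apply: measurable_funB => //; exact: measurable_funM.
have H0 y : (0 <= H y)%E by rewrite lee_fin !mulr_ge0 ?expR_ge0 ?gaussd_ge0.
have := @lebesgue_affine R 1 (beta * h) H ltr01 mH H0.
rewrite invr1 mul1e => <-; apply: eq_integral => x _; rewrite /F /H -EFinM.
rewrite add0r mul1r (addrC x); congr (_ * _)%:E.
rewrite /gaussd mulrCA -expRD; congr (_ * expR _).
have p0 : h != 0 by rewrite gt_eqF.
by field.
Qed.

(** The Cameron-Martin factor adds [beta ^+ 2 / 2] to [rate r] and makes it [(alpha + r) ^+ 2 / 2],
    so that [green_gaussd] applies with [Q = alpha + r]; this is what the quadratic parametrisation
    of the mixture is made for. The point [y = 0], where [green_gaussd] says nothing, is a null
    set. *)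
Lemma resolvent (r : R) : 0 < r ->
  (\int[mu]_h (pos h * expR (- (rate r * h)) * sg `|h| 0)%:E =
   \int[mu]_y (psi y * expR (beta * y) * (expR (- (`|y| * (alpha + r))) / (alpha + r)))%:E)%E.
Proof.
move=> r0; have p0 : 0 < alpha + r by rewrite addr_gt0// alpha_gt0.
pose K (z : measurableTypeR R * measurableTypeR R) : \bar R :=
  (pos z.1 * expR (- (rate r * z.1)) *
   (psi z.2 * (expR (beta * z.2 - beta ^+ 2 / 2 * z.1) * gaussd z.1 z.2)))%:E.
have m1 : measurable_fun [set: measurableTypeR R * measurableTypeR R] (fun z => z.1 : R).
  exact: measurable_fst_R.
have m2 : measurable_fun [set: measurableTypeR R * measurableTypeR R] (fun z => z.2 : R).
  exact: measurable_snd_R.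
have mK : measurable_fun setT K.
  apply/measurable_EFinP; apply: measurable_funM.
    apply: measurable_funM; first exact: (measurableT_comp (@measurable_pos R)).
    by apply: measurableT_comp => //; apply: measurableT_comp => //; exact: measurable_funM.
  apply: measurable_funM; first exact: (measurableT_comp mpsi).
  apply: measurable_funM; last exact: measurable_gaussd2.
  by apply: measurableT_comp => //; apply: measurable_funB; exact: measurable_funM.
have K0 z : (0 <= K z)%E by rewrite lee_fin !mulr_ge0 ?pos_ge0 ?expR_ge0 ?gaussd_ge0.
transitivity (\int[mu]_h \int[mu]_y K (h, y))%E.
  apply: eq_integral => h _; rewrite /K /=.
  have [h0|h0] := leP h 0.
    by rewrite (pos_le0 h0) !mul0r integral0_eq// => y _; rewrite !mul0r.
  rewrite gtr0_norm// EFinM bm_semigroup_density//.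
  under [RHS]eq_integral do rewrite EFinM.
  rewrite ge0_integralZl//.
  - apply/measurable_EFinP; apply: measurable_funM => //; apply: measurable_funM; last exact: measurable_gaussd.
    by apply: measurableT_comp => //; apply: measurable_funB => //; exact: measurable_funM.
  - by move=> y _; rewrite lee_fin !mulr_ge0 ?expR_ge0 ?gaussd_ge0.
  - by rewrite lee_fin mulr_ge0 ?pos_ge0 ?expR_ge0.
rewrite (tonelli_swap mu mu mK K0).
apply: (@integral_off_point R 0).
- exact: (measurable_fun_fubini_tonelli_G (m1 := mu) K mK K0).
- apply/measurable_EFinP; apply: measurable_funM.
    by apply: measurable_funM => //; apply: measurableT_comp => //; exact: measurable_funM.
  apply: measurable_funM => //; apply: measurableT_comp => //; apply: measurableT_comp => //.
  by apply: measurable_funM => //; exact: measurableT_comp.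
- by move=> y; apply: integral_ge0 => h _; exact: K0.
- by move=> y; rewrite lee_fin !mulr_ge0 ?expR_ge0// invr_ge0 ltW.
move=> y y0; rewrite EFinM -(green_gaussd p0 y0) -integral_pos.
rewrite -ge0_integralZl//.
- apply: eq_integral => h _; rewrite /K /= -EFinM; congr EFin.
  have -> : (alpha + r) ^+ 2 / 2 * h = rate r * h + beta ^+ 2 / 2 * h by rewrite /(rate _); field.
  rewrite opprD !expRD; move: (expR _) (expR _) (expR _) (pos _) (psi _) (gaussd _ _) => a b c e f g; ring.
- apply/measurable_EFinP; apply: measurable_funM; first exact: measurable_pos.
  apply: measurable_funM.
    by apply: measurableT_comp => //; apply: measurableT_comp => //; exact: measurable_funM.
  apply: (@measurableT_comp _ _ _ _ _ _ (fun z : measurableTypeR R * measurableTypeR R => gaussd z.1 z.2) _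
      (fun h : measurableTypeR R => (h, (y : measurableTypeR R))) (@measurable_gaussd2 R)).
  by apply/measurable_fun_pair; [exact: measurable_id|exact: measurable_cst].
- by move=> h _; rewrite lee_fin !mulr_ge0 ?pos_ge0 ?expR_ge0 ?gaussd_ge0.
- by rewrite lee_fin !mulr_ge0 ?expR_ge0.
Qed.

End resolvent.

Section space_law.
Context (R : realType) d (Omega : measurableType d) (P : probability Omega R)
  (W T : R -> Omega -> R) (nu beta lam : R).
Hypotheses (nu0 : 0 < nu) (BM : standard_BM P W) (GS : gamma_subordinator P nu T).
Notation mu := (@lebesgue_measure R).
Variables (psi : R -> R) (M : R).
Hypotheses (cpsi : continuous psi) (psiM : forall x, 0 <= psi x <= M).
Notation sg := (bm_semigroup P W beta psi).
Notation alpha := (alpha nu beta).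
Notation rate := (rate nu beta).
Notation subT := (subT T).
Variable f : R -> R.
Hypotheses (mf : measurable_fun setT f) (f0 : forall x, 0 <= f x).

Definition shifted_mean (s v : R) : \bar R := (\int[P]_w (f (subT s w + v))%:E)%E.

Definition shifted_transform (s r : R) : \bar R :=
  (\int[mu]_v ((pos v * expR (- (rate r * v)))%:E * shifted_mean s v))%E.

(** The factor [alpha + r] of the mixture weight has cancelled the [1 / (alpha + r)] of the
    resolvent kernel. *)
Definition space_kernel (y r : R) : R :=
  expR (beta * y) / nu * (pos r * expR (- (`|y| * (alpha + r)))).

Definition joint_density (s y : R) : \bar R :=
  (\int[mu]_r ((space_kernel y r)%:E * shifted_transform s r))%E.

Let psi0 x : 0 <= psi x. Proof. by case/andP: (psiM x). Qed.
Let mpsi : measurable_fun setT psi. Proof. exact: continuous_measurable_fun. Qed.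
Let msubT s : measurable_fun setT (subT s).
Proof. by apply: measurable_funM => //; exact: (sub_measurable GS). Qed.
Let mrate : measurable_fun setT rate.
Proof. by apply: continuous_measurable_fun; exact: continuous_rate. Qed.
Let sg0 h x : 0 <= sg h x. Proof. exact: (bm_semigroup_ge0 P W beta psiM). Qed.

Lemma shifted_mean_ge0 s v : (0 <= shifted_mean s v)%E.
Proof. by apply: integral_ge0 => w _; rewrite lee_fin. Qed.

Lemma measurable_shifted_mean s : measurable_fun setT (shifted_mean s).
Proof.
pose K (z : measurableTypeR R * Omega) : \bar R := (f (subT s z.2 + z.1))%:E.
apply: (measurable_fun_fubini_tonelli_F (m2 := P) K).
  apply/measurable_EFinP; apply: (measurableT_comp mf); apply: measurable_funD.
    by apply: (measurableT_comp (msubT s)); exact: measurable_snd.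
  exact: measurable_fst_R.
by move=> z; rewrite lee_fin.
Qed.

Lemma shifted_transform_ge0 s r : (0 <= shifted_transform s r)%E.
Proof.
apply: integral_ge0 => v _; rewrite mule_ge0 ?shifted_mean_ge0//.
by rewrite lee_fin mulr_ge0 ?pos_ge0 ?expR_ge0.
Qed.

Lemma measurable_shifted_transform s : measurable_fun setT (shifted_transform s).
Proof.
pose K (z : measurableTypeR R * measurableTypeR R) : \bar R :=
  ((pos z.2 * expR (- (rate z.1 * z.2)))%:E * shifted_mean s z.2)%E.
apply: (measurable_fun_fubini_tonelli_F (m2 := mu) K).
  have m2 : measurable_fun [set: measurableTypeR R * measurableTypeR R] (fun z => z.2 : R).
    exact: measurable_snd_R.
  apply: emeasurable_funM; last exact: (measurableT_comp (measurable_shifted_mean s) m2).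
  apply/measurable_EFinP; apply: measurable_funM.
    exact: (measurableT_comp (@measurable_pos R)).
  apply: measurableT_comp => //; apply: measurableT_comp => //; apply: measurable_funM => //.
  by apply: (measurableT_comp mrate); exact: measurable_fst_R.
move=> z; rewrite mule_ge0 ?shifted_mean_ge0//.
by rewrite lee_fin mulr_ge0 ?pos_ge0 ?expR_ge0.
Qed.

Lemma space_kernel_ge0 y r : 0 <= space_kernel y r.
Proof. by rewrite !mulr_ge0 ?expR_ge0 ?pos_ge0// invr_ge0 ltW. Qed.

Let c1 s : R := pos s * expR (- (lam * s)).
Let c10 s : 0 <= c1 s. Proof. by rewrite mulr_ge0 ?pos_ge0 ?expR_ge0. Qed.
Let ar r : R := pos r * ((alpha + r) / nu).
Let ar0 r : 0 <= ar r.
Proof.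
rewrite /ar; have [r0|r0] := ltP 0 r; last by rewrite pos_le0// mul0r.
by rewrite mulr_ge0 ?pos_ge0// divr_ge0 ?addr_ge0 ?(ltW (alpha_gt0 _ _)) ?(ltW r0) ?(ltW nu0).
Qed.
Let kh r h : R := pos h * expR (- (rate r * h)) * sg `|h| 0.
Let kh0 r h : 0 <= kh r h. Proof. by rewrite !mulr_ge0 ?pos_ge0 ?expR_ge0. Qed.
Let mkh r : measurable_fun setT (kh r).
Proof.
apply: measurable_funM.
  apply: measurable_funM; first exact: measurable_pos.
  by apply: measurableT_comp => //; apply: measurableT_comp => //; exact: measurable_funM.
apply: continuous_measurable_fun; apply: (bm_semigroup_continuous BM (M := M)) => // x.
by rewrite ger0_norm//; case/andP: (psiM x).
Qed.
Let kv r v : R := pos v * expR (- (rate r * v)).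
Let kv0 r v : 0 <= kv r v. Proof. by rewrite mulr_ge0 ?pos_ge0 ?expR_ge0. Qed.
Let mkv r : measurable_fun setT (kv r).
Proof.
apply: measurable_funM; first exact: measurable_pos.
by apply: measurableT_comp => //; apply: measurableT_comp => //; exact: measurable_funM.
Qed.

Let inner s r v : (\int[mu]_h \int[P]_w
     (f (subT s w + v) * sg `|h| 0 * crossing_weight nu beta lam s r v h)%:E =
   ((c1 s * ar r)%:E * \int[mu]_h (kh r h)%:E) * ((kv r v)%:E * shifted_mean s v))%E.
Proof.
transitivity (\int[mu]_h (((c1 s * ar r * kv r v)%:E * shifted_mean s v) * (kh r h)%:E))%E.
  apply: eq_integral => h _.
  transitivity (\int[P]_w ((f (subT s w + v))%:E * (c1 s * ar r * kv r v * kh r h)%:E))%E.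
    apply: eq_integral => w _; rewrite -EFinM; congr EFin; rewrite /crossing_weight /c1 /ar /kv /kh.
    rewrite mulrDr opprD expRD.
    by move: (expR _) (expR _) (expR _) (_ / nu) (pos _) (pos _) (pos _) (pos _) (sg _ _) (f _) => *; ring.
  rewrite ge0_integralZr//.
  - by rewrite -/(shifted_mean s v) EFinM muleA (muleC _ (shifted_mean s v)).
  - apply/measurable_EFinP; apply: (measurableT_comp mf); exact: measurable_funD.
  - by move=> w _; rewrite lee_fin.
  - by rewrite lee_fin; exact: (mulr_ge0 (mulr_ge0 (mulr_ge0 (c10 s) (ar0 r)) (kv0 r v)) (kh0 r h)).
rewrite ge0_integralZl//.
- rewrite EFinM -!muleA; congr (_ * _)%E; rewrite muleA muleC; congr (_ * _)%E.
- by apply/measurable_EFinP; exact: mkh.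
- by move=> h _; rewrite lee_fin.
- apply: mule_ge0; last exact: shifted_mean_ge0.
  by rewrite lee_fin; exact: (mulr_ge0 (mulr_ge0 (c10 s) (ar0 r)) (kv0 r v)).
Qed.

Let radial s r : ((c1 s * ar r)%:E * \int[mu]_h (kh r h)%:E =
   \int[mu]_y (c1 s * psi y * space_kernel y r)%:E)%E.
Proof.
have [r0|r0] := leP r 0.
  rewrite /ar (pos_le0 r0) mul0r mulr0 mul0e integral0_eq// => y _.
  by rewrite /space_kernel (pos_le0 r0) mul0r !mulr0.
have p0 : 0 < alpha + r by rewrite addr_gt0// alpha_gt0.
rewrite /kh (resolvent beta nu0 BM cpsi psiM r0) -ge0_integralZl//.
- apply: eq_integral => y _; rewrite -EFinM; congr EFin; rewrite /ar /space_kernel (pos_gt0 r0).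
  by field; rewrite !gt_eqF.
- apply/measurable_EFinP; apply: measurable_funM.
    by apply: measurable_funM => //; apply: measurableT_comp => //; exact: measurable_funM.
  apply: measurable_funM => //; apply: measurableT_comp => //; apply: measurableT_comp => //.
  by apply: measurable_funM => //; exact: measurableT_comp.
- by move=> y _; rewrite lee_fin !mulr_ge0 ?expR_ge0// invr_ge0 ltW.
- by rewrite lee_fin mulr_ge0.
Qed.

Lemma space_law :
  (\int[mu]_s \int[mu]_r \int[mu]_v \int[mu]_h \int[P]_w
     (f (subT s w + v) * sg `|h| 0 * crossing_weight nu beta lam s r v h)%:E =
   \int[mu]_s \int[mu]_y ((pos s * expR (- (lam * s)) * psi y)%:E * joint_density s y))%E.
Proof.
apply: eq_integral => s _.
have mpsi2 (z1 : R) : measurable_fun setT (fun y : R => c1 s * psi y) by exact: measurable_funM.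
have msk : measurable_fun [set: measurableTypeR R * measurableTypeR R] (fun z => space_kernel z.2 z.1).
  have m1 : measurable_fun [set: measurableTypeR R * measurableTypeR R] (fun z => z.1 : R).
    exact: measurable_fst_R.
  have m2 : measurable_fun [set: measurableTypeR R * measurableTypeR R] (fun z => z.2 : R).
    exact: measurable_snd_R.
  apply: measurable_funM.
    by apply: measurable_funM => //; apply: measurableT_comp => //; exact: measurable_funM.
  apply: measurable_funM; first exact: (measurableT_comp (@measurable_pos R)).
  apply: measurableT_comp => //; apply: measurableT_comp => //; apply: measurable_funM.
    exact: measurableT_comp.
  exact: measurable_funD.
pose K (z : measurableTypeR R * measurableTypeR R) : \bar R :=
  ((c1 s * psi z.2)%:E * ((space_kernel z.2 z.1)%:E * shifted_transform s z.1))%E.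
have mK : measurable_fun setT K.
  apply: emeasurable_funM.
    apply/measurable_EFinP; apply: measurable_funM => //; apply: (measurableT_comp mpsi).
    exact: measurable_snd_R.
  apply: emeasurable_funM; first exact/measurable_EFinP.
  by apply: (measurableT_comp (measurable_shifted_transform s)); exact: measurable_fst_R.
have K0 z : (0 <= K z)%E.
  apply: mule_ge0; first by rewrite lee_fin; exact: (mulr_ge0 (c10 s) (psi0 _)).
  by apply: mule_ge0; [rewrite lee_fin; exact: space_kernel_ge0|exact: shifted_transform_ge0].
transitivity (\int[mu]_r \int[mu]_y K (r, y))%E.
  apply: eq_integral => r _; under eq_integral do rewrite inner.
  rewrite ge0_integralZl//; last first.
  - apply: mule_ge0; first by rewrite lee_fin; exact: (mulr_ge0 (c10 s) (ar0 r)).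
    by apply: integral_ge0 => h _; rewrite lee_fin.
  - by move=> v _; rewrite mule_ge0 ?shifted_mean_ge0// lee_fin.
  - by apply: emeasurable_funM; [apply/measurable_EFinP; exact: mkv|exact: measurable_shifted_mean].
  rewrite radial -ge0_integralZr//.
  - by apply: eq_integral => y _; rewrite /K /= EFinM -muleA.
  - apply/measurable_EFinP; apply: measurable_funM; first exact: measurable_funM.
    apply: (@measurableT_comp _ _ _ _ _ _ (fun z : measurableTypeR R * measurableTypeR R => space_kernel z.2 z.1) _
      (fun y : measurableTypeR R => ((r : measurableTypeR R), y)) msk).
    by apply/measurable_fun_pair; [exact: measurable_cst|exact: measurable_id].
  - by move=> y _; rewrite lee_fin; exact: (mulr_ge0 (mulr_ge0 (c10 s) (psi0 y)) (space_kernel_ge0 y r)).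
  - exact: shifted_transform_ge0.
rewrite (tonelli_swap mu mu mK K0); apply: eq_integral => y _.
rewrite /K /= ge0_integralZl//.
- apply: emeasurable_funM; last exact: measurable_shifted_transform.
  apply/measurable_EFinP.
  apply: (@measurableT_comp _ _ _ _ _ _ (fun z : measurableTypeR R * measurableTypeR R => space_kernel z.2 z.1) _
      (fun r : measurableTypeR R => (r, (y : measurableTypeR R))) msk).
  by apply/measurable_fun_pair; [exact: measurable_id|exact: measurable_cst].
- by move=> r _; rewrite mule_ge0 ?shifted_transform_ge0// lee_fin space_kernel_ge0.
- by rewrite lee_fin mulr_ge0.
Qed.

End space_law.

(** * The Fourier form of the density *)

Section reflection.
Context (R : realType).
Notation mu := (@lebesgue_measure R).

Lemma lebesgue_opp (F : R -> \bar R) : measurable_fun setT F -> (forall x, (0 <= F x)%E) ->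
  (\int[mu]_x F (- x)%R = \int[mu]_x F x)%E.
Proof.
move=> mF F0.
pose opp : measurableTypeR R -> measurableTypeR R := fun x => - x.
have mopp : measurable_fun setT opp by exact: oppr_measurable.
pose m1 := @measure_function_pushforward__canonical__measure_function_Measure _ _ _ _ _ mu opp mopp.
have cov : \bigcup_n `](- n%:R), n%:R]%classic = [set: measurableTypeR R].
  apply/seteqP; split => // x _; exists (Num.bound `|x|) => //=; rewrite in_itv/=.
  by have := archi_boundP (normr_ge0 x); rewrite ltr_norml => /andP[-> /ltW]; exact.
have pre c e : opp @^-1` `]c, e]%classic = `[(- e), (- c)[%classic.
  by apply/seteqP; split => x /=; rewrite !in_itv/= /opp ltrNr lerNl andbC.
have H : forall A, measurable A -> m1 A = mu A.
  apply: (@measure_unique _ _ (measurableTypeR R) (@ocitv R) (fun n => `](- n%:R), n%:R]%classic) erefl (@ocitvI R)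
    (fun n => is_ocitv _ _) cov m1 mu).
  - move=> B /ocitvP[->|[[c e] /= ce ->]]; first by rewrite !measure0.
    rewrite /m1 /= /pushforward /= pre !lebesgue_measure_itv/= !lte_fin ltrN2 ce.
    by rewrite -!EFinD; congr EFin; ring.
  - move=> n; rewrite /m1 /= /pushforward pre lebesgue_measure_itv/=.
    by case: ifP => // _; rewrite -EFinD ltry.
transitivity (\int[m1]_x F x)%E; first by rewrite ge0_integral_pushforward//.
by apply: eq_measure_integral => A mA _; exact: H.
Qed.

Lemma integral_odd (g : R -> R) : mu.-integrable setT (EFin \o g) ->
  (forall x, g (- x) = - g x) -> \int[mu]_x g x = 0.
Proof.
move=> ig odd; have mg : measurable_fun setT (EFin \o g) by exact: measurable_int ig.
have E : (\int[mu]_x ((EFin \o g)^\- x) = \int[mu]_x ((EFin \o g)^\+ x))%E.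
  rewrite -(lebesgue_opp (measurable_funeneg mg) (fun x => funeneg_ge0 _ x)).
  by apply: eq_integral => x _; rewrite funenegE funeposE /= odd opprK.
rewrite /Rintegral integralE E subee//.
exact: (integrable_pos_fin_num measurableT ig).
Qed.

End reflection.

Section density_fourier.
Context (R : realType) d (Omega : measurableType d) (P : probability Omega R)
  (W T : R -> Omega -> R) (nu beta x0 : R).
Hypotheses (nu0 : 0 < nu) (x00 : 0 < x0).
Hypotheses (BM : standard_BM P W) (GS : gamma_subordinator P nu T).
Notation mu := (@lebesgue_measure R).
Notation RR := (measurableTypeR R * measurableTypeR R)%type.
Notation alpha := (alpha nu beta).
Notation rate := (rate nu beta).
Notation subT := (subT T).
Notation tau_pdf := (tau_pdf P W x0 beta).
Notation cos_tau := (cos_tau P W x0 beta).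
Notation sin_tau := (sin_tau P W x0 beta).
Notation tau_dom := (tau_dom x0 beta).

Let mcosE d' (T' : measurableType d') (f : T' -> R) : measurable_fun setT f ->
  measurable_fun setT (fun x => cos (f x)).
Proof. by move=> mf; apply: (measurableT_comp (continuous_measurable_fun (@continuous_cos R)) mf). Qed.

Let msinE d' (T' : measurableType d') (f : T' -> R) : measurable_fun setT f ->
  measurable_fun setT (fun x => sin (f x)).
Proof. by move=> mf; apply: (measurableT_comp (continuous_measurable_fun (@continuous_sin R)) mf). Qed.

Let cos1 (x : R) : `|cos x| <= 1. Proof. by rewrite ler_norml cos_geN1 cos_le1. Qed.
Let sin1 (x : R) : `|sin x| <= 1. Proof. by rewrite ler_norml sin_geN1 sin_le1. Qed.

Let hit01 w : 0 <= (\1_(hit W x0 beta) w : R) <= 1.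
Proof. by rewrite indicE; case: (_ \in _); rewrite ?lexx ?ler01. Qed.

Lemma measurable_cos_tau : measurable_fun setT cos_tau.
Proof. exact: (measurable_cos_transform P (measurable_tau0 BM beta x00) (measurable_hit BM beta x00) hit01). Qed.

Lemma measurable_sin_tau : measurable_fun setT sin_tau.
Proof. exact: (measurable_sin_transform P (measurable_tau0 BM beta x00) (measurable_hit BM beta x00) hit01). Qed.

Section at_time.
Variable s : R.
Hypothesis s0 : 0 < s.

Let msT : measurable_fun setT (T s). Proof. exact: (sub_measurable GS). Qed.

Definition cos_sub (z : R) := \int[P]_w cos (z * T s w).
Definition sin_sub (z : R) := \int[P]_w sin (z * T s w).

Let one01 (w : Omega) : 0 <= (1 : R) <= 1. Proof. by rewrite ler01 lexx. Qed.

Lemma measurable_cos_sub : measurable_fun setT cos_sub.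
Proof.
have := measurable_cos_transform P msT (@measurable_cst _ _ _ _ setT (1 : R)) one01.
by congr measurable_fun; apply/funext => z; apply: eq_Rintegral => w _; rewrite mul1r.
Qed.

Lemma measurable_sin_sub : measurable_fun setT sin_sub.
Proof.
have := measurable_sin_transform P msT (@measurable_cst _ _ _ _ setT (1 : R)) one01.
by congr measurable_fun; apply/funext => z; apply: eq_Rintegral => w _; rewrite mul1r.
Qed.

Let ib (f : Omega -> R) : measurable_fun setT f -> (forall w, `|f w| <= 1) ->
  P.-integrable setT (EFin \o f) /\ `|\int[P]_w f w| <= 1.
Proof.
move=> mf f1; have i1 : P.-integrable setT (EFin \o (fun=> 1 : R)) by exact: finite_measure_integrable_cst.
have i : P.-integrable setT (EFin \o f) by exact: (integrable_dom _ _ i1).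
split => //; rewrite (le_trans (le_normr_Rintegral measurableT i))//.
have -> : 1 = \int[P]_w (fun=> 1 : R) w by rewrite /Rintegral integral_prob_cst.
by apply: (le_Rintegral measurableT _ i1) => //; exact: (integrable_norm i).
Qed.

Let mzT (z : R) : measurable_fun setT (fun w => z * T s w). Proof. exact: measurable_funM. Qed.
Let icos z := ib (mcosE (mzT z)) (fun w => cos1 _).
Let isin z := ib (msinE (mzT z)) (fun w => sin1 _).

Lemma cos_sub_le1 z : `|cos_sub z| <= 1. Proof. exact: (icos z).2. Qed.
Lemma sin_sub_le1 z : `|sin_sub z| <= 1. Proof. exact: (isin z).2. Qed.

Lemma sub_cf z :
  cos_sub z = (1 + (nu * z) ^+ 2) `^ (- (s / nu / 2)) * cos (s / nu * atan (nu * z)) /\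
  sin_sub z = (1 + (nu * z) ^+ 2) `^ (- (s / nu / 2)) * sin (s / nu * atan (nu * z)).
Proof.
apply: (gamma_cf (k := s / nu) msT _ nu0) => //.
- by move=> w; apply: (sub_ge0 GS); exact: ltW.
- by rewrite divr_ge0// ltW.
- move=> u u0; case: (GS) => _ [_ _ _ _ /(_ u 0 s u0 (lexx 0) (ltW s0))] <-.
  by apply: eq_integral => w _; rewrite add0r (sub_0 GS) subr0 mulNr.
Qed.

(* Real and imaginary parts of [E (expR ('i * z * tau)) * E (expR (- 'i * z * T s))]. *)
Definition spec_re z := cos_tau z * cos_sub z + sin_tau z * sin_sub z.
Definition spec_im z := sin_tau z * cos_sub z - cos_tau z * sin_sub z.

Lemma measurable_spec_re : measurable_fun setT spec_re.
Proof.
by apply: measurable_funD; apply: measurable_funM; [exact: measurable_cos_tau|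
  exact: measurable_cos_sub|exact: measurable_sin_tau|exact: measurable_sin_sub].
Qed.

Lemma measurable_spec_im : measurable_fun setT spec_im.
Proof.
by apply: measurable_funB; apply: measurable_funM; [exact: measurable_sin_tau|
  exact: measurable_cos_sub|exact: measurable_cos_tau|exact: measurable_sin_sub].
Qed.

Let mul1_le (a b D : R) : `|a| <= D -> `|b| <= 1 -> `|a * b| <= D.
Proof. by move=> h1 h2; rewrite normrM -[leRHS]mulr1 ler_pM. Qed.

Lemma spec_re_le z : `|spec_re z| <= 2 * tau_dom z.
Proof.
rewrite (le_trans (ler_normD _ _))// mulr2n mulrDl mul1r.
by apply: lerD; apply: mul1_le; rewrite ?(cos_tau_le BM beta x00) ?(sin_tau_le BM beta x00)
  ?cos_sub_le1 ?sin_sub_le1.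
Qed.

Lemma spec_im_le z : `|spec_im z| <= 2 * tau_dom z.
Proof.
rewrite (le_trans (ler_normB _ _))// mulr2n mulrDl mul1r.
by apply: lerD; apply: mul1_le; rewrite ?(cos_tau_le BM beta x00) ?(sin_tau_le BM beta x00)
  ?cos_sub_le1 ?sin_sub_le1.
Qed.

Lemma tau_dom_ge0 z : 0 <= tau_dom z.
Proof. by rewrite mulr_ge0 ?expR_ge0// addr_ge0 ?expR_ge0. Qed.

Lemma integrable_tau_dom_scaled (c : R) : mu.-integrable setT (EFin \o (fun z => c * tau_dom z)).
Proof. by have := integrableZl measurableT c (integrable_tau_dom beta x00). Qed.

Let mzr : measurable_fun [set: RR] (fun z => z.1 * z.2).
Proof. by apply: measurable_funM; [exact: measurable_fst_R|exact: measurable_snd_R]. Qed.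

Let gmean v := (2 * pi)^-1 * \int[mu]_z (spec_re z * cos (z * v) + spec_im z * sin (z * v)).

(** The inversion integral of [tau_pdf] is inserted at [T s w + v]. After Fubini the addition
    formulas separate [T s w] from [v], and the mean over [w] produces the characteristic function
    of [T s]. *)
Lemma shifted_mean_fourier v : shifted_mean P T tau_pdf s v = (gmean v)%:E.
Proof.
pose f (x : Omega * measurableTypeR R) : R :=
  cos_tau x.2 * cos (x.2 * (T s x.1 + v)) + sin_tau x.2 * sin (x.2 * (T s x.1 + v)).
have m2 : measurable_fun [set: Omega * measurableTypeR R] (fun x => x.2 : R) by exact: measurable_snd_R.
have mt : measurable_fun [set: Omega * measurableTypeR R] (fun x => x.2 * (T s x.1 + v)).
  apply: measurable_funM => //; apply: measurable_funD => //.
  by apply: (measurableT_comp msT); exact: measurable_fst.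
have mf : measurable_fun setT f.
  apply: measurable_funD; apply: measurable_funM; [|exact: mcosE| |exact: msinE].
    exact: (measurableT_comp measurable_cos_tau m2).
  exact: (measurableT_comp measurable_sin_tau m2).
have i1 : P.-integrable setT (EFin \o (fun=> 1 : R)) by exact: finite_measure_integrable_cst.
have d0 z : 0 <= 2 * tau_dom z by rewrite mulr_ge0// tau_dom_ge0.
have fb w z : `|f (w, z)| <= 1 * (2 * tau_dom z).
  rewrite mul1r (le_trans (ler_normD _ _))// mulr2n mulrDl mul1r.
  by apply: lerD; apply: mul1_le; rewrite ?(cos_tau_le BM beta x00) ?(sin_tau_le BM beta x00).
have [ii E] := @fubini_Rint _ _ _ _ R P mu f (fun=> 1) (fun z => 2 * tau_dom z) mf i1
  (integrable_tau_dom_scaled 2) (fun=> ler01) d0 fb.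
have iP : P.-integrable setT (EFin \o (fun w => tau_pdf (T s w + v))).
  by have := integrableZl measurableT (2 * pi)^-1 ii.
have -> : shifted_mean P T tau_pdf s v = (\int[P]_w tau_pdf (T s w + v))%:E.
  rewrite /shifted_mean /Rintegral fineK; last exact: (integrable_fin_num _ iP).
  by apply: eq_integral => w _; rewrite /(subT _ _) pos_gt0// mul1r.
congr EFin; rewrite /gmean -/(Rintegral _ _ _).
transitivity ((2 * pi)^-1 * \int[P]_w \int[mu]_z f (w, z)).
  by rewrite -(@RintegralZl _ _ _ P _ _ (2 * pi)^-1 measurableT ii).
congr (_ * _); rewrite E; apply: eq_Rintegral => z _; rewrite /f /=.
have Ic := icos z; have Is := isin z.
pose a := cos_tau z * cos (z * v) + sin_tau z * sin (z * v).
pose b := sin_tau z * cos (z * v) - cos_tau z * sin (z * v).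
transitivity (\int[P]_w (a * cos (z * T s w) + b * sin (z * T s w))).
  apply: eq_Rintegral => w _; rewrite mulrDr cosD sinD /a /b.
  move: (cos _) (cos _) (sin _) (sin _) (cos_tau z) (sin_tau z) => *; ring.
have ia : P.-integrable setT (EFin \o (fun w => a * cos (z * T s w))).
  by have := integrableZl measurableT a Ic.1.
have ib' : P.-integrable setT (EFin \o (fun w => b * sin (z * T s w))).
  by have := integrableZl measurableT b Is.1.
rewrite (RintegralD measurableT ia ib').
rewrite (@RintegralZl _ _ _ P _ _ a measurableT Ic.1) (@RintegralZl _ _ _ P _ _ b measurableT Is.1).
rewrite -/(cos_sub z) -/(sin_sub z) /spec_re /spec_im /a /b.
move: (cos _) (sin _) (cos_tau z) (sin_tau z) (cos_sub z) (sin_sub z) => *; ring.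
Qed.

Section transform.
Variable u : R.
Hypothesis u0 : 0 < u.
Let ev v : R := pos v * expR (- (u * v)).
Let ev0 v : 0 <= ev v. Proof. by rewrite mulr_ge0 ?pos_ge0 ?expR_ge0. Qed.
Let mev : measurable_fun setT ev.
Proof.
apply: measurable_funM; first exact: measurable_pos.
by apply: measurableT_comp => //; apply: measurableT_comp => //; exact: measurable_funM.
Qed.
Let iev : mu.-integrable setT (EFin \o ev).
Proof.
apply/integrableP; split; first exact/measurable_EFinP.
under eq_integral do rewrite /= ger0_norm//.
by rewrite integral_pos_exp// ltry.
Qed.

Let pos_half (g : R -> R) : measurable_fun setT g ->
  \int[mu]_v (ev v * g v) = \int[mu]_(v in `[0, +oo[) (expR (- (u * v)) * g v).
Proof.
move=> mg; have me : measurable_fun setT (fun v => expR (- (u * v))).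
  by apply: measurableT_comp => //; apply: measurableT_comp => //; exact: measurable_funM.
rewrite /Rintegral -integral_itv_obnd_cbnd; last first.
  by apply: measurable_funTS; apply/measurable_EFinP; exact: measurable_funM.
by rewrite -integral_pos; congr fine; apply: eq_integral => v _; rewrite /ev mulrA.
Qed.

(** The Laplace transform of an oscillation is [1 / (u + 'i * z)]: the integrand on the right is the
    real part of [spec_re + 'i * spec_im] divided by [u + 'i * z]. *)
Lemma laplace_of_fourier :
  mu.-integrable setT (EFin \o (fun v => ev v * gmean v)) /\
  \int[mu]_v (ev v * gmean v) =
  (2 * pi)^-1 * \int[mu]_z ((spec_re z * u + spec_im z * z) / (u ^+ 2 + z ^+ 2)).
Proof.
pose f (x : RR) : R := ev x.1 * (spec_re x.2 * cos (x.2 * x.1) + spec_im x.2 * sin (x.2 * x.1)).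
have m1 : measurable_fun [set: RR] (fun x => x.1 : R) by exact: measurable_fst_R.
have m2 : measurable_fun [set: RR] (fun x => x.2 : R) by exact: measurable_snd_R.
have m21 : measurable_fun [set: RR] (fun x => x.2 * x.1) by exact: measurable_funM.
have mf : measurable_fun setT f.
  apply: measurable_funM; first exact: (measurableT_comp mev).
  apply: measurable_funD; apply: measurable_funM; [|exact: mcosE| |exact: msinE].
    exact: (measurableT_comp measurable_spec_re m2).
  exact: (measurableT_comp measurable_spec_im m2).
have d0 z : 0 <= 4 * tau_dom z by rewrite mulr_ge0// tau_dom_ge0.
have fb v z : `|f (v, z)| <= ev v * (4 * tau_dom z).
  rewrite /f normrM (ger0_norm (ev0 v)) ler_wpM2l//= (le_trans (ler_normD _ _))//.
  rewrite (_ : 4 * tau_dom z = 2 * tau_dom z + 2 * tau_dom z); last by ring.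
  by apply: lerD; apply: mul1_le; rewrite ?spec_re_le ?spec_im_le.
have [ii E] := @fubini_Rint _ _ _ _ R mu mu f ev (fun z => 4 * tau_dom z) mf iev
  (integrable_tau_dom_scaled 4) ev0 d0 fb.
have gE v : ev v * gmean v = (2 * pi)^-1 * \int[mu]_z f (v, z).
  rewrite /gmean mulrCA; congr (_ * _).
  rewrite -(@RintegralZl _ _ _ mu _ _ (ev v) measurableT)//.
  have mzv : measurable_fun setT (fun z : R => z * v) by exact: measurable_funM.
  apply: (@integrable_dom _ _ R mu setT (fun z => spec_re z * cos (z * v) + spec_im z * sin (z * v)) _ measurableT _
    (integrable_tau_dom_scaled 4)).
    apply: measurable_funD; apply: measurable_funM; [exact: measurable_spec_re|exact: mcosE|
      exact: measurable_spec_im|exact: msinE].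
  move=> z _; rewrite (le_trans (ler_normD _ _))//.
  rewrite (_ : 4 * tau_dom z = 2 * tau_dom z + 2 * tau_dom z); last by ring.
  by apply: lerD; apply: mul1_le; rewrite ?spec_re_le ?spec_im_le.
split.
  rewrite (_ : (fun v => _) = fun v => (2 * pi)^-1 * \int[mu]_z f (v, z)); last exact/funext.
  by have := integrableZl measurableT (2 * pi)^-1 ii.
under eq_Rintegral do rewrite gE.
rewrite (@RintegralZl _ _ _ mu _ _ (2 * pi)^-1 measurableT ii) E; congr (_ * _).
apply: eq_Rintegral => z _; rewrite /f /=.
have mzv : measurable_fun setT (fun v : R => z * v) by exact: measurable_funM.
have ic : mu.-integrable setT (EFin \o (fun v => ev v * cos (z * v))).
  have mm : measurable_fun [set: measurableTypeR R] (fun v : measurableTypeR R => ev v * cos (z * v)).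
    by apply: (measurable_funM mev); exact: mcosE.
  apply: (@integrable_dom _ _ R mu setT (fun v => ev v * cos (z * v)) ev measurableT mm iev).
  by move=> v _; rewrite normrM (ger0_norm (ev0 v)) ler_piMr.
have is_ : mu.-integrable setT (EFin \o (fun v => ev v * sin (z * v))).
  have mm : measurable_fun [set: measurableTypeR R] (fun v : measurableTypeR R => ev v * sin (z * v)).
    by apply: (measurable_funM mev); exact: msinE.
  apply: (@integrable_dom _ _ R mu setT (fun v => ev v * sin (z * v)) ev measurableT mm iev).
  by move=> v _; rewrite normrM (ger0_norm (ev0 v)) ler_piMr.
transitivity (\int[mu]_v (spec_re z * (ev v * cos (z * v)) + spec_im z * (ev v * sin (z * v)))).
  by apply: eq_Rintegral => v _; move: (ev v) (cos _) (sin _) (spec_re z) (spec_im z) => *; ring.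
have ia : mu.-integrable setT (EFin \o (fun v => spec_re z * (ev v * cos (z * v)))).
  by have := integrableZl measurableT (spec_re z) ic.
have ib' : mu.-integrable setT (EFin \o (fun v => spec_im z * (ev v * sin (z * v)))).
  by have := integrableZl measurableT (spec_im z) is_.
rewrite (RintegralD measurableT ia ib').
rewrite (@RintegralZl _ _ _ mu _ _ (spec_re z) measurableT ic) (@RintegralZl _ _ _ mu _ _ (spec_im z) measurableT is_).
have [hc hs] := expcos_halfline z u0.
rewrite (pos_half (mcosE mzv)) (pos_half (msinE mzv)) hc hs.
by rewrite !mulrA -mulrDl.
Qed.

End transform.

Section radial_kernel.
Variable a : R.
Hypothesis a0 : 0 < a.

Let K r : R := pos r * expR (- (a * (alpha + r))).
Let K0 r : 0 <= K r. Proof. by rewrite mulr_ge0 ?pos_ge0 ?expR_ge0. Qed.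
Let mK : measurable_fun setT K.
Proof.
apply: measurable_funM; first exact: measurable_pos.
by apply: measurableT_comp => //; apply: measurableT_comp => //; apply: measurable_funM => //; exact: measurable_funD.
Qed.
Let iK : mu.-integrable setT (EFin \o K).
Proof.
have h : mu.-integrable setT (EFin \o (fun r => pos r * expR (- (a * r)))).
  have m : measurable_fun setT (fun r : R => pos r * expR (- (a * r))).
    apply: measurable_funM; first exact: measurable_pos.
    by apply: measurableT_comp => //; apply: measurableT_comp => //; exact: measurable_funM.
  apply/integrableP; split; first exact/measurable_EFinP.
  under eq_integral do rewrite /= ger0_norm ?mulr_ge0 ?pos_ge0 ?expR_ge0//.
  by rewrite integral_pos_exp// ltry.
apply: (integrable_dom _ _ h) => // r _; rewrite ger0_norm// ler_wpM2l ?pos_ge0//.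
rewrite ler_expR lerN2 ler_wpM2l ?(ltW a0)// lerDr.
exact: (ltW (alpha_gt0 beta nu0)).
Qed.

(* Real part and minus the imaginary part of the integral over [r] of
   [expR (- a * (alpha + r)) / (rate r + 'i * z)]. *)
Definition radial_cos z := \int[mu]_r (pos r * expR (- (a * (alpha + r))) * (rate r / (rate r ^+ 2 + z ^+ 2))).
Definition radial_sin z := \int[mu]_r (pos r * expR (- (a * (alpha + r))) * (z / (rate r ^+ 2 + z ^+ 2))).

Let rate_ge r : 0 < r -> nu^-1 <= rate r.
Proof.
move=> r0; have al := alpha_gt0 beta nu0.
rewrite -(rate0 beta nu0) /(rate _) ler_pM2r ?invr_gt0// lerD2r addr0.
by rewrite ler_pXn2r ?nnegrE ?addr_ge0 ?(ltW al) ?(ltW r0)// lerDl ltW.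
Qed.

(** With [D = u ^+ 2 + z ^+ 2], the hypotheses give [|x| <= sqrt D] and [1 / nu <= u <= sqrt D]. *)
Let quot_bound (u z x : R) : nu^-1 <= u -> `|x| ^+ 2 <= u ^+ 2 + z ^+ 2 -> `|x / (u ^+ 2 + z ^+ 2)| <= nu.
Proof.
move=> u0 xb; have n0 : 0 < nu^-1 by rewrite invr_gt0.
have u1 : nu^-1 ^+ 2 <= u ^+ 2 by rewrite ler_pXn2r ?nnegrE ?(ltW n0)// (le_trans (ltW n0)).
have D0 : 0 < u ^+ 2 + z ^+ 2 by rewrite ltr_wpDr ?sqr_ge0// (lt_le_trans _ u1)// exprn_gt0.
rewrite normrM (ger0_norm (ltW _ : 0 <= (u ^+ 2 + z ^+ 2)^-1)) ?invr_gt0// ler_pdivrMr//.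
rewrite -(@ler_pXn2r _ 2) ?nnegrE ?mulr_ge0 ?(ltW nu0) ?(ltW D0)// (le_trans xb)//.
rewrite exprMn (expr2 (_ + _)) mulrA ler_peMl ?(ltW D0)//.
have h : nu^-1 ^+ 2 <= u ^+ 2 + z ^+ 2 by rewrite (le_trans u1)// lerDl sqr_ge0.
have := @ler_wpM2l _ (nu ^+ 2) (sqr_ge0 _) _ _ h.
by rewrite -exprMn divff ?gt_eqF// expr1n.
Qed.

Let cq (r z : R) : R := K r * (rate r / (rate r ^+ 2 + z ^+ 2)).
Let sq (r z : R) : R := K r * (z / (rate r ^+ 2 + z ^+ 2)).

Let Kb (r x : R) : (0 < r -> `|x| <= nu) -> `|K r * x| <= nu * K r.
Proof.
move=> h; have [r0|r0] := leP r 0; first by rewrite /K (pos_le0 r0) !mul0r normr0 mulr0.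
by rewrite normrM (ger0_norm (K0 r)) mulrC ler_wpM2r// h.
Qed.

Let cq_le r z : `|cq r z| <= nu * K r.
Proof.
apply: Kb => r0; apply: quot_bound; first exact: rate_ge.
by rewrite real_normK ?num_real// lerDl sqr_ge0.
Qed.

Let sq_le r z : `|sq r z| <= nu * K r.
Proof.
apply: Kb => r0; apply: quot_bound; first exact: rate_ge.
by rewrite real_normK ?num_real// lerDr sqr_ge0.
Qed.

Let mrate : measurable_fun setT rate.
Proof. by apply: continuous_measurable_fun; exact: continuous_rate. Qed.

Let mcq : measurable_fun [set: RR] (fun x => cq x.2 x.1) /\ measurable_fun [set: RR] (fun x => sq x.2 x.1).
Proof.
have m1 : measurable_fun [set: RR] (fun x => x.1 : R) by exact: measurable_fst_R.
have m2 : measurable_fun [set: RR] (fun x => x.2 : R) by exact: measurable_snd_R.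
have mr : measurable_fun [set: RR] (fun x => rate x.2) by exact: (measurableT_comp mrate).
have mi : measurable_fun [set: RR] (fun x => (rate x.2 ^+ 2 + x.1 ^+ 2)^-1).
  apply: (measurableT_comp (@measurable_invr R)).
  by apply: measurable_funD; exact: measurable_funX.
have mKx : measurable_fun [set: RR] (fun x => K x.2) by exact: (measurableT_comp mK).
by split; apply: measurable_funM => //; exact: measurable_funM.
Qed.

(** Stated for general [A] and [B] because it serves twice: [(spec_re, spec_im)] yields the density,
    and [(spec_im, - spec_re)] the integrability of the imaginary part of the integrand. *)
Lemma radial_fubini (A B : R -> R) (c : R) : measurable_fun setT A -> measurable_fun setT B ->
  (forall z, `|A z| <= c * tau_dom z) -> (forall z, `|B z| <= c * tau_dom z) -> 0 <= c ->
  [/\ mu.-integrable setT (EFin \o (fun z => A z * radial_cos z + B z * radial_sin z)),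
      mu.-integrable setT (EFin \o (fun r => K r * \int[mu]_z ((A z * rate r + B z * z) / (rate r ^+ 2 + z ^+ 2)))) &
  \int[mu]_r (K r * \int[mu]_z ((A z * rate r + B z * z) / (rate r ^+ 2 + z ^+ 2))) =
  \int[mu]_z (A z * radial_cos z + B z * radial_sin z)].
Proof.
move=> mA mB Ab Bb c0.
pose f (x : RR) : R := A x.1 * cq x.2 x.1 + B x.1 * sq x.2 x.1.
have m1 : measurable_fun [set: RR] (fun x => x.1 : R) by exact: measurable_fst_R.
have mf : measurable_fun setT f.
  by case: mcq => h1 h2; apply: measurable_funD; apply: measurable_funM => //; exact: (measurableT_comp _ m1).
have d0 z : 0 <= c * tau_dom z by rewrite mulr_ge0// tau_dom_ge0.
have k0 r : 0 <= 2 * nu * K r by rewrite !mulr_ge0// ltW.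
have fb z r : `|f (z, r)| <= (c * tau_dom z) * (2 * nu * K r).
  rewrite (le_trans (ler_normD _ _))//.
  rewrite (_ : _ * (2 * nu * K r) = c * tau_dom z * (nu * K r) + c * tau_dom z * (nu * K r)); last by ring.
  by apply: lerD; rewrite normrM ler_pM.
have ik2 : mu.-integrable setT (EFin \o (fun r => 2 * nu * K r)).
  by have := integrableZl measurableT (2 * nu) iK.
have id := integrable_tau_dom_scaled c.
have [i1 E] := @fubini_Rint _ _ _ _ R mu mu f _ _ mf id ik2 d0 k0 fb.
(* [fubini_Rint] gives integrability in the first variable only; exchanging the coordinates gives it
   in [r]. *)
pose f' (x : RR) := f (x.2, x.1).
have mf' : measurable_fun setT f'.
  by apply: (measurableT_comp mf); apply/measurable_fun_pair; [exact: measurable_snd|exact: measurable_fst].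
have fb' r z : `|f' (r, z)| <= (2 * nu * K r) * (c * tau_dom z) by rewrite mulrC; exact: fb.
have [i2 _] := @fubini_Rint _ _ _ _ R mu mu f' _ _ mf' ik2 id k0 d0 fb'.
have inK : mu.-integrable setT (EFin \o (fun r => nu * K r)) by have := integrableZl measurableT nu iK.
have E1 z : \int[mu]_r f (z, r) = A z * radial_cos z + B z * radial_sin z.
  have msec (g : R -> R -> R) : measurable_fun [set: RR] (fun x => g x.2 x.1) -> measurable_fun setT (g^~ z).
    move=> mg; exact: (measurableT_comp mg (pair1_measurable (z : measurableTypeR R))).
  have ic : mu.-integrable setT (EFin \o cq^~ z).
    by apply: (integrable_dom _ _ inK) => //; exact: (msec cq mcq.1).
  have is_ : mu.-integrable setT (EFin \o sq^~ z).
    by apply: (integrable_dom _ _ inK) => //; exact: (msec sq mcq.2).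
  have iA : mu.-integrable setT (EFin \o (fun r => A z * cq r z)) by have := integrableZl measurableT (A z) ic.
  have iB : mu.-integrable setT (EFin \o (fun r => B z * sq r z)) by have := integrableZl measurableT (B z) is_.
  rewrite /f /= (RintegralD measurableT iA iB).
  by rewrite (@RintegralZl _ _ _ mu _ _ (A z) measurableT ic) (@RintegralZl _ _ _ mu _ _ (B z) measurableT is_).
have E2 r : K r * \int[mu]_z ((A z * rate r + B z * z) / (rate r ^+ 2 + z ^+ 2)) = \int[mu]_z f (z, r).
  have [r0|r0] := leP r 0.
    have Kr0 : K r = 0 by rewrite /K (pos_le0 r0) mul0r.
    rewrite Kr0 mul0r /Rintegral integral0_eq// => z _.
    by rewrite /f /cq /sq /= Kr0 !(mul0r, mulr0) addr0.
  have q (x z : R) : `|x| ^+ 2 <= rate r ^+ 2 + z ^+ 2 -> `|x / (rate r ^+ 2 + z ^+ 2)| <= nu.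
    by apply: quot_bound; exact: rate_ge.
  have qr (z : R) : `|rate r / (rate r ^+ 2 + z ^+ 2)| <= nu.
    by apply: q; rewrite real_normK ?num_real// lerDl sqr_ge0.
  have qz (z : R) : `|z / (rate r ^+ 2 + z ^+ 2)| <= nu.
    by apply: q; rewrite real_normK ?num_real// lerDr sqr_ge0.
  rewrite -(@RintegralZl _ _ _ mu _ _ (K r) measurableT).
    have e (k A' B' u v i : R) : k * ((A' * u + B' * v) * i) = A' * (k * (u * i)) + B' * (k * (v * i)) by ring.
    by apply: eq_Rintegral => z _; exact: e.
  apply: (@integrable_dom _ _ R mu setT (fun z => (A z * rate r + B z * z) / (rate r ^+ 2 + z ^+ 2)) _ measurableT _
    (integrable_tau_dom_scaled (2 * nu * c))).
    apply: measurable_funM; first by apply: measurable_funD; exact: measurable_funM.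
    by apply: (measurableT_comp (@measurable_invr R)); apply: measurable_funD => //; exact: measurable_funX.
  move=> z _; rewrite mulrDl -(mulrA (A z)) -(mulrA (B z)) (le_trans (ler_normD _ _))//.
  rewrite [leRHS](_ : _ = c * tau_dom z * nu + c * tau_dom z * nu); last by ring.
  apply: lerD; rewrite normrM.
    exact: (ler_pM (normr_ge0 _) (normr_ge0 _) (Ab z) (qr z)).
  exact: (ler_pM (normr_ge0 _) (normr_ge0 _) (Bb z) (qz z)).
split.
- by rewrite (_ : (fun z => _) = fun z => \int[mu]_r f (z, r)) //; apply/funext => z; rewrite E1.
- by rewrite (_ : (fun r => _) = fun r => \int[mu]_z f (z, r)) //; exact/funext.
- under [LHS]eq_Rintegral do rewrite E2.
  by rewrite -E; apply: eq_Rintegral => z _; rewrite E1.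
Qed.

End radial_kernel.

(** The prefactor collects [1 / nu] from [space_kernel] and [1 / (2 * pi)] from the inversion
    formula. The condition on [y] provides the exponential decay in [r] that justifies Fubini. *)
Lemma joint_density_fourier y : y != 0 ->
  joint_density P T nu beta tau_pdf s y =
  (expR (beta * y) / (2 * pi * nu) * \int[mu]_z (spec_re z * radial_cos `|y| z + spec_im z * radial_sin `|y| z))%:E.
Proof.
move=> y0; have a0 : 0 < `|y| by rewrite normr_gt0.
have c0 : 0 <= 2 :> R by [].
have [_ i2 E] := radial_fubini a0 measurable_spec_re measurable_spec_im spec_re_le spec_im_le c0.
rewrite -E; set k := expR _ / _.
transitivity (\int[mu]_r (k * (pos r * expR (- (`|y| * (alpha + r))) *
   \int[mu]_z ((spec_re z * rate r + spec_im z * z) / (rate r ^+ 2 + z ^+ 2))))%:E)%E.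
  apply: eq_integral => r _; have [r0|r0] := leP r 0.
    by rewrite /space_kernel (pos_le0 r0) !(mul0r, mulr0) mul0e.
  have [il El] := laplace_of_fourier (rate_gt0 beta nu0 (ltW r0)).
  have -> : shifted_transform P T nu beta tau_pdf s r =
      ((2 * pi)^-1 * \int[mu]_z ((spec_re z * rate r + spec_im z * z) / (rate r ^+ 2 + z ^+ 2)))%:E.
    rewrite -El /shifted_transform /Rintegral fineK; last exact: (integrable_fin_num _ il).
    by apply: eq_integral => v _; rewrite shifted_mean_fourier -EFinM.
  rewrite -EFinM; congr EFin; rewrite /space_kernel /k.
  move: (expR _) (expR _) (\int[_]_z _) => e1 e2 I.
  have p0 := pi_gt0 R; move: (pi : R) p0 => p p0.
  by field; rewrite !gt_eqF.
have ik : mu.-integrable setT (EFin \o (fun r => k * (pos r * expR (- (`|y| * (alpha + r))) *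
   \int[mu]_z ((spec_re z * rate r + spec_im z * z) / (rate r ^+ 2 + z ^+ 2))))).
  by have := integrableZl measurableT k i2.
rewrite -(@RintegralZl _ _ _ mu _ _ k measurableT i2) /Rintegral fineK//.
exact: (integrable_fin_num _ ik).
Qed.

End at_time.
End density_fourier.

(** * The exponential integral *)

(* No integrability is needed: a divergent integral has the value [0]. *)
Lemma RintegralN_total d (T : measurableType d) (R : realType) (m : {measure set T -> \bar R}) (f : T -> R) :
  \int[m]_x (- f x) = - \int[m]_x f x.
Proof.
rewrite /Rintegral !(integralE m setT (fun x => (_ x)%:E)) integralE.
rewrite (_ : (fun x => (- f x)%:E) = (\- (EFin \o f))%E); last exact/funext.
rewrite funeposN funenegN -[fun x => (f x)%:E]/(EFin \o f).
have := @integral_ge0 _ _ _ m setT _ (fun x _ => funepos_ge0 (EFin \o f) x) : (0 <= \int[m]_x (EFin \o f)^\+ x)%E.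
have := @integral_ge0 _ _ _ m setT _ (fun x _ => funeneg_ge0 (EFin \o f) x) : (0 <= \int[m]_x (EFin \o f)^\- x)%E.
case: (integral _ _ _) => [u| |]; case: (integral _ _ _) => [v| |] //= _ _; rewrite ?oppr0//.
by rewrite opprB.
Qed.

Section off_point.
Context (R : realType).
Notation mu := (@lebesgue_measure R).
Variables (a : R) (f h : R -> R).
Hypothesis ih : mu.-integrable setT (EFin \o h).
Hypothesis fh : forall x, x != a -> f x = h x.

Let mf : measurable_fun setT f.
Proof.
have mh : measurable_fun setT h by apply/measurable_EFinP; exact: measurable_int ih.
have -> : f = fun x => h x + (f a - h a) * \1_[set a] x.
  apply/funext => x; rewrite indicE; have [->|xa] := eqVneq x a.
    by rewrite mem_set// mulr1 addrC subrK.
  by rewrite memNset ?mulr0 ?addr0 ?fh//; exact/eqP.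
by apply: measurable_funD => //; exact: measurable_funM.
Qed.

Let aefh : ae_eq mu setT (EFin \o h) (EFin \o f).
Proof.
exists [set a]; split => //; first exact: lebesgue_measure_set1.
move=> x /= nx; have [//|xa] := eqVneq x a.
by exfalso; apply: nx => _; rewrite fh.
Qed.

(** Changing a function at one point preserves measurability as well. It is applied at [z = 0],
    where the formulas in terms of the complex square root have not been established. *)
Lemma integrable_off_point : mu.-integrable setT (EFin \o f).
Proof.
have [/measurable_EFinP mh fh'] := integrableP _ _ _ ih.
apply/integrableP; split; first exact/measurable_EFinP.
rewrite (_ : integral _ _ _ = \int[mu]_x `|(EFin \o h) x|)%E//.
apply: (@integral_off_point R a) => //.
- by apply: measurableT_comp => //; exact/measurable_EFinP.
- by apply: measurableT_comp => //; exact/measurable_EFinP.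
- by move=> x xa /=; rewrite fh.
Qed.

Lemma Rintegral_off_point : \int[mu]_x f x = \int[mu]_x h x.
Proof.
rewrite /Rintegral; congr fine; apply/esym/ae_eq_integral => //.
  exact: measurable_int ih.
by apply/measurable_EFinP; exact: mf.
Qed.

End off_point.

Section complex_integral.
Context (R : realType).
Notation mu := (@lebesgue_measure R).
Notation C := R[i].

Lemma complex_eqP (x y : C) : complex.Re x = complex.Re y -> complex.Im x = complex.Im y -> x = y.
Proof. by case: x => a b; case: y => c d /= -> ->. Qed.

Lemma complex_mulE (x y : C) :
  x * y = ((cRe x * cRe y - cIm x * cIm y) +i* (cRe x * cIm y + cIm x * cRe y))%C.
Proof. by case: x => a b; case: y => c d. Qed.

Lemma cexpD (x y : C) : cexp (x + y) = cexp x * cexp y.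
Proof.
case: x => a b; case: y => c d; apply: complex_eqP; rewrite /cexp /cRe /cIm /= expRD.
  by rewrite cosD; move: (expR _) (expR _) (cos _) (cos _) (sin _) (sin _) => *; ring.
by rewrite sinD; move: (expR _) (expR _) (cos _) (cos _) (sin _) (sin _) => *; ring.
Qed.

Lemma cexp_real (x : R) : cexp (toC x) = toC (expR x).
Proof. by rewrite /cexp /toC /cRe /cIm /= cos0 sin0 mulr1 mulr0. Qed.

Lemma cintegralB (D : set (measurableTypeR R)) (f g : R -> C) : measurable D -> cintegrable D f -> cintegrable D g ->
  cintegral D f - cintegral D g = cintegral D (fun t => f t - g t).
Proof.
move=> mD [f1 f2] [g1 g2].
have h (f' : R -> C) (g' : R -> C) (t : R) :
  (cRe (f' t - g' t) = cRe (f' t) - cRe (g' t)) /\ (cIm (f' t - g' t) = cIm (f' t) - cIm (g' t)).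
  by case: (f' t) => a b; case: (g' t) => c d.
apply: complex_eqP; rewrite /cintegral /=.
  rewrite -(RintegralB mD f1 g1); apply: eq_Rintegral => t _.
  by rewrite (h f g t).1.
rewrite -(RintegralB mD f2 g2); apply: eq_Rintegral => t _.
by rewrite (h f g t).2.
Qed.

Lemma cintegrableB (D : set (measurableTypeR R)) (f g : R -> C) : measurable D -> cintegrable D f -> cintegrable D g ->
  cintegrable D (fun t => f t - g t).
Proof.
move=> mD [f1 f2] [g1 g2]; split.
  have := integrableB mD f1 g1; congr (integrable _ _ _); apply/funext => t /=.
  by case: (f t) => a b; case: (g t) => c d.
have := integrableB mD f2 g2; congr (integrable _ _ _); apply/funext => t /=.
by case: (f t) => a b; case: (g t) => c d.
Qed.

Lemma cintegralZ (D : set (measurableTypeR R)) (c : C) (f : R -> C) : measurable D -> cintegrable D f ->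
  c * cintegral D f = cintegral D (fun t => c * f t).
Proof.
move=> mD [f1 f2]; case: c => a b.
have e1 := integrableZl mD a f1. have e2 := integrableZl mD b f2.
have e3 := integrableZl mD a f2. have e4 := integrableZl mD b f1.
rewrite /cintegral complex_mulE /cRe /cIm /=; apply: complex_eqP => /=.
  rewrite -(@RintegralZl _ _ _ mu D _ a mD f1) -(@RintegralZl _ _ _ mu D _ b mD f2).
  rewrite -(RintegralB mD e1 e2); apply: eq_Rintegral => t _.
  by rewrite complex_mulE.
rewrite -(@RintegralZl _ _ _ mu D _ a mD f2) -(@RintegralZl _ _ _ mu D _ b mD f1).
rewrite -(RintegralD mD e3 e4); apply: eq_Rintegral => t _.
by rewrite complex_mulE.
Qed.

Lemma stieltjes_parts (e t : R) (w : C) : cIm w != 0 ->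
  toC e / (toC t + w) =
  ((e * ((t + cRe w) / ((t + cRe w) ^+ 2 + cIm w ^+ 2))) +i*
   (- (e * (cIm w / ((t + cRe w) ^+ 2 + cIm w ^+ 2)))))%C.
Proof.
case: w => X Y; rewrite /cRe /cIm /toC /= => Y0.
apply: complex_eqP; rewrite /= ?add0r ?mul0r ?subr0 ?addr0 //.
by rewrite mulrN.
Qed.

(** Off the real axis the denominator stays at distance at least the absolute value of [cIm w] from
    0, so the exponential dominates. *)
Lemma cintegrable_stieltjes (w : C) : cIm w != 0 ->
  cintegrable `[0, +oo[ (fun t => toC (expR (- t)) / (toC t + w)).
Proof.
move=> Y0; have [ie _] := @integrable_expRN_halfline R 1 ltr01.
have m0y : measurable (`[0, +oo[%classic : set (measurableTypeR R)) by [].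
set X := cRe w; set Y := cIm w.
have aY : 0 < `|Y| by rewrite normr_gt0.
have D0 t : 0 < (t + X) ^+ 2 + Y ^+ 2.
  by rewrite ltr_wpDl ?sqr_ge0// lt_neqAle eq_sym sqrf_eq0 Y0 sqr_ge0.
have ib := integrableZl m0y `|Y|^-1 ie.
have mD : measurable_fun setT (fun t : R => ((t + X) ^+ 2 + Y ^+ 2)^-1).
  apply: (measurableT_comp (@measurable_invr R)); apply: measurable_funD => //.
  by apply: measurable_funX; exact: measurable_funD.
have me : measurable_fun setT (fun t : R => expR (- t)) by apply: measurableT_comp.
have bnd (t x : R) : `|x| * `|Y| <= (t + X) ^+ 2 + Y ^+ 2 ->
    `|expR (- t) * (x * ((t + X) ^+ 2 + Y ^+ 2)^-1)| <= `|Y|^-1 * expR (- (1 * t)).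
  move=> h; rewrite mul1r normrM (ger0_norm (expR_ge0 _)) mulrC ler_wpM2r ?expR_ge0//.
  rewrite normrM (ger0_norm (ltW _ : 0 <= ((t + X) ^+ 2 + Y ^+ 2)^-1)) ?invr_gt0//.
  by rewrite ler_pdivrMr// mulrC ler_pdivlMr.
split.
  rewrite (_ : (fun t => _) = EFin \o (fun t => expR (- t) * ((t + X) / ((t + X) ^+ 2 + Y ^+ 2)))); last first.
    by apply/funext => t; rewrite stieltjes_parts.
  apply: (@integrable_dom _ _ R mu `[0, +oo[%classic _ _ m0y _ ib) => [|t _].
    apply: measurable_funTS; apply: measurable_funM => //; apply: measurable_funM => //.
    exact: measurable_funD.
  apply: bnd; rewrite -[in leRHS](real_normK (num_real (t + X))) -[in leRHS](real_normK (num_real Y)).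
  by move: `|t + X| `|Y| => v y; have := sqr_ge0 (v - y); have := sqr_ge0 (v + y); nra.
rewrite (_ : (fun t => _) = EFin \o (fun t => - (expR (- t) * (Y / ((t + X) ^+ 2 + Y ^+ 2))))); last first.
  by apply/funext => t; rewrite stieltjes_parts.
apply: (@integrable_dom _ _ R mu `[0, +oo[%classic _ _ m0y _ ib) => [|t _].
  apply: measurable_funTS; apply: measurableT_comp => //; apply: measurable_funM => //.
  exact: measurable_funM.
by rewrite normrN; apply: bnd; rewrite -expr2 real_normK ?num_real// lerDr sqr_ge0.
Qed.

End complex_integral.

(** * The difference of the two exponential integrals *)

Section bracket.
Context (R : realType).
Notation mu := (@lebesgue_measure R).
Variables (nu beta z a : R).
Hypotheses (nu0 : 0 < nu) (z0 : z != 0) (a0 : 0 < a).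
Notation alpha := (alpha nu beta).
Notation rate := (rate nu beta).

Definition csqrt_parts : R[i] := (qre beta z +i* qim beta z)%C.
Notation q := csqrt_parts.

Lemma qim_neq0 : qim beta z != 0.
Proof.
apply/eqP => h; have := qre_qim beta z0; rewrite h mulr0 => /esym/eqP.
by rewrite oppr_eq0 (negbTE z0).
Qed.

Lemma csqrt_parts_sq : q * q = toC (beta ^+ 2) - toC 2 * cI * toC z.
Proof.
apply: complex_eqP; rewrite /csqrt_parts /toC /cI /=.
  by rewrite -!expr2 (qre_qim_sq beta z0); ring.
by rewrite (mulrC (qim _ _)) (qre_qim beta z0); ring.
Qed.

(** Two square roots of one number agree up to sign. The principal one has nonnegative real part and
    [qre] is positive, which excludes the minus sign. *)
Lemma sqrtc_parts : sqrtc (toC (beta ^+ 2) - toC 2 * cI * toC z) = q.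
Proof.
set w := (X in sqrtc X); have h : sqrtc w ^+ 2 = q ^+ 2 by rewrite sqr_sqrtc expr2 csqrt_parts_sq.
have re0 : 0 <= complex.Re (sqrtc w) by case: (w) => x y /=; exact: sqrtr_ge0.
move/eqP: h; rewrite eqf_sqr => /orP[/eqP//|/eqP h].
by move: re0; rewrite h /= oppr_ge0 leNgt (qre_gt0 beta z0).
Qed.

Let neq0_im (w : R[i]) : cIm w != 0 -> w != 0.
Proof. by apply: contra => /eqP ->. Qed.

Let wm : R[i] := toC a * (toC alpha - q).
Let wp : R[i] := toC a * (toC alpha + q).

Let im_wm : cIm wm != 0.
Proof.
rewrite /wm complex_mulE /cIm /cRe /= mul0r addr0 sub0r mulf_neq0 ?oppr_eq0 ?qim_neq0//.
by rewrite gt_eqF.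
Qed.

Let im_wp : cIm wp != 0.
Proof.
rewrite /wp complex_mulE /cIm /cRe /= mul0r addr0 add0r mulf_neq0 ?qim_neq0//.
by rewrite gt_eqF.
Qed.

Let toC0 (x : R) : x != 0 -> toC x != 0.
Proof.
by move=> x0; apply: contra x0 => /eqP h; apply/eqP; exact: (congr1 (@cRe R) h).
Qed.

Let iz : R[i] := (0 +i* z)%C.

(* With [t = a * r] in the Stieltjes form of [Ei], this is the partial fraction
   decomposition of [1 / (rate r + 'i * z)]. *)
Let resolvent_identity t :
  toC (expR (- t)) / (toC t + wm) - toC (expR (- t)) / (toC t + wp) =
  (q / toC a) * (toC (expR (- t)) / (toC (rate (t / a)) + iz)).
Proof.
set e := toC (expR _); set m := toC t + wm; set p := toC t + wp; set dd := _ + iz.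
have m0 : m != 0.
  by apply: neq0_im; rewrite /m; move: im_wm; case: wm => x y; rewrite /cIm /toC /= add0r.
have p0 : p != 0.
  by apply: neq0_im; rewrite /p; move: im_wp; case: wp => x y; rewrite /cIm /toC /= add0r.
have d0 : dd != 0 by apply: neq0_im; rewrite /cIm /dd /toC /= add0r.
have A0 : toC a != 0 by apply: toC0; rewrite gt_eqF.
have tw0 : toC (2 : R) != 0 by apply: toC0.
have mp : m * p = toC 2 * toC a * toC a * dd.
  have -> : m * p = (toC t + toC a * toC alpha) * (toC t + toC a * toC alpha) - toC a * toC a * (q * q).
    by rewrite /m /p /wm /wp; ring.
  rewrite csqrt_parts_sq /dd /iz /(rate _); apply: complex_eqP; rewrite /toC /cI /=.
    by field; rewrite gt_eqF.
  by ring.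
have -> : e / m - e / p = e * (p - m) / (m * p) by field; rewrite m0 p0.
have -> : p - m = toC 2 * toC a * q.
  rewrite /m /p /wm /wp (_ : toC 2 = 1 + 1); first by ring.
  by apply: complex_eqP; rewrite /toC /= ?addr0.
have aux (E A Q D t2 : R[i]) : t2 != 0 -> A != 0 -> D != 0 ->
    E * (t2 * A * Q) / (t2 * A * A * D) = Q / A * (E / D).
  by move=> h1 h2 h3; field; rewrite h1 h2 h3.
by rewrite mp; exact: aux.
Qed.

(** The substitution [t = a * r] matches the integrals over the mixture parameter with the Stieltjes
    integrals in the definition of [Ei]. *)
Lemma radial_scale (phi : R -> R) (M : R) : measurable_fun setT phi -> (forall r, `|phi r| <= M) ->
  \int[mu]_r (pos r * expR (- (a * (alpha + r))) * phi r) =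
  expR (- (a * alpha)) * (a^-1 * \int[mu]_(t in `[0, +oo[) (expR (- t) * phi (t / a))).
Proof.
move=> mphi phiM.
have mpe (c : R) : measurable_fun setT (fun r : R => pos r * expR (- (c * r))).
  apply: measurable_funM; first exact: measurable_pos.
  by apply: measurableT_comp => //; apply: measurableT_comp => //; exact: measurable_funM.
have ipe (c : R) : 0 < c -> mu.-integrable setT (EFin \o (fun r => M * (pos r * expR (- (c * r))))).
  move=> c0; have h : mu.-integrable setT (EFin \o (fun r => pos r * expR (- (c * r)))).
    apply/integrableP; split; first by apply/measurable_EFinP; exact: mpe.
    under eq_integral do rewrite /= ger0_norm ?mulr_ge0 ?pos_ge0 ?expR_ge0//.
    by rewrite integral_pos_exp// ltry.
  by have := integrableZl measurableT M h.
have bnd (c r x : R) : `|x| <= M -> `|pos r * expR (- (c * r)) * x| <= M * (pos r * expR (- (c * r))).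
  move=> xM; have p0 : 0 <= pos r * expR (- (c * r)) by rewrite mulr_ge0 ?pos_ge0 ?expR_ge0.
  by rewrite normrM (ger0_norm p0) mulrC ler_wpM2r.
pose F (t : R) := pos t * expR (- (1 * t)) * phi (t / a).
have mphia : measurable_fun setT (fun t : R => phi (t / a)).
  by apply: (measurableT_comp mphi); exact: measurable_funM.
have iF : mu.-integrable setT (EFin \o F).
  apply: (@integrable_dom _ _ R mu setT F _ measurableT _ (ipe 1 ltr01)) => [|t _].
    by apply: measurable_funM; [exact: mpe|exact: mphia].
  exact: bnd.
have -> : \int[mu]_(t in `[0, +oo[) (expR (- t) * phi (t / a)) = \int[mu]_t F t.
  rewrite /Rintegral -integral_itv_obnd_cbnd; last first.
    apply: measurable_funTS; apply/measurable_EFinP; apply: measurable_funM => //.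
    exact: measurableT_comp.
  rewrite -integral_pos; congr fine; apply: eq_integral => t _.
  by rewrite /F mul1r mulrA.
rewrite -(Rlebesgue_affine 0 a0 iF).
have posa r : pos (a * r) = pos r.
  have [r0|r0] := leP r 0; first by rewrite !pos_le0// pmulr_rle0.
  by rewrite !pos_gt0// pmulr_rgt0.
have FE r : F (a * r + 0) = pos r * expR (- (a * r)) * phi r.
  rewrite /F addr0 posa mul1r; congr (_ * _ * phi _).
  by rewrite [a * r]mulrC mulfK// gt_eqF.
have iF' : mu.-integrable setT (EFin \o (fun r => F (a * r + 0))).
  apply: (@integrable_dom _ _ R mu setT _ _ measurableT _ (ipe a a0)) => [|r _].
    rewrite (_ : (fun r => _) = fun r => pos r * expR (- (a * r)) * phi r); last exact/funext.
    by apply: measurable_funM; [exact: mpe|exact: mphi].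
  by rewrite FE; exact: bnd.
rewrite -(@RintegralZl _ _ _ mu setT _ (expR (- (a * alpha))) measurableT iF').
apply: eq_Rintegral => r _; rewrite FE mulrDr opprD expRD.
by move: (pos r) (expR _) (expR _) (phi r) => *; ring.
Qed.

Let rb (u : R) : `|u / (u ^+ 2 + z ^+ 2)| <= `|z|^-1 /\ `|z / (u ^+ 2 + z ^+ 2)| <= `|z|^-1.
Proof.
have aY : 0 < `|z| by rewrite normr_gt0.
have D0 : 0 < u ^+ 2 + z ^+ 2.
  by rewrite ltr_wpDl ?sqr_ge0// lt_neqAle eq_sym sqrf_eq0 z0 sqr_ge0.
rewrite !normrM (ger0_norm (ltW _ : 0 <= (u ^+ 2 + z ^+ 2)^-1)) ?invr_gt0//.
rewrite !ler_pdivrMr// ![_^-1 * _]mulrC !ler_pdivlMr//; split; last first.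
  by rewrite -expr2 real_normK ?num_real// lerDr sqr_ge0.
rewrite -[in leRHS](real_normK (num_real u)) -[in leRHS](real_normK (num_real z)).
by move: `|u| `|z| => v y; have := sqr_ge0 (v - y); have := sqr_ge0 (v + y); nra.
Qed.

Let mrate : measurable_fun setT rate.
Proof. by apply: continuous_measurable_fun; exact: continuous_rate. Qed.

Let mD : measurable_fun setT (fun r => (rate r ^+ 2 + z ^+ 2)^-1).
Proof.
apply: (measurableT_comp (@measurable_invr R)); apply: measurable_funD => //.
exact: measurable_funX.
Qed.

(** In each product the exponential in front cancels the part of [cexp] in [Ei] that depends on [q].
    The common factor [expR (- (a * alpha))] remains, together with a difference of Stieltjes
    integrals to which [resolvent_identity] applies. *)
Lemma Ei_bracket :
  cexp (toC a * q) * Ei (- (toC a * (toC alpha + q))) -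
  cexp (- (toC a * q)) * Ei (- (toC a * (toC alpha - q))) =
  q * (radial_cos nu beta a z +i* (- radial_sin nu beta a z))%C.
Proof.
have m0y : measurable (`[0, +oo[%classic : set (measurableTypeR R)) by [].
have EiE (w : R[i]) : Ei (- w) = - (cexp (- w) * cintegral `[0, +oo[ (fun t => toC (expR (- t)) / (toC t + w))).
  by rewrite /Ei; congr (- (_ * cintegral _ _)); apply/funext => t; rewrite opprK.
rewrite !EiE -/wp -/wm.
set Ip := cintegral _ _; set Im := cintegral _ _.
have e1 : cexp (toC a * q) * cexp (- wp) = toC (expR (- (a * alpha))).
  rewrite -cexpD -cexp_real; congr cexp; rewrite /wp mulrDr opprD addrCA subrr addr0.
  by apply: complex_eqP; rewrite /toC /=; ring.
have e2 : cexp (- (toC a * q)) * cexp (- wm) = toC (expR (- (a * alpha))).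
  rewrite -cexpD -cexp_real; congr cexp; rewrite /wm mulrBr opprB addrA addNr add0r.
  by apply: complex_eqP; rewrite /toC /=; ring.
have -> : cexp (toC a * q) * - (cexp (- wp) * Ip) - cexp (- (toC a * q)) * - (cexp (- wm) * Im) =
    toC (expR (- (a * alpha))) * (Im - Ip).
  by rewrite mulrN mulrN opprK !mulrA e1 e2 addrC mulrBr.
rewrite (cintegralB m0y (cintegrable_stieltjes im_wm) (cintegrable_stieltjes im_wp)).
have cB := cintegrableB m0y (cintegrable_stieltjes im_wm) (cintegrable_stieltjes im_wp).
have A0 : toC a != 0 by apply: toC0; rewrite gt_eqF.
have q0 : q != 0 by apply: neq0_im; exact: qim_neq0.
have aux (A B X : R[i]) : A != 0 -> B != 0 -> X = A / B * (B / A * X).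
  by move=> h1 h2; field; rewrite h1 h2.
pose g t : R[i] := toC (expR (- t)) / (toC (rate (t / a)) + iz).
have gE : cintegral `[0, +oo[ g = (toC a / q) * cintegral `[0, +oo[ (fun t =>
    toC (expR (- t)) / (toC t + wm) - toC (expR (- t)) / (toC t + wp)).
  rewrite (cintegralZ _ m0y cB); congr cintegral; apply/funext => t.
  by rewrite resolvent_identity; exact: aux.
rewrite [X in _ * X](_ : _ = (q / toC a) * cintegral `[0, +oo[ g); last by rewrite gE; exact: aux.
have gparts : cintegral `[0, +oo[ g =
   ((\int[mu]_(t in `[0, +oo[) (expR (- t) * (rate (t / a) / (rate (t / a) ^+ 2 + z ^+ 2)))) +i*
    (- \int[mu]_(t in `[0, +oo[) (expR (- t) * (z / (rate (t / a) ^+ 2 + z ^+ 2)))))%C.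
  have gp t : g t = ((expR (- t) * (rate (t / a) / (rate (t / a) ^+ 2 + z ^+ 2))) +i*
      (- (expR (- t) * (z / (rate (t / a) ^+ 2 + z ^+ 2)))))%C.
    by rewrite /g stieltjes_parts// /iz /cRe /cIm /= addr0.
  rewrite (_ : g = fun t => ((expR (- t) * (rate (t / a) / (rate (t / a) ^+ 2 + z ^+ 2))) +i*
      (- (expR (- t) * (z / (rate (t / a) ^+ 2 + z ^+ 2)))))%C); last exact/funext.
  rewrite /cintegral /cRe /cIm; congr (_ +i* _)%C.
  under eq_Rintegral do rewrite /= -mulN1r.
  rewrite RintegralZl ?mulN1r//.
  have [ie _] := @integrable_expRN_halfline R 1 ltr01.
  apply: (@integrable_dom _ _ R mu `[0, +oo[%classic _ _ m0y _ (integrableZl m0y `|z|^-1 ie)) => [|t _].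
    apply: measurable_funTS; apply: measurable_funM; first exact: measurableT_comp.
    apply: (@measurableT_comp _ _ _ _ _ _ (fun r => z / (rate r ^+ 2 + z ^+ 2)) _ (fun t : R => t / a)).
      exact: measurable_funM.
    exact: measurable_funM.
  rewrite mul1r normrM (ger0_norm (expR_ge0 _)) mulrC ler_wpM2r ?expR_ge0//.
  by case: (rb (rate (t / a))).
rewrite gparts /radial_cos /radial_sin.
rewrite (@radial_scale (fun r => rate r / (rate r ^+ 2 + z ^+ 2)) `|z|^-1); last 2 first.
- exact: measurable_funM.
- by move=> r; case: (rb (rate r)).
rewrite (@radial_scale (fun r => z / (rate r ^+ 2 + z ^+ 2)) `|z|^-1); last 2 first.
- exact: measurable_funM.
- by move=> r; case: (rb (rate r)).
rewrite (_ : (_ +i* - (expR _ * (_ * _)))%C = toC (expR (- (a * alpha))) * toC a^-1 *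
   ((\int[mu]_(t in `[0, +oo[) (expR (- t) * (rate (t / a) / (rate (t / a) ^+ 2 + z ^+ 2)))) +i*
    (- \int[mu]_(t in `[0, +oo[) (expR (- t) * (z / (rate (t / a) ^+ 2 + z ^+ 2)))))%C); last first.
  by apply: complex_eqP; rewrite /toC /=; ring.
have -> : toC a^-1 = (toC a)^-1 by rewrite /toC fmorphV.
by rewrite !mulrA; congr (_ * _); rewrite mulrAC mulrC !mulrA.
Qed.

End bracket.

(** * The stated integrand in terms of the transforms *)

Section integrand.
Context (R : realType) d (Omega : measurableType d) (P : probability Omega R)
  (W T : R -> Omega -> R) (nu beta x0 : R).
Hypotheses (nu0 : 0 < nu) (x00 : 0 < x0).
Hypotheses (BM : standard_BM P W) (GS : gamma_subordinator P nu T).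
Notation mu := (@lebesgue_measure R).
Variables (s x1 : R).
Hypotheses (s0 : 0 < s) (x10 : x1 != 0).
Notation spec_re := (spec_re P W T beta x0 s).
Notation spec_im := (spec_im P W T beta x0 s).
Notation rcos := (radial_cos nu beta `|x1|).
Notation rsin := (radial_sin nu beta `|x1|).

Let a0 : 0 < `|x1|. Proof. by rewrite normr_gt0. Qed.

(** The base has real part 1, so [carg] is in its first branch and equals [atan (nu * z)]; the power
    is the conjugate of the characteristic function of [T s]. *)
Lemma cpow_cf z : cpow (1 + cI * toC nu * toC z) (toC (- (s / nu))) =
  (cos_sub P T s z +i* (- sin_sub P T s z))%C.
Proof.
have [-> ->] := sub_cf nu0 GS s0 z.
have D0 : 0 < 1 + (nu * z) ^+ 2 by rewrite ltr_wpDr ?sqr_ge0.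
have wE : 1 + cI * toC nu * toC z = (1 +i* (nu * z))%C.
  by apply: complex_eqP; rewrite /toC /cI /=; ring.
have lnE : ln (Num.sqrt (1 + (nu * z) ^+ 2)) = ln (1 + (nu * z) ^+ 2) / 2.
  rewrite -[in RHS](sqr_sqrtr (ltW D0)) lnXn ?sqrtr_gt0//.
  by move: (ln _) => l; lra.
rewrite wE /cpow /clog /carg /cRe /cIm /= ltr01 divr1 expr1n.
rewrite /cexp complex_mulE /cRe /cIm /toC /= lnE !mul0r subr0 addr0.
rewrite /powR gt_eqF//.
rewrite (_ : - (s / nu / 2) * ln _ = - (s / nu) * (ln (1 + (nu * z) ^+ 2) / 2)); last first.
  by move: (ln _) => l; field; rewrite gt_eqF.
by rewrite (mulNr _ (atan _)) cosN sinN mulrN.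
Qed.

(** The factor [expR (x0 * beta)] compensates the transform of [tau], which carries [beta + q] in
    the exponent where the integrand has [q] alone. The prefactor [expR (beta * (x1 - x0))] of the
    formula removes it again. *)
Lemma vg_integrandE z : z != 0 -> vg_integrand nu beta x0 s x1 z =
  toC (expR (x0 * beta)) *
  ((spec_re z +i* spec_im z)%C * (rcos z +i* (- rsin z))%C).
Proof.
move=> z0; rewrite /vg_integrand -/(alpha nu beta) (sqrtc_parts beta z0) (Ei_bracket nu beta z0 a0) cpow_cf.
set q := csqrt_parts beta z; set Rr := (rcos z +i* _)%C.
have q0 : q != 0.
  by apply/eqP => h; have := qim_neq0 beta z0; rewrite (_ : qim beta z = complex.Im q)// h eqxx.
have QE : cexp (- (toC x0 * q)) = toC (expR (x0 * beta)) * (cos_tau P W x0 beta z +i* sin_tau P W x0 beta z)%C.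
  rewrite (cos_tauE BM beta x00 z0) (sin_tauE BM beta x00 z0).
  rewrite /cexp complex_mulE /cRe /cIm /toC /q /csqrt_parts /= !mul0r !subr0 !addr0.
  rewrite (_ : - (beta + qre beta z) * x0 = - (x0 * beta) + - (x0 * qre beta z)); last by ring.
  rewrite (mulrC (qim beta z)) expRD cosN sinN.
  have ee : expR (x0 * beta) * expR (- (x0 * beta)) = 1 by rewrite -expRD subrr expR0.
  have aux (E E' F c e : R) : E * E' = 1 ->
      ((F * c) +i* (F * - e))%C = toC E * ((E' * F * c) -i* (E' * F * e))%C.
    move=> EE; apply: complex_eqP; rewrite /toC /= mul0r ?subr0 ?addr0 ?add0r; rewrite -[LHS]mul1r -EE; ring.
  exact: aux.
rewrite QE.
have sE : (cos_sub P T s z +i* - sin_sub P T s z)%C * (cos_tau P W x0 beta z +i* sin_tau P W x0 beta z)%C =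
    (spec_re z +i* spec_im z)%C.
  by apply: complex_eqP; rewrite /(spec_re _) /(spec_im _) /=; ring.
by rewrite -sE; field.
Qed.

Let cos_even (Q : Omega -> R) (g : Omega -> R) (z : R) :
  \int[P]_w (g w * cos (- z * Q w)) = \int[P]_w (g w * cos (z * Q w)).
Proof. by apply: eq_Rintegral => w _; rewrite mulNr cosN. Qed.

Let sin_odd (Q : Omega -> R) (g : Omega -> R) (z : R) :
  \int[P]_w (g w * sin (- z * Q w)) = - \int[P]_w (g w * sin (z * Q w)).
Proof.
rewrite -RintegralN_total; apply: eq_Rintegral => w _.
by rewrite mulNr sinN mulrN.
Qed.

Lemma spec_parity z : spec_re (- z) = spec_re z /\ spec_im (- z) = - spec_im z.
Proof.
have c1 : cos_tau P W x0 beta (- z) = cos_tau P W x0 beta z by exact: cos_even.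
have s1 : sin_tau P W x0 beta (- z) = - sin_tau P W x0 beta z.
  exact: sin_odd.
have c2 : cos_sub P T s (- z) = cos_sub P T s z.
  have := cos_even (T s) (fun=> 1) z.
  by under [in LHS]eq_Rintegral do rewrite mul1r; under [in RHS]eq_Rintegral do rewrite mul1r.
have s2 : sin_sub P T s (- z) = - sin_sub P T s z.
  have := sin_odd (T s) (fun=> 1) z.
  by under [in LHS]eq_Rintegral do rewrite mul1r; under [in RHS]eq_Rintegral do rewrite mul1r.
by rewrite /(spec_re (- z)) /(spec_re z) /(spec_im (- z)) /(spec_im z) c1 s1 c2 s2; split; ring.
Qed.

Lemma radial_parity z : rcos (- z) = rcos z /\ rsin (- z) = - rsin z.
Proof.
split; first by apply: eq_Rintegral => r _; rewrite sqrrN.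
rewrite /radial_sin -RintegralN_total; apply: eq_Rintegral => r _.
by rewrite sqrrN mulNr mulrN.
Qed.

Let re_part z := spec_re z * rcos z + spec_im z * rsin z.
Let im_part z := spec_im z * rcos z + (- spec_re z) * rsin z.

Let two0 : 0 <= 2 :> R. Proof. by []. Qed.

Let mre := measurable_spec_re beta x00 BM GS s.
Let mim := measurable_spec_im beta x00 BM GS s.

Let int_re : mu.-integrable setT (EFin \o re_part).
Proof.
have [] := radial_fubini nu0 x00 a0 mre mim (spec_re_le beta x00 BM GS s) (spec_im_le beta x00 BM GS s) two0.
by [].
Qed.

Let int_im : mu.-integrable setT (EFin \o im_part).
Proof.
have mN : measurable_fun setT (fun z => - spec_re z) by exact: measurableT_comp.
have bN z : `|- spec_re z| <= 2 * tau_dom x0 beta z by rewrite normrN; exact: (spec_re_le beta x00 BM GS s z).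
have [] := radial_fubini nu0 x00 a0 mim mN (spec_im_le beta x00 BM GS s) bN two0.
by [].
Qed.

Let int_re' : mu.-integrable setT (EFin \o (fun z => expR (x0 * beta) * re_part z)).
Proof. exact: (integrableZl measurableT (expR (x0 * beta)) int_re). Qed.

Let int_im' : mu.-integrable setT (EFin \o (fun z => expR (x0 * beta) * im_part z)).
Proof. exact: (integrableZl measurableT (expR (x0 * beta)) int_im). Qed.

Lemma vg_integrand_parts z : z != 0 ->
  cRe (vg_integrand nu beta x0 s x1 z) = expR (x0 * beta) * re_part z /\
  cIm (vg_integrand nu beta x0 s x1 z) = expR (x0 * beta) * im_part z.
Proof.
move=> z0; rewrite vg_integrandE// /re_part /im_part; move: (spec_re z) (spec_im z) (rcos z) (rsin z) (expR _).
by move=> a b c e k; rewrite /cRe /cIm /toC /=; split; ring.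
Qed.

Lemma cintegrable_vg_integrand : cintegrable setT (vg_integrand nu beta x0 s x1).
Proof.
split.
  apply: (@integrable_off_point R 0 _ (fun z => expR (x0 * beta) * re_part z)); first exact: int_re'.
  move=> z z0.
  by rewrite (vg_integrand_parts z0).1.
apply: (@integrable_off_point R 0 _ (fun z => expR (x0 * beta) * im_part z)); first exact: int_im'.
move=> z z0.
by rewrite (vg_integrand_parts z0).2.
Qed.

(** The imaginary part of the integrand is odd in [z], by the parities of the cosine and sine
    transforms, so only the real part contributes. *)
Lemma vg_density_formulaE : vg_density_formula nu beta x0 s x1 =
  toC (expR (beta * x1) / (2 * pi * nu) * \int[mu]_z (spec_re z * rcos z + spec_im z * rsin z)).
Proof.
have I1 : \int[mu]_z cRe (vg_integrand nu beta x0 s x1 z) = expR (x0 * beta) * \int[mu]_z re_part z.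
  rewrite -(@RintegralZl _ _ _ mu _ _ (expR (x0 * beta)) measurableT int_re).
  apply: (Rintegral_off_point (a := 0)) => [|z z0]; first exact: int_re'.
  by rewrite (vg_integrand_parts z0).1.
have I2 : \int[mu]_z cIm (vg_integrand nu beta x0 s x1 z) = 0.
  rewrite -(mulr0 (expR (x0 * beta))) -(integral_odd int_im).
    rewrite -(@RintegralZl _ _ _ mu _ _ (expR (x0 * beta)) measurableT int_im).
    apply: (Rintegral_off_point (a := 0)) => [|z z0]; first exact: int_im'.
    by rewrite (vg_integrand_parts z0).2.
  move=> z; rewrite /im_part; have [-> ->] := spec_parity z; have [-> ->] := radial_parity z.
  by move: (spec_re z) (spec_im z) (rcos z) (rsin z) => *; ring.
rewrite /vg_density_formula /cintegral I1 I2 mulrBr expRB -/re_part (mulrC beta x0).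
have := expR_gt0 (x0 * beta); have := pi_gt0 R.
move: (\int[mu]_z _) (expR _) (expR _) (pi : R) nu nu0 => I e1 e2 p n n0 p0 e20.
apply: complex_eqP; rewrite /toC /=; first by field; rewrite !gt_eqF.
by ring.
Qed.

End integrand.

(** * Conclusion *)

Section joint_density_measurable.
Context (R : realType) d (Omega : measurableType d) (P : probability Omega R)
  (T : R -> Omega -> R) (nu beta : R).
Hypotheses (nu0 : 0 < nu) (GS : gamma_subordinator P nu T).
Notation mu := (@lebesgue_measure R).
Notation R1 := (measurableTypeR R).
Variable f : R -> R.
Hypotheses (mf : measurable_fun setT f) (f0 : forall x, 0 <= f x).

Let mrate : measurable_fun setT (rate nu beta).
Proof. by apply: continuous_measurable_fun; exact: continuous_rate. Qed.

Lemma measurable_shifted_mean2 :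
  measurable_fun [set: R1 * R1] (fun z => shifted_mean P T f z.1 z.2).
Proof.
pose K (z : (R1 * R1) * Omega) : \bar R := (f (subT T z.1.1 z.2 + z.1.2))%:E.
apply: (measurable_fun_fubini_tonelli_F (m2 := P) K).
  have m11 : measurable_fun [set: (R1 * R1) * Omega] (fun z => z.1.1 : R1).
    exact: (measurableT_comp measurable_fst measurable_fst).
  have m12 : measurable_fun [set: (R1 * R1) * Omega] (fun z => z.1.2 : R).
    exact: (measurableT_comp (@measurable_snd_R _ _ _) measurable_fst).
  apply/measurable_EFinP; apply: (measurableT_comp mf); apply: measurable_funD => //.
  exact: (@measurableT_comp _ _ _ _ _ _ (fun z : R1 * Omega => subT T z.1 z.2) _
    (fun z : (R1 * R1) * Omega => (z.1.1, z.2)) (measurable_subT GS)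
    (measurable_fun_pair m11 measurable_snd)).
by move=> z; rewrite lee_fin.
Qed.

Lemma measurable_shifted_transform2 :
  measurable_fun [set: R1 * R1] (fun z => shifted_transform P T nu beta f z.1 z.2).
Proof.
pose K (z : (R1 * R1) * R1) : \bar R :=
  ((pos z.2 * expR (- (rate nu beta z.1.2 * z.2)))%:E * shifted_mean P T f z.1.1 z.2)%E.
apply: (measurable_fun_fubini_tonelli_F (m2 := mu) K).
  have m11 : measurable_fun [set: (R1 * R1) * R1] (fun z => z.1.1 : R1).
    exact: (measurableT_comp measurable_fst measurable_fst).
  have m12 : measurable_fun [set: (R1 * R1) * R1] (fun z => z.1.2 : R).
    exact: (measurableT_comp (@measurable_snd_R _ _ _) measurable_fst).
  have m2 : measurable_fun [set: (R1 * R1) * R1] (fun z => z.2 : R).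
    exact: measurable_snd_R.
  apply: emeasurable_funM.
    apply/measurable_EFinP; apply: measurable_funM.
      exact: (measurableT_comp (@measurable_pos R)).
    apply: measurableT_comp => //; apply: measurableT_comp => //; apply: measurable_funM => //.
    exact: (measurableT_comp mrate).
  exact: (@measurableT_comp _ _ _ _ _ _ (fun z : R1 * R1 => shifted_mean P T f z.1 z.2) _
    (fun z : (R1 * R1) * R1 => (z.1.1, z.2)) measurable_shifted_mean2
    (measurable_fun_pair m11 measurable_snd)).
move=> z; rewrite mule_ge0 ?shifted_mean_ge0//.
by rewrite lee_fin mulr_ge0 ?pos_ge0 ?expR_ge0.
Qed.

Lemma measurable_joint_density2 :
  measurable_fun [set: R1 * R1] (fun z => joint_density P T nu beta f z.1 z.2).
Proof.
pose K (z : (R1 * R1) * R1) : \bar R :=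
  ((space_kernel nu beta z.1.2 z.2)%:E * shifted_transform P T nu beta f z.1.1 z.2)%E.
apply: (measurable_fun_fubini_tonelli_F (m2 := mu) K).
  have m11 : measurable_fun [set: (R1 * R1) * R1] (fun z => z.1.1 : R1).
    exact: (measurableT_comp measurable_fst measurable_fst).
  have m12 : measurable_fun [set: (R1 * R1) * R1] (fun z => z.1.2 : R).
    exact: (measurableT_comp (@measurable_snd_R _ _ _) measurable_fst).
  have m2 : measurable_fun [set: (R1 * R1) * R1] (fun z => z.2 : R).
    exact: measurable_snd_R.
  apply: emeasurable_funM.
    apply/measurable_EFinP; apply: measurable_funM.
      by apply: measurable_funM => //; apply: measurableT_comp => //; exact: measurable_funM.
    apply: measurable_funM; first exact: (measurableT_comp (@measurable_pos R)).
    apply: measurableT_comp => //; apply: measurableT_comp => //; apply: measurable_funM.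
      exact: measurableT_comp.
    exact: measurable_funD.
  exact: (@measurableT_comp _ _ _ _ _ _ (fun z : R1 * R1 => shifted_transform P T nu beta f z.1 z.2) _
    (fun z : (R1 * R1) * R1 => (z.1.1, z.2)) measurable_shifted_transform2
    (measurable_fun_pair m11 measurable_snd)).
by move=> z; rewrite mule_ge0 ?lee_fin ?space_kernel_ge0 ?shifted_transform_ge0.
Qed.

Lemma joint_density_ge0 s y : (0 <= joint_density P T nu beta f s y)%E.
Proof.
by apply: integral_ge0 => r _; rewrite mule_ge0 ?lee_fin ?space_kernel_ge0 ?shifted_transform_ge0.
Qed.

End joint_density_measurable.

(** * Comparison of the law of the passage with the formula *)

Section first_passage.
Context (R : realType) d (Omega : measurableType d) (P : probability Omega R)
  (W T : R -> Omega -> R) (nu beta x0 : R).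
Hypotheses (nu0 : 0 < nu) (x00 : 0 < x0).
Hypotheses (BM : standard_BM P W) (GS : gamma_subordinator P nu T).
Notation mu := (@lebesgue_measure R).
Notation R1 := (measurableTypeR R).
Notation hit := (hit W x0 beta).
Notation tau0 := (tau0 W x0 beta).
Notation t1 w := (cross (T^~ w) (tau0 w)).
Notation passed w := (reach_set T (tau0 w, w)).

Let tau0E w : hit w -> tau0 w = tau W x0 beta w.
Proof. by move=> h; rewrite /(tau0 _) indicE mem_set// mul1r. Qed.

Lemma t1star_passed w : hit w -> passed w -> t1star x0 beta W T w = (t1 w)%:E.
Proof.
move=> h p; have H := @crossP _ (T^~ w) (@sub_mon _ _ _ _ _ _ GS w) (@sub_rc _ _ _ _ _ _ GS w).
rewrite /t1star (Tstar_hit BM h) -(tau0E h); apply/eqP; rewrite eq_le; apply/andP; split.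
  apply: ereal_inf_lbound; exists (t1 w) => //; split; first exact: cross_ge0.
  by rewrite lee_fin; apply/H => //; exact: cross_ge0.
by apply: le_ereal_inf_tmp => _ [t [t0 ht] <-]; rewrite lee_fin in ht *; have [_] := (H _ _ t0).1 ht.
Qed.

Lemma t1star_fin w s : t1star x0 beta W T w = s%:E -> hit w /\ passed w.
Proof.
have [h|nh] := pselect (hit w); last first.
  rewrite /t1star (Tstar_nohit nh) (_ : [set t%:E | t in _] = set0) ?ereal_inf0//.
  by apply/seteqP; split => t //= [S [_]].
move=> e; split => //; apply: contrapT => np; move: e.
rewrite /t1star (Tstar_hit BM h) -(tau0E h) (_ : [set t%:E | t in _] = set0) ?ereal_inf0//.
apply/seteqP; split => // e [t [t0 ht] _]; apply: np.
by exists t; split => //; rewrite lee_fin in ht.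
Qed.

Lemma first_passage_eventE A w : first_passage_event x0 beta W T A w <->
  [/\ hit w, passed w & A (t1 w, LSBM x0 beta W T (t1 w) w)].
Proof.
split=> [[s [es As]]|[h p As]]; last by exists (t1 w); rewrite t1star_passed.
have [h p] := t1star_fin es; split => //.
by move: es; rewrite t1star_passed// => -[->].
Qed.

(** [over], [X1] and [r1] are versions, measurable on all of [Omega], of the subordinator after the
    passage, the position and the passage time; [g1] is the indicator of a finite passage time. Off
    that event their values do not matter, because [g1] vanishes there. *)
Let over w : R := \1_(`]0, +oo[) (tau0 w) * overshoot0 T (tau0 w, w).
Let X1 w : R := x0 + pos (over w) * W (over w) w + beta * over w.
Let r1 w : R := cross0 T (tau0 w, w).
Let g1 w : R := \1_hit w * \1_(reach_set T) (tau0 w, w).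

Let mtau : measurable_fun setT tau0. Proof. exact: (measurable_tau0 BM). Qed.

Let mpair : measurable_fun setT (fun w => (tau0 w : R1, w)).
Proof. by apply: measurable_fun_pair => //; exact: mtau. Qed.

Let mr1 : measurable_fun setT r1.
Proof. exact: (measurableT_comp (measurable_cross0 GS) mpair). Qed.

Let mover : measurable_fun setT over.
Proof. exact: (measurableT_comp (measurable_overshoot0 GS) mpair). Qed.

Let mX1 : measurable_fun setT X1.
Proof.
apply: measurable_funD; last exact: measurable_funM.
apply: measurable_funD => //.
apply: (measurableT_comp (measurable_path BM) (_ : measurable_fun setT (fun w => (over w : R1, w)))).
by apply: measurable_fun_pair => //; exact: mover.
Qed.

Let mg1 : measurable_fun setT g1.
Proof.
apply: measurable_funM; first exact: (measurable_hit BM).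
apply: (measurableT_comp (_ : measurable_fun setT (\1_(reach_set T) : R1 * Omega -> R)) mpair).
by apply: measurable_indic; exact: (measurable_reach_set GS).
Qed.

Let g1_in w : hit w -> passed w -> g1 w = 1.
Proof. by move=> h p; rewrite /g1 !indicE !mem_set ?mulr1. Qed.

Let g1_out w : ~ (hit w /\ passed w) -> g1 w = 0.
Proof.
move=> n; rewrite /g1 !indicE; have [h|h] := pselect (hit w); last by rewrite (memNset h) mul0r.
by rewrite (@memNset _ (reach_set T)) ?mulr0// => p; apply: n.
Qed.

Let r1E w : passed w -> r1 w = t1 w.
Proof. exact: cross0E. Qed.

Let X1E w : hit w -> passed w -> X1 w = LSBM x0 beta W T (t1 w) w.
Proof.
move=> h p; have t0 : 0 < tau0 w by rewrite tau0E//; exact: (tau_gt0 BM x00 h).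
have oE : over w = T (t1 w) w.
  rewrite /over indicE mem_set ?mul1r; first exact: overshoot0E.
  by rewrite /= in_itv /= t0.
have o0 : 0 < over w.
  rewrite oE (lt_le_trans t0)//.
  exact: (@cross_in _ (T^~ w) (@sub_mon _ _ _ _ _ _ GS w) (@sub_rc _ _ _ _ _ _ GS w) _ p).
by rewrite /X1 (pos_gt0 o0) mul1r oE.
Qed.

Hypothesis ind : forall (n m : nat) (s t : nat -> R) (A B : nat -> set R),
  (forall i, measurable (A i)) -> (forall j, measurable (B j)) ->
    P (finite_inter n (fun i => [set w | W (s i) w \in A i]) `&`
       finite_inter m (fun j => [set w | T (t j) w \in B j]))
    = (P (finite_inter n (fun i => [set w | W (s i) w \in A i])) *
      P (finite_inter m (fun j => [set w | T (t j) w \in B j])))%E.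

Notation jd := (joint_density P T nu beta (tau_pdf P W x0 beta)).
Notation m2 := (prodm mu mu).

(** [fine] loses nothing here: for positive time and nonzero position [joint_density_fourier] shows
    the density to be finite, and the excluded line [z.2 = 0] is a null set. *)
Let g2 (z : R1 * R1) : R := pos z.1 * ((z.2 : R) != 0)%:R * fine (jd z.1 z.2).

Let mpdf := measurable_tau_pdf BM beta x00.
Let pdf0 := tau_pdf_ge0 BM beta x00.

Let mjd : measurable_fun [set: R1 * R1] (fun z => jd z.1 z.2).
Proof. exact: (measurable_joint_density2 beta nu0 GS mpdf pdf0). Qed.

Let mne0 : measurable_fun setT (fun y : R => (y != 0)%:R : R).
Proof.
rewrite (_ : (fun y => _) = \1_(~` [set 0])); last first.
  apply/funext => y; rewrite indicE; have [->|y0] := eqVneq y 0.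
    by rewrite memNset//=; apply.
  by rewrite mem_set//=; exact/eqP.
by apply: measurable_indic; apply: measurableC.
Qed.

Let mg2 : measurable_fun [set: R1 * R1] g2.
Proof.
apply: measurable_funM; last exact: (measurableT_comp (@fine_measurable R setT measurableT) mjd).
apply: measurable_funM.
  by apply: (measurableT_comp (@measurable_pos R)); exact: measurable_fst_R.
by apply: (measurableT_comp mne0); exact: measurable_snd_R.
Qed.

Let g20 z : 0 <= g2 z.
Proof. by rewrite !mulr_ge0 ?pos_ge0 ?fine_ge0 ?joint_density_ge0. Qed.

(** Laplace kernel in the positive and negative parts of the position. It is a bounded continuous
    function on the line, hence an admissible test function in [passage_transform]. *)
Let psi (v w x : R) : R := expR (- (v * Num.max x 0)) * expR (- (w * Num.max (- x) 0)).

Let psi01 v w x : 0 <= v -> 0 <= w -> 0 <= psi v w x <= 1.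
Proof.
move=> v0 w0; rewrite mulr_ge0 ?expR_ge0//= mulr_ile1 ?expR_ge0// expR_le1 oppr_le0 mulr_ge0// le_max lexx orbT//.
Qed.

Let cmax v (f : R -> R) : continuous f -> continuous (fun x => expR (- (v * Num.max (f x) 0))).
Proof.
move=> cf x.
apply: (@continuous_comp R R R (fun x => - (v * Num.max (f x) 0)) expR x); last exact: continuous_expR.
apply: (@continuousN R R R (fun x => v * Num.max (f x) 0)).
apply: (@continuousM R R (fun=> v) (fun x => Num.max (f x) 0)); first exact: cst_continuous.
by apply: (@continuous_max R R f (fun=> 0)); [exact: cf|exact: cst_continuous].
Qed.

Let cpsi v w : continuous (psi v w).
Proof.
move=> x.
apply: (@continuousM R R (fun x => expR (- (v * Num.max x 0))) (fun x => expR (- (w * Num.max (- x) 0)))).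
  by apply: (@cmax v id) => y; exact: cvg_id.
by apply: (@cmax w -%R) => y; exact: continuousN.
Qed.

Let mE d' (S : measurableType d') (g : S -> R) c : measurable_fun setT g ->
  measurable_fun setT (fun z => expR (- (c * g z))).
Proof. by move=> mg; case: (measurable_fun_expRN_indic c 0 mg). Qed.

Let m2' : measurable_fun [set: R1 * R1] (fun z => z.2 : R). Proof. exact: measurable_snd_R. Qed.
Let m1' : measurable_fun [set: R1 * R1] (fun z => `|z.1 : R|).
Proof. by apply: measurableT_comp => //; exact: measurable_fst_R. Qed.
Let mp : measurable_fun [set: R1 * R1] (fun z => Num.max (z.2 : R) 0).
Proof. exact: (measurable_maxr m2'). Qed.
Let mn : measurable_fun [set: R1 * R1] (fun z => Num.max (- (z.2 : R)) 0).
Proof. by apply: measurable_maxr => //; exact: measurableT_comp. Qed.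

Let transforms (u v w : R) : 0 <= u -> 0 <= v -> 0 <= w ->
  (\int[P]_x (expR (- (u * r1 x)) * (expR (- (v * Num.max (X1 x) 0)) *
       (expR (- (w * Num.max (- X1 x) 0)) * g1 x)))%:E =
   \int[m2]_z (expR (- (u * `|z.1 : R|)) * (expR (- (v * Num.max (z.2 : R) 0)) *
       (expR (- (w * Num.max (- (z.2 : R)) 0)) * g2 z)))%:E)%E.
Proof.
move=> u0 v0 w0; have psiM x := psi01 x v0 w0.
have L := passage_transform beta nu0 x00 u0 BM GS ind (@cpsi v w) psiM.
rewrite (space_law beta u nu0 BM GS (@cpsi v w) psiM mpdf pdf0) in L.
transitivity (\int[P]_x (\1_hit x * (\1_(reach_set T) (tau0 x, x) *
     (expR (- (u * t1 x)) * psi v w (LSBM x0 beta W T (t1 x) x))))%:E)%E.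
  apply: eq_integral => x _; congr EFin.
  have [[h p]|n] := pselect (hit x /\ passed x).
    by rewrite g1_in// r1E// X1E// !indicE !mem_set// !mul1r mulr1.
  rewrite [RHS]mulrA -/(g1 x) g1_out//.
  by rewrite mul0r !mulr0.
have mI : measurable_fun [set: R1 * R1] (fun z => (expR (- (u * `|z.1 : R|)) *
     (expR (- (v * Num.max (z.2 : R) 0)) * (expR (- (w * Num.max (- (z.2 : R)) 0)) * g2 z)))%:E).
  apply/measurable_EFinP; apply: measurable_funM; first exact: mE.
  by apply: measurable_funM; [exact: mE|apply: measurable_funM; [exact: mE|exact: mg2]].
have I0 (z : R1 * R1) : (0 <= (expR (- (u * `|z.1 : R|)) *
     (expR (- (v * Num.max (z.2 : R) 0)) * (expR (- (w * Num.max (- (z.2 : R)) 0)) * g2 z)))%:E)%E.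
  by rewrite lee_fin; do 3 apply: (mulr_ge0 (expR_ge0 _)).
rewrite L (tonelli_fst mI I0).
apply: eq_integral => s _; apply: (@integral_off_point R 0).
- apply: emeasurable_funM; last exact: (measurableT_comp mjd (pair1_measurable s)).
  apply/measurable_EFinP; apply: measurable_funM => //.
  exact: (continuous_measurable_fun (@cpsi v w)).
- exact: (measurableT_comp mI (pair1_measurable s)).
- by move=> y; rewrite mule_ge0 ?joint_density_ge0// lee_fin !mulr_ge0 ?pos_ge0 ?expR_ge0.
- by move=> y; exact: I0.
move=> y y0; rewrite /g2 /= y0 mulr1; have [s0|s0] := ltP 0 s; last first.
  by rewrite pos_le0// !(mul0r, mulr0) mul0e.
have fin : jd s y \is a fin_num by rewrite (joint_density_fourier beta nu0 x00 BM GS s0 y0).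
rewrite -[in LHS](fineK fin) -EFinM pos_gt0// gtr0_norm//; congr EFin.
by rewrite /psi; ring.
Qed.

Let int_g1 : P.-integrable setT (EFin \o g1).
Proof.
have i1 : P.-integrable setT (EFin \o (fun=> 1 : R)) by exact: finite_measure_integrable_cst.
apply: (@integrable_dom _ _ R P setT g1 _ measurableT mg1 i1) => w _; have [[h p]|n] := pselect (hit w /\ passed w); first by rewrite g1_in// normr1.
by rewrite g1_out// normr0.
Qed.

Let int_g2 : m2.-integrable setT (EFin \o g2).
Proof.
(* At the zero parameters the transforms are total masses, so [g2] inherits the finite mass of
   [g1]. *)
have := transforms (lexx 0) (lexx 0) (lexx 0).
under eq_integral do rewrite !mul0r oppr0 expR0 !mul1r.
under [in RHS]eq_integral do rewrite !mul0r oppr0 expR0 !mul1r.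
move=> E; apply/integrableP; split; first by apply/measurable_EFinP; exact: mg2.
under eq_integral do rewrite /= ger0_norm//.
rewrite -E; have /integrableP[_] := int_g1.
by under [X in (X < _)%E -> _]eq_integral do rewrite /= ger0_norm ?mulr_ge0//.
Qed.

Theorem first_passage_law (A : set (R * R)) : measurable A ->
  P (first_passage_event x0 beta W T A) =
  (\int[(mu \x mu)%E]_(p in A `&` [set p : R * R | (0 < p.1)%R /\ (p.2 != 0)%R])
     (complex.Re (vg_density_formula nu beta x0 p.1 p.2))%:E)%E.
Proof.
(* The position is recovered as the difference of its positive and negative parts. *)
move=> mA; pose F (z : R * (R * R)) : \bar R := (\1_A (z.1, z.2.1 - z.2.2))%:E.
have F0 z : (0 <= F z)%E by rewrite lee_fin.
have mF : measurable_fun setT F.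
  apply/measurable_EFinP.
  apply: (measurableT_comp (_ : measurable_fun setT (\1_A : R * R -> R))); first exact: measurable_indic.
  apply: measurable_fun_pair; first exact: measurable_fst.
  apply: measurable_funB.
    exact: (measurableT_comp measurable_fst measurable_snd).
  exact: (measurableT_comp measurable_snd measurable_snd).
have maxB (x : R) : Num.max x 0 - Num.max (- x) 0 = x.
  have [h|h] := leP x 0; first by rewrite max_l ?sub0r ?opprK// oppr_ge0.
  by rewrite max_r ?subr0// oppr_le0 ltW.
have mX1p : measurable_fun setT (fun w => Num.max (X1 w) 0) by exact: measurable_maxr.
have mX1n : measurable_fun setT (fun w => Num.max (- X1 w) 0).
  by apply: measurable_maxr => //; exact: measurableT_comp.
have := @laplace3_unique R _ _ _ _ P m2 r1 (fun w => Num.max (X1 w) 0) (fun w => Num.max (- X1 w) 0) g1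
  (fun z => `|z.1 : R|) (fun z => Num.max (z.2 : R) 0) (fun z => Num.max (- (z.2 : R)) 0) g2 F.
move=> /(_ mr1 mX1p mX1n m1' mp mn _ _
  int_g1 int_g2 transforms mF F0) H.
transitivity (\int[P]_w (F (r1 w, (Num.max (X1 w) 0%R, Num.max (- X1 w)%R 0%R)) * (g1 w)%:E))%E.
  have E : (fun w => F (r1 w, (Num.max (X1 w) 0%R, Num.max (- X1 w)%R 0%R)) * (g1 w)%:E)%E =
      EFin \o \1_(first_passage_event x0 beta W T A).
    apply/funext => w; rewrite /F /= maxB -EFinM; congr EFin.
    have [[h p]|n] := pselect (hit w /\ passed w).
      rewrite g1_in// r1E// X1E// mulr1 !indicE; congr (_%:R); congr nat_of_bool.
      apply/idP/idP; rewrite !inE => a; first exact/first_passage_eventE.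
      by case/first_passage_eventE: a.
    rewrite (g1_out n) mulr0 indicE memNset// => /first_passage_eventE[h p _].
    by apply: n.
  have mE' : measurable (first_passage_event x0 beta W T A).
    have : measurable_fun setT (EFin \o (\1_(first_passage_event x0 beta W T A) : Omega -> R)).
      rewrite -E; apply: emeasurable_funM; last by apply/measurable_EFinP; exact: mg1.
      apply: (measurableT_comp mF); apply: measurable_fun_pair; first exact: mr1.
      by apply: measurable_fun_pair; apply: measurable_maxr => //; exact: measurableT_comp.
    by move/measurable_EFinP/measurable_indicP.
  rewrite [RHS](_ : _ = \int[P]_w (\1_(first_passage_event x0 beta W T A) w)%:E)%E; last by rewrite E.
  by rewrite integral_indic// setIT.
rewrite H.
- rewrite [RHS]integral_mkcond; apply: eq_integral => z _.
  rewrite (_ : F _ = (\1_A (`|z.1 : R|, z.2 : R))%:E); last by rewrite /F /= maxB.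
  rewrite patchE.
  have [/set_mem[Az [z1 z2]]|nz] := boolP (z \in _).
    have z1' : 0 < (z.1 : R) by exact: z1.
    rewrite gtr0_norm// indicE mem_set; last by move: Az; case: (z).
    rewrite mul1e /g2 (pos_gt0 z1') z2 !mul1r (joint_density_fourier beta nu0 x00 BM GS z1' z2).
    by rewrite (vg_density_formulaE beta nu0 x00 BM GS z1' z2).
  rewrite /g2; have [z1|z1] := ltP 0 (z.1 : R); last by rewrite pos_le0// !mul0r mule0.
  have [z2|z2] := eqVneq (z.2 : R) 0; first by rewrite /= mulr0 mul0r mule0.
  rewrite gtr0_norm// indicE memNset ?mul0e// => Az.
  by move/negP: nz; apply; apply/mem_set; split => //; move: Az; case: (z).
- by move=> x; split; rewrite ?cross0_ge0 ?le_max ?lexx ?orbT// mulr_ge0.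
- by move=> z; split; rewrite ?le_max ?lexx ?orbT//; exact: g20.
Qed.

End first_passage.

Section time_reflection.
Context (R : realType) d (Omega : measurableType d) (P : probability Omega R).

(* Processes are only constrained at nonnegative times; reflecting time makes
   independence hold at all real times without changing the first passage. *)
Definition even_time (X : R -> Omega -> R) : R -> Omega -> R := fun t w => X `|t| w.

Lemma even_timeE X t w : 0 <= t -> even_time X t w = X t w.
Proof. by move=> t0; rewrite /even_time ger0_norm. Qed.

Let indep_increments_even X : indep_increments P X -> indep_increments P (even_time X).
Proof.
move=> iX n t A t0 tS mA; have tn i : 0 <= t i.
  by elim: i => // i ih; rewrite (le_trans ih)// ltW.
have := iX n t A t0 tS mA; congr (P _ = _).
  by rewrite /finite_inter; apply: eq_bigr => i _; apply/funext => w /=; rewrite !even_timeE.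
by apply: eq_bigr => i _; congr (P _); apply/funext => w /=; rewrite !even_timeE.
Qed.

Lemma standard_BM_even W : standard_BM P W -> standard_BM P (even_time W).
Proof.
case=> mW W0 cW iW law; split => //.
- by move=> t; exact: mW.
- by move=> w; rewrite even_timeE.
- move=> w; apply: subspace_eq_continuous (cW w) => t; rewrite inE /= in_itv /= andbT => t0.
  by rewrite /from_subspace/= even_timeE.
- exact: indep_increments_even.
- move=> s t A s0 st mA; rewrite -law//; congr (P _); apply/funext => w /=.
  by rewrite !even_timeE// (le_trans s0)// ltW.
Qed.

Lemma gamma_subordinator_even nu T : gamma_subordinator P nu T -> gamma_subordinator P nu (even_time T).
Proof.
case=> mT [T0 Tm Trc iT lap]; split; first by move=> t; exact: mT.
split.
- by move=> w; rewrite even_timeE.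
- by move=> w s t s0 st; rewrite !even_timeE ?Tm// (le_trans s0).
- move=> w t t0; rewrite even_timeE//; apply: cvg_trans (Trc w t t0); apply: near_eq_cvg.
  apply: (filterS _ (nbhs_right_gt t)) => r tr.
  by rewrite even_timeE// (le_trans t0)// ltW.
- exact: indep_increments_even.
- move=> u t h u0 t0 h0; rewrite -(lap u t h)//; apply: eq_integral => w _.
  by rewrite !even_timeE// addr_ge0.
Qed.

Lemma first_passage_event_even nu x0 beta W T A : gamma_subordinator P nu T ->
  first_passage_event x0 beta (even_time W) (even_time T) A = first_passage_event x0 beta W T A.
Proof.
move=> GS; have TsE w : Tstar x0 beta (even_time W) w = Tstar x0 beta W w.
  rewrite /Tstar; congr (ereal_inf [set S%:E | S in _]); apply/seteqP; split => S [S0].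
    by rewrite /= /Wtilde even_timeE.
  by rewrite /= /Wtilde even_timeE.
have tE w : t1star x0 beta (even_time W) (even_time T) w = t1star x0 beta W T w.
  rewrite /t1star TsE; congr (ereal_inf [set t%:E | t in _]); apply/seteqP; split => t [t0].
    by rewrite /= even_timeE.
  by rewrite /= even_timeE.
apply/seteqP; split => w [s [es As]]; exists s; (split; first by move: es; rewrite tE).
all: have s0 : 0 <= s by rewrite -lee_fin -es ?tE; apply: le_ereal_inf_tmp => _ [t [t0 _] <-]; rewrite lee_fin.
all: move: As; rewrite /LSBM /Wtilde (even_timeE T)// (even_timeE W)//; exact: (sub_ge0 GS).
Qed.

Lemma indep_processes_even W T : indep_processes P W T ->
  forall (n m : nat) (s t : nat -> R) (A B : nat -> set R),
  (forall i, measurable (A i)) -> (forall j, measurable (B j)) ->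
    P (finite_inter n (fun i => [set w | even_time W (s i) w \in A i]) `&`
       finite_inter m (fun j => [set w | even_time T (t j) w \in B j]))
    = (P (finite_inter n (fun i => [set w | even_time W (s i) w \in A i])) *
      P (finite_inter m (fun j => [set w | even_time T (t j) w \in B j])))%E.
Proof.
by move=> ind n m s t A B mA mB; apply: (ind n m (fun i => `|s i|) (fun j => `|t j|)).
Qed.

End time_reflection.

Theorem theorem5p1 (R : realType) (d : measure_display) (Omega : measurableType d)
    (P : probability Omega R) (W T : R -> Omega -> R) (nu beta x0 : R) :
  0 < nu -> 0 < x0 ->
  standard_BM P W -> gamma_subordinator P nu T -> indep_processes P W T ->
  (* the integral in the formula converges and the formula is real *)
  (forall s x1, 0 < s -> x1 != 0 ->
     cintegrable setT (vg_integrand nu beta x0 s x1) /\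
     complex.Im (vg_density_formula nu beta x0 s x1) = 0) /\
  (* it is the joint density of (t1*, X_{t1*}) (on the event t1* < oo) *)
  (forall A : set (R * R), measurable A ->
     P (first_passage_event x0 beta W T A) =
     (\int[(@lebesgue_measure R \x @lebesgue_measure R)%E]_(p in
          A `&` [set p : R * R | (0 < p.1)%R /\ (p.2 != 0)%R])
        (complex.Re (vg_density_formula nu beta x0 p.1 p.2))%:E)%E).
Proof.
move=> nu0 x00 BM GS ind; split=> [s x1 s0 x10|A mA].
  split; first exact: (cintegrable_vg_integrand beta nu0 x00 BM GS s0 x10).
  by rewrite (vg_density_formulaE beta nu0 x00 BM GS s0 x10).
rewrite -(first_passage_event_even _ _ _ _ GS).
exact: (first_passage_law beta nu0 x00 (standard_BM_even BM) (gamma_subordinator_even GS)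
  (indep_processes_even ind) mA).
Qed.
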